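(* Let $X_1$ and $X_2$ be compact Riemann surfaces of genera $g_1,g_2\ge 2$, with associated spectral triples $\mathcal{S}_{X_1},\mathcal{S}_{X_2}$ and zeta functions $\zeta_{X_i,a}(s)=\mathrm{tr}(a|D_i|^s)$. Suppose that $\zeta_{X_1,a}(s)=\zeta_{X_2,a}(s)$ for all $a\in A_\infty$ (equality understood as explained in the context). Then $X_1$ and $X_2$ are conformally or anti-conformally equivalent as Riemann surfaces. In particular, the spectral triple $\mathcal{S}_X$ of a compact Riemann surface $X$ of genus at least $2$ determines $X$ up to conformal or anti-conformal isomorphism.
   Context: Schottky uniformization. $F_g$ is the free group on $g\ge 2$ generators in a fixed alphabet. A Schottky group of rank $g$ is given by an injective homomorphism $\rho:F_g\hookrightarrow \mathrm{PGL}(2,\mathbf{C})$ with discrete image $\Gamma$ and limit set $\Lambda\subset \mathbf{P}^1(\mathbf{C})$; every compact Riemann surface $X$ of genus $g\ge2$ can be written as $X=\Gamma\backslash(\mathbf{P}^1(\mathbf{C})-\Lambda)$ for such a group, and $\mathcal{S}_X$ is built from a choice of such $\rho$. For $X_i$ write $\rho_i,\Gamma_i,\Lambda_i,A_i,A_{i,\infty},D_i$ for the corresponding data. Words and ends. All words are reduced words in the generators of $F_g$ and their inverses; $|w|$ is the word length, $e$ the empty word, and $i(w)$, $t(w)$ the initial and terminal letters. For a word $w$ and a word or infinite word $v$, write $w\subseteq v$ if $v=w\cdot w_0$ for some $w_0$ with $t(w)\ne i(w_0)^{-1}$ (no cancellation). Let $Y_g$ be the Cayley graph of $F_g$, in which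 the edge between words $a$ and $b$ is given length $\min\{|a|^{-2},|b|^{-2}\}$ (with $|e|^{-2}:=1$); let $\bar Y_g$ be its metric completion and $\bar F_g=\bar Y_g-Y_g$ (its points are the infinite reduced words, as limits of finite words). The map $\iota_\rho:\bar F_g\to\Lambda$, $\lim_i w_i\mapsto\lim_i\rho(w_i)(x_0)$, for a base point $x_0\in\mathbf{P}^1(\mathbf{C})\setminus\Lambda$, is a continuous bijection of compact Hausdorff spaces, hence a homeomorphism (Floyd). For a word $w$, put $\overrightarrow{w}_\rho=\{\iota_\rho(v): v\in\bar F_g,\ w\subseteq v\}\subseteq\Lambda$. The triple $\mathcal{S}_X=(A,H,D)$. $A=C(\Lambda)$, and $A_\infty=C(\Lambda,\mathbf{Z})\otimes_{\mathbf{Z}}\mathbf{C}$ is the dense subalgebra of locally constant functions, i.e. the span of the characteristic functions $\chi_{\overrightarrow{w}_\rho}$, $w\in F_g$. Let $\mu=\mu_\Lambda$ be the Patterson–Sullivan measure on $\Lambda$, normalized to be a probability measure; it satisfies $(\gamma^*d\mu)(x)=|\gamma'(x)|^{\delta_H}d\mu(x)$ for $\gamma\in\Gamma$, where $\delta_H$ is the Hausdorff dimension of $\Lambda$. Let $\tau(a)=\int_\Lambda a\,d\mu$. $H$ is the completion of $A$ for $\langle a|b\rangle=\tau(b^*a)$ (GNS representation), with $A$ acting by multiplication. For $n\ge0$, $A_n$ is the span of the $\chi_{\overrightarrow{w}_\rho}$ with $|w|\le n$, $H_n$ is the corresponding subspace of $H$, and $P_n$ is the orthogonal projection onto $H_n$.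 The Dirac operator is $D=\lambda_0P_0+\sum_{n\ge1}\lambda_n(P_n-P_{n-1})$ with $\lambda_n=(\dim A_n)^3$. Zeta functions. For $a\in A_\infty$, $\zeta_{X,a}(s)=\mathrm{tr}(a|D|^s)$, defined for $\mathrm{Re}(s)$ sufficiently negative and then extended meromorphically. Meaning of equality of zeta functions. ''$\zeta_{X_1,a}=\zeta_{X_2,a}$ for all $a\in A_\infty$'' means: (i) $\zeta_{X_1,1}=\zeta_{X_2,1}$ for the units $1\in A_1$, $1\in A_2$; the paper shows that this forces $g_1=g_2=:g$; (ii) then, using the homeomorphism $\Phi=\iota_{\rho_2}\circ\iota_{\rho_1}^{-1}:\Lambda_1\to\Lambda_2$ to identify $A_{1,\infty}$ with $A_{2,\infty}$ (so that $\chi_{\overrightarrow{w}_{\rho_1}}$ corresponds to $\chi_{\overrightarrow{w}_{\rho_2}}$), one has $\zeta_{X_1,a}(s)=\zeta_{X_2,a\circ\Phi^{-1}}(s)$ for all $a\in A_{1,\infty}$. *)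

(* Defs.v *)
From HB Require Import structures.
From mathcomp Require Import all_boot all_order all_algebra.
From mathcomp Require Import all_classical all_reals all_analysis.
From mathcomp Require Import complex.

Set Implicit Arguments.
Unset Strict Implicit.
Unset Printing Implicit Defensive.

Import Order.TTheory GRing.Theory Num.Theory.
Import numFieldNormedType.Exports.

Local Open Scope classical_set_scope.
Local Open Scope ring_scope.

(* The library puts the norm topology on every abstract [numFieldType]; this
   exports it to the concrete field [R[i]]. *)
HB.instance Definition _ (R : rcfType) :=
  NormedModule.copy R[i] (R[i] : numFieldType).

Section linear_span.
Context {K : fieldType} {V : lmodType K}.

Definition lin_span (S : set V) : set V :=
  [set v | exists n (c : 'I_n -> K) (b : 'I_n -> V),
     (forall i, S (b i)) /\ v = \sum_i c i *: b i].

Definition has_dim (E : set V) (d : nat) : Prop :=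
  exists b : 'I_d -> V,
    (forall c : 'I_d -> K, \sum_i c i *: b i = 0 -> forall i, c i = 0) /\
    lin_span (range b) = E.

Definition lin_dim (E : set V) : nat := xget 0%N (has_dim E).

End linear_span.

Section complex_analysis.
Context {R : realType}.
Local Notation C := R[i].

Definition holomorphic_at (f : C -> C) (z : C) : Prop :=
  \forall w \near z, derivable f w 1.

(* The value of a meromorphic [Z] at a pole is irrelevant. *)
Definition meromorphic (Z : C -> C) : Prop :=
  forall z0, exists (n : nat) (h : C -> C), holomorphic_at h z0 /\
    \forall z \near z0, z != z0 -> (z - z0) ^+ n * Z z = h z.

(* [x ^ s] for [0 < x], that is exp (s ln x). *)
Definition cpow (x : R) (s : C) : C :=
  (x `^ complex.Re s)%:C%C *
  Complex (cos (complex.Im s * ln x)) (sin (complex.Im s * ln x)).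

End complex_analysis.

(* A chart is an open domain together with a coordinate function, whose values
   off the domain are irrelevant. *)
Definition chart (R : realType) (X : topologicalType) : Type :=
  (set X * (X -> R[i]))%type.

Section holomorphic_maps.
Context {R : realType} {X Y : topologicalType}.

(* Near [x], [h] is a holomorphic function of the local coordinate [z]. *)
Definition holomorphic_in (z h : X -> R[i]) (x : X) : Prop :=
  exists f : R[i] -> R[i],
    holomorphic_at f (z x) /\ \forall y \near x, h y = f (z y).

Definition holomorphic_map (aX : set (chart R X)) (aY : set (chart R Y))
    (D : set X) (h : X -> Y) : Prop :=
  forall x, D x -> {for x, continuous h} /\
    forall c d, aX c -> c.1 x -> aY d -> d.1 (h x) ->
      holomorphic_in c.2 (d.2 \o h) x.

Definition antiholomorphic_map (aX : set (chart R X)) (aY : set (chart R Y))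
    (D : set X) (h : X -> Y) : Prop :=
  forall x, D x -> {for x, continuous h} /\
    forall c d, aX c -> c.1 x -> aY d -> d.1 (h x) ->
      holomorphic_in c.2 (fun y => (d.2 (h y))^*%C) x.

End holomorphic_maps.

Record riemann_surface (R : realType) := RiemannSurface {
  rs_space :> topologicalType;
  rs_atlas : set (chart R rs_space);
  rs_hausdorff : hausdorff_space rs_space;
  rs_connected : connected [set: rs_space];
  rs_chart : forall c, rs_atlas c ->
    [/\ open c.1, {within c.1, continuous c.2}, set_inj c.1 c.2 &
        forall V, V `<=` c.1 -> open V -> open (c.2 @` V)];
  rs_cover : forall x, exists2 c, rs_atlas c & c.1 x;
  rs_compat : forall c d x, rs_atlas c -> rs_atlas d -> c.1 x -> d.1 x ->
    holomorphic_in c.2 d.2 x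
}.

Section riemann_surfaces.
Context {R : realType}.
Implicit Types X Y : riemann_surface R.

(* A holomorphic 1-form is given by its coefficients: it is [w c x dz_c] at the
   point [x] of the chart [c]. Off the charts, [w] is set to 0 so that distinct
   families are distinct forms. *)
Definition holomorphic_form X (w : chart R X -> X -> R[i]) : Prop :=
  [/\ forall c x, rs_atlas c -> c.1 x -> holomorphic_in c.2 (w c) x,
      forall c d x (T : R[i] -> R[i]),
        rs_atlas c -> rs_atlas d -> c.1 x -> d.1 x ->
        holomorphic_at T (c.2 x) -> (\forall y \near x, d.2 y = T (c.2 y)) ->
        w c x = w d x * 'D_1 T (c.2 x) &
      forall c x, ~ (rs_atlas c /\ c.1 x) -> w c x = 0].

(* The genus is the dimension of the space of holomorphic differentials. *)
Definition has_genus X (g : nat) : Prop := has_dim (@holomorphic_form X) g.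

Definition conformally_equivalent X Y : Prop :=
  exists (h : X -> Y) (k : Y -> X), [/\ cancel h k, cancel k h,
    holomorphic_map (@rs_atlas R X) (@rs_atlas R Y) setT h &
    holomorphic_map (@rs_atlas R Y) (@rs_atlas R X) setT k].

Definition anticonformally_equivalent X Y : Prop :=
  exists (h : X -> Y) (k : Y -> X), [/\ cancel h k, cancel k h,
    antiholomorphic_map (@rs_atlas R X) (@rs_atlas R Y) setT h &
    antiholomorphic_map (@rs_atlas R Y) (@rs_atlas R X) setT k].

End riemann_surfaces.

(* [Some z] is the affine point [z : 1], [None] is the point at infinity. *)
Definition P1 (R : realType) : ptopologicalType := one_point_compactification R[i].

Definition borelP1 (R : realType) := g_sigma_algebraType (@open (P1 R)).

Section projective_line.
Context {R : realType}.
Local Notation C := R[i].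
Local Notation P := (P1 R).

Definition P1_atlas : set (chart R P) :=
  [set c | c = ([set x : P | x <> None], fun x : P => if x is Some z then z else 0)
        \/ c = ([set x : P | x <> Some 0],
                fun x : P => if x is Some z then z^-1 else 0)].

Definition mobius (M : 'M[C]_2) (x : P) : P :=
  match x with
  | Some z => if M 1 0 * z + M 1 1 == 0 then None
              else Some ((M 0 0 * z + M 0 1) / (M 1 0 * z + M 1 1))
  | None => if M 1 0 == 0 then None else Some (M 0 0 / M 1 0)
  end.

Local Notation normc := (@ComplexField.Normc.normc R).

Definition chordal (x y : P) : R :=
  match x, y with
  | Some z, Some w => 2 * normc (z - w) /
      (Num.sqrt (1 + normc z ^+ 2) * Num.sqrt (1 + normc w ^+ 2))
  | Some z, None | None, Some z => 2 / Num.sqrt (1 + normc z ^+ 2)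
  | None, None => 0
  end.

(* [|h'(x)|], with respect to the spherical metric. *)
Definition conformal_derivative (h : P -> P) (x : P) : R :=
  lim ((chordal (h y) (h x) / chordal y x) @[y --> x^']).

Definition diameter (U : set P) : R :=
  sup [set r | exists x y, [/\ U x, U y & r = chordal x y]].

Definition hausdorff_content (s eps : R) (E : set P) : \bar R :=
  ereal_inf [set (\sum_(0 <= i <oo) (diameter (U i) `^ s)%:E)%E |
    U in [set U : nat -> set P |
            E `<=` \bigcup_i U i /\ forall i, diameter (U i) <= eps]].

Definition hausdorff_measure (s : R) (E : set P) : \bar R :=
  ereal_sup [set hausdorff_content s eps E | eps in [set eps | 0 < eps]].

(* Restricting to [0 < s] does not change the infimum, and avoids the
   convention [0 `^ 0 = 1]. *)
Definition hausdorff_dim (E : set P) : R :=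
  inf [set s | 0 < s /\ hausdorff_measure s E = 0%E].

End projective_line.

Section words.
Variable g : nat.

(* [(i, false)] is the [i]-th generator and [(i, true)] its inverse. *)
Definition letter : Type := ('I_g * bool)%type.
Definition linv (a : letter) : letter := (a.1, ~~ a.2).

(* Elements of the free group are reduced words. *)
Definition reduced (w : seq letter) : bool := sorted (fun a b => b != linv a) w.

(* Elements of the completion of the Cayley graph outside the graph. *)
Definition reduced_inf (v : nat -> letter) : Prop :=
  forall n, v n.+1 != linv (v n).

(* As [v] is reduced, there is no cancellation after the initial word [w]. *)
Definition prefix_inf (w : seq letter) (v : nat -> letter) : Prop :=
  w = mkseq v (size w).

End words.

Definition cast_letter g1 g2 (e : g1 = g2) (a : letter g1) : letter g2 :=
  (cast_ord e a.1, a.2).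

Section words_in_PGL2.
Context {R : realType}.
Local Notation C := R[i].

(* Elements of PGL(2,C) are represented by invertible matrices. *)
Definition pgl_eq (A B : 'M[C]_2) : Prop := exists2 c : C, c != 0 & A = c *: B.

Definition word_mx g (G : 'I_g -> 'M[C]_2) (w : seq (letter g)) : 'M[C]_2 :=
  \prod_(a <- w) (if a.2 then invmx (G a.1) else G a.1).

End words_in_PGL2.

(* A homomorphism from the free group to PGL(2,C) is given by (representatives
   of) the images of the generators; the last two fields say that it is injective
   and that its image is a discrete subset. *)
Record schottky (R : realType) (g : nat) := Schottky {
  sch_gen : 'I_g -> 'M[R[i]]_2;
  sch_unit : forall i, sch_gen i \in unitmx;
  sch_inj : forall w v, reduced w -> reduced v ->
    pgl_eq (word_mx sch_gen w) (word_mx sch_gen v) -> w = v;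
  sch_discrete : forall v, reduced v ->
    \forall B \near word_mx sch_gen v, forall w, reduced w ->
      pgl_eq B (word_mx sch_gen w) ->
      pgl_eq (word_mx sch_gen w) (word_mx sch_gen v)
}.

Section schottky_groups.
Context {R : realType} {g : nat}.
Variable rho : schottky R g.
Local Notation C := R[i].
Local Notation P := (P1 R).

Definition sch_act (w : seq (letter g)) : P -> P :=
  mobius (word_mx (sch_gen rho) w).

Definition limit_set : set P :=
  [set y | exists (x : P) (w : nat -> seq (letter g)),
     [/\ injective w, forall n, reduced (w n) &
         (fun n => sch_act (w n) x) @ \oo --> y]].

Definition domain_of_discontinuity : set P := ~` limit_set.

(* [p] exhibits [X] as the quotient Riemann surface of the domain of
   discontinuity by the group. *)
Definition uniformizes (X : riemann_surface R) (p : P -> X) : Prop :=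
  [/\ holomorphic_map P1_atlas (@rs_atlas R X) domain_of_discontinuity p,
      p @` domain_of_discontinuity = setT &
      forall x y, domain_of_discontinuity x -> domain_of_discontinuity y ->
        (p x = p y <-> exists2 w, reduced w & y = sch_act w x)].

Definition end_point (x0 : P) (v : nat -> letter g) : P :=
  lim ((fun n => sch_act (mkseq v n) x0) @ \oo).

Definition shadow (x0 : P) (w : seq (letter g)) : set P :=
  end_point x0 @` [set v | reduced_inf v /\ prefix_inf w v].

(* A probability measure on the limit set that is conformal, for the spherical
   metric, of dimension the Hausdorff dimension of the limit set. For a convex
   cocompact group there is exactly one (Sullivan). *)
Definition patterson_sullivan (mu : probability (borelP1 R) R) : Prop :=
  mu limit_set = 1%E /\
  forall w (E : set (borelP1 R)), reduced w -> measurable E ->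
    mu (sch_act w @` E) =
    (\int[mu]_(x in E)
       (conformal_derivative (sch_act w) x `^ hausdorff_dim limit_set)%:E)%E.

(* Functions on the limit set are represented by functions on P^1(C), whose
   values off the limit set are irrelevant. *)
Definition continuous_functions : set (P -> C) :=
  [set a | {within limit_set, continuous a}].

Definition locally_constant_functions : set (P -> C) :=
  [set a | forall x, limit_set x ->
     \forall y \near x, limit_set y -> a y = a x].

Definition state (mu : probability (borelP1 R) R) (a : P -> C) : C :=
  Complex (\int[mu]_(x in limit_set) complex.Re (a x))
          (\int[mu]_(x in limit_set) complex.Im (a x)).

Definition filtration (x0 : P) (n : nat) : set (P -> C) :=
  lin_span [set a | exists w, [/\ reduced w, (size w <= n)%N &
                      a = \1_(shadow x0 w) :> (P -> C)]].

End schottky_groups.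

Section hilbert_spaces.
Context {R : realType} {H : completeNormedModType R[i]}.
Variable ip : H -> H -> R[i].

Definition hilbert_product : Prop :=
  [/\ forall c x y z, ip (c *: x + y) z = c * ip x z + ip y z,
      forall x y, ip y x = (ip x y)^*%C &
      forall x, `|x| ^+ 2 = ip x x].

Definition orthogonal_projection (E : set H) (x : H) : H :=
  xget 0 [set p | E p /\ forall h, E h -> ip (x - p) h = 0].

Definition orthonormal_basis (e : nat -> H) : Prop :=
  (forall i j, ip (e i) (e j) = (i == j)%:R) /\
  (forall x, (forall k, ip x (e k) = 0) -> x = 0).

(* Convergence for all bases (hence for all reorderings of a basis) is absolute
   convergence. *)
Definition has_trace (T : H -> H) (t : R[i]) : Prop :=
  forall e, orthonormal_basis e ->
    (fun N => \sum_(k < N) ip (T (e k)) (e k)) @ \oo --> t.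

End hilbert_spaces.

(* The data depending on the choices: the base point, and the Hilbert space
   completion with its GNS representation [st_rep]; [st_vec] is the canonical map
   from the algebra to its completion. *)
Record spectral_triple (R : realType) (g : nat) (rho : schottky R g) :=
  SpectralTriple {
  st_base : P1 R;
  st_baseP : domain_of_discontinuity rho st_base;
  st_mu : probability (borelP1 R) R;
  st_muP : patterson_sullivan rho st_mu;
  st_H :> completeNormedModType R[i];
  st_ip : st_H -> st_H -> R[i];
  st_ipP : hilbert_product st_ip;
  st_vec : (P1 R -> R[i]) -> st_H;
  st_vec_linear : forall (c : R[i]) a b, continuous_functions rho a ->
    continuous_functions rho b -> st_vec (c *: a + b) = c *: st_vec a + st_vec b;
  st_vec_isometry : forall a b, continuous_functions rho a ->
    continuous_functions rho b ->
    st_ip (st_vec a) (st_vec b) = state rho st_mu (fun x => (b x)^*%C * a x);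
  st_vec_dense : closure (st_vec @` continuous_functions rho) = setT;
  st_rep : (P1 R -> R[i]) -> st_H -> st_H;
  st_rep_continuous : forall a, continuous_functions rho a ->
    continuous (st_rep a);
  st_rep_mul : forall a b, continuous_functions rho a ->
    continuous_functions rho b -> st_rep a (st_vec b) = st_vec (fun x => a x * b x)
}.

Section dirac_operator.
Context {R : realType} {g : nat} {rho : schottky R g}.
Variable S : spectral_triple rho.

Definition proj (n : nat) : S -> S :=
  orthogonal_projection (@st_ip _ _ _ S)
    (@st_vec _ _ _ S @` filtration rho (st_base S) n).

Definition dirac_eigenvalue (n : nat) : R :=
  (lin_dim (filtration rho (st_base S) n) ^ 3)%:R.

Definition dirac_spectral_proj (n : nat) (x : S) : S :=
  if n is m.+1 then proj m.+1 x - proj m x else proj 0 x.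

(* The partial sums of [f(D) x = \sum_n f(lambda_n) (P_n - P_{n-1}) x]. *)
Definition dirac_calculus (f : R -> R[i]) (x : S) (N : nat) : S :=
  \sum_(n < N) f (dirac_eigenvalue n) *: dirac_spectral_proj n x.

(* The graph of the unbounded operator [D]. *)
Definition dirac (x y : S) : Prop :=
  dirac_calculus (fun l => l%:C%C) x @ \oo --> y.

Definition abs_dirac_pow (s : R[i]) (x : S) : S :=
  lim (dirac_calculus (fun l => cpow `|l| s) x @ \oo).

(* The zeta function of [a] is tr(a |D|^s) for [Re s] sufficiently negative,
   continued meromorphically. *)
Definition is_zeta (a : P1 R -> R[i]) (Z : R[i] -> R[i]) : Prop :=
  meromorphic Z /\
  exists c : R, forall s, complex.Re s < c ->
    has_trace (@st_ip _ _ _ S) (fun x => st_rep a (abs_dirac_pow s x)) (Z s).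

End dirac_operator.

Section comparison.
Context {R : realType} {g1 g2 : nat}.
Context {rho1 : schottky R g1} {rho2 : schottky R g2}.
Variables (S1 : spectral_triple rho1) (S2 : spectral_triple rho2).

(* The homeomorphism between the limit sets that identifies their points with the
   same ends of the free group. *)
Definition boundary_map (e : g1 = g2) (x : P1 R) : P1 R :=
  xget point [set y | exists v : nat -> letter g1,
    [/\ reduced_inf v, x = end_point rho1 (st_base S1) v &
        y = end_point rho2 (st_base S2) (cast_letter e \o v)]].

Definition push (e : g1 = g2) (a : P1 R -> R[i]) : P1 R -> R[i] :=
  a \o pinv (limit_set rho1) (boundary_map e).

Definition same_zeta (a b : P1 R -> R[i]) : Prop :=
  exists Z, is_zeta S1 a Z /\ is_zeta S2 b Z.

(* The first condition implies [g1 = g2]. *)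
Definition same_zetas : Prop :=
  same_zeta (fun=> 1) (fun=> 1) /\
  forall (e : g1 = g2) a, locally_constant_functions rho1 a ->
    same_zeta a (push e a).

(* A unitary equivalence of spectral triples for which the algebras are identified
   as in [same_zetas]; that the Dirac operators correspond implies [g1 = g2]. *)
Definition same_spectral_triples : Prop :=
  exists U : S1 -> S2,
    [/\ forall (c : R[i]) x y, U (c *: x + y) = c *: U x + U y,
        (forall x y, st_ip (U x) (U y) = st_ip x y) /\
          (forall z, exists x, U x = z),
        forall x y, dirac x y <-> dirac (U x) (U y) &
        forall (e : g1 = g2) a x, continuous_functions rho1 a ->
          U (st_rep a x) = st_rep (push e a) (U x)].

End comparison.

(* Main.v *)
Require Import Defs.
From mathcomp Require Import all_boot all_order all_algebra.
From mathcomp Require Import all_classical all_reals all_analysis.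
From mathcomp Require Import complex ring lra zify measurable_realfun.

Set Implicit Arguments.
Unset Strict Implicit.
Unset Printing Implicit Defensive.

Import Order.TTheory GRing.Theory Num.Theory.
Import numFieldNormedType.Exports.

Local Open Scope classical_set_scope.
Local Open Scope ring_scope.

(** Why the theorem is true.

    The limit set of a convex cocompact free group is the set of ends of the group, and
    the shadow of a reduced word is the set of ends that begin with it. Both the zeta
    functions and the spectral triple determine the Patterson-Sullivan measure of every
    shadow. The operator [D] has the simple eigenvalue [1], on the constant functions, and
    its other eigenvalues are at least [(2 g)^3], which is attained. Hence, as [s] tends to
    [-oo], [tr (|D|^s) - 1] decays like [(2 g)^(3 s)], which determines [g], and
    [tr (a |D|^s)] tends to the integral of [a]. A unitary equivalence preserves the
    eigenvalues, and the line of the constant functions up to a phase, so it preserves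
    these integrals as well ([same_zetas_mass], [same_triples_mass]).

    Equal masses of shadows give equal densities: if [Phi] is the boundary map, then
    [|a'(x)|^d1 = |a'(Phi x)|^d2] for every letter [a], where [d1] and [d2] are the two
    dimensions ([mass_ratio], [same_density]). Therefore
    [chordal x y ^ d1 / chordal (Phi x) (Phi y) ^ d2] is invariant under the group. It is
    continuous on the pairs of distinct points, and any two such pairs are limits of pairs
    in a single orbit; so it is constant ([distortion_const]). Send the two fixed points
    of a generator to [oo] and [0], and a third end to [1]: then
    [|z - w| ^ d1 = |Phi z - Phi w| ^ d2]. The generator acts on both sides as a dilation,
    and the parallelogram law for [1] and its factor forces [d1 = d2]
    ([dimension_eq]). So [Phi] preserves Euclidean distances and fixes [0] and [1]: it
    is the identity or the complex conjugation, that is, in the original coordinates, a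
    Möbius or anti-Möbius transformation ([boundary_rigidity]). This transformation is
    equivariant at the ends, hence everywhere, and maps one domain of discontinuity onto
    the other. It descends to a bijection of the surfaces that is holomorphic, or
    antiholomorphic, in both directions ([conformal_of_mobius],
    [anticonformal_of_mobius]); for this, the inverse of an injective holomorphic map must
    be holomorphic ([injective_derivative0], from Cauchy's theorem for rectangles).

    It remains to know that the ends are the limit points, without assuming anything on
    the fundamental domain. Discreteness yields the convergence property: any sequence of
    distinct elements contracts, along a subsequence, the complement of one limit point to a
    limit point ([convergence]). The map to the compact surface is a local homeomorphism,
    by invariance of domain, so the domain of discontinuity is covered by translates of
    a compact set [K] ([cocompact]). For a reduced word [w], the tiles beyond [w] meet the
    other ones only in a small set near [w K]. Janiszewski's theorem ([separator]) then
    provides a function on the sphere that vanishes off a small ball, is at least [1/2]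
    on the former, at most [1/2] on the latter, and an integer on the limit set. It
    follows that the domain is connected ([Om_connected]), that the tiles beyond a long
    word form a small set, and that their closure meets the closure of the other tiles in
    no limit point ([beyond_small]). So ends and limit points correspond, and shadows are
    small, open and closed in the limit set. *)

(** * Complex numbers in real terms *)

Section complex_plane.
Context {R : realType}.
Local Notation C := R[i].
Local Notation cn := (@ComplexField.Normc.normc R).
Implicit Types (z w : C) (U : set C).

Lemma cn_ge0 z : 0 <= cn z.
Proof. by case: z => a b; exact: sqrtr_ge0. Qed.

Lemma normE z : `|z| = (cn z)%:C%C.
Proof. by rewrite normc_def; case: z. Qed.

Lemma cn_eq0 z : (cn z == 0) = (z == 0).
Proof.
apply/eqP/eqP => [|->]; first exact: ComplexField.Normc.eq0_normc.
by rewrite ComplexField.Normc.normc0.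
Qed.

Lemma cn_gt0 z : (0 < cn z) = (z != 0).
Proof. by rewrite lt_neqAle cn_ge0 andbT eq_sym cn_eq0. Qed.

Lemma cnM z w : cn (z * w) = cn z * cn w.
Proof. exact: ComplexField.Normc.normcM. Qed.

Lemma cnV z : cn z^-1 = (cn z)^-1.
Proof. exact: ComplexField.Normc.normcV. Qed.

Lemma cnN z : cn (- z) = cn z. Proof. exact: normcN. Qed.

Lemma cn0 : cn 0 = 0. Proof. exact: ComplexField.Normc.normc0. Qed.
Lemma cn1 : cn 1 = 1. Proof. exact: ComplexField.Normc.normc1. Qed.

Lemma cnB z w : cn (z - w) = cn (w - z).
Proof. by rewrite -cnN opprB. Qed.

Lemma cnD z w : cn (z + w) <= cn z + cn w. Proof. exact: le_normcD. Qed.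

Lemma cn_sqr z : cn z ^+ 2 = complex.Re z ^+ 2 + complex.Im z ^+ 2.
Proof. by case: z => a b; rewrite sqr_sqrtr // addr_ge0 // sqr_ge0. Qed.

Lemma cnX z n : cn (z ^+ n) = cn z ^+ n.
Proof. by elim: n => [|n IH]; rewrite ?expr0 ?cn1 // !exprS cnM IH. Qed.

Lemma cn_real (x : R) : cn x%:C%C = `|x|.
Proof. by rewrite /= expr0n /= addr0 sqrtr_sqr. Qed.

Lemma cn_conj z : cn z^*%C = cn z.
Proof. by case: z => a b /=; rewrite sqrrN. Qed.

Lemma ReD z w : complex.Re (z + w) = complex.Re z + complex.Re w.
Proof. by case: z; case: w. Qed.
Lemma ImD z w : complex.Im (z + w) = complex.Im z + complex.Im w.
Proof. by case: z; case: w. Qed.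
Lemma ReB z w : complex.Re (z - w) = complex.Re z - complex.Re w.
Proof. by case: z; case: w. Qed.
Lemma ImB z w : complex.Im (z - w) = complex.Im z - complex.Im w.
Proof. by case: z; case: w. Qed.

Lemma Re_le_cn z : `|complex.Re z| <= cn z.
Proof.
by case: z => a b /=; rewrite -(sqrtr_sqr a) ler_wsqrtr // lerDl sqr_ge0.
Qed.

Lemma Im_le_cn z : `|complex.Im z| <= cn z.
Proof.
by case: z => a b /=; rewrite -(sqrtr_sqr b) ler_wsqrtr // lerDr sqr_ge0.
Qed.

Lemma cn_le_ReIm z : cn z <= `|complex.Re z| + `|complex.Im z|.
Proof.
rewrite -(ler_pXn2r (n := 2)) ?nnegrE ?cn_ge0 ?addr_ge0 // cn_sqr.
rewrite sqrrD !real_normK ?num_real //.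
by rewrite -addrA lerD2l lerDr mulrn_wge0 // mulr_ge0.
Qed.

Lemma nbhs_cn z U :
  nbhs z U <-> exists2 e : R, 0 < e & forall w, cn (w - z) < e -> U w.
Proof.
split.
- move=> /nbhs_ballP [e /= e0 eU]; exists (complex.Re e).
    by move: e0; rewrite ltcE => /andP[].
  move=> w we; apply: eU; rewrite /ball /= -normrN opprB normE.
  by move: e0; rewrite !ltcE /= => /andP[/eqP -> _]; rewrite eqxx.
- move=> [e e0 eU]; apply/nbhs_ballP; exists e%:C%C => /=; first by rewrite ltcR.
  by move=> w; rewrite /ball /= -normrN opprB normE ltcR => /eU.
Qed.

Lemma cvg_cn T (F : set_system T) (f : T -> C) z : Filter F ->
  (f x @[x --> F] --> z) <->
  (forall e : R, 0 < e -> \forall x \near F, cn (f x - z) < e).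
Proof.
move=> FF; split=> [fz e e0|fz U /nbhs_cn[e e0 eU]].
  by apply: (fz [set w | cn (w - z) < e]); apply/nbhs_cn; exists e.
by apply: filterS (fz e e0) => x /eU.
Qed.

Lemma continuous_Re : continuous (@complex.Re R : C -> R).
Proof.
move=> z; have FF : Filter (nbhs (z : C)) by exact: nbhs_filter.
apply/cvgrPdist_lt => e e0; apply/nbhs_cn; exists e => [//|w].
apply: le_lt_trans; rewrite -normrN opprB.
by rewrite -ReB; exact: Re_le_cn.
Qed.

Lemma continuous_Im : continuous (@complex.Im R : C -> R).
Proof.
move=> z; have FF : Filter (nbhs (z : C)) by exact: nbhs_filter.
apply/cvgrPdist_lt => e e0; apply/nbhs_cn; exists e => [//|w].
apply: le_lt_trans; rewrite -normrN opprB.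
by rewrite -ImB; exact: Im_le_cn.
Qed.

Lemma cvg_Complex T (F : set_system T) (f g : T -> R) a b : Filter F ->
  f x @[x --> F] --> a -> g x @[x --> F] --> b ->
  Complex (f x) (g x) @[x --> F] --> Complex a b.
Proof.
move=> FF fa gb; apply/cvg_cn => e e0.
have e20 : 0 < e / 2 by rewrite divr_gt0.
near=> x; apply: (le_lt_trans (cn_le_ReIm _)) => /=.
rewrite (splitr e); apply: ltrD.
  by rewrite -normrN opprB; near: x; move/cvgrPdist_lt : fa; apply.
by rewrite -normrN opprB; near: x; move/cvgrPdist_lt : gb; apply.
Unshelve. all: by end_near. Qed.

Lemma continuous_cn : continuous (cn : C -> R).
Proof.
move=> z; have FF : Filter (nbhs (z : C)) by exact: nbhs_filter.
apply/cvgrPdist_lt => e e0; apply/nbhs_cn; exists e => [//|w].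
apply: le_lt_trans; rewrite ler_norml.
have := cnD (w - z) z; have := cnD (z - w) w; rewrite !subrK (cnB z w); lra.
Qed.

Lemma cvg_cnorm T (F : set_system T) (f : T -> C) z : Filter F ->
  f x @[x --> F] --> z -> cn (f x) @[x --> F] --> cn z.
Proof. by move=> FF fz; apply: (cvg_comp _ _ fz); exact: continuous_cn. Qed.

Lemma compact_disc (r : R) : compact [set z | cn z <= r].
Proof.
pose f (p : R * R) : C := Complex p.1 p.2.
have fc : continuous f.
  move=> p; apply: cvg_Complex; [exact: cvg_fst|exact: cvg_snd].
have cK : compact (f @` (`[- r, r] `*` `[- r, r])).
  apply: continuous_compact; first exact: continuous_subspaceT.
  by apply: compact_setX; exact: segment_compact.
apply: (subclosed_compact _ cK).
- rewrite (_ : [set z | _] = cn @^-1` [set x | x <= r]) //.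
  have /continuous_closedP := continuous_cn; apply; exact: closed_le.
- move=> z /= zr; exists (complex.Re z, complex.Im z); last by case: z zr.
  have := le_trans (Re_le_cn z) zr; have := le_trans (Im_le_cn z) zr.
  by rewrite !ler_norml /= !in_itv /= => -> ->.
Qed.

Lemma complex_hausdorff : hausdorff_space C.
Proof. exact: norm_hausdorff. Qed.

End complex_plane.

#[global] Arguments ComplexField.Normc.normc : simpl never.
#[global] Arguments mobius : simpl never.
#[global] Arguments chordal : simpl never.
#[global] Arguments reduced : simpl never.

(** * The projective line and its Möbius transformations *)

Section projective_geometry.
Context {R : realType}.
Local Notation C := R[i].
Local Notation cn := (@ComplexField.Normc.normc R).
Local Notation P := (P1 R).
Implicit Types (x y z : P) (M N : 'M[C]_2).

Definition nrm2 (a b : C) : R := Num.sqrt (cn a ^+ 2 + cn b ^+ 2).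

Lemma nrm2_ge0 a b : 0 <= nrm2 a b. Proof. exact: sqrtr_ge0. Qed.

Lemma nrm2_sqr a b : nrm2 a b ^+ 2 = cn a ^+ 2 + cn b ^+ 2.
Proof. by rewrite sqr_sqrtr // addr_ge0 // sqr_ge0. Qed.

Lemma nrm2_gt0 a b : (0 < nrm2 a b) = (a != 0) || (b != 0).
Proof.
rewrite sqrtr_gt0 lt_neqAle eq_sym addr_ge0 ?sqr_ge0 // andbT.
by rewrite paddr_eq0 ?sqr_ge0 // !sqrf_eq0 !cn_eq0 negb_and.
Qed.

Lemma nrm2Z c a b : nrm2 (c * a) (c * b) = cn c * nrm2 a b.
Proof.
rewrite /nrm2 !cnM !exprMn -mulrDr sqrtrM ?sqr_ge0 // sqrtr_sqr.
by rewrite ger0_norm ?cn_ge0.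
Qed.

Lemma cn_le_nrm2l a b : cn a <= nrm2 a b.
Proof.
rewrite -(ler_pXn2r (n := 2)) ?nnegrE ?cn_ge0 ?nrm2_ge0 // nrm2_sqr.
by rewrite lerDl sqr_ge0.
Qed.

Lemma cn_le_nrm2r a b : cn b <= nrm2 a b.
Proof.
rewrite -(ler_pXn2r (n := 2)) ?nnegrE ?cn_ge0 ?nrm2_ge0 // nrm2_sqr.
by rewrite lerDr sqr_ge0.
Qed.

Lemma nrm2D a b c d : nrm2 (a + c) (b + d) <= nrm2 a b + nrm2 c d.
Proof.
have sq u : 0 <= u -> Num.sqrt u ^+ 2 = u :> R by move=> ?; rewrite sqr_sqrtr.
rewrite -(ler_pXn2r (n := 2)) ?nnegrE ?addr_ge0 ?nrm2_ge0 //.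
rewrite sqrrD !nrm2_sqr.
have h : cn a * cn c + cn b * cn d <= nrm2 a b * nrm2 c d.
  rewrite -(ler_pXn2r (n := 2)) ?nnegrE ?addr_ge0 ?mulr_ge0 ?cn_ge0 ?nrm2_ge0 //.
  rewrite exprMn !nrm2_sqr -subr_ge0.
  rewrite (_ : _ - _ = (cn a * cn d - cn b * cn c) ^+ 2) ?sqr_ge0 //; ring.
have h1 : cn (a + c) ^+ 2 <= (cn a + cn c) ^+ 2.
  by rewrite ler_pXn2r ?nnegrE ?addr_ge0 ?cn_ge0 // cnD.
have h2 : cn (b + d) ^+ 2 <= (cn b + cn d) ^+ 2.
  by rewrite ler_pXn2r ?nnegrE ?addr_ge0 ?cn_ge0 // cnD.
nra.
Qed.

(** Homogeneous coordinates of a point. *)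
Definition h0 x : C := if x is Some z then z else 1.
Definition h1 x : C := if x is Some _ then 1 else 0.
Definition hn x : R := nrm2 (h0 x) (h1 x).
Definition hdet x y : C := h0 x * h1 y - h1 x * h0 y.
Definition pt (a b : C) : P := if b == 0 then None else Some (a / b).

Lemma h_neq0 x : (h0 x != 0) || (h1 x != 0).
Proof. by case: x => [z|] /=; rewrite ?oner_eq0 ?orbT. Qed.

Lemma hn_gt0 x : 0 < hn x. Proof. by rewrite nrm2_gt0 h_neq0. Qed.
Lemma hn_neq0 x : hn x != 0. Proof. by rewrite gt_eqF ?hn_gt0. Qed.
Lemma hn_ge1 x : 1 <= hn x.
Proof.
case: x => [z|]; rewrite /hn /=.
  by apply: le_trans (cn_le_nrm2r _ _); rewrite cn1.
by apply: le_trans (cn_le_nrm2l _ _); rewrite cn1.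
Qed.

(** The chordal distance of two lines of the plane is twice the sine of their angle. *)
Lemma chordalE x y : chordal x y = 2 * cn (hdet x y) / (hn x * hn y).
Proof.
rewrite /hdet /hn /nrm2 /chordal; case: x y => [z|] [w|] /=.
- rewrite !mulr1 !mul1r !cn1 !expr1n.
  by rewrite ![cn _ ^+ 2 + 1]addrC.
- rewrite !(mulr0, mulr1, mul0r, sub0r) cnN !cn1 cn0 !expr1n expr0n /= addr0.
  by rewrite sqrtr1 mulr1 [1 + _]addrC mulr1.
- rewrite !(mulr0, mulr1, mul0r, subr0) !cn1 cn0 !expr1n expr0n /= addr0.
  by rewrite sqrtr1 mulr1 mul1r [1 + _]addrC.
- by rewrite !(mulr0, mul0r, subr0) cn0 mulr0 mul0r.
Qed.

Lemma chordal_ge0 x y : 0 <= chordal x y.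
Proof. by rewrite chordalE !(divr_ge0, mulr_ge0) ?cn_ge0 ?nrm2_ge0. Qed.

Lemma chordal_sym x y : chordal x y = chordal y x.
Proof.
by rewrite !chordalE [hn x * _]mulrC /hdet -(cnN (_ - _)) opprB ![h1 x * _]mulrC
  ![h0 x * _]mulrC.
Qed.

Lemma pt_h x : pt (h0 x) (h1 x) = x.
Proof. by case: x => [z|]; rewrite /pt /= ?oner_eq0 ?divr1 ?eqxx. Qed.

Lemma ptZ c a b : c != 0 -> pt (c * a) (c * b) = pt a b.
Proof.
move=> c0; rewrite /pt mulf_eq0 (negbTE c0) /=.
by case: eqP => // /eqP b0; rewrite -mulf_div divff ?mul1r.
Qed.

Lemma h_pt a b : (a != 0) || (b != 0) ->
  exists2 c, c != 0 & a = c * h0 (pt a b) /\ b = c * h1 (pt a b).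
Proof.
rewrite /pt; case: (eqVneq b 0) => [->|b0 _] /=.
  by rewrite orbF => a0; exists a; rewrite // mulr1 mulr0.
by exists b => //; rewrite mulr1 mulrC divfK.
Qed.

Lemma eq_hdet0 x y : (hdet x y == 0) = (x == y).
Proof.
apply/eqP/eqP => [|->]; last by rewrite /hdet mulrC subrr.
case: x y => [z|] [w|]; rewrite /hdet /= ?(mulr1, mul1r, mulr0, mul0r, subr0, sub0r) //.
- by move/eqP; rewrite subr_eq0 => /eqP ->.
- by move/eqP; rewrite oppr_eq0 oner_eq0.
- by move/eqP; rewrite oner_eq0.
Qed.

Lemma chordal_eq0 x y : (chordal x y == 0) = (x == y).
Proof.
rewrite chordalE mulf_eq0 invr_eq0 (mulf_eq0 (hn x)) !(negbTE (hn_neq0 _)) !orbF.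
by rewrite mulf_eq0 pnatr_eq0 /= cn_eq0 eq_hdet0.
Qed.

Lemma chordalxx x : chordal x x = 0. Proof. by apply/eqP; rewrite chordal_eq0. Qed.

Lemma chordal_gt0 x y : (0 < chordal x y) = (x != y).
Proof. by rewrite lt_neqAle chordal_ge0 andbT eq_sym chordal_eq0. Qed.

(** The identity [hdet x y * h z + hdet y z * h x = hdet x z * h y] between homogeneous
    coordinates [h] turns the triangle inequality of the norm into that of the distance. *)
Lemma chordal_tri x y z : chordal x z <= chordal x y + chordal y z.
Proof.
have key : cn (hdet x z) * hn y <= cn (hdet x y) * hn z + cn (hdet y z) * hn x.
  rewrite /hn -!nrm2Z; apply: le_trans (nrm2D _ _ _ _).
  rewrite (_ : hdet x y * _ + _ = hdet x z * h0 y); last by rewrite /hdet; ring.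
  by rewrite (_ : hdet x y * _ + _ = hdet x z * h1 y) //; rewrite /hdet; ring.
rewrite !chordalE.
rewrite -subr_ge0 (_ : _ - _ =
  2 * (cn (hdet x y) * hn z + cn (hdet y z) * hn x - cn (hdet x z) * hn y) /
  (hn x * hn y * hn z)); last first.
  by field; rewrite !hn_neq0.
by rewrite divr_ge0 ?mulr_ge0 ?subr_ge0 // ?nrm2_ge0.
Qed.

Lemma chordal_pt a b c d : (a != 0) || (b != 0) -> (c != 0) || (d != 0) ->
  chordal (pt a b) (pt c d) = 2 * cn (a * d - b * c) / (nrm2 a b * nrm2 c d).
Proof.
move=> /h_pt [u u0 [eqa eqb]] /h_pt [v v0 [eqc eqd]].
rewrite chordalE; set x := pt a b in eqa eqb *; set y := pt c d in eqc eqd *.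
rewrite eqa eqb eqc eqd !nrm2Z -!/(hn _).
rewrite (_ : _ - _ = u * v * hdet x y).
  rewrite !cnM; field.
  by rewrite !hn_neq0 !cn_eq0 u0 v0.
by rewrite /hdet; ring.
Qed.

Lemma chordal_Some (z w : C) : chordal (Some z : P) (Some w : P) <= 2 * cn (z - w).
Proof.
rewrite chordalE ler_pdivrMr ?mulr_gt0 ?hn_gt0 // /hdet /= mulr1 mul1r.
rewrite -mulrA ler_pM2l // ler_peMr ?cn_ge0 //.
by rewrite -[1]mulr1 ler_pM ?hn_ge1.
Qed.

Lemma chordal_None (z : C) (e : R) : 0 < e -> 2 / e < cn z ->
  chordal (Some z : P) (None : P) < e.
Proof.
move=> e0 ez; rewrite chordalE /hdet /= mulr0 mul1r sub0r cnN cn1 mulr1.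
rewrite ltr_pdivrMr ?mulr_gt0 ?hn_gt0 //.
rewrite ltr_pdivrMr // in ez; apply: (lt_le_trans ez); rewrite mulrC ler_pM2l //.
rewrite -[X in X <= _]mulr1 ler_pM ?cn_ge0 ?hn_ge1 //.
exact: cn_le_nrm2l.
Qed.

Lemma nbhs_chordal_ball x (e : R) : 0 < e -> nbhs x [set y : P | chordal y x < e].
Proof.
move=> e0; case: x => [z|].
  have : nbhs z [set w | 2 * cn (w - z) < e].
    apply/nbhs_cn; exists (e / 2); first by rewrite divr_gt0.
    by move=> w; rewrite ltr_pdivlMr // mulrC.
  apply: filterS => w /=; apply: le_lt_trans; exact: chordal_Some.
exists [set z | cn z <= 2 / e] => /=.
  split; first exact: compact_disc.
  by apply: compact_closed; [exact: complex_hausdorff|exact: compact_disc].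
move=> y [[z /= zr] <-|->]; last by rewrite /mkset chordalxx.
rewrite /mkset.
by apply: chordal_None => //; rewrite ltNge; apply/negP.
Qed.

Lemma P1_compact : compact [set: P].
Proof. exact: one_point_compactification_compact. Qed.

(** The topology of the one-point compactification is that of the chordal distance. *)
Lemma nbhs_P x (U : set P) :
  nbhs x U <-> exists2 e : R, 0 < e & forall y, chordal y x < e -> U y.
Proof.
split=> [xU|[e e0 eU]]; last exact: filterS (nbhs_chordal_ball x e0).
move: xU; rewrite nbhsE => -[V [oV Vx] VU].
have cV : compact (~` V).
  by apply: (subclosed_compact _ P1_compact) => //; exact: open_closedC.
have : \forall e \near (0 : R)^'+, forall y, (~` V) y -> e <= chordal y x.
  move/compact_near_coveringP: cV; apply => y Vy.
  have d0 : 0 < chordal y x.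
    by rewrite chordal_gt0; apply/eqP => yx; apply: Vy; rewrite yx.
  have d20 : 0 < chordal y x / 2 by rewrite divr_gt0.
  near=> y' e.
  have : chordal y' y < chordal y x / 2.
    by near: y'; exact: nbhs_chordal_ball.
  have : e <= chordal y x / 2 by near: e; exact: nbhs_right_le.
  have := chordal_tri y y' x; rewrite (chordal_sym y y') /=; lra.
move=> H; have [e [e0 eP]] : exists e : R, 0 < e /\ forall y, (~` V) y -> e <= chordal y x.
  have /filter_ex [e] : \forall e \near (0 : R)^'+,
      0 < e /\ forall y, (~` V) y -> e <= chordal y x.
    by near=> e; split; near: e => //; exact: nbhs_right_gt.
  by exists e.
exists e => // y yx; apply: VU; apply: contrapT => /eP; rewrite leNgt yx //.
Unshelve. all: by end_near. Qed.

Lemma cvg_chordal T (F : set_system T) (f : T -> P) x : Filter F ->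
  (f t @[t --> F] --> x) <->
  (forall e : R, 0 < e -> \forall t \near F, chordal (f t) x < e).
Proof.
move=> FF; split=> [fx e e0|fx U /nbhs_P[e e0 eU]].
  by apply: (fx [set y | chordal y x < e]); exact: nbhs_chordal_ball.
by apply: filterS (fx e e0) => t /eU.
Qed.

Lemma P1_hausdorff : hausdorff_space P.
Proof.
move=> x y xy; apply/eqP; rewrite -chordal_eq0 eq_le chordal_ge0 andbT leNgt.
apply/negP => d0; have d20 : 0 < chordal x y / 2 by rewrite divr_gt0.
have [z [/= zx zy]] := xy _ _ (nbhs_chordal_ball x d20) (nbhs_chordal_ball y d20).
have := chordal_tri x z y; rewrite (chordal_sym x z); lra.
Qed.

Lemma continuous_chordal y : continuous ((fun x => chordal x y) : P -> R).
Proof.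
move=> x; have FF : Filter (nbhs x) by exact: nbhs_filter.
apply/cvgrPdist_lt => e e0; apply/nbhs_P; exists e => // z zx.
apply: le_lt_trans zx; rewrite ler_norml.
have := chordal_tri x z y; have := chordal_tri z x y.
rewrite (chordal_sym x z); lra.
Qed.

Lemma hn_sqr x : hn x ^+ 2 = cn (h0 x) ^+ 2 + cn (h1 x) ^+ 2.
Proof. exact: nrm2_sqr. Qed.

Definition ma M x : C := M 0 0 * h0 x + M 0 1 * h1 x.
Definition mb M x : C := M 1 0 * h0 x + M 1 1 * h1 x.
Definition mdet M : C := M 0 0 * M 1 1 - M 0 1 * M 1 0.

Lemma mobiusE M x : mobius M x = pt (ma M x) (mb M x).
Proof.
by case: x => [z|]; rewrite /mobius /pt /ma /mb /= ?mulr1 // !mulr0 !addr0.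
Qed.

Lemma I2P (i : 'I_2) : (i = 0) + (i = 1).
Proof.
by case: i => [[|[|//]] ?]; [left|right]; apply/val_inj.
Qed.

Lemma mx2E M N i j : (M * N) i j = M i 0 * N 0 j + M i 1 * N 1 j.
Proof.
rewrite mxE big_ord_recl big_ord_recl big_ord0 addr0.
by rewrite (_ : lift ord0 ord0 = 1) //; apply/val_inj.
Qed.

Lemma mdetM M N : mdet (M * N) = mdet M * mdet N.
Proof. by rewrite /mdet !mx2E; ring. Qed.

Lemma mdet1 : mdet 1 = 1.
Proof. by rewrite /mdet !mxE /= !mulr1 mul0r subr0. Qed.

Lemma mobius_neq0 M x : mdet M != 0 -> (ma M x != 0) || (mb M x != 0).
Proof.
move=> dM; apply: contraR dM; rewrite negb_or !negbK => /andP[/eqP a0 /eqP b0].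
have e0 : mdet M * h0 x = M 1 1 * ma M x - M 0 1 * mb M x.
  by rewrite /mdet /ma /mb; ring.
have e1 : mdet M * h1 x = M 0 0 * mb M x - M 1 0 * ma M x.
  by rewrite /mdet /ma /mb; ring.
move: e0 e1; rewrite a0 b0 !mulr0 subr0 => /eqP; rewrite mulf_eq0 => /orP[//|x0].
by move=> /eqP; rewrite mulf_eq0 => /orP[//|x1]; have := h_neq0 x; rewrite x0 x1.
Qed.

Lemma ma_comp M N x : ma (M * N) x = M 0 0 * ma N x + M 0 1 * mb N x.
Proof. by rewrite /ma /mb !mx2E; ring. Qed.
Lemma mb_comp M N x : mb (M * N) x = M 1 0 * ma N x + M 1 1 * mb N x.
Proof. by rewrite /ma /mb !mx2E; ring. Qed.

Lemma mobius_comp M N x : mdet N != 0 ->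
  mobius (M * N) x = mobius M (mobius N x).
Proof.
move=> dN; rewrite (mobiusE N) (mobiusE (M * N)) ma_comp mb_comp.
have [c c0 [ea eb]] := h_pt (mobius_neq0 x dN).
set y := pt _ _ in ea eb *; rewrite ea eb (mobiusE M) /ma /mb.
by rewrite !(mulrCA _ c) -!mulrDr ptZ.
Qed.

Lemma mobius1 x : mobius 1 x = x.
Proof.
rewrite mobiusE /ma /mb !mxE /= !mul1r !mul0r addr0 add0r; exact: pt_h.
Qed.

Lemma mobiusZ c M x : c != 0 -> mobius (c *: M) x = mobius M x.
Proof.
by move=> c0; rewrite !mobiusE /ma /mb !mxE -!mulrA -!mulrDr ptZ.
Qed.

(** The square root of the spherical derivative of the transformation. *)
Definition sD M x : R := Num.sqrt (cn (mdet M)) * hn x / nrm2 (ma M x) (mb M x).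

Lemma sD_gt0 M x : mdet M != 0 -> 0 < sD M x.
Proof.
move=> dM; rewrite /sD divr_gt0 ?mulr_gt0 ?hn_gt0 ?sqrtr_gt0 ?cn_gt0 //.
by rewrite -sqrtr_gt0 -/(nrm2 _ _) nrm2_gt0 mobius_neq0.
Qed.

(** A linear map multiplies all areas [hdet] by its determinant; only the norms of the
    homogeneous coordinates vary. *)
Lemma chordal_mobius M x y : mdet M != 0 ->
  chordal (mobius M x) (mobius M y) = sD M x * sD M y * chordal x y.
Proof.
move=> dM; rewrite !mobiusE chordal_pt ?mobius_neq0 // chordalE /sD.
rewrite (_ : _ - _ = mdet M * hdet x y); last by rewrite /mdet /hdet /ma /mb; ring.
rewrite cnM -{1}(sqr_sqrtr (cn_ge0 (mdet M))).
field; rewrite !hn_neq0 /= !gt_eqF ?nrm2_gt0 ?mobius_neq0 //.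
Qed.

Lemma mobius_inj M : mdet M != 0 -> injective (mobius M).
Proof.
move=> dM x y xy; apply/eqP; rewrite -chordal_eq0.
have := chordal_mobius x y dM; rewrite xy chordalxx => /esym/eqP.
rewrite mulf_eq0 => /orP[|//]; rewrite mulf_eq0.
by have /lt0r_neq0/negbTE -> := sD_gt0 x dM; have /lt0r_neq0/negbTE -> := sD_gt0 y dM.
Qed.

(** The adjugate, which inverts the transformation without dividing by the determinant. *)
Definition madj M : 'M[C]_2 :=
  \matrix_(i, j) (if i == 0 then (if j == 0 then M 1 1 else - M 0 1)
                  else (if j == 0 then - M 1 0 else M 0 0)).

Lemma madjM M : madj M * M = mdet M *: 1.
Proof.
apply/matrixP => i j; rewrite mx2E !mxE /mdet /=.
by case: (I2P i) => ->; case: (I2P j) => -> /=; ring.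
Qed.

Lemma mdet_adj M : mdet (madj M) = mdet M.
Proof. by rewrite /mdet !mxE /=; ring. Qed.

Lemma mobius_adjK M x : mdet M != 0 -> mobius (madj M) (mobius M x) = x.
Proof. by move=> dM; rewrite -mobius_comp // madjM mobiusZ // mobius1. Qed.

Lemma Mmadj M : M * madj M = mdet M *: 1.
Proof.
apply/matrixP => i j; rewrite mx2E !mxE /mdet /=.
by case: (I2P i) => ->; case: (I2P j) => -> /=; ring.
Qed.

Lemma mobius_Kadj M x : mdet M != 0 -> mobius M (mobius (madj M) x) = x.
Proof.
by move=> dM; rewrite -mobius_comp ?mdet_adj // Mmadj mobiusZ // mobius1.
Qed.

Definition mnorm M : R := cn (M 0 0) + cn (M 0 1) + cn (M 1 0) + cn (M 1 1).

Lemma mnorm_ge0 M : 0 <= mnorm M.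
Proof. by rewrite !addr_ge0 ?cn_ge0. Qed.

Lemma nrm2_le a b : nrm2 a b <= cn a + cn b.
Proof.
rewrite -(ler_pXn2r (n := 2)) ?nnegrE ?addr_ge0 ?cn_ge0 ?nrm2_ge0 // nrm2_sqr.
have := cn_ge0 a; have := cn_ge0 b; nra.
Qed.

Lemma nrm2_mx M (a b : C) :
  nrm2 (M 0 0 * a + M 0 1 * b) (M 1 0 * a + M 1 1 * b) <= mnorm M * nrm2 a b.
Proof.
apply: le_trans (nrm2_le _ _) _.
have ha := cn_le_nrm2l a b; have hb := cn_le_nrm2r a b.
have k u v : cn u * cn v <= cn u * nrm2 a b -> cn (u * v) <= cn u * nrm2 a b.
  by rewrite cnM.
have := cnD (M 0 0 * a) (M 0 1 * b); have := cnD (M 1 0 * a) (M 1 1 * b).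
rewrite !cnM /mnorm.
have := ler_wpM2l (cn_ge0 (M 0 0)) ha; have := ler_wpM2l (cn_ge0 (M 0 1)) hb.
have := ler_wpM2l (cn_ge0 (M 1 0)) ha; have := ler_wpM2l (cn_ge0 (M 1 1)) hb.
lra.
Qed.

Lemma sD_le M x : mdet M != 0 ->
  sD M x <= mnorm (madj M) / Num.sqrt (cn (mdet M)).
Proof.
move=> dM; rewrite /sD.
have d0 : 0 < cn (mdet M) by rewrite cn_gt0.
have s0 : 0 < Num.sqrt (cn (mdet M)) by rewrite sqrtr_gt0.
rewrite ler_pdivrMr ?nrm2_gt0 ?mobius_neq0 //.
have := nrm2_mx (madj M) (ma M x) (mb M x); rewrite -ma_comp -mb_comp madjM.
rewrite (_ : ma _ x = mdet M * h0 x); last by rewrite /ma !mxE /=; ring.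
rewrite (_ : mb _ x = mdet M * h1 x); last by rewrite /mb !mxE /=; ring.
rewrite nrm2Z -/(hn x) => h.
rewrite -(ler_pM2r s0) [X in X <= _](_ : _ = cn (mdet M) * hn x).
  by apply: (le_trans h); rewrite mulrAC divfK // gt_eqF.
by rewrite mulrAC -expr2 sqr_sqrtr // ltW.
Qed.

Lemma mobius_lip M : mdet M != 0 -> exists2 L : R, 0 < L &
  forall x y, chordal (mobius M x) (mobius M y) <= L * chordal x y.
Proof.
move=> dM; pose k := mnorm (madj M) / Num.sqrt (cn (mdet M)).
have k0 : 0 < k by apply: lt_le_trans (sD_le None dM); exact: sD_gt0.
exists (k * k) => [|x y]; first by rewrite mulr_gt0.
rewrite chordal_mobius // ler_wpM2r ?chordal_ge0 //.
by apply: ler_pM; rewrite ?(ltW (sD_gt0 _ dM)) //; exact: sD_le.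
Qed.

Lemma mobius_continuous M : mdet M != 0 -> continuous (mobius M).
Proof.
move=> /mobius_lip [L L0 lip] x; have FF : Filter (nbhs x) by exact: nbhs_filter.
apply/cvg_chordal => e e0; apply/nbhs_P; exists (e / L); first by rewrite divr_gt0.
move=> y; rewrite ltr_pdivlMr // mulrC; apply: le_lt_trans; exact: lip.
Qed.

End projective_geometry.

(** * Reduced words and the matrices of the group *)

Section reduced_words.
Variable g : nat.
Local Notation letter := (letter g).
Local Notation word := (seq letter).
Implicit Types (a b : letter) (u v w s t : word).

Lemma linvK : involutive (@linv g).
Proof. by case=> i b; rewrite /linv /= negbK. Qed.

Lemma linv_neq a : linv a != a.
Proof. by case: a => i b; apply/eqP => -[]; case: b. Qed.

Lemma reduced_cons a w : reduced (a :: w) =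
  (if w is b :: _ then b != linv a else true) && reduced w.
Proof. by case: w. Qed.

Lemma reduced_behead a w : reduced (a :: w) -> reduced w.
Proof. by rewrite reduced_cons => /andP[]. Qed.

Definition nocancel s t : bool :=
  if t is b :: _ then (if s is a :: s' then b != linv (last a s') else true)
  else true.

Lemma reduced_cat s t : reduced (s ++ t) = [&& reduced s, reduced t & nocancel s t].
Proof.
elim: s => [|a s IH] /=; first by case: t => //= b t; rewrite andbT.
rewrite !reduced_cons IH; case: s {IH} => [|b s] /=.
  by case: t => [|b t]; rewrite ?andbT // andbC.
by rewrite -!andbA.
Qed.

Definition winv w : word := rev (map (@linv g) w).

Lemma winvK : involutive winv.
Proof.
by move=> w; rewrite /winv map_rev revK -map_comp map_id_in // => a _ /=; exact: linvK.
Qed.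

Lemma winv_cat s t : winv (s ++ t) = winv t ++ winv s.
Proof. by rewrite /winv map_cat rev_cat. Qed.

Lemma winv_cons a w : winv (a :: w) = rcons (winv w) (linv a).
Proof. by rewrite /winv /= rev_cons. Qed.

Lemma size_winv w : size (winv w) = size w.
Proof. by rewrite size_rev size_map. Qed.

Lemma reduced_winv w : reduced (winv w) = reduced w.
Proof.
rewrite /reduced /winv rev_sorted sorted_map; apply: eq_sorted => a b /=.
by rewrite linvK eq_sym.
Qed.

(** Free reduction, one letter at a time from the right. *)
Definition cred a w : word :=
  if w is b :: w' then (if b == linv a then w' else a :: w) else [:: a].

Definition red s : word := foldr cred [::] s.

Lemma reduced_cred a w : reduced w -> reduced (cred a w).
Proof.
case: w => [|b w] //= rw; case: ifPn => [_|ba]; first exact: reduced_behead rw.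
by rewrite reduced_cons ba rw.
Qed.

Lemma reduced_red s : reduced (red s).
Proof. by elim: s => //= a s; exact: reduced_cred. Qed.

Lemma red_id w : reduced w -> red w = w.
Proof.
elim: w => //= a w IH rw; rewrite IH ?(reduced_behead rw) //.
by move: rw; rewrite reduced_cons; case: w {IH} => //= b w /andP[/negbTE ->].
Qed.

Definition heads_differ u v : bool :=
  if u is a :: _ then (if v is b :: _ then a != b else true) else true.

Lemma common_prefix u v : exists p u' v', [/\ u = p ++ u', v = p ++ v' &
  heads_differ u' v'].
Proof.
elim: u v => [|a u IH] v; first by exists [::], [::], v.
case: v => [|b v]; first by exists [::], (a :: u), [::].
have [<-|ab] := eqVneq a b; last by exists [::], (a :: u), (b :: v).
have [p [u' [v' [-> -> h]]]] := IH v.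
by exists (a :: p), u', v'.
Qed.

Lemma last_winv a w d : last d (winv (a :: w)) = linv a.
Proof. by rewrite winv_cons last_rcons. Qed.

Lemma nocancel_winv u v :
  nocancel (winv u) v = heads_differ u v.
Proof.
case: v u => [|b v] [|a u] //.
rewrite /nocancel; case E : (winv (a :: u)) => [|c s].
  by move/(congr1 size): E; rewrite size_winv.
have : last c (winv (a :: u)) = linv a by rewrite last_winv.
by rewrite E /= => ->; rewrite linvK eq_sym.
Qed.

Lemma reduced_quot p u v : reduced (p ++ u) -> reduced (p ++ v) ->
  heads_differ u v ->
  reduced (winv u ++ v).
Proof.
rewrite !reduced_cat => /and3P[_ ru _] /and3P[_ rv _] h.
by rewrite reduced_winv ru rv /= nocancel_winv.
Qed.

Lemma finite_words n : finite_set [set w : word | (size w <= n)%N].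
Proof.
elim: n => [|n IH].
  by apply: (@sub_finite_set _ _ [set [::]]) => // -[].
apply: (@sub_finite_set _ _ ([set [::]] `|`
    (fun p : letter * word => p.1 :: p.2) @` (setT `*` [set w | (size w <= n)%N]))).
  by case=> [|a w] /= sw; [left|right; exists (a, w)].
rewrite finite_setU; split; first exact: finite_set1.
by apply: finite_image; apply: finite_setX => //; exact: finite_finset.
Qed.

Lemma reduced_mkseq (v : nat -> letter) n : reduced_inf v -> reduced (mkseq v n).
Proof.
move=> rv; rewrite /reduced /mkseq sorted_map; apply/(sortedP 0%N) => i.
rewrite size_iota => ilt /=; rewrite !nth_iota //; last exact: ltnW.
exact: rv.
Qed.

Lemma mkseqS (v : nat -> letter) n : mkseq v n.+1 = rcons (mkseq v n) (v n).
Proof. by rewrite /mkseq -addn1 iotaD map_cat cats1. Qed.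

Lemma mkseq_shift (v : nat -> letter) n :
  mkseq v n.+1 = v 0%N :: mkseq (fun k => v k.+1) n.
Proof. by rewrite /mkseq /= -[1%N]/(1 + 0)%N iotaDl -map_comp. Qed.

Lemma mkseqD (v : nat -> letter) m n :
  mkseq v (m + n) = mkseq v m ++ mkseq (fun k => v (m + k)%N) n.
Proof.
by rewrite /mkseq iotaD map_cat add0n -[in LHS](addn0 m) iotaDl -map_comp addn0.
Qed.

Lemma prefix_inf_mkseq (v : nat -> letter) n : prefix_inf (mkseq v n) v.
Proof. by rewrite /prefix_inf size_mkseq. Qed.

End reduced_words.

Section words_as_matrices.
Context {R : realType} {g : nat}.
Variable rho : schottky R g.
Local Notation C := R[i].
Local Notation P := (P1 R).
Local Notation word := (seq (letter g)).
Local Notation G := (sch_gen rho).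
Implicit Types (u v w s t : word) (x y : P).

Definition wmx w : 'M[C]_2 := word_mx G w.
Definition act w (x : P) : P := sch_act rho w x.

Lemma wmx_nil : wmx [::] = 1.
Proof. by rewrite /wmx /word_mx big_nil. Qed.

Lemma wmx_cat s t : wmx (s ++ t) = wmx s * wmx t.
Proof. by rewrite /wmx /word_mx big_cat. Qed.

Lemma wmx_cons a w : wmx (a :: w) = wmx [:: a] * wmx w.
Proof. by rewrite -cat1s wmx_cat. Qed.

Lemma wmx_linv a : wmx [:: linv a] * wmx [:: a] = 1.
Proof.
rewrite /wmx /word_mx !big_seq1; case: a => i [] /=.
  by apply: mulmxV; exact: sch_unit.
by apply: mulVmx; exact: sch_unit.
Qed.

Lemma mdet_wmx w : mdet (wmx w) != 0.
Proof.
elim: w => [|a w IH]; first by rewrite wmx_nil mdet1 oner_eq0.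
rewrite wmx_cons mdetM mulf_neq0 //.
have := congr1 mdet (wmx_linv a); rewrite mdetM mdet1.
by apply: contra_eq_neq => ->; rewrite mulr0 eq_sym oner_eq0.
Qed.

Lemma wmx_cred a w : wmx (cred a w) = wmx (a :: w).
Proof.
case: w => [|b w] //=; case: eqP => // ->.
by rewrite wmx_cons (wmx_cons (linv a)) mulrA -{1}(linvK a) wmx_linv mul1r.
Qed.

Lemma wmx_red s : wmx (red s) = wmx s.
Proof.
by elim: s => //= a s IH; rewrite wmx_cred wmx_cons IH -wmx_cons.
Qed.

Lemma wmx_winv w : wmx (winv w) * wmx w = 1.
Proof.
elim: w => [|a w IH]; first by rewrite wmx_nil mul1r.
rewrite winv_cons -cats1 wmx_cat (wmx_cons a w) mulrA -(mulrA (wmx (winv w))).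
by rewrite wmx_linv mulr1.
Qed.

Lemma wmx_winvr w : wmx w * wmx (winv w) = 1.
Proof. by rewrite -{1}(winvK w) wmx_winv. Qed.

Lemma wmx_inj u v : reduced u -> reduced v -> wmx u = wmx v -> u = v.
Proof.
move=> ru rv uv; apply: (sch_inj (s := rho) ru rv); rewrite -!/(wmx _) uv.
by exists 1; [exact: oner_neq0|rewrite scale1r].
Qed.

(** Since the group is free, free reduction is determined by the matrix of the word. *)
Lemma red_unique u s : reduced u -> wmx u = wmx s -> red s = u.
Proof.
by move=> ru us; apply: wmx_inj => //; rewrite ?reduced_red // wmx_red.
Qed.

Lemma act_nil x : act [::] x = x.
Proof. by rewrite /act /sch_act -/(wmx [::]) wmx_nil mobius1. Qed.

Lemma act_cat s t x : act (s ++ t) x = act s (act t x).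
Proof. by rewrite /act /sch_act -!/(wmx _) wmx_cat mobius_comp // mdet_wmx. Qed.

Lemma act_red s x : act (red s) x = act s x.
Proof. by rewrite /act /sch_act -!/(wmx _) wmx_red. Qed.

Lemma act_winvK w : cancel (act w) (act (winv w)).
Proof.
by move=> x; rewrite -act_cat /act /sch_act -/(wmx _) wmx_cat wmx_winv mobius1.
Qed.

Lemma act_continuous w : continuous (act w).
Proof. by apply: mobius_continuous; exact: mdet_wmx. Qed.

(** A word whose quotient by a word without the prefix [w] is short is not much
   longer than [w]. *)
Lemma prefix_quot w c d : reduced c -> reduced d -> prefix w c -> ~~ prefix w d ->
  (size c - size w < size (red (winv c ++ d)))%N.
Proof.
move=> rc rd pc npd; have [p [c' [d' [ec ed h]]]] := common_prefix c d.
have sp : (size p < size w)%N.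
  rewrite ltnNge; apply: contra npd => wp; move: pc; rewrite ec ed.
  by rewrite !prefixE !takel_cat.
have -> : red (winv c ++ d) = winv c' ++ d'.
  have rq : reduced (winv c' ++ d').
    by apply: (reduced_quot (p := p) _ _ h); [rewrite -ec|rewrite -ed].
  apply: (red_unique rq).
  by rewrite ec ed winv_cat !wmx_cat -!mulrA (mulrA (wmx (winv p))) wmx_winv mul1r.
rewrite size_cat size_winv ec size_cat.
have : (size w <= size p + size c')%N.
  by rewrite -size_cat -ec; have /prefixP [t ->] := pc; rewrite size_cat leq_addr.
move: sp; lia.
Qed.

End words_as_matrices.

(** * Convergence dynamics and the limit set *)

Lemma filter_ex2 T (F : set_system T) (A B : set T) : ProperFilter F ->
  F A -> F B -> exists x, A x /\ B x.
Proof. by move=> PF FA FB; exact: (@filter_ex _ _ PF _ (filterI FA FB)). Qed.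

(** Ultrafilters of words replace the extraction of subsequences. *)
Lemma ultra_cvg T (X : topologicalType) (U : set_system T) (f : T -> X) (K : set X) :
  UltraFilter U -> compact K -> (forall t, K (f t)) ->
  exists2 z, K z & f t @[t --> U] --> z.
Proof.
move=> UU cK Kf; have PU : ProperFilter (f t @[t --> U]) by exact: fmap_proper_filter.
have [|z [Kz zcl]] := cK _ PU; first by apply: (@filterE _ U); exact: Kf.
exists z => // V zV; have [//|UV] := in_ultra_setVsetC (f @^-1` V) UU.
have := zcl (~` V) V; case=> // x [] //.
Qed.

Section escaping_ultrafilters.
Variable g : nat.
Local Notation word := (seq (letter g)).

Definition escaping (U : set_system word) : Prop :=
  forall n, U [set w | reduced w /\ (n < size w)%N].

Lemma escaping_infinite (U : set_system word) (S : set word) :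
  ProperFilter U -> escaping U -> U S -> infinite_set S.
Proof.
move=> PU eU US fS.
have [n nS] : exists n, forall w, S w -> (size w <= n)%N.
  have /finite_seqP [s sE] := fS.
  exists (\max_(w <- s) size w) => w; rewrite sE /= => ws.
  by rewrite (big_rem w) //= leq_maxl.
have [w [Sw [_]]] := filter_ex2 PU US (eU n).
by rewrite ltnNge nS.
Qed.

(** The sets [S e] generate, together with the complements of finite sets, a proper
    filter, as they are infinite and decreasing. *)
Lemma infinite_escaping (R : realType) (S : R -> set word) :
  (forall e w, S e w -> reduced w) ->
  (forall d e, d <= e -> S d `<=` S e) ->
  (forall e, 0 < e -> infinite_set (S e)) ->
  exists U, [/\ UltraFilter U, escaping U & forall e, 0 < e -> U (S e)].
Proof.
move=> rS mS iS.
pose F : set_system word := [set A | exists2 e, 0 < e & finite_set (S e `\` A)].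
have PF : ProperFilter F.
  split; last split.
  - by move=> [e e0]; rewrite setD0; exact: iS.
  - by exists 1 => //; rewrite setDT.
  - move=> A B [d d0 dA] [e e0 eB]; exists (Num.min d e); first by rewrite lt_min d0.
    apply: (@sub_finite_set _ _ ((S d `\` A) `|` (S e `\` B))).
      move=> w [Sw nAB]; have [Aw|nAw] := pselect (A w); [right|left]; split => //.
      - by apply: mS Sw; rewrite ge_min lexx orbT.
      - by move=> Bw; apply: nAB.
      - by apply: mS Sw; rewrite ge_min lexx.
    by rewrite finite_setU.
  - move=> A B AB [e e0 eA]; exists e => //.
    by apply: sub_finite_set eA => w [Sw nB]; split => // /AB.
have [U [UU FU]] := ultraFilterLemma PF.
exists U; split => // [n|e e0]; apply: FU.
- exists 1 => //; apply: (@sub_finite_set _ _ [set w | (size w <= n)%N]).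
    move=> w [Sw] /not_andP[]; first by move: (rS _ _ Sw).
    by move/negP; rewrite -leqNgt.
  exact: finite_words.
- by exists e => //; rewrite setDv.
Qed.

End escaping_ultrafilters.

Section rank_one.
Context {R : realType}.
Local Notation C := R[i].
Local Notation cn := (@ComplexField.Normc.normc R).
Local Notation P := (P1 R).

Lemma det_le (a b c d : C) : cn (a * d - b * c) <= nrm2 a b * nrm2 c d.
Proof.
rewrite -(ler_pXn2r (n := 2)) ?nnegrE ?mulr_ge0 ?cn_ge0 ?nrm2_ge0 //.
rewrite exprMn !nrm2_sqr.
case: a b c d => [a a'] [b b'] [c c'] [d d'].
rewrite !cn_sqr /= -subr_ge0.
set u := (X in 0 <= X).
rewrite (_ : u = (a * c + a' * c' + b * d + b' * d') ^+ 2 +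
   (a * c' - a' * c + b * d' - b' * d) ^+ 2) ?addr_ge0 ?sqr_ge0 //.
rewrite /u; ring.
Qed.

Lemma nrm2N (a b : C) : nrm2 (- a) b = nrm2 b a.
Proof. by rewrite /nrm2 cnN addrC. Qed.

(** If matrices tend to a rank one matrix, their Möbius maps tend to a constant,
    uniformly away from the kernel. *)
Lemma rank1_cvg (T : Type) (F : set_system T) (N : T -> 'M[C]_2) (M : 'M[C]_2)
    (u0 u1 f0 f1 : C) : Filter F ->
  (u0 != 0) || (u1 != 0) -> (f0 != 0) || (f1 != 0) ->
  M 0 0 = u0 * f0 -> M 0 1 = u0 * f1 -> M 1 0 = u1 * f0 -> M 1 1 = u1 * f1 ->
  (forall d : R, 0 < d -> \forall t \near F, mnorm (N t - M) < d) ->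
  forall c e : R, 0 < c -> 0 < e -> \forall t \near F,
    forall x : P, c <= chordal x (pt (- f1) f0) ->
      chordal (mobius (N t) x) (pt u0 u1) < e.
Proof.
move=> FF u_neq0 f_neq0 M00 M01 M10 M11 NM c e c0 e0.
have nu0 : 0 < nrm2 u0 u1 by rewrite nrm2_gt0.
have nf0 : 0 < nrm2 f0 f1 by rewrite nrm2_gt0.
pose k := nrm2 u0 u1 * (c * nrm2 f0 f1 / 2).
have k0 : 0 < k by rewrite mulr_gt0 // divr_gt0 // mulr_gt0.
pose d := k * e / (4 + 2 * e).
have d0 : 0 < d by rewrite divr_gt0 ?mulr_gt0 //; lra.
have dE : d * (4 + 2 * e) = k * e by rewrite /d divfK // gt_eqF //; lra.
have dk : d < k by nra.
apply: filterS (NM d d0) => t tM x cx.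
set E := N t - M in tM.
pose p := f0 * h0 x + f1 * h1 x.
have aE : ma (N t) x = u0 * p + ma E x.
  by rewrite /p /ma /E !mxE M00 M01; ring.
have bE : mb (N t) x = u1 * p + mb E x.
  by rewrite /p /mb /E !mxE M10 M11; ring.
have Eh : nrm2 (ma E x) (mb E x) <= d * hn x.
  apply: le_trans (nrm2_mx E _ _) _.
  by rewrite ler_wpM2r ?nrm2_ge0 // ltW.
have pE : cn p = chordal x (pt (- f1) f0) * nrm2 f0 f1 / 2 * hn x.
  rewrite -[X in chordal X _](pt_h x) chordal_pt ?h_neq0 ?oppr_eq0 1?orbC // nrm2N -/(hn x).
  rewrite (_ : _ - _ = p); last by rewrite /p; ring.
  by field; rewrite hn_neq0 gt_eqF.
have up : k * hn x <= nrm2 (p * u0) (p * u1).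
  rewrite nrm2Z pE /k -subr_ge0 (_ : _ - _ = (chordal x (pt (- f1) f0) - c) *
    (nrm2 u0 u1 * nrm2 f0 f1 * hn x) / 2); last by field.
  by rewrite divr_ge0 ?mulr_ge0 ?subr_ge0 ?nrm2_ge0.
have Nh : (k - d) * hn x <= nrm2 (ma (N t) x) (mb (N t) x).
  have := nrm2D (ma (N t) x) (mb (N t) x) (- ma E x) (- mb E x).
  rewrite aE bE !addrK ![_ * p]mulrC.
  rewrite (_ : nrm2 (- ma E x) _ = nrm2 (ma E x) (mb E x)); last first.
    by rewrite /nrm2 !cnN.
  lra.
have hx := hn_gt0 x.
have Nh0 : 0 < nrm2 (ma (N t) x) (mb (N t) x).
  by apply: lt_le_trans Nh; rewrite mulr_gt0 // subr_gt0.
rewrite mobiusE chordal_pt // -?nrm2_gt0 //.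
rewrite (_ : _ - _ = ma E x * u1 - mb E x * u0); last by rewrite aE bE; ring.
have num := le_trans (det_le (ma E x) (mb E x) u0 u1) (ler_wpM2r (ltW nu0) Eh).
rewrite ltr_pdivrMr ?mulr_gt0 //.
apply: (@le_lt_trans _ _ (2 * (d * hn x * nrm2 u0 u1))); first by rewrite ler_pM2l.
apply: (@lt_le_trans _ _ (e * ((k - d) * hn x * nrm2 u0 u1))); last first.
  by rewrite ler_pM2l // ler_wpM2r // ltW.
rewrite -subr_gt0 (_ : _ - _ = (e * (k - d) - 2 * d) * (hn x * nrm2 u0 u1));
  last by ring.
by rewrite mulr_gt0 ?mulr_gt0 //; nra.
Qed.

Lemma nbhs_mx (M : 'M[C]_2) (A : set 'M[C]_2) : nbhs M A ->
  exists2 e : R, 0 < e & forall B : 'M[C]_2, (forall i j, cn (B i j - M i j) < e) -> A B.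
Proof.
move=> [Q MQ QA].
have /choice [e eP] : forall ij : 'I_2 * 'I_2, exists e : R,
    0 < e /\ forall w, cn (w - M ij.1 ij.2) < e -> Q ij.1 ij.2 w.
  by move=> ij; have /nbhs_cn [e e0 eQ] := MQ ij.1 ij.2; exists e.
exists (Num.min (Num.min (e (0, 0)) (e (0, 1))) (Num.min (e (1, 0)) (e (1, 1)))).
  by rewrite !lt_min !(eP _).1.
move=> B BM; apply: QA => i j; apply: (eP (i, j)).2.
apply: lt_le_trans (BM i j) _ => /=.
by case: (I2P i) => ->; case: (I2P j) => ->; rewrite !ge_min lexx ?orbT.
Qed.

Lemma mul_close (a b c d : C) (e f : R) : cn b <= 1 -> cn c <= 1 ->
  cn (a - c) <= e -> cn (b - d) <= f -> cn (a * b - c * d) <= e + f.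
Proof.
move=> b1 c1 ac bd; rewrite (_ : _ - _ = (a - c) * b + c * (b - d)); last by ring.
apply: le_trans (cnD _ _) _; rewrite !cnM.
have := cn_ge0 b; have := cn_ge0 c; have := cn_ge0 (a - c); have := cn_ge0 (b - d).
by move=> *; apply: lerD; nra.
Qed.

Lemma mnorm_entry (M : 'M[C]_2) i j : cn (M i j) <= mnorm M.
Proof.
have h k l := cn_ge0 (M k l); rewrite /mnorm.
by have := (h 0 0, h 0 1, h 1 0, h 1 1) => -[[[]]];
  case: (I2P i) => ->; case: (I2P j) => -> *; lra.
Qed.

Lemma mnorm_gt0 (M : 'M[C]_2) : mdet M != 0 -> 0 < mnorm M.
Proof.
move=> dM; rewrite lt_neqAle mnorm_ge0 andbT; apply: contraNneq dM => m0.
have z i j : M i j = 0.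
  by apply/eqP; rewrite -cn_eq0 eq_le cn_ge0 [X in _ <= X]m0 mnorm_entry.
by rewrite /mdet !z !mul0r subrr.
Qed.

Lemma mnormZ c (M : 'M[C]_2) : mnorm (c *: M) = cn c * mnorm M.
Proof. by rewrite /mnorm !mxE !cnM !mulrDr. Qed.

Lemma mnormB (M N : 'M[C]_2) : `|mnorm M - mnorm N| <= mnorm (M - N).
Proof.
have h i j : - cn ((M - N) i j) <= cn (M i j) - cn (N i j) <= cn ((M - N) i j).
  rewrite !mxE; have := cnD (M i j - N i j) (N i j); have := cnD (N i j - M i j) (M i j).
  rewrite !subrK cnB => *; apply/andP; lra.
have /andP[? ?] := h 0 0; have /andP[? ?] := h 0 1.
have /andP[? ?] := h 1 0; have /andP[? ?] := h 1 1.
by rewrite /mnorm ler_norml; apply/andP; lra.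
Qed.

Lemma mnorm_madjB (M N : 'M[C]_2) : mnorm (madj M - madj N) = mnorm (M - N).
Proof.
rewrite /mnorm !mxE /= -!opprD !cnN; ring.
Qed.

Lemma madjZ c (M : 'M[C]_2) : madj (c *: M) = c *: madj M.
Proof.
by apply/matrixP => i j; rewrite !mxE; case: ifP; case: ifP; rewrite ?mulrN.
Qed.

Lemma rank1P (M : 'M[C]_2) : mdet M = 0 -> mnorm M != 0 ->
  exists u0 u1 f0 f1, [/\ (u0 != 0) || (u1 != 0), (f0 != 0) || (f1 != 0),
    M 0 0 = u0 * f0 /\ M 0 1 = u0 * f1 & M 1 0 = u1 * f0 /\ M 1 1 = u1 * f1].
Proof.
rewrite /mdet => /eqP; rewrite subr_eq0 => /eqP d0 m0.
have [a0|a0] := eqVneq (M 0 0) 0; last first.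
  exists (M 0 0), (M 1 0), 1, (M 0 1 / M 0 0); rewrite a0 oner_eq0 !mulr1; split=> //.
    by rewrite mulrC divfK.
  split=> //; apply: (mulfI a0); rewrite d0; field; exact: a0.
have [c0|c0] := eqVneq (M 1 0) 0; last first.
  exists (M 0 0), (M 1 0), 1, (M 1 1 / M 1 0); rewrite c0 oner_eq0 orbT !mulr1.
  split=> //; last by rewrite mulrC divfK.
  split=> //; apply: (mulIf c0); rewrite -d0; field; exact: c0.
exists (M 0 1), (M 1 1), 0, 1; rewrite oner_eq0 orbT !mulr0 !mulr1 a0 c0; split=> //.
rewrite -negb_and; apply: contra m0 => /andP[/eqP b0 /eqP e0].
by rewrite /mnorm a0 b0 c0 e0 !cn0 !addr0.
Qed.

End rank_one.

Section convergence_dynamics.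
Context {R : realType} {g : nat}.
Variable rho : schottky R g.
Local Notation C := R[i].
Local Notation cn := (@ComplexField.Normc.normc R).
Local Notation P := (P1 R).
Local Notation word := (seq (letter g)).
Local Notation wmx := (wmx rho).
Local Notation act := (act rho).
Local Notation Lam := (limit_set rho).
Local Notation Om := (domain_of_discontinuity rho).

Lemma madj_wmx w : madj (wmx w) = mdet (wmx w) *: wmx (winv w).
Proof.
by rewrite -[LHS]mulr1 -(wmx_winvr rho w) mulrA madjM -scalerAl mul1r.
Qed.

Let Nw w : 'M[C]_2 := (mnorm (wmx w))^-1%:C%C *: wmx w.

Let mnorm_Nw w : mnorm (Nw w) = 1.
Proof.
have m0 := mnorm_gt0 (mdet_wmx rho w).
by rewrite mnormZ cn_real ger0_norm ?invr_ge0 ?ltW // mulVf // gt_eqF.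
Qed.

Let Nw_scale w : (mnorm (wmx w))^-1%:C%C != 0 :> C.
Proof.
have m0 := mnorm_gt0 (mdet_wmx rho w).
by rewrite -cn_gt0 cn_real normr_gt0 invr_eq0 gt_eqF.
Qed.

Let Nw_lim (U : set_system word) : UltraFilter U ->
  exists M, forall d : R, 0 < d -> \forall w \near U, mnorm (Nw w - M) < d.
Proof.
move=> UU.
have /choice [z zP] : forall ij : 'I_2 * 'I_2, exists z : C,
    Nw w ij.1 ij.2 @[w --> U] --> z.
  move=> ij; have [|z _ ?] := @ultra_cvg _ _ U (fun w => Nw w ij.1 ij.2) _ UU
    (@compact_disc R 1); last by exists z.
  by move=> w; rewrite /= -(mnorm_Nw w); exact: mnorm_entry.
exists (\matrix_(i, j) z (i, j)) => d d0.
have d40 : 0 < d / 4 by rewrite divr_gt0.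
have h i j : \forall w \near U, cn (Nw w i j - z (i, j)) < d / 4.
  by have /cvg_cn := zP (i, j); apply.
near=> w; rewrite /mnorm !mxE.
have h1 : cn (Nw w 0 0 - z (0, 0)) < d / 4 by near: w; exact: h.
have h2 : cn (Nw w 0 1 - z (0, 1)) < d / 4 by near: w; exact: h.
have h3 : cn (Nw w 1 0 - z (1, 0)) < d / 4 by near: w; exact: h.
have h4 : cn (Nw w 1 1 - z (1, 1)) < d / 4 by near: w; exact: h.
move: h1 h2 h3 h4; rewrite !mxE; lra.
Unshelve. all: by end_near. Qed.

(** If the limit were invertible, quotients of two long words would tend to the identity,
    against discreteness. *)
Let Nw_lim_det (U : set_system word) M : UltraFilter U -> escaping U ->
  (forall d : R, 0 < d -> \forall w \near U, mnorm (Nw w - M) < d) -> mdet M = 0.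
Proof.
move=> UU eU NM; apply/eqP/negPn/negP => dM.
have [e e0 eP] := nbhs_mx (@sch_discrete _ _ rho [::] erefl).
have m1 : 0 < cn (mdet M) by rewrite cn_gt0.
pose d := Num.min 1 (e * cn (mdet M) / 5).
have d0 : 0 < d by rewrite lt_min ltr01 /= divr_gt0 // mulr_gt0.
have d5 : 4 * d < e * cn (mdet M).
  have : d <= e * cn (mdet M) / 5 by rewrite ge_min lexx orbT.
  have : 0 < e * cn (mdet M) by rewrite mulr_gt0.
  lra.
have M1 i j : cn (M i j) <= 1.
  rewrite leNgt; apply/negP => h.
  have h0 : 0 < cn (M i j) - 1 by rewrite subr_gt0.
  have /filter_ex [w hw] := NM _ h0.
  have := mnorm_entry (Nw w - M) i j; have := mnorm_entry (Nw w) i j.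
  rewrite mnorm_Nw !mxE; have := cnD (M i j - Nw w i j) (Nw w i j).
  rewrite !mxE subrK cnB; lra.
have N1 w i j : cn (Nw w i j) <= 1 by rewrite -(mnorm_Nw w) mnorm_entry.
have [w [ [rw _] wM]] := filter_ex2 _ (eU 0%N) (NM d d0).
have [w' [ [rw' sw'] wM']] := filter_ex2 _ (eU (size w)) (NM d d0).
suff : w = w' by move=> ww'; rewrite ww' ltnn in sw'.
pose s := red (winv w ++ w').
pose B := (mdet M)^-1 *: (madj (Nw w) * Nw w').
have closeN v i j : mnorm (Nw v - M) < d -> cn (Nw v i j - M i j) <= d.
  move=> h; have := le_trans (mnorm_entry (Nw v - M) i j) (ltW h).
  by rewrite !mxE.
have closeB i j : cn (B i j - wmx [::] i j) < e.
  have -> : B i j - wmx [::] i j = (mdet M)^-1 * ((madj (Nw w) * Nw w') i j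
      - (madj M * M) i j).
    by rewrite wmx_nil madjM !mxE; field.
  rewrite cnM cnV mulrC ltr_pdivrMr //; apply: le_lt_trans d5.
  have adj v k l : mnorm (Nw v - M) < d ->
      cn (madj (Nw v) k l - madj M k l) <= d /\ cn (madj M k l) <= 1.
    move=> h; split.
      have := mnorm_entry (madj (Nw v) - madj M) k l.
      by rewrite mnorm_madjB !mxE => /le_trans; apply; exact: ltW.
    by rewrite !mxE; case: ifP => _; case: ifP => _; rewrite ?cnN M1.
  rewrite !mx2E opprD addrACA; apply: le_trans (cnD _ _) _.
  have [a1 a2] := adj w i 0 wM; have [b1 b2] := adj w i 1 wM.
  have h1 := mul_close (N1 w' 0 j) a2 a1 (closeN w' 0 j wM').
  have h2 := mul_close (N1 w' 1 j) b2 b1 (closeN w' 1 j wM').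
  by apply: le_trans (lerD h1 h2) _; rewrite le_eqVlt; apply/orP; left; apply/eqP; ring.
have Bs : pgl_eq B (wmx s).
  pose k := (mdet M)^-1 * ((mnorm (wmx w))^-1%:C%C * mdet (wmx w)) *
     (mnorm (wmx w'))^-1%:C%C.
  exists k; first by rewrite !mulf_neq0 ?invr_eq0 ?mdet_wmx ?Nw_scale.
  rewrite /B /k /s wmx_red wmx_cat.
  by rewrite madjZ madj_wmx -!scalerAl -scalerAr !scalerA !mulrA.
have := eP B closeB s (reduced_red _) Bs.
move=> /(sch_inj (reduced_red _) (erefl : reduced [::])) s0.
apply: (@wmx_inj _ _ rho) => //.
have : wmx s = 1 by rewrite /s s0 wmx_nil.
rewrite wmx_red wmx_cat => h.
by rewrite -[RHS]mul1r -(wmx_winvr rho w) -mulrA h mulr1.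
Qed.

(** Normalized to norm [1], the matrices of the words have a limit, which has rank one by
    discreteness; so the words contract everything to the image [a] of the limit, except
    near its kernel [b]. The adjugates do the same with [a] and [b] exchanged. *)
Lemma convergence_ultra (U : set_system word) : UltraFilter U -> escaping U ->
  exists a b : P,
  (forall c e : R, 0 < c -> 0 < e -> \forall w \near U,
     forall x, c <= chordal x b -> chordal (act w x) a < e) /\
  (forall c e : R, 0 < c -> 0 < e -> \forall w \near U,
     forall x, c <= chordal x a -> chordal (act (winv w) x) b < e).
Proof.
move=> UU eU; have [M NM] := Nw_lim UU.
have dM := Nw_lim_det UU eU NM.
have m0 : mnorm M != 0.
  apply/eqP => m0; have /filter_ex [w] := NM 1 ltr01.
  have := mnormB (Nw w) M; rewrite mnorm_Nw m0 subr0 normr1; lra.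
have [u0 [u1 [f0 [f1 [u_neq0 f_neq0 [M00 M01] [M10 M11]]]]]] := rank1P dM m0.
exists (pt u0 u1), (pt (- f1) f0); split=> c e c0 e0.
  apply: filterS (rank1_cvg _ u_neq0 f_neq0 M00 M01 M10 M11 NM c0 e0) => w h x xb.
  by have := h x xb; rewrite mobiusZ // Nw_scale.
have f_neq0' : (- f1 != 0) || (f0 != 0) by rewrite oppr_eq0 orbC.
have u_neq0' : (- u1 != 0) || (u0 != 0) by rewrite oppr_eq0 orbC.
have NM' : forall d : R, 0 < d -> \forall w \near U, mnorm (madj (Nw w) - madj M) < d.
  by move=> d /NM; apply: filterS => w; rewrite mnorm_madjB.
have e1 : madj M 0 0 = - f1 * - u1 by rewrite !mxE /= M11; ring.
have e2 : madj M 0 1 = - f1 * u0 by rewrite !mxE /= M01; ring.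
have e3 : madj M 1 0 = f0 * - u1 by rewrite !mxE /= M10; ring.
have e4 : madj M 1 1 = f0 * u0 by rewrite !mxE /= M00; ring.
have FU : Filter U by exact: filter_filter.
have := @rank1_cvg R word U (fun w => madj (Nw w)) (madj M) (- f1) f0 (- u1) u0 FU
  f_neq0' u_neq0' e1 e2 e3 e4 NM' c e c0 e0.
apply: filterS => w h x xa.
have -> : act (winv w) x = mobius (madj (Nw w)) x.
  by rewrite madjZ madj_wmx !mobiusZ ?mdet_wmx // Nw_scale.
apply: h; rewrite (_ : pt (- u0) (- u1) = pt u0 u1) //.
by rewrite -(@ptZ _ (-1)) ?oppr_eq0 ?oner_eq0 // !mulN1r !opprK.
Qed.

(** The form in which [escaping] ultrafilters produce limit points. *)
Lemma limit_setP y : Lam y <->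
  exists x, forall e : R, 0 < e ->
    infinite_set [set w : word | reduced w /\ chordal (act w x) y < e].
Proof.
split=> [[x [w [wI rw wy]]]|[x xP]].
  exists x => e e0 fS; have FF : Filter (\oo : set_system nat) by exact: eventually_filter.
  have /cvg_chordal /(_ e e0) [N _ NP] := wy.
  apply: infinite_nat; apply: (@sub_finite_set _ _ (`I_N `|`
    (w @^-1` [set w | reduced w /\ chordal (act w x) y < e]))).
    move=> n _; have [nN|Nn] := ltnP n N; [by left|right].
    by split; [exact: rw|exact: NP].
  rewrite finite_setU; split; first exact: finite_II.
  by apply: finite_preimage => // ? ? _ _; exact: wI.
have /choice [c cP] : forall km : nat * nat, exists w : word,
    [/\ reduced w, chordal (act w x) y < km.1.+1%:R^-1 & (km.2 < size w)%N].
  move=> [k m]; have k0 : 0 < k.+1%:R^-1 :> R by rewrite invr_gt0.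
  apply: contrapT => no; apply: (xP _ k0).
  apply: (@sub_finite_set _ _ [set w | (size w <= m)%N]); last exact: finite_words.
  move=> w [rw wy] /=; rewrite leqNgt; apply/negP => sw; apply: no; by exists w.
pose f := fix f n := if n is m.+1 then c (n, size (f m)) else c (0%N, 0%N).
have fP n : reduced (f n) /\ chordal (act (f n) x) y < n.+1%:R^-1.
  by case: n => [|n] /=; [have [] := cP (0%N, 0%N)|have [] := cP (n.+1, size (f n))].
have fS n : (size (f n) < size (f n.+1))%N by have [] := cP (n.+1, size (f n)).
have fH m n : (m < n)%N -> (size (f m) < size (f n))%N.
  by apply: (homo_ltn (f := fun n => size (f n)) (r := fun i j => (i < j)%N)) => //;
    exact: ltn_trans.
exists x, f; split=> [m n fmn|n|]; [|exact: (fP n).1|].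
  have [/fH|/fH|//] := ltngtP m n; by rewrite fmn ltnn.
apply/cvg_chordal => e e0.
near=> n; apply: lt_trans (fP n).2 _.
by near: n; exact: near_infty_natSinv_lt (PosNum e0).
Unshelve. all: by end_near. Qed.

Lemma other_point (b : P) : exists x, 0 < chordal x b.
Proof.
by case: b => [z|]; [exists None|exists (Some 0)]; rewrite chordal_gt0.
Qed.

Lemma convergence (U : set_system word) : UltraFilter U -> escaping U ->
  exists a b : P, [/\ Lam a, Lam b,
  (forall c e : R, 0 < c -> 0 < e -> \forall w \near U,
     forall x, c <= chordal x b -> chordal (act w x) a < e) &
  (forall c e : R, 0 < c -> 0 < e -> \forall w \near U,
     forall x, c <= chordal x a -> chordal (act (winv w) x) b < e)].
Proof.
move=> UU eU; have [a [b [h1 h2]]] := convergence_ultra UU eU.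
have PU : ProperFilter U by exact: ultra_proper.
exists a, b; split => //; apply/limit_setP.
- have [x xb] := other_point b; exists x => e e0; apply: (escaping_infinite PU eU).
  apply: filterS2 (eU 0%N) (h1 _ e xb e0) => w [rw _] hw; split=> //.
  exact: hw (lexx _).
- have [x xa] := other_point a; exists x => e e0 fS.
  apply: (escaping_infinite PU eU _ (finite_image (@winv g) fS)).
  apply: filterS2 (eU 0%N) (h2 _ e xa e0) => w [rw _] hw.
  exists (winv w); last exact: winvK.
  by split; [rewrite reduced_winv|exact: hw (lexx _)].
Qed.

Lemma infinite_translate w (A B : set word) :
  (forall u, A u -> reduced u /\ B (red (w ++ u))) -> infinite_set A ->
  infinite_set B.
Proof.
move=> AB iA fB; apply: iA.
apply: (sub_finite_set _ (finite_image (fun v => red (winv w ++ v)) fB)).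
move=> u /AB [ru Bu]; exists (red (w ++ u)) => //.
apply: (red_unique (rho := rho)) => //.
by rewrite wmx_cat wmx_red wmx_cat mulrA wmx_winv mul1r.
Qed.

Lemma limit_act w y : Lam y -> Lam (act w y).
Proof.
move=> /limit_setP [x xP]; apply/limit_setP; exists x => e e0.
have FF : Filter (nbhs y) by exact: nbhs_filter.
have /cvg_chordal /(_ e e0) /nbhs_P [d d0 dP] := @act_continuous _ _ rho w y.
apply: infinite_translate (xP d d0) => u [ru uy]; split=> //.
by split; [exact: reduced_red|rewrite act_red act_cat; exact: dP].
Qed.

Lemma Om_act w x : Om x -> Om (act w x).
Proof. by move=> Ox /(limit_act (winv w)); rewrite act_winvK. Qed.

(** Every orbit in the domain of discontinuity, not only the one that defines [y], comes
    close to [y] infinitely often: the attracting point of its words is [y], or the orbit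
    defining [y] consists of the translates of a repelling point. *)
Lemma orbit_limit x y : Om x -> Lam y -> forall e : R, 0 < e ->
  infinite_set [set w : word | reduced w /\ chordal (act w x) y < e].
Proof.
move=> Ox /limit_setP [x' xP].
pose S (e : R) := [set w : word | reduced w /\ chordal (act w x') y < e].
have [U [UU eU US]] := @infinite_escaping g R S
  (fun e w Sw => Sw.1) (fun d e de w Sw => conj Sw.1 (lt_le_trans Sw.2 de)) xP.
have PU : ProperFilter U by exact: ultra_proper.
have [a [b [La Lb h1 h2]]] := convergence UU eU.
have xb : 0 < chordal x b.
  by rewrite chordal_gt0; apply/eqP => xb; apply: Ox; rewrite xb.
have xa : 0 < chordal x a.
  by rewrite chordal_gt0; apply/eqP => xb'; apply: Ox; rewrite xb'.
(* If the defining orbit starts at the repelling point [b], then [y] is a limit of points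
   [act w b], and [b] is itself a limit of the orbit of [x] under inverses. *)
have [x'b|x'b] := eqVneq x' b.
  move=> e e0; have e20 : 0 < e / 2 by rewrite divr_gt0.
  have /filter_ex [w [rw wy]] := US _ e20.
  have FF : Filter (nbhs b) by exact: nbhs_filter.
  have /cvg_chordal /(_ _ e20) /nbhs_P [d d0 dP] := @act_continuous _ _ rho w b.
  have iA : infinite_set [set u : word | reduced u /\ chordal (act u x) b < d].
    move=> fS; apply: (escaping_infinite PU eU _ (finite_image (@winv g) fS)).
    apply: filterS2 (eU 0%N) (h2 _ d xa d0) => v [rv _] hv.
    exists (winv v); last exact: winvK.
    by split; [rewrite reduced_winv|exact: hv (lexx _)].
  apply: infinite_translate iA => u [ru uy]; split=> //.
  split; first exact: reduced_red.
  rewrite act_red act_cat; apply: le_lt_trans (chordal_tri _ (act w b) _) _.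
  by rewrite (splitr e); apply: ltrD; [exact: dP|rewrite -x'b].
have x'b0 : 0 < chordal x' b by rewrite chordal_gt0.
have ya : y = a.
  apply/eqP; rewrite -chordal_eq0 eq_le chordal_ge0 andbT leNgt; apply/negP => ya.
  have ya2 : 0 < chordal y a / 2 by rewrite divr_gt0.
  have [w [[_ w1] w2]] := filter_ex2 PU (US _ ya2) (h1 _ _ x'b0 ya2).
  have := w2 _ (lexx _); have := chordal_tri y (act w x') a.
  rewrite (chordal_sym y (act w x')); lra.
move=> e e0; apply: (escaping_infinite PU eU).
apply: filterS2 (eU 0%N) (h1 _ e xb e0) => w [rw _] hw; split=> //.
by rewrite ya; exact: hw (lexx _).
Qed.

(** Limit points near [y] are approached by the orbit of one fixed point, so [y] is too. *)
Lemma limit_closed : closed Lam.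
Proof.
have [[x Ox]|no] := pselect (exists x, Om x); last first.
  rewrite (_ : Lam = setT); first exact: closedT.
  by apply/seteqP; split=> // y _; apply: contrapT => h; apply: no; exists y.
move=> y yL; apply/limit_setP; exists x => e e0.
have e20 : 0 < e / 2 by rewrite divr_gt0.
have [y' [Ly' /= yy']] := yL _ (nbhs_chordal_ball y e20).
apply: (sub_infinite_set _ (orbit_limit Ox Ly' e20)) => w /= [rw h]; split=> //.
have := chordal_tri (act w x) y' y; lra.
Qed.

Lemma Om_open : open Om. Proof. exact: closed_openC limit_closed. Qed.

Lemma compact_far (K : set P) (b : P) : compact K -> ~ K b ->
  exists2 c : R, 0 < c & forall x, K x -> c <= chordal x b.
Proof.
move=> cK Kb.
have : \forall e \near (0 : R)^'+, forall y, K y -> e <= chordal y b.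
  move/compact_near_coveringP: cK; apply => y Ky.
  have d0 : 0 < chordal y b by rewrite chordal_gt0; apply/eqP => yx; apply: Kb; rewrite -yx.
  have d20 : 0 < chordal y b / 2 by rewrite divr_gt0.
  near=> y' e.
  have : chordal y' y < chordal y b / 2 by near: y'; exact: nbhs_chordal_ball.
  have : e <= chordal y b / 2 by near: e; exact: nbhs_right_le.
  have := chordal_tri y y' b; rewrite (chordal_sym y y') /=; lra.
move=> H; have /filter_ex [e [e0 eP]] : \forall e \near (0 : R)^'+,
    0 < e /\ forall y, K y -> e <= chordal y b.
  by near=> e; split; near: e => //; exact: nbhs_right_gt.
by exists e.
Unshelve. all: by end_near. Qed.

Lemma const_escaping (S : set word) : (forall w, S w -> reduced w) ->
  infinite_set S -> exists U, [/\ UltraFilter U, escaping U & U S].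
Proof.
move=> rS iS; have [U [UU eU US]] := @infinite_escaping g R (fun=> S) (fun=> rS)
  (fun _ _ _ _ h => h) (fun _ _ => iS).
by exists U; split=> //; exact: US ltr01.
Qed.

(** Otherwise infinitely many words spread [K], whereas an escaping ultrafilter contracts
    the complement of a limit point. *)
Lemma small_images (K : set P) (e : R) : compact K -> K `<=` Om -> 0 < e ->
  finite_set [set w : word | reduced w /\
    exists x y, [/\ K x, K y & e <= chordal (act w x) (act w y)]].
Proof.
move=> cK KO e0; apply: contrapT => /const_escaping [|U [UU eU US]].
  by move=> w [].
have PU : ProperFilter U by exact: ultra_proper.
have [a [b [La Lb h1 _]]] := convergence UU eU.
have [|c c0 cP] := @compact_far K b cK; first by move=> /KO; exact.
have e20 : 0 < e / 2 by rewrite divr_gt0.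
have [w [[rw [x [y [Kx Ky exy]]]] w2]] := filter_ex2 PU US (h1 c _ c0 e20).
have := w2 x (cP _ Kx); have := w2 y (cP _ Ky).
have := chordal_tri (act w x) a (act w y); rewrite (chordal_sym a); lra.
Qed.

(** Otherwise an escaping ultrafilter would move points of [K] to [L], whereas it
    attracts [K] to a limit point. *)
Lemma proper_discontinuity (K L : set P) : compact K -> compact L ->
  K `<=` Om -> L `<=` Om ->
  finite_set [set w : word | reduced w /\ exists2 x, K x & L (act w x)].
Proof.
move=> cK cL KO LO; apply: contrapT => /const_escaping [|U [UU eU US]].
  by move=> w [].
have PU : ProperFilter U by exact: ultra_proper.
have [a [b [La Lb h1 _]]] := convergence UU eU.
have [|c c0 cP] := @compact_far K b cK; first by move=> /KO; exact.
have [|d d0 dP] := @compact_far L a cL; first by move=> /LO; exact.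
have [w [[rw [x Kx Lx]] w2]] := filter_ex2 PU US (h1 c _ c0 d0).
by have := w2 x (cP _ Kx); rewrite ltNge dP.
Qed.

End convergence_dynamics.

(** * Arguments of plane maps and invariance of domain *)

Section pointwise_continuity.
Context {X : topologicalType} {K : numFieldType}.
Implicit Types (f h : X -> K) (x : X).

Lemma cfM f h x : {for x, continuous f} -> {for x, continuous h} ->
  {for x, continuous (fun y => f y * h y)}.
Proof. by move=> cf ch; exact: (cvgM cf ch). Qed.
Lemma cfD f h x : {for x, continuous f} -> {for x, continuous h} ->
  {for x, continuous (fun y => f y + h y)}.
Proof. by move=> cf ch; exact: (cvgD cf ch). Qed.
Lemma cfB f h x : {for x, continuous f} -> {for x, continuous h} ->
  {for x, continuous (fun y => f y - h y)}.
Proof. by move=> cf ch; exact: (cvgB cf ch). Qed.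
Lemma cfN f x : {for x, continuous f} -> {for x, continuous (fun y => - f y)}.
Proof. by move=> cf; exact: (cvgN cf). Qed.
Lemma cfV f x : f x != 0 -> {for x, continuous f} ->
  {for x, continuous (fun y => (f y)^-1)}.
Proof. by move=> f0 cf; exact: (cvgV f0 cf). Qed.
Lemma cfc (c : K) x : {for x, continuous (fun=> c : K)}.
Proof. exact: cvg_cst. Qed.

End pointwise_continuity.

Lemma cf_id (X : topologicalType) (x : X) : {for x, continuous (fun y : X => y)}.
Proof. exact: cvg_id. Qed.

Lemma cf_comp (X Y Z : topologicalType) (f : X -> Y) (h : Y -> Z) x :
  {for x, continuous f} -> {for f x, continuous h} ->
  {for x, continuous (fun y => h (f y))}.
Proof. exact: continuous_comp. Qed.

Lemma cf_Complex (R : realType) (X : topologicalType) (f h : X -> R) x :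
  {for x, continuous f} -> {for x, continuous h} ->
  {for x, continuous (fun y => Complex (f y) (h y) : R[i])}.
Proof. by move=> cf ch; exact: cvg_Complex. Qed.

Lemma cf_fst (X Y : topologicalType) (p : X * Y) :
  {for p, continuous (fun q : X * Y => q.1)}.
Proof. exact: cvg_fst. Qed.
Lemma cf_snd (X Y : topologicalType) (p : X * Y) :
  {for p, continuous (fun q : X * Y => q.2)}.
Proof. exact: cvg_snd. Qed.

Section angles.
Context {R : realType}.
Local Notation C := R[i].
Local Notation cn := (@ComplexField.Normc.normc R).

Definition cis (t : R) : C := Complex (cos t) (sin t).

Lemma cisD a b : cis (a + b) = cis a * cis b.
Proof. by rewrite /cis cosD sinD; congr Complex; rewrite addrC [X in X + _]mulrC. Qed.

Lemma cis0 : cis 0 = 1. Proof. by rewrite /cis cos0 sin0. Qed.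

Lemma cn_cis t : cn (cis t) = 1.
Proof. by apply/eqP; rewrite -(@pexpr_eq1 _ _ 2) ?cn_ge0 // cn_sqr /= cos2Dsin2. Qed.

Lemma cis_neq0 t : cis t != 0.
Proof. by rewrite -cn_gt0 cn_cis ltr01. Qed.

Lemma cisB a b : cis (a - b) = cis a / cis b.
Proof. by apply: (mulIf (cis_neq0 b)); rewrite divfK ?cis_neq0 // -cisD subrK. Qed.

Lemma cispi : cis pi = -1.
Proof. by rewrite /cis cospi sinpi; apply/eqP; rewrite eq_complex /= oppr0 !eqxx. Qed.

Lemma cis2pi : cis (pi *+ 2) = 1.
Proof. by rewrite mulr2n cisD cispi mulrNN mulr1. Qed.

Lemma cis_pi2int (n : int) : cis (n%:~R * (pi *+ 2)) = 1.
Proof.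
have nat_case (m : nat) : cis (m%:R * (pi *+ 2)) = 1.
  elim: m => [|m IH]; first by rewrite mul0r cis0.
  by rewrite -natr1 mulrDl mul1r cisD IH cis2pi mulr1.
case: n => m; first by exact: nat_case.
by rewrite NegzE mulrNz mulNr -sub0r cisB cis0 nat_case divr1.
Qed.

Lemma cis_eq1 t : cis t = 1 -> exists n : int, t = n%:~R * (pi *+ 2).
Proof.
move=> t1; have p0 : 0 < pi *+ 2 :> R by rewrite pmulrn_lgt0 ?pi_gt0.
pose n := Num.floor (t / (pi *+ 2)); exists n.
pose s := t - n%:~R * (pi *+ 2).
have s1 : cis s = 1 by rewrite /s cisB t1 cis_pi2int divr1.
have /andP[s_ge s_lt] : 0 <= s < pi *+ 2.
  have /andP[h1 h2] := floor_itv (t / (pi *+ 2)).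
  rewrite /s subr_ge0 -ler_pdivlMr // h1 /= ltrBlDr.
  by move: h2; rewrite ltr_pdivrMr // intrD mulrDl mul1r addrC.
have sin0s : sin (s / 2) = 0.
  have : cos s = 1 by case: s1.
  rewrite (_ : cos s = cos ((s / 2) *+ 2)); last by rewrite -mulr_natr divfK.
  rewrite cos_mulr2n => /eqP; rewrite subr_eq -mulr2n -subr_eq0 -mulrnBl.
  rewrite mulrn_eq0 /= => /eqP c1; apply/eqP; rewrite -sqrf_eq0.
  by have := cos2Dsin2 (s / 2); move: c1; lra.
suff s0 : s = 0 by apply/eqP; rewrite -subr_eq0 -/s s0.
apply/eqP; rewrite eq_le s_ge andbT leNgt; apply/negP => s_gt.
have : 0 < sin (s / 2).
  apply: sin_gt0_pi; rewrite divr_gt0 //= ltr_pdivrMr //.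
  by rewrite mulr_natr.
by rewrite sin0s ltxx.
Qed.

Definition argpos (z : C) : R := atan (complex.Im z / complex.Re z).

Lemma argposP z : 0 < complex.Re z -> z = (cn z)%:C%C * cis (argpos z).
Proof.
have zE : z = Complex (complex.Re z) (complex.Im z) by case: z.
rewrite /argpos; set a := complex.Re z in zE *; set b := complex.Im z in zE * => a0.
have tE : tan (atan (b / a)) = b / a := atanK _.
have cE := cos_atan (b / a).
have cz : 0 < cn z by apply: lt_le_trans (Re_le_cn z); rewrite gtr0_norm.
have c_eq : cos (atan (b / a)) = a / cn z.
  rewrite cE; have -> : 1 + (b / a) ^+ 2 = (cn z / a) ^+ 2.
    rewrite !expr_div_n cn_sqr -/a -/b; field; exact: lt0r_neq0.
  by rewrite sqrtr_sqr ger0_norm ?divr_ge0 ?ltW // invf_div.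
have s_eq : sin (atan (b / a)) = b / cn z.
  have -> : sin (atan (b / a)) = tan (atan (b / a)) * cos (atan (b / a)).
    rewrite /tan divfK // c_eq gt_eqF // divr_gt0 //.
  by rewrite tE c_eq; field; rewrite !lt0r_neq0.
rewrite /cis c_eq s_eq {1}zE; apply/eqP; rewrite eq_complex /= !mul0r addr0 subr0.
by rewrite !(mulrC (cn _)) !divfK ?eqxx // lt0r_neq0.
Qed.

Lemma polar (z : C) : exists t, z = (cn z)%:C%C * cis t.
Proof.
have [re0|re0] := ltrP 0 (complex.Re z); first by exists (argpos z); exact: argposP.
have [re0'|re0'] := ltrP (complex.Re z) 0.
  have h : 0 < complex.Re (- z) by case: z re0' {re0} => a b /=; rewrite oppr_gt0.
  exists (argpos (- z) + pi); rewrite cisD cispi mulrN1 mulrN.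
  by have := argposP h; rewrite cnN => <-; rewrite opprK.
have re : complex.Re z = 0 by apply/eqP; rewrite eq_le re0 re0'.
have iE : z = Complex 0 (complex.Im z) by case: z re {re0 re0'} => a b /= ->.
have cE : cn z = `|complex.Im z|.
  by rewrite {1}iE -[LHS]ger0_norm ?cn_ge0 // -sqrtr_sqr cn_sqr /= expr0n add0r sqrtr_sqr.
have [i0|i0] := lerP 0 (complex.Im z).
  exists (pi / 2); rewrite cE ger0_norm // {1}iE /cis cos_pihalf sin_pihalf.
  by apply/eqP; rewrite eq_complex /= !mulr0 !mul0r subr0 addr0 mulr1 !eqxx.
exists (- (pi / 2)); rewrite cE ltr0_norm // {1}iE /cis cosN sinN cos_pihalf sin_pihalf.
by apply/eqP; rewrite eq_complex /= !mulr0 !mul0r !subr0 addr0 mulrNN mulr1 !eqxx.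
Qed.

Definition cont_on (D : set C) (u : C -> R) : Prop :=
  forall z, D z -> forall e : R, 0 < e -> exists2 d : R, 0 < d &
    forall w, D w -> cn (w - z) < d -> `|u w - u z| < e.

Definition has_arg (D : set C) (f : C -> C) : Prop :=
  exists2 u, cont_on D u & forall z, D z -> f z = (cn (f z))%:C%C * cis (u z).

Lemma cont_onD D u v : cont_on D u -> cont_on D v -> cont_on D (fun z => u z + v z).
Proof.
move=> cu cv z Dz e e0; have e20 : 0 < e / 2 by rewrite divr_gt0.
have [d d0 dP] := cu z Dz _ e20; have [k k0 kP] := cv z Dz _ e20.
exists (Num.min d k) => [|w Dw]; first by rewrite lt_min d0.
rewrite lt_min => /andP[wd wk]; have := dP w Dw wd; have := kP w Dw wk.
rewrite (_ : _ + _ - _ = (u w - u z) + (v w - v z)); last by ring.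
move=> h1 h2; apply: le_lt_trans (ler_normD _ _) _; lra.
Qed.

Lemma cont_on_continuous D (u : C -> R) :
  (forall z, D z -> {for z, continuous u}) -> cont_on D u.
Proof.
move=> cu z Dz e e0; have FF : Filter (nbhs (z : C)) by exact: nbhs_filter.
have /cvgrPdist_lt /(_ e e0) /nbhs_cn [d d0 dP] := cu z Dz.
by exists d => // w _ /dP; rewrite distrC.
Qed.

Lemma cont_on_sub D E u : E `<=` D -> cont_on D u -> cont_on E u.
Proof.
move=> ED cu z Ez e e0; have [d d0 dP] := cu z (ED _ Ez) e e0.
by exists d => // w Ew; apply: dP; exact: ED.
Qed.

Lemma Re_close (a b h : C) : cn (a - h) < cn h / 4 -> cn (b - h) < cn h / 4 ->
  0 < complex.Re (a / b).
Proof.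
move=> ah bh; have h0 : 0 < cn h by have := cn_ge0 (a - h); lra.
have bge : cn h * 3 / 4 < cn b by have := cnD (h - b) b; rewrite subrK cnB; lra.
have b0 : 0 < cn b by have := h0; lra.
have bn : b != 0 by rewrite -cn_gt0.
have : cn (a / b - 1) < 1.
  rewrite (_ : _ - 1 = (a - b) / b); last by field.
  rewrite cnM cnV ltr_pdivrMr // mul1r.
  have := cnD (a - h) (h - b); rewrite addrA subrK (cnB h); lra.
have := Re_le_cn (a / b - 1); rewrite ReB /= ler_norml => /andP[]; lra.
Qed.

Lemma continuous_argpos (z : C) : 0 < complex.Re z -> {for z, continuous argpos}.
Proof.
move=> z0; rewrite /argpos; apply: (@continuous_comp _ _ _
  (fun z : C => complex.Im z / complex.Re z) (@atan R)); last exact: continuous_atan.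
apply: cfM; first exact: continuous_Im.
by apply: cfV; [rewrite gt_eqF|exact: continuous_Re].
Qed.

(** The quotient has a continuous argument between [- pi / 2] and [pi / 2]. *)
Lemma has_arg_near D (f h : C -> C) :
  (forall z, D z -> {for z, continuous f}) -> (forall z, D z -> {for z, continuous h}) ->
  (forall z, D z -> 0 < complex.Re (f z / h z)) ->
  has_arg D h -> has_arg D f.
Proof.
move=> cf ch fh [u cu uP].
have h_neq0 z : D z -> h z != 0.
  by move=> Dz; apply/eqP => h0; have := fh z Dz; rewrite h0 invr0 mulr0 ltxx.
exists (fun z => u z + argpos (f z / h z)).
  apply: cont_onD => //; apply: cont_on_continuous => z Dz.
  apply: (@continuous_comp _ _ _ (fun z => f z / h z) argpos); last first.
    by apply: continuous_argpos; exact: fh.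
  by apply: cfM; [exact: cf|apply: cfV; [exact: h_neq0|exact: ch]].
move=> z Dz; rewrite cisD mulrCA -[LHS](divfK (h_neq0 z Dz)).
rewrite {1}(argposP (fh z Dz)) mulrC {1}(uP z Dz) cnM cnV.
have hz : (cn (h z))%:C%C != 0 :> C by rewrite -cn_gt0 cn_real normr_gt0 cn_eq0 h_neq0.
rewrite rmorphM /= fmorphV /=; field; exact: hz.
Qed.

Lemma has_arg_const D (c : C) : has_arg D (fun=> c).
Proof.
have [t ct] := polar c; exists (fun=> t) => // z Dz e e0.
by exists 1 => // w _ _; rewrite subrr normr0.
Qed.

(** By compactness the homotopy can be divided into steps during which the values turn by
    less than a right angle. *)
Lemma has_arg_homotopy (D : set C) (H : C -> R -> C) : compact D ->
  (forall z t, D z -> 0 <= t <= 1 ->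
     {for (z, t), continuous ((fun p => H p.1 p.2) : C * R -> C)}) ->
  (forall z t, D z -> 0 <= t <= 1 -> H z t != 0) ->
  has_arg D (H^~ 0) -> has_arg D (H^~ 1).
Proof.
move=> cD cH H0 arg0.
have cK : compact (D `*` `[(0 : R), 1]) by apply: compact_setX => //; exact: segment_compact.
have : \forall d \near (0 : R)^'+, forall p, (D `*` `[(0 : R), 1]) p ->
    forall s, 0 <= s <= 1 -> `|s - p.2| <= d -> 0 < complex.Re (H p.1 s / H p.1 p.2).
  move/compact_near_coveringP: cK; apply => -[z t] [/= Dz]; rewrite in_itv /= => t01.
  have h40 : 0 < cn (H z t) / 4 by rewrite divr_gt0 // cn_gt0 H0.
  have FF : Filter (nbhs (z, t)) by exact: nbhs_filter.
  have /cvg_cn /(_ _ h40) [[A B] [/= Az Bt] ABP] := cH z t Dz t01.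
  have /nbhs_ballP [b /= b0 bB] := Bt.
  have b20 : 0 < b / 2 by rewrite divr_gt0.
  have tb : nbhs t (ball t (b / 2)) by exact: nbhsx_ballx.
  near=> p d => s s01 sd.
  have pA : A p.1 by near: p; exists (A, setT) => //=; [split => //; exact: filterT|move=> q []].
  have pB : B p.2 by near: p; exists (setT, B) => //=; [split => //; exact: filterT|move=> q []].
  have h1 : `|t - p.2| < b / 2.
    by near: p; exists (setT, ball t (b / 2)) => //=; [split => //; exact: filterT|move=> q []].
  have sd' : `|s - p.2| <= d by [].
  apply: (@Re_close _ _ (H z t)); last by apply: (ABP p).
    apply: (ABP (p.1, s)); split => //=; apply: bB; rewrite /ball /=.
    have h2 : d <= b / 2 by near: d; exact: nbhs_right_le.
    rewrite (_ : t - s = (t - p.2) - (s - p.2)); last by ring.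
    by apply: le_lt_trans (ler_normB _ _) _; lra.
move=> near_d.
have [d [d0 dP]] : exists d : R, 0 < d /\ forall p, (D `*` `[(0 : R), 1]) p ->
    forall s, 0 <= s <= 1 -> `|s - p.2| <= d -> 0 < complex.Re (H p.1 s / H p.1 p.2).
  have /filter_ex [d [d0 dP]] : \forall d \near (0 : R)^'+, 0 < d /\
      forall p, (D `*` `[(0 : R), 1]) p -> forall s, 0 <= s <= 1 ->
      `|s - p.2| <= d -> 0 < complex.Re (H p.1 s / H p.1 p.2).
    by near=> d; split; near: d => //; exact: nbhs_right_gt.
  by exists d.
pose n := (Num.trunc d^-1).+1; have n0 : 0 < n%:R :> R by rewrite ltr0n.
have nd : n%:R^-1 <= d.
  rewrite -[d]invrK lef_pV2 ?posrE ?invr_gt0 //; apply: ltW.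
  by rewrite truncnS_gt.
have cHt t : 0 <= t <= 1 -> forall z, D z -> {for z, continuous (H^~ t)}.
  move=> t01 z Dz.
  apply: (@continuous_comp _ _ _ (fun w : C => (w, t)) (fun p => H p.1 p.2)); last exact: cH.
  move=> U [[A B] /= [Az Bt] AB]; apply: filterS Az => w Aw.
  by apply: AB; split => //; exact: nbhs_singleton.
have step k : (k <= n)%N -> has_arg D (H^~ (k%:R / n%:R)).
  elim: k => [_|k IH kn]; first by rewrite mul0r.
  have k1 : 0 <= (k.+1%:R / n%:R : R) <= 1.
    by rewrite divr_ge0 ?ler0n // ler_pdivrMr // mul1r ler_nat.
  have k0 : 0 <= (k%:R / n%:R : R) <= 1.
    by rewrite divr_ge0 ?ler0n // ler_pdivrMr // mul1r ler_nat ltnW.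
  apply: has_arg_near (IH (ltnW kn)); [exact: cHt|exact: cHt|] => z Dz.
  have Dk : (D `*` `[(0 : R), 1]) (z, k%:R / n%:R) by split => //=; rewrite in_itv.
  have dk : `|k.+1%:R / n%:R - k%:R / n%:R| <= d.
    by rewrite -mulrBl -natr1 addrAC subrr add0r mul1r ger0_norm ?invr_ge0 ?ler0n.
  exact: (dP _ Dk _ k1 dk).
by have := step n (leqnn n); rewrite divff ?gt_eqF.
Unshelve. all: by end_near. Qed.

(** Going around half of the circle changes the argument of an odd function by an
    odd multiple of [pi], so the argument cannot come back to its value. *)
Lemma odd_no_arg (r : R) (f : C -> C) : 0 < r ->
  (forall z, cn z = r -> f z != 0) -> (forall z, cn z = r -> f (- z) = - f z) ->
  ~ has_arg [set z | cn z = r] f.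
Proof.
move=> r0 f0 fodd [u cu uP].
pose p (t : R) : C := r%:C%C * cis t.
have cp t : cn (p t) = r by rewrite cnM cn_cis mulr1 cn_real gtr0_norm.
pose h t := u (p t) - u (- p t).
have pc : continuous p.
  move=> t; apply: cvgM; first exact: cvg_cst.
  by apply: cvg_Complex; [exact: continuous_cos|exact: continuous_sin].
have hc : continuous h.
  move=> t; have FF : Filter (nbhs t) by exact: nbhs_filter.
  apply: cvgB; apply/cvgrPdist_lt => e e0.
    have [d d0 dP] := cu (p t) (cp t) e e0.
    have /cvg_cn /(_ d d0) := pc t; apply: filterS => s sd.
    by rewrite distrC; apply: dP.
  have [d d0 dP] := cu (- p t) (etrans (cnN _) (cp t)) e e0.
  have /cvg_cn /(_ d d0) := pc t; apply: filterS => s sd.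
  by rewrite distrC; apply: dP; rewrite /mkset ?cnN // -opprD cnN.
have hpi : h pi = - h 0.
  by rewrite /h /p cispi cis0 mulrN1 mulr1 opprK opprB.
have [||t _ ht] := @IVT R h 0 pi 0 (pi_ge0 _).
- exact: continuous_subspaceT.
- rewrite hpi; have [h00|h00] := lerP 0 (h 0).
    by rewrite ge_min oppr_le0 h00 orbT le_max h00.
  by rewrite ge_min le_max oppr_ge0 !(ltW h00) orbT.
have ft := f0 _ (cp t).
have cn0 : (cn (f (p t)))%:C%C != 0 :> C.
  by rewrite -cn_gt0 cn_real normr_gt0 cn_eq0.
have e1 := uP (p t) (cp t).
have e2 := uP (- p t) (etrans (cnN _) (cp t)).
have ut : u (p t) = u (- p t) by apply/eqP; rewrite -subr_eq0 -/(h t) ht.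
rewrite fodd // cnN -ut -e1 in e2.
have : f (p t) *+ 2 = 0 by rewrite mulr2n -{1}e2 addNr.
by move/eqP; rewrite -mulr_natl mulf_eq0 (negbTE ft) orbF pnatr_eq0.
Qed.

Lemma compact_circle (r : R) : compact [set z : C | cn z = r].
Proof.
apply: (subclosed_compact _ (@compact_disc R r)); last by move=> z /= ->.
by have /continuous_closedP /(_ _ (@closed_eq _ r)) := @continuous_cn R.
Qed.

(** A disc contracts to its center. *)
Lemma has_arg_disc (r : R) (f : C -> C) : 0 <= r ->
  (forall z, cn z <= r -> {for z, continuous f}) ->
  (forall z, cn z <= r -> f z != 0) -> has_arg [set z | cn z <= r] f.
Proof.
move=> r0 cf f0.
have dt z t : cn z <= r -> 0 <= t <= 1 -> cn (t%:C%C * z) <= r.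
  move=> zr /andP[t0 t1]; rewrite cnM cn_real ger0_norm //.
  by apply: le_trans zr; rewrite ler_piMl ?cn_ge0.
have -> : f = fun z => f ((1 : R)%:C%C * z) by apply/funext => z; rewrite mul1r.
apply: (@has_arg_homotopy _ (fun z t => f (t%:C%C * z)) (@compact_disc R r)).
- move=> z t zr t01.
  apply: (@continuous_comp _ _ _ (fun p : C * R => p.2%:C%C * p.1) f).
    apply: cfM; last exact: cf_fst.
    by apply: cf_Complex; [exact: cf_snd|exact: cfc].
  by apply: cf; exact: dt.
- by move=> z t zr t01; apply: f0; exact: dt.
- rewrite (_ : (fun z => _) = fun=> f 0); first exact: has_arg_const.
  by apply/funext => z; rewrite mul0r.
Qed.

(** Invariance of domain in the plane. If [w] is close to [f z0] but not a value of
    [f], then [f - w], hence [f - f z0], has an argument on the circle; a homotopy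
    through differences of distinct values of [f] then gives an argument to an odd
    function. *)
Lemma invariance_of_domain (f : C -> C) (z0 : C) (r : R) : 0 < r ->
  (forall z, cn (z - z0) <= r -> {for z, continuous f}) ->
  (forall z w, cn (z - z0) <= r -> cn (w - z0) <= r -> f z = f w -> z = w) ->
  exists2 e : R, 0 < e & forall w, cn (w - f z0) < e ->
    exists2 z, cn (z - z0) <= r & f z = w.
Proof.
move=> r0 cf0 fI0; pose h z := f (z + z0).
have ch z : cn z <= r -> {for z, continuous h}.
  move=> zr; apply: (@continuous_comp _ _ _ (fun z : C => z + z0) f).
    by apply: cfD; [exact: cf_id|exact: cfc].
  by apply: cf0; rewrite addrK.
have hI z w : cn z <= r -> cn w <= r -> h z = h w -> z = w.
  by move=> zr wr /fI0 zw; apply: (addIr z0); apply: zw; rewrite addrK.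
have [m m0 mP] : exists2 m : R, 0 < m & forall z, cn z = r -> m <= cn (h z - h 0).
  have : \forall d \near (0 : R)^'+, forall z, [set z | cn z = r] z -> d <= cn (h z - h 0).
    move/compact_near_coveringP: (@compact_circle r); apply => z /= zr.
    have d0 : 0 < cn (h z - h 0).
      rewrite cn_gt0 subr_eq0; apply/eqP => /hI; rewrite zr cn0 => /(_ (lexx _) (ltW r0)) z0'.
      by rewrite z0' cn0 in zr; rewrite -zr ltxx in r0.
    have d20 : 0 < cn (h z - h 0) / 2 by rewrite divr_gt0.
    have zr' : cn z <= r by rewrite zr.
    have /cvg_cn /(_ _ d20) hz := ch z zr'.
    near=> z' d.
    have : cn (h z' - h z) < cn (h z - h 0) / 2 by near: z'; exact: hz.
    have : d <= cn (h z - h 0) / 2 by near: d; exact: nbhs_right_le.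
    have := cnD (h z - h z') (h z' - h 0); rewrite addrA subrK (cnB (h z)) /=; lra.
  move=> H; have /filter_ex [d [d0 dP]] : \forall d \near (0 : R)^'+, 0 < d /\
      forall z, [set z | cn z = r] z -> d <= cn (h z - h 0).
    by near=> d; split; near: d => //; exact: nbhs_right_gt.
  by exists d.
(* A quarter of the least distance keeps [h z - w] in a half-plane around [h z - h 0]. *)
exists (m / 4) => [|w wm]; first by rewrite divr_gt0.
apply: contrapT => no.
have hw z : cn z <= r -> h z - w != 0.
  move=> zr; rewrite subr_eq0; apply/eqP => hzw; apply: no.
  by exists (z + z0) => //; rewrite addrK.
have cB c z : cn z <= r -> {for z, continuous (fun z => h z - c)}.
  by move=> zr; apply: cfB; [exact: ch|exact: cfc].
have arg1 : has_arg [set z | cn z = r] (fun z => h z - w).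
  have [u cu uP] := has_arg_disc (ltW r0) (cB w) hw.
  have sub : [set z | cn z = r] `<=` [set z | cn z <= r] by move=> z /= ->.
  by exists u => [|z /sub]; [exact: cont_on_sub cu|exact: uP].
have arg2 : has_arg [set z | cn z = r] (fun z => h z - h 0).
  apply: has_arg_near arg1 => z /= zr; [by apply: cB; rewrite zr|by apply: cB; rewrite zr|].
  apply: (@Re_close _ _ (h z - h 0)); first by rewrite subrr cn0 divr_gt0 // (lt_le_trans m0) // mP.
  rewrite (_ : _ - _ = f z0 - w); last by rewrite /h add0r; ring.
  by rewrite cnB; apply: lt_le_trans wm _; rewrite ler_pM2r ?invr_gt0 // mP.
pose k (s : R) := (1 + s)^-1.
have kP s : 0 <= s <= 1 -> [/\ 0 < 1 + s, 0 <= k s <= 1 & 0 <= s * k s <= 1].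
  move=> /andP[s0 s1]; have p : 0 < 1 + s by lra.
  split=> //; first by rewrite /k invr_ge0 ltW //= invf_le1 //; lra.
  apply/andP; split; first by rewrite mulr_ge0 // invr_ge0 ltW.
  by rewrite /k ler_pdivrMr // mul1r; lra.
(* [H] joins [h z - h 0], at [s = 0], to the odd map [h (z / 2) - h (- z / 2)]; the two
   arguments of [h] always differ by [z]. *)
pose H (z : C) (s : R) := h ((k s)%:C%C * z) - h (- ((s * k s)%:C%C * z)).
have dle z (c : R) : cn z = r -> 0 <= c <= 1 -> cn (c%:C%C * z) <= r.
  by move=> zr /andP[c0 c1]; rewrite cnM cn_real ger0_norm // zr ler_piMl // ltW.
apply: (@odd_no_arg r (H^~ 1)) => //.
- move=> z zr; rewrite /H subr_eq0; apply/eqP.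
  have [_ k1 k2] := kP 1 (introT andP (conj ler01 (lexx _))).
  move=> /hI -/(_ (dle _ _ zr k1)); rewrite cnN => /(_ (dle _ _ zr k2)) => /eqP.
  rewrite mul1r -addr_eq0 -mulr2n -mulr_natl mulf_eq0 pnatr_eq0 /= mulf_eq0.
  rewrite -!cn_eq0 cn_real zr !gt_eqF //.
  by rewrite normr_gt0 invr_eq0 gt_eqF //; lra.
- by move=> z zr; rewrite /H !mulrN opprK mul1r opprB.
apply: has_arg_homotopy; first exact: compact_circle.
- move=> z s /= zr s01; have [s1 k1 k2] := kP s s01.
  have ck : {for (z, s), continuous (fun q : C * R => k q.2)}.
    apply: (@cf_comp _ _ _ (fun q : C * R => q.2) k); first exact: cf_snd.
    apply: cfV; first by rewrite gt_eqF.
    by apply: cfD; [exact: cfc|exact: cf_id].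
  rewrite /H; apply: cfB.
    apply: (@cf_comp _ _ _ (fun p : C * R => (k p.2)%:C%C * p.1) h).
      apply: cfM; last exact: cf_fst.
      by apply: cf_Complex; [exact: ck|exact: cfc].
    by apply: ch; exact: dle.
  apply: (@cf_comp _ _ _ (fun p : C * R => - ((p.2 * k p.2)%:C%C * p.1)) h).
    apply: cfN; apply: cfM; last exact: cf_fst.
    apply: cf_Complex; last exact: cfc.
    by apply: cfM; [exact: cf_snd|exact: ck].
  by apply: ch; rewrite cnN; exact: dle.
- move=> z s /= zr s01; have [s1 k1 k2] := kP s s01.
  rewrite /H subr_eq0; apply/eqP.
  move=> /hI -/(_ (dle _ _ zr k1)); rewrite cnN => /(_ (dle _ _ zr k2)) => /eqP.
  rewrite -addr_eq0 -mulrDl -rmorphD /= mulf_eq0 -!cn_eq0 cn_real zr.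
  rewrite (_ : k s + s * k s = 1) ?normr1 ?oner_eq0 ?gt_eqF //.
  by rewrite -{1}[k s]mul1r -mulrDl /k divff ?gt_eqF.
- rewrite (_ : H^~ 0 = fun z => h z - h 0) //; apply/funext => z.
  by rewrite /H /k addr0 invr1 mul1r !mul0r oppr0.
Unshelve. all: by end_near. Qed.

End angles.

(** * Separation of the sphere *)

Lemma open_near (X : topologicalType) (O : set X) x : open O -> O x -> nbhs x O.
Proof. by move=> oO Ox; apply: open_nbhs_nbhs; split. Qed.

Lemma cf_near (X Y : topologicalType) (f h : X -> Y) x :
  (\forall y \near x, f y = h y) -> {for x, continuous h} -> {for x, continuous f}.
Proof.
move=> fh ch U; rewrite /= (nbhs_singleton fh) => /ch hU.
have hU' : nbhs x (h @^-1` U) := hU.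
suff : nbhs x (f @^-1` U) by [].
by apply: filterS2 fh hU' => y /= ->.
Qed.

Lemma cf_min (R : realType) (X : topologicalType) (f h : X -> R) x :
  {for x, continuous f} -> {for x, continuous h} ->
  {for x, continuous (fun y => Num.min (f y) (h y))}.
Proof.
move=> cf ch; rewrite (_ : (fun y => _) = fun y => (f y + h y - `|f y - h y|) / 2).
  apply: cfM; last exact: cfc.
  by apply: cfB; [exact: cfD|exact: (cvg_norm (cfB cf ch))].
by apply/funext => y; rewrite minr_absE.
Qed.

Section lifts_to_the_line.
Context {R : realType}.
Local Notation C := R[i].
Local Notation cn := (@ComplexField.Normc.normc R).
Local Notation P := (P1 R).

Lemma int_valued_const (X : topologicalType) (A : set X) (p : X -> R) :
  connected A -> {within A, continuous p} ->
  (forall x, A x -> exists n : int, p x = n%:~R) ->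
  forall x y, A x -> A y -> p x = p y.
Proof.
move=> cA cp ip.
have /connected_intervalP iA : connected (p @` A) by exact: connected_continuous_connected.
suff lt_absurd x y : A x -> A y -> ~ (p x < p y).
  move=> x y Ax Ay; apply/eqP; rewrite eq_le !leNgt.
  by apply/andP; split; apply/negP; apply: lt_absurd.
move=> Ax Ay; have [m pm] := ip x Ax; have [n pn] := ip y Ay.
rewrite pm pn ltr_int => mn.
have : (p @` A) (m%:~R + 2^-1).
  apply: (iA (p x) (p y)); [by exists x|by exists y|].
  rewrite pm pn lerDl invr_ge0 ler0n /=.
  apply: (@le_trans _ _ (m + 1)%:~R); last by rewrite ler_int lezD1.
  by rewrite intrD lerD2l; lra.
move=> [z Az]; have [k ->] := ip z Az => kE.
have : (k - m)%:~R = 2^-1 :> R by rewrite intrB kE; ring.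
move=> h; have h2 : ((k - m) * 2)%:~R = 1%:~R :> R by rewrite intrM h mulVf // pnatr_eq0.
move/intr_inj: h2; lia.
Qed.

Lemma cis_eq a b : cis a = cis b :> C ->
  exists n : int, a = b + n%:~R * (pi *+ 2).
Proof.
move=> ab; have [|n nE] := @cis_eq1 R (a - b); first by rewrite cisB ab divff ?cis_neq0.
by exists n; rewrite -nE addrC subrK.
Qed.

Lemma continuous_cis : continuous (cis : R -> C).
Proof.
by move=> t; apply: cf_Complex; [exact: continuous_cos|exact: continuous_sin].
Qed.

Lemma cont_on_path (D : set C) (u : C -> R) (p : R -> C) :
  cont_on D u -> continuous p -> (forall t, D (p t)) -> continuous (u \o p).
Proof.
move=> cu cp Dp t; have FF : Filter (nbhs t) by exact: nbhs_filter.
apply/cvgrPdist_lt => e e0; have [d d0 dP] := cu _ (Dp t) e e0.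
have /cvg_cn /(_ d d0) := cp t; apply: filterS => s sd.
by rewrite distrC; apply: dP.
Qed.

Lemma cont_on_nbhs (D : set C) (u : C -> R) z : cont_on D u -> nbhs z D ->
  {for z, continuous u}.
Proof.
move=> cu Dz; have FF : Filter (nbhs z) by exact: nbhs_filter.
apply/cvgrPdist_lt => e e0; have [d d0 dP] := cu z (nbhs_singleton Dz) e e0.
have bz : nbhs z [set w | cn (w - z) < d] by apply/nbhs_cn; exists d.
near=> w; rewrite distrC; apply: dP; [near: w; exact: Dz|near: w; exact: bz].
Unshelve. all: by end_near. Qed.

(** The argument is constant on the annulus where [h] is [1], which is path-connected, and
    can be normalized to vanish there. *)
Lemma plane_lift (h : C -> C) (r : R) : 0 < r -> continuous h ->
  (forall z, cn (h z) = 1) -> (forall z, r <= cn z -> h z = 1) ->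
  exists u : C -> R, [/\ continuous u, forall z, h z = cis (u z) &
    forall z, r <= cn z -> u z = 0].
Proof.
move=> r0 ch h1 hr.
have r2 : 0 <= 2 * r by rewrite mulr_ge0 // ltW.
have [||v cv vP] := @has_arg_disc R (2 * r) h r2; first by move=> z _; exact: ch.
  by move=> z _; rewrite -cn_gt0 h1.
have {vP} vP z : cn z <= 2 * r -> h z = cis (v z).
  by move=> zr; rewrite [LHS]vP // h1 mul1r.
pose c := v r%:C%C.
have vc z : r <= cn z -> cn z <= 2 * r -> v z = c.
  move=> zr z2r; have [a za] := polar z.
  pose p (t : R) : C := (r + (cn z - r) * sin t ^+ 2)%:C%C * cis (a * (t / (pi / 2))).
  have cp t : cn (p t) = r + (cn z - r) * sin t ^+ 2.
    rewrite cnM cn_cis mulr1 cn_real ger0_norm // addr_ge0 ?(ltW r0) //.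
    by rewrite mulr_ge0 ?subr_ge0 ?sqr_ge0.
  have s1 (t : R) : 0 <= sin t ^+ 2 <= 1.
    rewrite sqr_ge0 /=; have := cos2Dsin2 t; have := sqr_ge0 (cos t); lra.
  have rp t : r <= cn (p t).
    by have /andP[? ?] := s1 t; rewrite cp lerDl mulr_ge0 // subr_ge0.
  have pr t : cn (p t) <= 2 * r.
    have /andP[? ?] := s1 t; rewrite cp; apply: le_trans z2r.
    by rewrite -lerBrDl ler_piMr // subr_ge0.
  have contp : continuous p.
    rewrite /p => t; apply: (@cfM _ _ (fun t => (r + (cn z - r) * sin t ^+ 2)%:C%C)
      (fun t => cis (a * (t / (pi / 2))))).
      apply: cf_Complex; last exact: cfc.
      apply: cfD; first exact: cfc.
      apply: cfM; first exact: cfc.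
      by rewrite (_ : (fun t => _) = fun t => sin t * sin t) //; apply: cfM; exact: continuous_sin.
    apply: (@cf_comp R R C (fun t : R => a * (t / (pi / 2))) cis); last exact: continuous_cis.
    by apply: cfM; [exact: cfc|apply: cfM; [exact: cf_id|exact: cfc]].
  have pi0 : pi / 2 != 0 :> R by rewrite gt_eqF // divr_gt0 // pi_gt0.
  have p2 : pi *+ 2 != 0 :> R by rewrite gt_eqF // pmulrn_lgt0 ?pi_gt0.
  have E : v (p (pi / 2)) / (pi *+ 2) = v (p 0) / (pi *+ 2).
    apply: (@int_valued_const R `[(0 : R), (pi / 2)] (fun t => v (p t) / (pi *+ 2))).
    - exact: segment_connected.
    - apply: continuous_subspaceT => t.
      apply: (@cfM R R (fun t : R => v (p t)) (fun=> (pi *+ 2)^-1)); last exact: cfc.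
      exact: (cont_on_path cv contp pr).
    - move=> t _; have [|n nE] := @cis_eq1 R (v (p t)); last by exists n; rewrite nE mulfK.
      by rewrite -vP // hr.
    - by rewrite /= in_itv /= lexx divr_ge0 // pi_ge0.
    - by rewrite /= in_itv /= lexx divr_ge0 // pi_ge0.
  move/(mulIf (invr_neq0 p2)): E.
  rewrite /p sin_pihalf sin0 divff // mul0r expr1n expr0n /= !mulr0 !mulr1 cis0 mulr1.
  by rewrite addr0 addrC subrK -za.
have c1 : cis c = 1 :> C.
  rewrite -vP ?hr //; rewrite cn_real gtr0_norm //; lra.
exists (fun z => if cn z < 2 * r then v z - c else 0); split.
- move=> z; have [z2|z2] := ltP (cn z) (2 * r).
    have near2 : \forall w \near z, cn w < 2 * r.
      by have := @continuous_cn R z [set x | x < 2 * r]; apply; exact: lt_nbhsl.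
    have cvz : {for z, continuous (fun w => v w - c)}.
      apply: cfB; last exact: cfc.
      by apply: cont_on_nbhs cv _; apply: filterS near2 => w /ltW.
    by apply: cf_near cvz; apply: filterS near2 => w ->.
  have near1 : \forall w \near z, r < cn w.
    have := @continuous_cn R z [set x | r < x]; apply; apply: lt_nbhsr.
    by apply: lt_le_trans z2; lra.
  apply: cf_near (@cfc _ _ (0 : R) z); apply: filterS near1 => w wr.
  by case: ltP => // w2; rewrite vc ?subrr // ltW.
- move=> z; case: ltP => [z2|z2]; first by rewrite cisB c1 divr1 vP // ltW.
  by rewrite cis0 hr //; apply: le_trans z2; lra.
- by move=> z zr; case: ltP => // z2; rewrite vc ?subrr // ltW.
Qed.

(** A unitary matrix up to scaling, hence an isometry of the sphere; it takes [c] to [0]. *)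
Definition rot (c : P) : 'M[C]_2 :=
  \matrix_(i, j) (if i == 0 then (if j == 0 then h1 c else - h0 c)
                  else (if j == 0 then (h0 c)^*%C else (h1 c)^*%C)).

Lemma mulc_conj (a : C) : a * a^*%C = (cn a ^+ 2)%:C%C.
Proof.
rewrite cn_sqr; case: a => a b; apply/eqP; rewrite eq_complex /=.
by apply/andP; split; apply/eqP; ring.
Qed.

Lemma mdet_rot c : mdet (rot c) = (hn c ^+ 2)%:C%C.
Proof.
by rewrite /mdet !mxE /= mulNr opprK !mulc_conj -rmorphD /= hn_sqr addrC.
Qed.

Lemma mdet_rot_neq0 c : mdet (rot c) != 0.
Proof.
by rewrite mdet_rot -cn_gt0 cn_real normr_gt0 expf_neq0 // hn_neq0.
Qed.

Lemma sD_rot c x : sD (rot c) x = 1.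
Proof.
rewrite /sD mdet_rot cn_real ger0_norm ?sqr_ge0 // sqrtr_sqr ger0_norm ?nrm2_ge0 //.
suff -> : nrm2 (ma (rot c) x) (mb (rot c) x) = hn c * hn x.
  by rewrite divff // mulf_neq0 // hn_neq0.
apply/eqP; rewrite -(@eqrXn2 _ 2) ?nrm2_ge0 ?mulr_ge0 ?nrm2_ge0 //.
rewrite exprMn nrm2_sqr !hn_sqr /ma /mb !mxE /=.
case: (h0 c) (h1 c) (h0 x) (h1 x) => [a a'] [b b'] [d d'] [e e'].
by rewrite !cn_sqr /=; apply/eqP; ring.
Qed.

Lemma mobius_rot c : mobius (rot c) c = Some 0.
Proof.
rewrite mobiusE /pt.
rewrite (_ : ma (rot c) c = 0); last by rewrite /ma !mxE /=; ring.
rewrite mul0r ifF //; apply/negbTE.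
rewrite /mb !mxE /= ![_^*%C * _]mulrC !mulc_conj -rmorphD /= -hn_sqr.
by rewrite -cn_gt0 cn_real normr_gt0 expf_neq0 // hn_neq0.
Qed.

Lemma chordal_rot c x y : chordal (mobius (rot c) x) (mobius (rot c) y) = chordal x y.
Proof. by rewrite chordal_mobius ?mdet_rot_neq0 // !sD_rot !mul1r. Qed.

Lemma chordal_0 (e : R) (z : C) : 0 < e -> e < 2 ->
  (e <= chordal (Some z : P) (Some 0)) = (e / Num.sqrt (4 - e ^+ 2) <= cn z).
Proof.
move=> e0 e2; have d0 : 0 < 4 - e ^+ 2 by nra.
have n0 : 0 < 1 + cn z ^+ 2 by rewrite ltr_pwDl // sqr_ge0.
rewrite /chordal subr0 !cn0 expr0n /= addr0 sqrtr1 mulr1.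
rewrite ler_pdivlMr ?sqrtr_gt0 // ler_pdivrMr ?sqrtr_gt0 //.
rewrite -[LHS](@ler_pXn2r _ 2) ?nnegrE ?mulr_ge0 ?sqrtr_ge0 ?cn_ge0 ?(ltW e0) //.
rewrite -[RHS](@ler_pXn2r _ 2) ?nnegrE ?mulr_ge0 ?sqrtr_ge0 ?cn_ge0 ?(ltW e0) //.
rewrite !exprMn !sqr_sqrtr ?(ltW n0) ?(ltW d0) //.
by apply/idP/idP => h; lra.
Qed.

(** After a rotation [c] is [0], and the condition on [h] is the one of [plane_lift] on the
    complement of a disc. *)
Lemma sphere_lift (h : P -> C) (c : P) (e : R) : 0 < e -> e < 2 -> continuous h ->
  (forall x, cn (h x) = 1) -> (forall x, e <= chordal x c -> h x = 1) ->
  exists u : P -> R, [/\ continuous u, forall x, h x = cis (u x) &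
    forall x, e <= chordal x c -> u x = 0].
Proof.
move=> e0 e2 ch hn1 he; have dM := mdet_rot_neq0 c; set M := rot c in dM.
pose r := e / Num.sqrt (4 - e ^+ 2).
have r0 : 0 < r by rewrite divr_gt0 // sqrtr_gt0; nra.
have Mc y : chordal (mobius (madj M) y) c = chordal y (Some 0).
  by rewrite -(chordal_rot c) -/M mobius_Kadj // mobius_rot.
pose k (z : C) := h (mobius (madj M) (Some z)).
have [||||u [cu uP ur]] := @plane_lift k r => //.
- move=> z; apply: (@cf_comp _ _ _ (fun z : C => mobius (madj M) (Some z : P)) h);
    last exact: ch.
  apply: (@cf_comp _ _ _ (fun z : C => Some z : P) (mobius (madj M))).
    exact: one_point_compactification_some_continuous.
  by apply: mobius_continuous; rewrite mdet_adj.
- by move=> z; exact: hn1.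
- by move=> z zr; apply: he; rewrite Mc chordal_0.
pose F (y : P) : R := if y is Some z then u z else 0.
have cF : continuous F.
  move=> [z|]; first by move=> U; exact: cu.
  move=> U U0; exists [set z | cn z <= r] => /=.
    split; first exact: compact_disc.
    by apply: compact_closed; [exact: complex_hausdorff|exact: compact_disc].
  move=> y [[z /= zr] <-|->]; last exact: nbhs_singleton U0.
  have -> : F (Some z) = F None by rewrite /= ur // ltW // ltNge; apply/negP.
  exact: nbhs_singleton U0.
have Fe y : e <= chordal y (Some 0) -> F y = 0.
  by case: y => // z; rewrite chordal_0 // => /ur.
exists (fun x => F (mobius M x)); split.
- move=> x; apply: (@cf_comp _ _ _ (mobius M) F); last exact: cF.
  exact: mobius_continuous.
- move=> x; rewrite -{1}(mobius_adjK x dM).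
  case E : (mobius M x) => [z|] /=; first exact: uP.
  rewrite cis0 he // Mc chordal_sym; apply: le_trans (ltW e2) _.
  rewrite /chordal cn0 expr0n /= addr0 sqrtr1 divr1 //.
- by move=> x xe; apply: Fe; rewrite -(mobius_rot c) chordal_rot.
Qed.

(** The distance to a set, cut off at 3, which exceeds the diameter of the sphere. *)
Definition dist_to (K : set P) (x : P) : R :=
  inf [set d | d = 3 \/ exists2 y, K y & d = chordal x y].

Lemma dist_to_has_inf K x :
  has_inf [set d : R | d = 3 \/ exists2 y, K y & d = chordal x y].
Proof.
split; first by exists 3; left.
exists 0 => d [->|[y _ ->]]; [lra|exact: chordal_ge0].
Qed.

Lemma dist_to_ge0 K x : 0 <= dist_to K x.
Proof.
apply: lb_le_inf; first by exists 3; left.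
by move=> d [->|[y _ ->]]; [lra|exact: chordal_ge0].
Qed.

Lemma dist_to_le K x y : K y -> dist_to K x <= chordal x y.
Proof.
by move=> Ky; apply: ge_inf; [exact: (dist_to_has_inf K x).2|right; exists y].
Qed.

Lemma dist_to_lt K x (e : R) : e <= 3 -> dist_to K x < e ->
  exists2 y, K y & chordal x y < e.
Proof.
move=> e3 /(inf_lt (dist_to_has_inf K x).1) [d [->|[y Ky ->]]] de; last by exists y.
by move: de e3; lra.
Qed.

Lemma dist_to_lip K x y : dist_to K x <= dist_to K y + chordal x y.
Proof.
rewrite -lerBlDr; apply: lb_le_inf; first by exists 3; left.
move=> d [->|[z Kz ->]]; rewrite lerBlDr.
  rewrite (@le_trans _ _ 3) ?lerDl ?chordal_ge0 //.
  by apply: ge_inf; [exact: (dist_to_has_inf K x).2|left].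
apply: le_trans (dist_to_le x Kz) _; rewrite addrC; exact: chordal_tri.
Qed.

Lemma continuous_dist_to K : continuous (dist_to K).
Proof.
move=> x; have FF : Filter (nbhs x) by exact: nbhs_filter.
apply/cvgrPdist_lt => e e0; apply/nbhs_P; exists e => // y yx.
have := dist_to_lip K x y; have := dist_to_lip K y x.
by rewrite (chordal_sym x) ltr_norml => *; apply/andP; lra.
Qed.

(** Janiszewski's theorem on the sphere, in the form used below. Let [A] and [B] be
    relatively closed sets covering a connected open set [O] and meeting in a
    compact part [K] of [O]. Let [f] go from 0 to 1 across [K], with [f >= 1/2] on
    [A] and [f <= 1/2] on [B]. Then [exp (2 pi i f)] extends by 1 to the sphere,
    where it has a logarithm; as [O] is connected, [f] itself extends, up to a
    constant [k], to a continuous function which takes integer values off [O]. *)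
Lemma separator (O A B K : set P) (c : P) (e : R) : 0 < e -> e < 2 ->
  open O -> connected O -> O `<=` A `|` B ->
  (forall x, O x -> closure A x -> A x) -> (forall x, O x -> closure B x -> B x) ->
  (forall x, O x -> A x -> B x -> K x) -> compact K -> K `<=` O ->
  (forall x, K x -> chordal x c < e) ->
  exists (u : P -> R) (k : int), [/\ continuous u,
    forall x, e <= chordal x c -> u x = 0,
    forall x, ~ O x -> exists n : int, u x = n%:~R,
    forall x, O x -> k%:~R <= u x <= k%:~R + 1 &
    (forall x, O x -> A x -> k%:~R + 2^-1 <= u x) /\
    (forall x, O x -> B x -> u x <= k%:~R + 2^-1)].
Proof.
move=> e0 e2 oO cO OAB clA clB ABK cK KO Kc.
have [d [d0 d1 dP]] : exists d : R, [/\ 0 < d, d <= 1 & forall x, dist_to K x < d ->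
    O x /\ chordal x c < e].
  have : \forall d \near (0 : R)^'+, forall y, K y ->
      forall x, chordal x y < d -> O x /\ chordal x c < e.
    move/compact_near_coveringP: cK; apply => y Ky.
    have /nbhs_P [b b0 bO] : nbhs y (O `&` [set x | chordal x c < e]).
      apply: filterI; first exact: open_near oO (KO _ Ky).
      have := @continuous_chordal R c y [set t | t < e]; apply; apply: lt_nbhsl; exact: Kc.
    have b20 : 0 < b / 2 by rewrite divr_gt0.
    near=> y' d => x xy'; apply: bO.
    have h1 : chordal y' y < b / 2 by near: y'; exact: nbhs_chordal_ball.
    have h2 : d <= b / 2 by near: d; exact: nbhs_right_le.
    have xy'' : chordal x y' < d by [].
    by apply: le_lt_trans (chordal_tri _ y' _) _; rewrite (splitr b) ltrD // (lt_le_trans xy'').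
  move=> H; have /filter_ex [d [d0 d1 dP]] : \forall d \near (0 : R)^'+, [/\ 0 < d, d <= 1 &
      forall y, K y -> forall x, chordal x y < d -> O x /\ chordal x c < e].
    near=> d; split; near: d => //; [exact: nbhs_right_gt|exact: nbhs_right_le].
  exists d; split=> // x /dist_to_lt [|y Ky]; last exact: dP.
  by move: d1; lra.
pose m (x : P) := Num.min (dist_to K x / d) (2^-1 : R).
have cm : continuous m.
  rewrite /m => x.
  apply: (@cf_min R P (fun x => dist_to K x / d) (fun=> 2^-1)); last exact: cfc.
  by apply: cfM; [exact: continuous_dist_to|exact: cfc].
have m0 x : 0 <= m x <= 2^-1.
  by rewrite /m le_min ge_min lexx orbT !andbT divr_ge0 ?dist_to_ge0 ?(ltW d0) // invr_ge0 ler0n.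
(* [f] crosses [1/2] exactly along [K], at a speed measured by the distance to [K]. *)
pose f (x : P) : R := if `[< A x >] then 2^-1 + m x else 2^-1 - m x.
have fA x : A x -> f x = 2^-1 + m x by move=> Ax; rewrite /f asboolT.
have fB x : ~ A x -> f x = 2^-1 - m x by move=> Ax; rewrite /f asboolF.
have mK x : K x -> m x = 0.
  move=> Kx; have : dist_to K x = 0.
    by apply/eqP; rewrite eq_le dist_to_ge0 andbT -(chordalxx x) dist_to_le.
  by move=> h; rewrite /m h mul0r min_l // invr_ge0.
have f_half x : `|f x - 2^-1| = m x.
  have /andP[mx _] := m0 x; rewrite /f; case: asboolP => _.
    by rewrite addrC addKr ger0_norm.
  by rewrite addrC addKr normrN ger0_norm.
have cf x : O x -> {for x, continuous f}.
  move=> Ox; have Onear : \forall y \near x, O y by exact: open_near.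
  have [Kx|nKx] := pselect (K x).
    have fx : f x = 2^-1 by apply/eqP; rewrite -subr_eq0 -normr_eq0 f_half mK.
    have FF : Filter (nbhs x) by exact: nbhs_filter.
    apply/cvgrPdist_lt => b b0; rewrite fx.
    have /cvgrPdist_lt /(_ b b0) := cm x; rewrite mK //; apply: filterS => y.
    rewrite sub0r normrN -{1}f_half normr_id distrC //.
  have [Ax|nAx] := pselect (A x).
    have nBx : ~ B x by move=> Bx; apply: nKx; exact: ABK.
    have : \forall y \near x, ~ B y.
      have : (~` closure B) x by move=> /(clB x Ox).
      move=> h; have : nbhs x (~` closure B).
        by apply: open_nbhs_nbhs; split=> //; apply: closed_openC; exact: closed_closure.
      by apply: filterS => y h' By; apply: h'; exact: subset_closure.
    move=> nB; apply: cf_near (cfD (@cfc _ _ (2^-1 : R) x) (cm x)).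
    near=> y; rewrite fA //.
    have Oy : O y by near: y.
    have nBy : ~ B y by near: y.
    by have [] := OAB y Oy.
  have : \forall y \near x, ~ A y.
    have : (~` closure A) x by move=> /(clA x Ox).
    move=> h; have : nbhs x (~` closure A).
      by apply: open_nbhs_nbhs; split=> //; apply: closed_openC; exact: closed_closure.
    by apply: filterS => y h' By; apply: h'; exact: subset_closure.
  move=> nA; apply: cf_near (cfB (@cfc _ _ (2^-1 : R) x) (cm x)).
  by apply: filterS nA => y nAy; rewrite fB.
pose twopi : R := pi *+ 2.
have tp0 : twopi != 0 by rewrite gt_eqF // pmulrn_lgt0 ?pi_gt0.
have cis_far x : d / 2 <= dist_to K x -> cis (twopi * f x) = 1 :> C.
  move=> xd; have mx : m x = 2^-1.
    rewrite /m min_r // ler_pdivlMr // mulrC //.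
  rewrite /f mx; case: asboolP => _.
    rewrite (_ : 2^-1 + 2^-1 = 1); last by lra.
    by rewrite mulr1 /twopi cis2pi.
  by rewrite subrr mulr0 cis0.
pose h (x : P) : C := if `[< O x >] then cis (twopi * f x) else 1.
have hO x : O x -> h x = cis (twopi * f x) by move=> Ox; rewrite /h asboolT.
have hfar x : d / 2 <= dist_to K x -> h x = 1.
  by move=> xd; rewrite /h; case: asboolP => // _; exact: cis_far.
have ch : continuous h.
  move=> x; have [Ox|nOx] := pselect (O x).
    have cx : {for x, continuous (fun y => cis (twopi * f y) : C)}.
      apply: (@cf_comp P R C (fun y => twopi * f y) cis); last exact: continuous_cis.
      by apply: cfM; [exact: cfc|exact: cf].
    apply: cf_near cx; have : \forall y \near x, O y by exact: open_near.
    by apply: filterS => y Oy; rewrite hO.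
  have xd : d <= dist_to K x by rewrite leNgt; apply/negP => /dP [].
  have near_far : \forall y \near x, d / 2 < dist_to K y.
    have := @continuous_dist_to K x [set t | d / 2 < t]; apply; apply: lt_nbhsr; lra.
  apply: cf_near (@cfc _ _ (1 : C) x).
  by apply: filterS near_far => y /ltW /hfar ->.
have [|||||u [cu uP ue]] := @sphere_lift h c e => //.
- by move=> x; rewrite /h; case: asboolP => _; [exact: cn_cis|exact: cn1].
- move=> x xe; apply: hfar; have [//|xd] := lerP (d / 2) (dist_to K x).
  have [|_ xc] := dP x; first by apply: lt_trans xd _; lra.
  by move: xc; rewrite ltNge xe.
pose v (x : P) := u x / twopi.
have cv : continuous v.
  by rewrite /v => x; apply: (@cfM P R u (fun=> twopi^-1)); [exact: cu|exact: cfc].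
have vf_int x : O x -> exists n : int, v x - f x = n%:~R.
  move=> Ox; have := uP x; rewrite hO // => /esym/cis_eq [n nE]; exists n.
  rewrite /v nE mulrDl mulfK //; rewrite mulrAC divff // mul1r addrC addKr //.
have [k kP] : exists k : int, forall x, O x -> v x = f x + k%:~R.
  have [[x0 Ox0]|nO] := pselect (exists x, O x); last first.
    by exists 0 => x Ox; case: nO; exists x.
  have [k kE] := vf_int x0 Ox0; exists k => x Ox.
  have := @int_valued_const _ O (fun x => v x - f x) cO _ vf_int x x0 Ox Ox0.
  rewrite kE => <-; first by rewrite addrC subrK.
  apply/subspace_continuousP => y Oy; apply: cvg_within_filter.
  by apply: cfB; [exact: cv|exact: cf].
exists v, k; split=> //.
- by move=> x xe; rewrite /v ue // mul0r.
- move=> x nOx; have := uP x; rewrite /h asboolF // => /esym /cis_eq1 [n nE].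
  by exists n; rewrite /v nE mulfK.
- move=> x Ox; rewrite kP //; have /andP[? ?] := m0 x.
  by rewrite /f; case: asboolP => _; apply/andP; lra.
- split=> x Ox xAB; rewrite kP //; have /andP[? ?] := m0 x.
    by rewrite fA //; lra.
  have [Ax|nAx] := pselect (A x); last by rewrite fB //; lra.
  by rewrite fA // mK; [lra|exact: ABK].
Unshelve. all: by end_near. Qed.

End lifts_to_the_line.

(** * The quotient surface and cocompactness *)

Section torsion_free.
Context {R : realType} {g : nat}.
Variable rho : schottky R g.
Local Notation word := (seq (letter g)).
Local Notation wmx := (wmx rho).
Local Notation act := (act rho).

Lemma wmx_act s t x : wmx s = wmx t -> act s x = act t x.
Proof. by rewrite /act /sch_act -!/(wmx _) => ->. Qed.

(** Conjugating by the first letter shortens a word that starts and ends with inverse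
    letters. *)
Lemma cyclic_conj (w : word) : reduced w -> w != [::] ->
  exists u c, [/\ reduced c, c != [::], nocancel c c &
    wmx w = wmx u * wmx c * wmx (winv u)].
Proof.
have [n] := ubnP (size w); elim: n w => // n IH [|a w] //=; rewrite ltnS => sw rw _.
have triv : nocancel (a :: w) (a :: w) -> exists u c, [/\ reduced c, c != [::],
    nocancel c c & wmx (a :: w) = wmx u * wmx c * wmx (winv u)].
  by move=> h; exists [::], (a :: w); rewrite wmx_nil mul1r mulr1.
case: (lastP w) => [|m b] in sw rw triv *.
  by apply: triv; rewrite /= eq_sym linv_neq.
have [ab|ab] := eqVneq a (linv b); last by apply: triv; rewrite /= last_rcons.
have rm : reduced m.
  by move: (reduced_behead rw); rewrite -cats1 reduced_cat => /and3P[].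
have m0 : m != [::].
  by apply: contraTneq rw => ->; rewrite /= reduced_cons ab linvK eqxx.
have sm : (size m < n)%N by apply: leq_trans sw; rewrite size_rcons.
have [u [c [rc c0 cc mE]]] := IH m sm rm m0.
exists (a :: u), c; split=> //.
rewrite wmx_cons -cats1 wmx_cat mE (wmx_cons _ a u) winv_cons -cats1 wmx_cat.
by rewrite ab linvK !mulrA.
Qed.

Lemma reduced_power (c : word) k : reduced c -> c != [::] -> nocancel c c ->
  reduced (flatten (nseq k c)).
Proof.
move=> rc c0 cc; elim: k => //= k IH; rewrite reduced_cat rc IH /=.
by case: k {IH} => [|k] //=; case: (c) cc c0.
Qed.

(** The powers of [w] are infinitely many elements of the group, and they do not move [x]. *)
Lemma fixed_in_limit (w : word) x : reduced w -> w != [::] -> act w x = x ->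
  limit_set rho x.
Proof.
move=> rw w0 wx; have [u [c [rc c0 cc wE]]] := cyclic_conj rw w0.
pose pw k := flatten (nseq k c).
pose f k := red (u ++ pw k ++ winv u).
have wpow k : wmx (u ++ pw k ++ winv u) = wmx (flatten (nseq k w)).
  elim: k => [|k IH]; first by rewrite /= wmx_cat wmx_winvr wmx_nil.
  have -> : wmx (flatten (nseq k.+1 w)) = wmx w * wmx (flatten (nseq k w)).
    exact: wmx_cat.
  rewrite wE -IH /pw /= !wmx_cat -!mulrA (mulrA (wmx (winv u))).
  by rewrite wmx_winv mul1r.
have fx k : act (f k) x = x.
  rewrite act_red (wmx_act _ (wpow k)).
  by elim: k => [|k IH]; [rewrite act_nil|rewrite /= act_cat IH].
have fI : injective f.
  move=> i j /(congr1 wmx); rewrite !wmx_red !wmx_cat => /(congr1 (fun M => wmx (winv u) * M)).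
  rewrite !mulrA wmx_winv !mul1r => /(congr1 (fun M => M * wmx u)).
  rewrite -!mulrA wmx_winv !mulr1 => /wmx_inj h.
  have := congr1 size (h (reduced_power i rc c0 cc) (reduced_power j rc c0 cc)).
  rewrite !size_flatten /shape !map_nseq !sumn_nseq => /eqP.
  by rewrite eqn_mul2l size_eq0 (negbTE c0) => /eqP.
apply/limit_setP; exists x => e e0 fS; apply: infinite_nat.
apply: (sub_finite_set _ (finite_preimage (f := f) _ fS)) => [k _|? ? _ _]; last exact: fI.
by split; [exact: reduced_red|rewrite fx chordalxx].
Qed.

End torsion_free.

Lemma near_all_seq T I (F : set_system T) (s : seq I) (Q : I -> set T) : Filter F ->
  (forall i, List.In i s -> F (Q i)) -> F [set t | forall i, List.In i s -> Q i t].
Proof.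
move=> FF; elim: s => [|i s IH] h; first by apply: filterE => t j [].
have h1 := h i (or_introl erefl).
have h2 := IH (fun j js => h j (or_intror js)).
by apply: filterS2 h1 h2 => t Qi Qs j [<-|/Qs].
Qed.

Lemma near_all_finite T (I : eqType) (F : set_system T) (S : set I) (Q : I -> set T) :
  Filter F -> finite_set S -> (forall i, S i -> F (Q i)) ->
  F [set t | forall i, S i -> Q i t].
Proof.
move=> FF /finite_seqP [s sE] h; have InP i : List.In i s <-> i \in s.
  elim: s {sE} => //= j s IH; rewrite inE; split=> [[->|/IH ->]|/orP[/eqP ->|/IH]];
    rewrite ?eqxx ?orbT //; by [left|right].
apply: filterS (@near_all_seq _ _ F s Q FF _) => [t tQ i Si|i /InP si].
  by apply: tQ; apply/InP; rewrite sE in Si.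
by apply: h; rewrite sE.
Qed.

Definition cocompact_group (R : realType) (g : nat) (rho : schottky R g) : Prop :=
  exists K : set (P1 R), [/\ compact K, K `<=` domain_of_discontinuity rho &
    forall x, domain_of_discontinuity rho x ->
      exists w k, [/\ reduced w, K k & x = act rho w k]].

Section quotient_surface.
Context {R : realType} {g : nat}.
Variables (rho : schottky R g) (X : riemann_surface R) (p : P1 R -> X).
Hypotheses (pU : uniformizes rho p).
Local Notation C := R[i].
Local Notation cn := (@ComplexField.Normc.normc R).
Local Notation P := (P1 R).
Local Notation word := (seq (letter g)).
Local Notation act := (act rho).
Local Notation Lam := (limit_set rho).
Local Notation Om := (domain_of_discontinuity rho).

Lemma Om_ball x : Om x -> exists e : R, [/\ 0 < e, e < 2 &
  forall y, chordal y x <= e -> Om y].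
Proof.
move=> Ox; have /nbhs_P [e e0 eO] := open_near (@Om_open _ _ rho) Ox.
exists (Num.min (e / 2) 1); split.
- by rewrite lt_min ltr01 divr_gt0.
- by rewrite gt_min; apply/orP; right; lra.
- move=> y yx; apply: eO; apply: le_lt_trans yx _; rewrite gt_min; apply/orP; left; lra.
Qed.

Lemma closed_ball_compact (x : P) (e : R) : compact [set y | chordal y x <= e].
Proof.
apply: (subclosed_compact _ (@P1_compact R)) => //.
have /continuous_closedP /(_ _ (@closed_le _ e)) := @continuous_chordal R x; exact.
Qed.

(** Only finitely many words return to a compact neighbourhood of [x], and none but the
    empty one fixes [x]. *)
Lemma locally_injective x : Om x -> exists2 e : R, 0 < e &
  forall y, chordal y x < e -> Om y /\
    forall w, reduced w -> chordal (act w y) x < e -> w = [::].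
Proof.
move=> Ox; have [e [e0 _ eO]] := Om_ball Ox.
pose N := [set y : P | chordal y x <= e].
have cN : compact N by exact: closed_ball_compact.
have fF := proper_discontinuity cN cN eO eO.
have /nbhs_P [d d0 dP] : \forall y \near x, forall w,
    [set w | reduced w /\ exists2 x, N x & N (act w x)] w ->
    w <> [::] -> chordal (act w x) x / 2 < chordal (act w y) x.
  apply: near_all_finite fF _ => w [rw _].
  have [->|w0] := eqVneq w [::]; first by apply: filterE.
  have wx : 0 < chordal (act w x) x.
    by rewrite chordal_gt0; apply/eqP => /(fixed_in_limit rw w0).
  have : \forall y \near x, chordal (act w x) x / 2 < chordal (act w y) x.
    have cc : {for x, continuous (fun y => chordal (act w y) x)}.
      apply: (@cf_comp P P R (act w) (fun z => chordal z x)); first exact: act_continuous.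
      exact: continuous_chordal.
    apply: (cc [set t | chordal (act w x) x / 2 < t]); apply: lt_nbhsr; lra.
  by apply: filterS => y h _.
have : \forall b \near (0 : R)^'+, forall w,
    [set w | reduced w /\ exists2 x, N x & N (act w x)] w ->
    w <> [::] -> b <= chordal (act w x) x / 2.
  apply: near_all_finite fF _ => w [rw _].
  have [->|w0] := eqVneq w [::]; first by apply: filterE.
  have wx : 0 < chordal (act w x) x / 2.
    by rewrite divr_gt0 // chordal_gt0; apply/eqP => /(fixed_in_limit rw w0).
  by near=> b => _; near: b; exact: nbhs_right_le.
move=> nb; have /filter_ex [b [b0 [be [bd bP]]]] : \forall b \near (0 : R)^'+,
    0 < b /\ b <= e /\ b <= d /\ forall w,
    [set w | reduced w /\ exists2 x, N x & N (act w x)] w ->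
    w <> [::] -> b <= chordal (act w x) x / 2.
  by near=> b; (split; last split; last split); near: b => //;
    [exact: nbhs_right_gt|exact: nbhs_right_le|exact: nbhs_right_le].
exists b => // y yx; split.
  by apply: eO; apply: ltW; apply: lt_le_trans be.
move=> w rw wy; apply: contrapT => w0.
have Sw : [set w | reduced w /\ exists2 x, N x & N (act w x)] w.
  by split=> //; exists y; rewrite /N /=; apply: ltW; apply: lt_le_trans be.
have := dP y (lt_le_trans yx bd) w Sw w0; have := bP w Sw w0; move: wy; lra.
Unshelve. all: by end_near. Qed.

Lemma p_continuous x : Om x -> {for x, continuous p}.
Proof. by move=> Ox; case: pU => /(_ x Ox) []. Qed.

Lemma p_eq x y : Om x -> Om y -> p x = p y <-> exists2 w, reduced w & y = act w x.
Proof. by case: pU => _ _ h; exact: h. Qed.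

(** A parametrization of the sphere that maps discs around [0] to balls around [z]. *)
Definition coord (z : P) (u : C) : P := mobius (madj (rot z)) (Some u).

Lemma coord0 z : coord z 0 = z.
Proof. by rewrite /coord -(mobius_rot z) mobius_adjK // mdet_rot_neq0. Qed.

Lemma coord_continuous z : continuous (coord z).
Proof.
move=> u; apply: (@cf_comp C P P (fun u : C => Some u : P) (mobius (madj (rot z)))).
  exact: one_point_compactification_some_continuous.
by apply: mobius_continuous; rewrite mdet_adj mdet_rot_neq0.
Qed.

Lemma coord_inj z : injective (coord z).
Proof.
move=> u v /(mobius_inj (_ : mdet (madj (rot z)) != 0)) h.
by have := h; rewrite mdet_adj mdet_rot_neq0 => /(_ isT) [].
Qed.

Lemma continuous_chart (c : chart R X) y : rs_atlas c -> c.1 y -> {for y, continuous c.2}.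
Proof.
move=> Ac cy; have [oc wc _ _] := rs_chart Ac.
by move: wc; rewrite continuous_open_subspace // => /(_ y (mem_set cy)).
Qed.

(** [p] is locally injective, so in charts it is an injective continuous map between
    plane domains. *)
Lemma p_open z (e : R) : Om z -> 0 < e ->
  nbhs (p z) (p @` [set x | Om x /\ chordal x z < e]).
Proof.
move=> Oz e0; have [c Ac cz] := rs_cover (p z).
have [oc wc ic _] := rs_chart Ac.
have [d d0 dP] := locally_injective Oz.
have := p_continuous Oz (open_near oc cz) => /nbhs_P [k k0 kP].
pose m := Num.min e (Num.min d k).
have m0 : 0 < m by rewrite !lt_min e0 d0.
have [r r0 rP] : exists2 r : R, 0 < r & forall u, cn u <= r -> chordal (coord z u) z < m.
  have := @coord_continuous z 0; rewrite /continuous_at coord0 => /cvg_chordal /(_ m m0).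
  move=> /nbhs_cn [r r0 rP]; exists (r / 2); first by rewrite divr_gt0.
  by move=> u ur; apply: rP; rewrite subr0; apply: le_lt_trans ur _; lra.
have ball u : cn u <= r -> [/\ Om (coord z u), c.1 (p (coord z u)) &
    chordal (coord z u) z < e].
  move=> /rP; rewrite !lt_min => /and3P[h1 h2 h3]; split=> //; first exact: (dP _ h2).1.
  exact: kP.
pose f u := c.2 (p (coord z u)).
have cf u : cn (u - 0) <= r -> {for u, continuous f}.
  rewrite subr0 => ur; have [Ou cu _] := ball u ur.
  apply: (@cf_comp C X C (fun u => p (coord z u)) c.2); last exact: continuous_chart.
  apply: (@cf_comp C P X (coord z) p); first exact: coord_continuous.
  exact: p_continuous.
have fI u v : cn (u - 0) <= r -> cn (v - 0) <= r -> f u = f v -> u = v.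
  rewrite !subr0 => ur vr; have [Ou cu _] := ball u ur; have [Ov cv _] := ball v vr.
  move=> /(ic _ _ (mem_set cu) (mem_set cv)) /(p_eq Ou Ov) [w rw vE].
  have hu := rP u ur; have hv := rP v vr; rewrite !lt_min in hu hv.
  have /and3P[_ hu2 _] := hu; have /and3P[_ hv2 _] := hv.
  have w0 : w = [::] by apply: ((dP _ hu2).2 w rw); rewrite -vE.
  by apply: (@coord_inj z); rewrite vE w0 act_nil.
have [b b0 bP] := invariance_of_domain r0 cf fI.
have : nbhs (p z) (c.1 `&` c.2 @^-1` [set t | cn (t - c.2 (p z)) < b]).
  apply: filterI; first exact: open_near.
  by apply: (continuous_chart Ac cz); apply/nbhs_cn; exists b.
apply: filterS => y [cy yb].
have [|u] := bP (c.2 y); first by rewrite /f coord0.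
rewrite subr0 => ur fu; have [Ou cu ue] := ball u ur.
exists (coord z u) => //; apply: (ic _ _ (mem_set cu) (mem_set cy)); exact: fu.
Qed.

(** As [p] is open, points of the surface close to each other have preimages at a distance
    bounded below from the limit set; compactness makes the bound uniform. *)
Lemma cocompact : compact [set: X] -> cocompact_group rho.
Proof.
move=> cX; have [_ psurj _] := pU.
have : \forall d \near (0 : R)^'+, forall y : X, setT y ->
    exists x, d <= dist_to Lam x /\ p x = y.
  move/compact_near_coveringP: cX; apply => y _.
  have [x Ox pxy] : (p @` Om) y by rewrite psurj.
  have [e [e0 e2 eO]] := Om_ball Ox.
  have dx : e <= dist_to Lam x.
    rewrite leNgt; apply/negP => /dist_to_lt [|z Lz zx]; first by lra.
    by apply: (eO z) => //; rewrite chordal_sym ltW.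
  have e20 : 0 < e / 2 by rewrite divr_gt0.
  have py := p_open Ox e20; rewrite pxy in py.
  near=> y' d => /=.
  have [x' [Ox' xx'] px'] : (p @` [set x' | Om x' /\ chordal x' x < e / 2]) y'.
    by near: y'.
  exists x'; split=> //; have h : d <= e / 2 by near: d; exact: nbhs_right_le.
  have := dist_to_lip Lam x x'; rewrite (chordal_sym x x') => h2.
  apply: le_trans h _; move: xx' dx h2; lra.
move=> H; have /filter_ex [d [d0 dP]] : \forall d \near (0 : R)^'+, 0 < d /\
    forall y : X, setT y -> exists x, d <= dist_to Lam x /\ p x = y.
  by near=> d; split; near: d => //; exact: nbhs_right_gt.
exists [set x | d <= dist_to Lam x]; split.
- apply: (subclosed_compact _ (@P1_compact R)) => //.
  by have /continuous_closedP /(_ _ (@closed_ge _ d)) := @continuous_dist_to R Lam; exact.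
- move=> x /= dx Lx; have := dist_to_le x Lx; rewrite chordalxx.
  by move=> h; have := lt_le_trans d0 (le_trans dx h); rewrite ltxx.
- move=> x Ox; have [k [dk pk]] := dP (p x) I.
  have Ok : Om k.
    move=> Lk; have := dist_to_le k Lk; rewrite chordalxx.
    by move=> h; have := lt_le_trans d0 (le_trans dk h); rewrite ltxx.
  by have [w rw xE] := (p_eq Ok Ox).1 pk; exists w, k.
Unshelve. all: by end_near. Qed.

End quotient_surface.

(** * Ends of the group and points of the limit set *)

Lemma finite_bounded g (S : set (seq (letter g))) : finite_set S ->
  exists n, forall w, S w -> (size w <= n)%N.
Proof.
move=> /finite_seqP [s sE]; exists (\max_(w <- s) size w) => w; rewrite sE /= => ws.
by rewrite (big_rem w) //= leq_maxl.
Qed.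

Lemma finite_bigcup_compact (T : topologicalType) (I : eqType) (S : set I)
    (F : I -> set T) : finite_set S -> (forall i, S i -> compact (F i)) ->
  compact [set x | exists2 i, S i & F i x].
Proof.
move=> /finite_seqP [s ->] cF.
have {cF} : forall i, i \in s -> compact (F i) by move=> i; exact: cF.
elim: s => [|i s IH] cF.
  rewrite (_ : [set x | _] = set0); first exact: compact0.
  by apply/seteqP; split=> // x [].
rewrite (_ : [set x | _] = F i `|` [set x | exists2 i, [set` s] i & F i x]).
  apply: compactU; first by apply: cF; rewrite mem_head.
  by apply: IH => j js; apply: cF; rewrite inE js orbT.
apply/seteqP; split=> [x [j /=]|x [Fx|[j /= js Fx]]].
- by rewrite inE => /orP[/eqP ->|js] Fx; [left|right; exists j].
- by exists i => //=; rewrite mem_head.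
- by exists j => //=; rewrite inE js orbT.
Qed.

Section sphere_connectedness.
Context {R : realType}.
Local Notation C := R[i].
Local Notation cn := (@ComplexField.Normc.normc R).
Local Notation P := (P1 R).

Lemma ray_connected (v : C) : connected ((fun t : R => t%:C%C * v) @` `[0, 1]).
Proof.
apply: connected_continuous_connected; first exact: segment_connected.
apply: continuous_subspaceT => t.
apply: (@cfM R C (fun t : R => t%:C%C) (fun=> v)); last exact: cfc.
by apply: cf_Complex; [exact: cf_id|exact: cfc].
Qed.

Lemma starlike_connected (D : set C) :
  (forall (t : R) z, 0 <= t <= 1 -> D z -> D (t%:C%C * z)) -> connected D.
Proof.
move=> starD; rewrite (_ : D = \bigcup_(v in D) ((fun t : R => t%:C%C * v) @` `[0, 1])).
  apply: bigcup_connected => [|v _]; last exact: ray_connected.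
  exists 0 => v _ /=; exists 0; first by rewrite /= in_itv /= lexx ler01.
  by rewrite mul0r.
apply/seteqP; split=> [z Dz|z [v Dv [t]]].
  exists z => //; exists 1; first by rewrite /= in_itv /= lexx ler01.
  by rewrite mul1r.
by rewrite /= in_itv /= => t01 <-; exact: starD.
Qed.

Lemma disc_connected (r : R) : connected [set z : C | cn z <= r].
Proof.
apply: starlike_connected => t z /andP[t0 t1] /= zr.
by rewrite cnM cn_real ger0_norm //; apply: le_trans zr; rewrite ler_piMl ?cn_ge0.
Qed.

Lemma connected_near (x : P) (U : set P) : nbhs x U ->
  exists V, [/\ nbhs x V, V x, V `<=` U & connected V].
Proof.
move=> xU; have := @coord_continuous R x 0 U; rewrite coord0 => /(_ xU).
move=> /nbhs_cn [r r0 rU]; have r20 : 0 < r / 2 by rewrite divr_gt0.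
exists (coord x @` [set z | cn z <= r / 2]); split.
- have dM := @mdet_rot_neq0 R x.
  have : nbhs (mobius (rot x) x) (Some @` [set z : C | cn z < r / 2]).
    rewrite mobius_rot; apply: one_point_compactification_some_nbhs.
    by apply/nbhs_cn; exists (r / 2) => // w; rewrite subr0.
  move=> h; have h' : nbhs x (mobius (rot x) @^-1`
    (Some @` [set z : C | cn z < r / 2])) := mobius_continuous dM h.
  apply: filterS h' => y [z /= zr zE].
  by exists z => //=; [exact: ltW|rewrite /coord zE mobius_adjK].
- by exists 0; [rewrite /= cn0 ltW|rewrite coord0].
- by move=> y [z /= zr <-]; apply: rU; rewrite subr0; apply: le_lt_trans zr _; lra.
- apply: connected_continuous_connected; first exact: disc_connected.
  by apply: continuous_subspaceT; exact: coord_continuous.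
Qed.

Lemma component_open (U : set P) (x : P) : open U -> open (connected_component U x).
Proof.
move=> oU; rewrite openE => y Cy; rewrite /interior.
have Uy := connected_component_sub Cy.
have [V [yV Vy VU cV]] := connected_near (open_near oU Uy).
apply: filterS yV; rewrite (same_connected_component Cy).
exact: connected_component_max.
Qed.

Lemma P1_connected : connected [set: P].
Proof.
have cS : connected (Some @` [set: C] : set P).
  apply: connected_continuous_connected; first by apply: starlike_connected.
  apply: continuous_subspaceT; exact: one_point_compactification_some_continuous.
have := connected_closure cS; congr connected; apply/seteqP; split=> // -[z|] _.
  by apply: subset_closure; exists z.
move=> U /nbhs_P [e e0 eU].
have h : 0 < 2 / e + 1 by rewrite addr_gt0 // divr_gt0.
exists (Some (2 / e + 1)%:C%C); split; first by exists (2 / e + 1)%:C%C.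
by apply: eU; apply: chordal_None => //; rewrite cn_real gtr0_norm // ltrDl.
Qed.

End sphere_connectedness.

Section ends_of_the_group.
Context {R : realType} {g : nat}.
Variables (rho : schottky R g) (K : set (P1 R)).
Local Notation C := R[i].
Local Notation cn := (@ComplexField.Normc.normc R).
Local Notation P := (P1 R).
Local Notation word := (seq (letter g)).
Local Notation act := (act rho).
Local Notation wmx := (wmx rho).
Local Notation Lam := (limit_set rho).
Local Notation Om := (domain_of_discontinuity rho).
Hypotheses (cK : compact K) (KO : K `<=` Om).
Hypothesis Kcov : forall x, Om x -> exists w k, [/\ reduced w, K k & x = act w k].

Definition tiles (S : set word) : set P :=
  [set x | exists w k, [/\ reduced w, S w, K k & x = act w k]].

(** Traces on the domain of neighbourhoods of the ends with prefix [w], and of the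
    other ends. *)
Definition beyond (w : word) : set P := tiles [set c | prefix w c].
Definition aside (w : word) : set P := tiles [set c | ~~ prefix w c].

Lemma tiles_Om S : tiles S `<=` Om.
Proof. by move=> x [w [k [_ _ /KO Ok ->]]]; exact: Om_act. Qed.

Lemma tile_compact w : compact (act w @` K).
Proof.
apply: continuous_compact => //.
by apply: continuous_subspaceT; exact: act_continuous.
Qed.

Lemma tile_closed w : closed (act w @` K).
Proof. by apply: compact_closed; [exact: P1_hausdorff|exact: tile_compact]. Qed.

Lemma near_not_tile w y : ~ (act w @` K) y -> \forall z \near y, ~ (act w @` K) z.
Proof.
by move=> ny; apply: open_near ny; apply: closed_openC; exact: tile_closed.
Qed.

(** The tiles are closed and locally finite in the domain. *)
Lemma tiles_closed S x : Om x -> closure (tiles S) x -> tiles S x.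
Proof.
move=> Ox Sx; apply: contrapT => nSx.
have [e [e0 _ eO]] := Om_ball Ox.
have fF := proper_discontinuity cK (@closed_ball_compact R x e) KO eO.
have near1 : \forall z \near x, forall w, [set w | reduced w /\
    exists2 y, K y & [set y | chordal y x <= e] (act w y)] w -> S w -> ~ (act w @` K) z.
  apply: near_all_finite fF _ => w [rw _].
  have [Sw|nSw] := pselect (S w); last by apply: filterE.
  apply: filterS (@near_not_tile w x _) => [z h _ //|[k Kk kx]].
  by apply: nSx; exists w, k.
have [z [[w [k [rw Sw Kk zE]]] [h1 h2]]] := Sx _ (filterI near1 (nbhs_chordal_ball x e0)).
apply: (h1 w _ Sw); last by exists k.
by split=> //; exists k => //; rewrite /= -zE ltW.
Qed.

Lemma beyond_or_aside w : Om `<=` beyond w `|` aside w.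
Proof.
move=> x /Kcov [c [k [rc Kk xE]]].
by have [h|h] := boolP (prefix w c); [left|right]; exists c, k.
Qed.

Let meets_bound : {L | forall w, reduced w -> (exists2 k, K k & K (act w k)) ->
  (size w <= L)%N}.
Proof.
apply: cid; have [L LP] := finite_bounded (proper_discontinuity cK cK KO KO).
by exists L => w rw wk; apply: LP.
Qed.
Let L := sval meets_bound.
Let LP := svalP meets_bound.

Let KL : set P := [set x | exists2 w, [set w : word | reduced w /\ (size w <= L)%N] w &
  (act w @` K) x].

Let cKL : compact KL.
Proof.
apply: finite_bigcup_compact => [|w _]; last exact: tile_compact.
by apply: sub_finite_set (@finite_words g L) => w [].
Qed.

Let KLO : KL `<=` Om.
Proof. by move=> x [w _ [k /KO Ok <-]]; exact: Om_act. Qed.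

Let KKL : K `<=` KL.
Proof. by move=> k Kk; exists [::] => //; exists k => //; rewrite act_nil. Qed.

(** Adjacent tiles are at bounded distance in the group, so the tiles beyond [w] are
    adjacent to the other ones only near [w]. *)
Let beyond_aside w x : beyond w x -> aside w x -> (act w @` KL) x.
Proof.
move=> [c [k [rc /= wc Kk xE]]] [d [l [rd /= nwd Kl xE']]].
have sz : (size (red (winv c ++ d)) <= L)%N.
  apply: LP; first exact: reduced_red.
  by exists l => //; rewrite act_red act_cat -xE' xE act_winvK.
have /prefixP [a cE] := wc.
exists (act a k); last by rewrite -act_cat -cE.
exists a; last by exists k.
split; first by move: rc; rewrite cE reduced_cat => /and3P[].
have := prefix_quot rho rc rd wc nwd; rewrite cE size_cat addKn => /ltnW h.
by rewrite cE in sz; exact: leq_trans h sz.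
Qed.

(** Since translates of a compact set are small, the tiles beyond a long word are
    separated from the others by a small set; Janiszewski's theorem does the rest. *)
Lemma long_word_separator (x0 : P) (e : R) : Om x0 -> 0 < e ->
  let O := connected_component Om x0 in
  exists N, forall w, reduced w -> (N <= size w)%N ->
  exists c u, [/\ continuous u, forall x, e <= chordal x c -> u x = 0,
    forall x, ~ O x -> exists n : int, u x = n%:~R :> R,
    forall x, O x -> beyond w x -> 2^-1 <= u x &
    forall x, O x -> aside w x -> u x <= 2^-1].
Proof.
move=> Ox0 e0 O; have [b [b0 b2 bO]] := Om_ball Ox0.
pose d := Num.min e b.
have d0 : 0 < d by rewrite lt_min e0.
have db : d <= b by rewrite ge_min lexx orbT.
have de : d <= e by rewrite ge_min lexx.
have d2 : d < 2 by apply: le_lt_trans b2.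
have [n1 n1P] := finite_bounded (small_images cKL KLO d0).
have bO' : [set y | chordal y x0 <= d] `<=` Om by move=> y /= yd; apply: bO; apply: le_trans db.
have [n2 n2P] := finite_bounded (proper_discontinuity cKL (@closed_ball_compact R x0 d) KLO bO').
have [n3 n3P] := finite_bounded (proper_discontinuity cK (@closed_ball_compact R x0 d) KO bO').
exists (maxn n1 (maxn n2 n3)).+1 => w rw; rewrite !gtn_max => /and3P[s1 s2 s3].
have [w0 [k0 [_ Kk0 _]]] := Kcov Ox0.
pose c := act w k0.
have near_c x : (act w @` KL) x -> chordal x c < d.
  move=> [k KLk <-]; rewrite ltNge; apply/negP => h.
  have : (size w <= n1)%N by apply: n1P; split=> //; exists k, k0; split=> //; exact: KKL.
  by rewrite leqNgt s1.
have x0c : d <= chordal x0 c.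
  rewrite leNgt; apply/negP => h; have : (size w <= n2)%N.
    by apply: n2P; split=> //; exists k0; [exact: KKL|rewrite /= chordal_sym ltW].
  by rewrite leqNgt s2.
have Ox0' : O x0 by exact: connected_component_refl.
have nbx0 : ~ beyond w x0.
  move=> [v [k [rv /= /prefixP [a vE] Kk x0E]]].
  have : (size v <= n3)%N by apply: n3P; split=> //; exists k => //=; rewrite -x0E chordalxx ltW.
  by rewrite vE size_cat leqNgt (leq_trans s3) // leq_addr.
have oO : open O by apply: component_open; exact: Om_open.
have sO : O `<=` Om by exact: connected_component_sub.
have cKw : compact ((act w @` KL) `&` O).
  have cw : compact (act w @` KL).
    by apply: continuous_compact => //; apply: continuous_subspaceT; exact: act_continuous.
  apply: (subclosed_compact _ cw); last by move=> x [].
  move=> x xcl; have wx : (act w @` KL) x.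
    have := compact_closed (@P1_hausdorff R) cw; apply.
    by apply: closureS xcl => y [].
  split=> //; have Ox : Om x by have [k /KLO Ok <-] := wx; exact: Om_act.
  have /xcl [y [[_ Oy] xy]] : nbhs x (connected_component Om x).
    apply: open_near; first by apply: component_open; exact: Om_open.
    exact: connected_component_refl.
  by apply: connected_component_trans Oy _; exact: connected_component_sym.
have [|x Ox|x Ox|x Ox bx ax|x []//|x [wx _]|u [k [cu ud uint ub [uA uB]]]] :=
  @separator R O (beyond w) (aside w) ((act w @` KL) `&` O) c d d0 d2 oO
    (@component_connected _ _ _) _ _ _ _ cKw.
- by move=> x /sO; exact: beyond_or_aside.
- by apply: tiles_closed; exact: sO.
- by apply: tiles_closed; exact: sO.
- by split=> //; exact: beyond_aside.
- exact: near_c.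
have ax0 : aside w x0 by have [] := beyond_or_aside w Ox0.
(* At the base point, [u] vanishes and lies in the range [[k, k + 1/2]] of the other tiles. *)
have k0' : k = 0.
  have := ub x0 Ox0'; have := uB x0 Ox0' ax0; rewrite ud // => h1 /andP[h2 h3].
  apply/eqP; rewrite eq_le -(@ler_int R) h2 /= -ltzD1 -(@ltr_int R) intrD.
  by apply: le_lt_trans h1 _; rewrite ltrD2l; lra.
move: uA uB; rewrite k0' !add0r => uA uB.
by exists c, u; split=> // x xe; apply: ud; apply: le_trans xe.
Qed.

Lemma reduced_size_finite n : finite_set [set w : word | reduced w /\ (size w <= n)%N].
Proof. by apply: sub_finite_set (@finite_words g n) => w []. Qed.

(** Near a limit point there are no tiles of short words, so all tiles are beyond one of the
    finitely many words of length [n]. *)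
Lemma limit_beyond (O : set P) y n : O `<=` Om -> Lam y -> closure O y ->
  exists w, [/\ reduced w, size w = n & closure (beyond w `&` O) y].
Proof.
move=> OO Ly Oy; apply: contrapT => no.
have near1 : \forall z \near y, forall w, [set w | reduced w /\ (size w <= n)%N] w ->
    ~ (act w @` K) z.
  apply: near_all_finite (reduced_size_finite n) _ => w _.
  by apply: near_not_tile => -[k /KO Ok ky]; apply: (@Om_act _ _ rho w k Ok); rewrite -/(act w k) ky.
have near2 : \forall z \near y, forall w, [set w | reduced w /\ (size w <= n)%N] w ->
    size w = n -> ~ (beyond w `&` O) z.
  apply: near_all_finite (reduced_size_finite n) _ => w [rw _].
  have [swn|swn] := eqVneq (size w) n; last by apply: filterE => z /eqP; rewrite (negbTE swn).
  have ncl : ~ closure (beyond w `&` O) y by move=> cl; apply: no; exists w.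
  have : nbhs y (~` closure (beyond w `&` O)).
    by apply: open_near => //; apply: closed_openC; exact: closed_closure.
  by apply: filterS => z h _ hz; apply: h; exact: subset_closure.
have [z [Oz [h1 h2]]] := Oy _ (filterI near1 near2).
have [c [k [rc Kk zE]]] := Kcov (OO _ Oz).
have [cn'|nc] := leqP (size c) n; first by apply: (h1 c); [split|exists k].
have rt : reduced (take n c).
  by move: rc; rewrite -{1}(cat_take_drop n c) reduced_cat => /and3P[].
have st : size (take n c) = n by rewrite size_take nc.
apply: (h2 (take n c)); rewrite ?st //; first by split; rewrite ?st.
split=> //; exists c, k; split=> //=.
by apply/prefixP; exists (drop n c); rewrite cat_take_drop.
Qed.

Lemma Om_closure x0 y : Om x0 -> Lam y -> closure Om y.
Proof.
move=> Ox0 Ly U /nbhs_P [e e0 eU].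
have iS := orbit_limit Ox0 Ly e0.
have [w [rw wy]] : [set w : word | reduced w /\ chordal (act w x0) y < e] !=set0.
  by apply/set0P/eqP => S0; apply: iS; rewrite S0.
by exists (act w x0); split; [exact: Om_act|exact: eU].
Qed.

(** Another component [O'] would lie in a component [W] of the complement of [O]; the
    separating functions are constant on [W], and nonzero for a sequence of words
    which approach a boundary point of [O] in [W], so [W] is a point. *)
Lemma Om_connected x0 : Om x0 -> connected Om.
Proof.
move=> Ox0; set O := connected_component Om x0.
suff -> : Om = O by exact: component_connected.
apply/seteqP; split; last exact: connected_component_sub.
move=> y1 Oy1; apply: contrapT => nOy1.
have oO : open O by apply: component_open; exact: Om_open.
pose W := connected_component (~` O) y1.
have clW : closed W by apply: component_closed; exact: open_closedC.
have WO : W `<=` ~` O by exact: connected_component_sub.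
have Wy1 : W y1 by exact: connected_component_refl.
have [y [Wy Oy]] : exists y, W y /\ closure O y.
  apply: contrapT => no.
  have oW : open W.
    rewrite openE => y Wy; rewrite /interior.
    have : nbhs y (~` closure O).
      apply: open_near; first by apply: closed_openC; exact: closed_closure.
      by move=> Oy; apply: no; exists y.
    move=> /connected_near [V [yV Vy VO cV]]; apply: filterS yV.
    rewrite /W (same_connected_component Wy); apply: connected_component_max => //.
    by move=> z /VO h Oz; apply: h; exact: subset_closure.
  have WT : W = setT.
    apply: (@P1_connected R); first by exists y1.
      by exists W => //; rewrite setTI.
    by exists W => //; rewrite setTI.
  have : W x0 by rewrite WT.
  by move=> /WO; apply; exact: connected_component_refl.
have nOy : ~ O y by exact: WO.
have Ly : Lam y.
  apply: contrapT => Oy'; have /Oy [z [Oz yz]] : nbhs y (connected_component Om y).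
    apply: open_near; first by apply: component_open; exact: Om_open.
    exact: connected_component_refl.
  apply: nOy; apply: connected_component_trans Oz _; exact: connected_component_sym.
have yy1 : 0 < chordal y1 y / 2.
  by rewrite divr_gt0 // chordal_gt0; apply/eqP => y1y; apply: Oy1; rewrite y1y.
have [N NP] := long_word_separator Ox0 yy1.
have [w [rw sw wy]] := limit_beyond N (@connected_component_sub _ _ _) Ly Oy.
have [c [u [cu ue uint uA _]]] : exists c u, [/\ continuous u,
    forall x, chordal y1 y / 2 <= chordal x c -> u x = 0,
    forall x, ~ O x -> exists n : int, u x = n%:~R :> R,
    forall x, O x -> beyond w x -> 2^-1 <= u x &
    forall x, O x -> aside w x -> u x <= 2^-1] by apply: NP => //; rewrite sw.
have uy : 2^-1 <= u y.
  have /continuous_closedP /(_ _ (@closed_ge _ (2^-1 : R))) cl := cu.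
  by apply: cl; apply: closureS wy => x [wx Ox]; exact: uA.
have near_c x : W x -> chordal x c < chordal y1 y / 2.
  move=> Wx; rewrite ltNge; apply/negP => /ue ux.
  have := @int_valued_const R _ W u (@component_connected _ _ _)
    (@continuous_subspaceT _ _ _ _ cu) (fun x Wx => uint x (WO x Wx)) x y Wx Wy.
  by move=> h; move: uy; rewrite -h ux; lra.
have := near_c y Wy; have := near_c y1 Wy1; have := chordal_tri y1 c y.
rewrite (chordal_sym c y); lra.
Qed.

Variables (x0 : P) (Ox0 : Om x0).

(** The separating functions vanish away from a small ball, and are at least [1/2] beyond [w],
    at most [1/2] on the other tiles, and integers on the limit set. *)
Lemma beyond_small (e : R) : 0 < e -> exists N, forall w, reduced w ->
  (N <= size w)%N -> (exists c, forall x, closure (beyond w) x -> chordal x c <= e) /\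
  (forall y, Lam y -> closure (beyond w) y -> closure (aside w) y -> False).
Proof.
move=> e0; have [N NP] := long_word_separator Ox0 e0; exists N => w rw sw.
have [c [u [cu ue uint uA uB]]] := NP w rw sw.
have OE : connected_component Om x0 = Om.
  by apply: connected_component_id => //; exact: Om_connected Ox0.
rewrite OE in uint uA uB.
split.
  exists c => x.
  have /continuous_closedP /(_ _ (@closed_le _ e)) cl := @continuous_chordal R c.
  move=> xcl; apply: cl; apply: closureS xcl => z wz /=.
  rewrite leNgt; apply/negP => h.
  have := uA z (tiles_Om wz) wz; rewrite (ue _ (ltW h)) => h2.
  have : 0 < 2^-1 :> R by rewrite invr_gt0.
  by rewrite ltNge h2.
move=> y Ly yA yB.
have h1 : 2^-1 <= u y.
  have /continuous_closedP /(_ _ (@closed_ge _ (2^-1 : R))) cl := cu.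
  by apply: cl; apply: closureS yA => x wx; apply: uA => //; exact: tiles_Om wx.
have h2 : u y <= 2^-1.
  have /continuous_closedP /(_ _ (@closed_le _ (2^-1 : R))) cl := cu.
  by apply: cl; apply: closureS yB => x wx; apply: uB => //; exact: tiles_Om wx.
have [|n nE] := uint y; first by [].
(* The separating function is an integer off the domain, but would be [1/2] at [y]. *)
have hn : n%:~R = 2^-1 :> R by apply/eqP; rewrite eq_le -nE h1 h2.
have h3 : (n * 2)%:~R = 1%:~R :> R by rewrite intrM hn mulVf // pnatr_eq0.
by move/intr_inj: h3; lia.
Qed.

Lemma beyond_cat u w : reduced (u ++ w) -> w != [::] ->
  act u @` beyond w `<=` beyond (u ++ w).
Proof.
move=> ruw w0 _ [x [c [k [rc /= /prefixP [t cE] Kk ->]]] <-].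
exists (u ++ c), k; split=> //=; last by rewrite act_cat.
  move: ruw rc; rewrite cE !reduced_cat => /and3P[-> rw uw] /and3P[_ rt wt].
  by rewrite rw rt wt /=; case: (w) w0 uw.
by apply/prefixP; exists t; rewrite cE catA.
Qed.

Lemma aside_cat u w : reduced (u ++ w) -> act u @` aside w `<=` aside (u ++ w).
Proof.
move=> ruw _ [x [c [k [rc /= nwc Kk ->]]] <-].
exists (red (u ++ c)), k; split=> //=; first exact: reduced_red.
  apply: contra nwc => /prefixP [t tE]; apply/prefixP; exists t.
  apply: (@wmx_inj _ _ rho) => //.
    by have := reduced_red (u ++ c); rewrite tE -catA reduced_cat => /and3P[].
  have := wmx_red rho (u ++ c); rewrite tE -catA (wmx_cat _ u c) (wmx_cat _ u (w ++ t)).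
  move/(congr1 (fun M => wmx (winv u) * M)).
  by rewrite !mulrA wmx_winv !mul1r.
by rewrite act_red act_cat.
Qed.

Lemma closure_act u (S T : set P) y : act u @` S `<=` T -> closure S y ->
  closure T (act u y).
Proof.
move=> ST Sy U yU; have /Sy [z [Sz Uz]] := @act_continuous _ _ rho u y U yU.
by exists (act u z); split=> //; apply: ST; exists z.
Qed.

(** The statement is invariant under the group, which allows to lengthen the word. *)
Lemma beyond_aside_disjoint w y : reduced w -> Lam y -> closure (beyond w) y ->
  closure (aside w) y -> False.
Proof.
move=> rw Ly yA yB; case: w rw yA yB => [|a w] rw yA yB.
  by have [z [[c [k [_ /=]]]]] := yB _ (@filterT _ _ _); rewrite prefix0s.
(* A long power of [a] in front of [w] makes [beyond_small] applicable. *)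
have [N NP] := beyond_small ltr01.
have rN : reduced (nseq N a ++ a :: w).
  elim: N {NP} => //= n IH; rewrite reduced_cons IH.
  by case: n {IH} => [|n] /=; rewrite eq_sym linv_neq.
have [|_ /(_ (act (nseq N a) y)) h] := NP _ rN; first by rewrite size_cat size_nseq leq_addr.
apply: h; first exact: limit_act.
- by apply: closure_act yA; exact: beyond_cat.
- by apply: closure_act yB; exact: aside_cat.
Qed.

Lemma prefix_red (p q d : word) : reduced (p ++ q) -> reduced d -> (size d <= size q)%N ->
  prefix p (red (p ++ q ++ d)).
Proof.
move=> rpq rd sd; apply: contraT => np.
have := prefix_quot rho rpq (reduced_red _) (prefix_prefix p q) np.
rewrite size_cat addKn.
rewrite (_ : red (winv (p ++ q) ++ red (p ++ q ++ d)) = d); last first.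
  apply: (@red_unique _ _ rho) => //.
  by rewrite wmx_cat wmx_red catA (wmx_cat _ (p ++ q)) mulrA wmx_winv mul1r.
by rewrite ltnNge sd.
Qed.

(** The orbit point lies in a tile whose word is [mkseq v n] up to a bounded right factor,
    whose cancellation cannot reach the first [m] letters. *)
Lemma orbit_beyond x : Om x -> exists M, forall v m n, reduced_inf v ->
  (m + M <= n)%N -> beyond (mkseq v m) (act (mkseq v n) x).
Proof.
move=> /Kcov [d [k [rd Kk xE]]]; exists (size d) => v m n rv mn.
exists (red (mkseq v n ++ d)), k; split=> //; first exact: reduced_red.
  rewrite /= -(subnKC (leq_trans (leq_addr _ _) mn)) mkseqD -catA.
  apply: prefix_red => //; last by rewrite size_mkseq leq_subRL // (leq_trans _ mn) // leq_addr.
  by rewrite -mkseqD reduced_mkseq.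
by rewrite act_red act_cat -xE.
Qed.

(** The tail of the sequence lies beyond [mkseq v N], which is a small set. *)
Lemma end_point_cvg v : reduced_inf v ->
  act (mkseq v n) x0 @[n --> \oo] --> end_point rho x0 v.
Proof.
move=> rv; have [M MP] := orbit_beyond Ox0.
have PF : ProperFilter (act (mkseq v n) x0 @[n --> \oo]) by exact: fmap_proper_filter.
have [|y [_ ycl]] := @P1_compact R _ PF; first exact: filterT.
suff cv : act (mkseq v n) x0 @[n --> \oo] --> y.
  by rewrite (_ : end_point rho x0 v = y) //; exact: (cvg_lim (@P1_hausdorff R) cv).
apply/cvg_chordal => e e0; have e4 : 0 < e / 4 by rewrite divr_gt0.
have [N NP] := beyond_small e4.
have [|[c cP] _] := NP (mkseq v N) (reduced_mkseq N rv); first by rewrite size_mkseq.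
have inN n : (N + M <= n)%N -> chordal (act (mkseq v n) x0) c <= e / 4.
  by move=> nN; apply: cP; apply: subset_closure; exact: MP.
have nearN : (act (mkseq v n) x0 @[n --> \oo]) [set z | chordal z c <= e / 4].
  by exists (N + M)%N => // n /inN.
have [z [/= zc zy]] := ycl _ _ nearN (nbhs_chordal_ball y e4).
exists (N + M)%N => // n /= /inN nc.
have := chordal_tri (act (mkseq v n) x0) c y; have := chordal_tri c z y.
rewrite (chordal_sym c z); move: zc zy nc e0; lra.
Qed.

Lemma end_point_limit v : reduced_inf v -> Lam (end_point rho x0 v).
Proof.
move=> rv; exists x0, (mkseq v); split.
- by move=> i j /(congr1 size); rewrite !size_mkseq.
- by move=> n; exact: reduced_mkseq.
- exact: end_point_cvg.
Qed.

Lemma end_point_beyond v m : reduced_inf v ->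
  closure (beyond (mkseq v m)) (end_point rho x0 v).
Proof.
move=> rv; have [M MP] := orbit_beyond Ox0.
move=> U /(end_point_cvg rv) [N _ NP].
exists (act (mkseq v (maxn N (m + M))) x0); split; last by apply: NP; exact: leq_maxl.
by apply: MP => //; exact: leq_maxr.
Qed.

Lemma beyond_other w w' : size w = size w' -> w != w' -> beyond w' `<=` aside w.
Proof.
move=> sw ww' x [c [k [rc /= /prefixP [t cE] Kk xE]]]; exists c, k; split=> //=.
apply: contra ww' => /prefixP [t' cE'].
by move/eqP: cE' ; rewrite cE eqseq_cat // => /andP[/eqP ->].
Qed.

Lemma limit_word_unique y w w' : Lam y -> reduced w -> size w = size w' ->
  closure (beyond w) y -> closure (beyond w') y -> w = w'.
Proof.
move=> Ly rw sw yw yw'; apply/eqP; apply: contraT => ww'.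
case: (@beyond_aside_disjoint w y rw Ly yw).
by apply: closureS yw'; exact: beyond_other.
Qed.

(** Distinct ends are beyond distinct words of the same length, whose closures meet at no
    limit point. *)
Lemma end_point_inj v v' : reduced_inf v -> reduced_inf v' ->
  end_point rho x0 v = end_point rho x0 v' -> v = v'.
Proof.
move=> rv rv' vv'; apply/funext => n.
have : mkseq v n.+1 = mkseq v' n.+1.
  apply: (@limit_word_unique (end_point rho x0 v)); first exact: end_point_limit.
  - exact: reduced_mkseq.
  - by rewrite !size_mkseq.
  - exact: end_point_beyond.
  - by rewrite vv'; exact: end_point_beyond.
by move=> /(congr1 (nth (v n) ^~ n)); rewrite !nth_mkseq.
Qed.

(** A limit point is in the closure of the tiles beyond exactly one word of each length;
    these words are the prefixes of the end. *)
Lemma limit_end_point y : Lam y -> exists2 v, reduced_inf v & y = end_point rho x0 v.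
Proof.
move=> Ly; have Oy := Om_closure Ox0 Ly.
have /choice [w wP] : forall n, exists w, [/\ reduced w, size w = n & closure (beyond w) y].
  move=> n; have [w [rw sw wy]] := limit_beyond n (fun _ h => h) Ly Oy.
  by exists w; split=> //; apply: closureS wy => x [].
have wS n : exists a, w n.+1 = rcons (w n) a.
  have [rw sw yw] := wP n.+1; case/lastP E : (w n.+1) => [|u a]; first by rewrite E in sw.
  exists a; congr rcons; have [rwn swn ywn] := wP n.
  apply: (limit_word_unique Ly).
  - by move: rw; rewrite E -cats1 reduced_cat => /and3P[].
  - by move: sw; rewrite E size_rcons swn => -[].
  - apply: closureS yw => x [c [k [rc /= /prefixP [t cE] Kk xE]]]; exists c, k; split=> //=.
    by apply/prefixP; exists (a :: t); rewrite cE E cat_rcons.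
  - exact: ywn.
have /choice [v vP] := wS.
have wE n : w n = mkseq v n.
  elim: n => [|n IH]; first by have [_ /size0nil ->] := wP 0%N.
  by rewrite vP IH mkseqS.
have rv : reduced_inf v.
  move=> n; have [] := wP n.+2; rewrite wE !mkseqS -!cats1 -catA reduced_cat.
  by move=> /and3P[_ + _] _ _; rewrite reduced_cons /= => /andP[].
exists v => //; apply/eqP; rewrite -chordal_eq0 eq_le chordal_ge0 andbT leNgt.
apply/negP => d0; have d30 : 0 < chordal y (end_point rho x0 v) / 3 by rewrite divr_gt0.
have [N NP] := beyond_small d30.
have [|[c cP] _] := NP (mkseq v N) (reduced_mkseq N rv); first by rewrite size_mkseq.
have h1 := cP _ (end_point_beyond N rv).
have h2 : chordal y c <= chordal y (end_point rho x0 v) / 3.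
  by apply: cP; have [_ _] := wP N; rewrite wE.
have := chordal_tri y c (end_point rho x0 v); rewrite (chordal_sym c); lra.
Qed.

(** This description shows that shadows are closed and open in the limit set. *)
Lemma shadowE w y : reduced w ->
  shadow rho x0 w y <-> Lam y /\ closure (beyond w) y.
Proof.
move=> rw; split=> [[v [rv vw] <-]|[Ly yw]].
  split; first exact: end_point_limit.
  by rewrite vw; exact: end_point_beyond.
have [v rv yE] := limit_end_point Ly; exists v => //; split=> //.
apply: (limit_word_unique Ly rw) => //; first by rewrite size_mkseq.
by rewrite yE; exact: end_point_beyond.
Qed.

Lemma shadow_closed w : reduced w -> closed (shadow rho x0 w).
Proof.
move=> rw; rewrite (_ : shadow rho x0 w = Lam `&` closure (beyond w)).
  by apply: closedI; [exact: limit_closed|exact: closed_closure].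
by apply/seteqP; split=> y /(shadowE _ rw).
Qed.

Lemma shadow_compl_closed w : reduced w -> closed (Lam `\` shadow rho x0 w).
Proof.
move=> rw; rewrite (_ : _ `\` _ = Lam `&` closure (aside w)).
  by apply: closedI; [exact: limit_closed|exact: closed_closure].
apply/seteqP; split=> y [Ly h]; split=> //.
  have [v rv yE] := limit_end_point Ly.
  have := end_point_beyond (size w) rv; rewrite -yE.
  apply: closureS; apply: beyond_other; first by rewrite size_mkseq.
  by apply: contra_notN h => /eqP wE; exists v.
by move=> /(shadowE _ rw) [_ yw]; exact: (beyond_aside_disjoint rw Ly yw h).
Qed.

Lemma shadow_small (e : R) : 0 < e -> exists N, forall w, reduced w -> (N <= size w)%N ->
  forall x y, shadow rho x0 w x -> shadow rho x0 w y -> chordal x y < e.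
Proof.
move=> e0; have e3 : 0 < e / 3 by rewrite divr_gt0.
have [N NP] := beyond_small e3; exists N => w rw sw x y /(shadowE _ rw) [_ wx].
move=> /(shadowE _ rw) [_ wy]; have [[c cP] _] := NP w rw sw.
have := cP _ wx; have := cP _ wy; have := chordal_tri x c y.
rewrite (chordal_sym c y); lra.
Qed.

End ends_of_the_group.

(** * Complex differentiability *)

Section complex_derivatives.
Context {R : realType}.
Local Notation C := R[i].
Local Notation cn := (@ComplexField.Normc.normc R).
Implicit Types (f h k : C -> C) (z w a b c : C).

(** Complex differentiability in metric form. *)
Definition cdiff f w a := forall e : R, 0 < e -> exists2 d : R, 0 < d &
  forall z, cn (z - w) < d -> cn (f z - f w - a * (z - w)) <= e * cn (z - w).

Lemma derivable_cdiff f w : derivable f w 1 <-> exists a, cdiff f w a.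
Proof.
split.
- move=> df; set q := (fun h : C => h^-1 *: ((f \o shift w) (h *: 1) - f w)) in df.
  exists (lim (q @ 0^')) => e e0.
  have : q @ 0^' --> lim (q @ 0^') by [].
  move/cvg_cn => /(_ e e0) /nbhs_cn [d d0 dP]; exists d => // z zd.
  have [->|zw] := eqVneq z w; first by rewrite !subrr mulr0 subr0 cn0 mulr0.
  have h0 : z - w != 0 by rewrite subr_eq0.
  have := dP (z - w); rewrite subr0 => /(_ zd h0).
  rewrite /q /= /shift /= [(z - w) *: 1]mulr1 subrK => /ltW.
  rewrite -(ler_pM2r (x := cn (z - w))) ?cn_gt0 // -cnM; apply: le_trans.
  rewrite mulrBl [_^-1 *: _]mulrC divfK //.
- move=> [a fa]; apply/cvg_ex; exists a; apply/cvg_cn => e e0.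
  have e20 : 0 < e / 2 by rewrite divr_gt0.
  have [d d0 dP] := fa _ e20.
  apply/nbhs_cn; exists d => // h; rewrite subr0 => hd h0.
  have := dP (h + w); rewrite addrK => /(_ hd).
  rewrite /= /shift /= [h *: 1]mulr1 => le2.
  have hp : 0 < cn h by rewrite cn_gt0.
  rewrite -(ltr_pM2r hp) -cnM mulrBl [_^-1 *: _]mulrC divfK //.
  by apply: le_lt_trans le2 _; rewrite ltr_pM2r //; lra.
Qed.

Lemma cdiff_bound f w a : cdiff f w a -> exists2 d : R, 0 < d &
  forall z, cn (z - w) < d -> cn (f z - f w) <= (cn a + 1) * cn (z - w).
Proof.
move=> /(_ 1 ltr01) [d d0 dP]; exists d => // z /dP; rewrite mul1r => zd.
have := cnD (f z - f w - a * (z - w)) (a * (z - w)); rewrite subrK cnM; lra.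
Qed.

Lemma cdiff_cont f w a : cdiff f w a -> {for w, continuous f}.
Proof.
move=> fa; have FF : Filter (nbhs (w : C)) by exact: nbhs_filter.
have [d d0 dP] := cdiff_bound fa.
apply/cvg_cn => e e0.
have a1 : 0 < cn a + 1 by have := cn_ge0 a; lra.
apply/nbhs_cn; exists (Num.min d (e / (cn a + 1))) => [|z]; first by rewrite lt_min d0 divr_gt0.
rewrite lt_min ltr_pdivlMr // mulrC => /andP[/dP zd ze].
exact: le_lt_trans zd ze.
Qed.

Lemma cdiff_near f h w a : (\forall z \near w, f z = h z) -> cdiff h w a -> cdiff f w a.
Proof.
move=> fh ha e e0; have fhw : f w = h w := nbhs_singleton fh.
move/nbhs_cn : fh => [d d0 dP]; have [k k0 kP] := ha e e0.
exists (Num.min d k) => [|z]; first by rewrite lt_min d0.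
by rewrite lt_min => /andP[/dP -> /kP]; rewrite fhw.
Qed.

Lemma cdiff_id w : cdiff (fun z => z) w 1.
Proof. by move=> e e0; exists 1 => // z _; rewrite mul1r subrr cn0 mulr_ge0 ?cn_ge0 ?ltW. Qed.

Lemma cdiff_affine c b w : cdiff (fun z => c * z + b) w c.
Proof.
move=> e e0; exists 1 => // z _; rewrite (_ : _ - _ - _ = 0); last by ring.
by rewrite cn0 mulr_ge0 ?cn_ge0 ?ltW.
Qed.

Lemma cdiffD f h w a b : cdiff f w a -> cdiff h w b ->
  cdiff (fun z => f z + h z) w (a + b).
Proof.
move=> fa hb e e0; have e2 : 0 < e / 2 by rewrite divr_gt0.
have [d d0 dP] := fa _ e2; have [k k0 kP] := hb _ e2.
exists (Num.min d k) => [|z]; first by rewrite lt_min d0.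
rewrite lt_min => /andP[/dP zd /kP zk].
rewrite (_ : _ - _ - _ = (f z - f w - a * (z - w)) + (h z - h w - b * (z - w))); last by ring.
by apply: le_trans (cnD _ _) _; lra.
Qed.

Lemma cdiff_comp f h w a b : cdiff f w a -> cdiff h (f w) b ->
  cdiff (fun z => h (f z)) w (b * a).
Proof.
move=> fa hb e e0.
have a1 : 0 < cn a + 1 by have := cn_ge0 a; lra.
have b1 : 0 < cn b + 1 by have := cn_ge0 b; lra.
have e1 : 0 < e / 2 / (cn a + 1) by rewrite !divr_gt0.
have e2 : 0 < e / 2 / (cn b + 1) by rewrite !divr_gt0.
have [d d0 dP] := hb _ e1; have [d1 d10 dP1] := fa _ e2; have [d2 d20 dP2] := cdiff_bound fa.
exists (Num.min (Num.min d1 d2) (d / (cn a + 1))) => [|z].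
  by rewrite !lt_min d10 d20 divr_gt0.
rewrite !lt_min ltr_pdivlMr // => /andP[/andP[/dP1 z1 /dP2 z2] z3].
have zf : cn (f z - f w) < d by apply: le_lt_trans z2 _; rewrite mulrC.
have := dP _ zf.
rewrite (_ : _ - _ - b * a * (z - w) =
  (h (f z) - h (f w) - b * (f z - f w)) + b * (f z - f w - a * (z - w))); last by ring.
move=> z4; apply: le_trans (cnD _ _) _; rewrite cnM.
have h1 : e / 2 / (cn a + 1) * cn (f z - f w) <= e / 2 * cn (z - w).
  by rewrite -mulrA ler_pM2l ?divr_gt0 // ler_pdivrMl.
have h2 : cn b * cn (f z - f w - a * (z - w)) <= e / 2 * cn (z - w).
  apply: (@le_trans _ _ ((cn b + 1) * (e / 2 / (cn b + 1) * cn (z - w)))).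
    by apply: ler_pM; rewrite ?cn_ge0 //; lra.
  by rewrite mulrA [(cn b + 1) * _]mulrC divfK // lt0r_neq0.
lra.
Qed.

Lemma cdiff_conj f w a : cdiff f w a ->
  cdiff (fun z => (f z^*%C)^*%C) w^*%C a^*%C.
Proof.
move=> fa e /fa [d d0 dP]; exists d => // z zd.
have E : cn (z^*%C - w) = cn (z - w^*%C) by rewrite -cn_conj rmorphB /= conjcK.
by have := dP z^*%C; rewrite E => /(_ zd); rewrite -cn_conj !rmorphB rmorphM !rmorphB /= !conjcK.
Qed.

Lemma cdiff_inv w : w != 0 -> cdiff (fun z => z^-1) w (- w ^- 2).
Proof.
move=> w0 e e0; have cw : 0 < cn w by rewrite cn_gt0.
exists (Num.min (cn w / 2) (e * cn w ^+ 3 / 2)) => [|z].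
  by rewrite lt_min !divr_gt0 // mulr_gt0 // exprn_gt0.
rewrite lt_min => /andP[z1 z2].
have cz : cn w / 2 < cn z by have := cnD (w - z) z; rewrite subrK cnB; lra.
have cz0 : 0 < cn z by apply: lt_trans cz; rewrite divr_gt0.
have z0 : z != 0 by rewrite -cn_gt0.
rewrite (_ : _ - _ - _ = (z - w) ^+ 2 / (z * w ^+ 2)); last by field; rewrite z0 w0.
rewrite cnM cnX cnV cnM cnX ler_pdivrMr ?mulr_gt0 ?exprn_gt0 //.
rewrite [_ ^+ 2]expr2 [leRHS]mulrAC ler_wpM2r ?cn_ge0 //.
apply: le_trans (ltW z2) _; rewrite -mulrA ler_pM2l // (exprS _ 2) mulrAC.
by rewrite ler_pM2r ?exprn_gt0 // ltW.
Qed.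

(** Solutions [k] of [h (k w) = f w] : the difference quotient of [k] is controlled
    by that of [f], which yields inverse functions and logarithms. *)
Lemma cdiff_solve f h k w a b : b != 0 -> {for w, continuous k} ->
  cdiff h (k w) b -> cdiff f w a -> (\forall z \near w, h (k z) = f z) ->
  cdiff k w (a / b).
Proof.
move=> b0 ck hb fa hkf e e0.
have cb : 0 < cn b by rewrite cn_gt0.
pose m : R := 2 * (cn a + 1) / cn b.
have m0 : 0 < m by rewrite divr_gt0 // mulr_gt0 //; have := cn_ge0 a; lra.
pose e1 := Num.min 1 (e * cn b / 2); pose e2 := Num.min (cn b / 2) (e * cn b / 2 / m).
have e10 : 0 < e1 by rewrite lt_min ltr01 divr_gt0 // mulr_gt0.
have eb : 0 < e * cn b by rewrite mulr_gt0.
have e20 : 0 < e2 by rewrite lt_min divr_gt0 //=; do 2! apply: divr_gt0 => //.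
have [d1 d10 dP1] := fa _ e10; have [d2 d20 dP2] := hb _ e20.
have FF : Filter (nbhs (w : C)) by exact: nbhs_filter.
move/cvg_cn : ck => /(_ _ d20) /nbhs_cn [d3 d30 dP3].
have hkw : h (k w) = f w := nbhs_singleton hkf.
move/nbhs_cn : hkf => [d4 d40 dP4].
exists (Num.min (Num.min d1 d3) d4) => [|z]; first by rewrite !lt_min d10 d30.
rewrite !lt_min => /andP[/andP[/dP1 z1 /dP3 /dP2 z2] /dP4 z4].
rewrite z4 hkw in z2.
set u := k z - k w in z2 *; set v := z - w in z1 *.
have bu : cn (b * u - a * v) <= e1 * cn v + e2 * cn u.
  rewrite (_ : b * u - a * v = (f z - f w - a * v) - (f z - f w - b * u)); last by ring.
  by apply: le_trans (cnD _ _) _; rewrite cnN lerD.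
have cv := cn_ge0 v; have cu := cn_ge0 u.
have e1le1 : e1 <= 1 by rewrite ge_min lexx.
have e2le : e2 <= cn b / 2 by rewrite ge_min lexx.
have um : cn u <= m * cn v.
  have h1 : cn b * cn u <= (cn a + 1) * cn v + cn b / 2 * cn u.
    rewrite -cnM -[b * u](subrK (a * v)); apply: le_trans (cnD _ _) _; rewrite cnM.
    have : e1 * cn v <= 1 * cn v by rewrite ler_wpM2r.
    have : e2 * cn u <= cn b / 2 * cn u by rewrite ler_wpM2r.
    by move: bu; lra.
  by rewrite /m mulrAC ler_pdivlMr //; lra.
rewrite (_ : u - a / b * v = (b * u - a * v) / b); last by field.
rewrite cnM cnV ler_pdivrMr //; apply: le_trans bu _.
have : e1 * cn v <= e * cn b / 2 * cn v by rewrite ler_wpM2r // ge_min lexx orbT.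
have : e2 * cn u <= e * cn b / 2 / m * (m * cn v).
  by rewrite ler_pM // ?ge_min ?lexx ?orbT // ltW.
rewrite [_ / m * _]mulrA divfK ?lt0r_neq0 //; lra.
Qed.

Definition cexp z : C := (expR (complex.Re z))%:C%C * cis (complex.Im z).

Lemma cexpD z w : cexp (z + w) = cexp z * cexp w.
Proof. by rewrite /cexp ReD ImD expRD cisD rmorphM /= mulrACA. Qed.

Lemma cn_cexp z : cn (cexp z) = expR (complex.Re z).
Proof. by rewrite cnM cn_cis mulr1 cn_real gtr0_norm ?expR_gt0. Qed.

Lemma cexp_neq0 z : cexp z != 0.
Proof. by rewrite -cn_gt0 cn_cexp expR_gt0. Qed.

Lemma cexp0 : cexp 0 = 1.
Proof. by rewrite /cexp /= expR0 cis0 mul1r. Qed.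

Lemma is_derive_eps (f : R -> R) (x df : R) : is_derive x 1 f df ->
  forall e : R, 0 < e -> exists2 d : R, 0 < d &
  forall t, `|t| < d -> `|f (t + x) - f x - df * t| <= e * `|t|.
Proof.
move=> [dx dE] e e0.
have : (fun s : R => s^-1 *: (f (s *: 1 + x) - f x)) @ 0^' --> df.
  by rewrite -dE.
move/cvgrPdist_lt => /(_ e e0) /nbhs_ballP [d d0 dP]; exists d => // t td.
have [->|t0] := eqVneq t 0; first by rewrite add0r subrr mulr0 subr0 normr0 mulr0.
have := dP t; rewrite /ball /= sub0r normrN => /(_ td t0) /ltW.
rewrite -(ler_pM2r (x := `|t|)) ?normr_gt0 // -normrM mulrBl.
rewrite [_^-1 *: _]mulrC divfK // [t *: 1]mulr1; apply: le_trans.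
by rewrite distrC.
Qed.

(** By the functional equation it suffices to treat the point [0], where the estimate
    follows from those for the real exponential, cosine and sine. *)
Lemma cdiff_cexp w : cdiff cexp w (cexp w).
Proof.
have H0 : forall e : R, 0 < e -> exists2 d : R, 0 < d &
  forall z, cn z < d -> cn (cexp z - 1 - z) <= e * cn z.
  move=> e e0; have e8 : 0 < e / 8 by rewrite divr_gt0.
  have [dx dx0 dxP] := is_derive_eps (is_derive_expR (0 : R)) e8.
  have [dc dc0 dcP] := is_derive_eps (is_derive_cos (0 : R)) e8.
  have [ds ds0 dsP] := is_derive_eps (is_derive_sin (0 : R)) e8.
  have [d1 d10 d1P] := is_derive_eps (is_derive_expR (0 : R)) ltr01.
  exists (Num.min (Num.min dx dc) (Num.min (Num.min ds d1) (Num.min (e / 8) 2^-1))) => [|z].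
    by rewrite !lt_min dx0 dc0 ds0 d10 e8 invr_gt0 ltr0n.
  rewrite !lt_min => /andP[/andP[z1 z2] /andP[/andP[z3 z4] /andP[z5 z6]]].
  have rz := Re_le_cn z; have iz := Im_le_cn z.
  move: (dxP _ (le_lt_trans rz z1)) (dcP _ (le_lt_trans iz z2)) (dsP _ (le_lt_trans iz z3)).
  move: (d1P _ (le_lt_trans rz z4)).
  rewrite !addr0 expR0 cos0 sin0 subr0 oppr0 mul0r !subr0 !mul1r.
  set x := complex.Re z in rz *; set y := complex.Im z in iz *.
  move=> ex1 ex ec es.
  have c0 := cn_ge0 z.
  have exle : `|expR x| <= 2.
    rewrite (_ : expR x = (expR x - 1 - x) + 1 + x); last by ring.
    have := ler_normD (expR x - 1 - x + 1) x; have := ler_normD (expR x - 1 - x) 1.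
    by rewrite normr1; lra.
  have re : complex.Re (cexp z - 1 - z) = (expR x - 1 - x) + expR x * (cos y - 1).
    by rewrite !ReB /= !mul0r -/x -/y; ring.
  have im : complex.Im (cexp z - 1 - z) = expR x * (sin y - y) + (expR x - 1 - x) * y + x * y.
    by rewrite !ImB /= !mul0r -/x -/y; ring.
  have ez : 0 <= e / 8 * cn z by rewrite mulr_ge0 // ltW.
  have ex' : `|expR x - 1 - x| <= e / 8 * cn z by apply: le_trans ex _; rewrite ler_pM2l.
  have ec' : `|cos y - 1| <= e / 8 * cn z by apply: le_trans ec _; rewrite ler_pM2l.
  have es' : `|sin y - y| <= e / 8 * cn z by apply: le_trans es _; rewrite ler_pM2l.
  apply: le_trans (cn_le_ReIm _) _; rewrite re im.
  have t1 : `|expR x * (cos y - 1)| <= 2 * (e / 8 * cn z) by rewrite normrM ler_pM.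
  have t2 : `|expR x * (sin y - y)| <= 2 * (e / 8 * cn z) by rewrite normrM ler_pM.
  have t3 : `|(expR x - 1 - x) * y| <= (e / 8 * cn z) * 1 by rewrite normrM ler_pM //; lra.
  have t4 : `|x * y| <= (e / 8) * cn z by rewrite normrM ler_pM //; lra.
  have n1 := ler_normD (expR x - 1 - x) (expR x * (cos y - 1)).
  have n2 := ler_normD (expR x * (sin y - y) + (expR x - 1 - x) * y) (x * y).
  have n3 := ler_normD (expR x * (sin y - y)) ((expR x - 1 - x) * y).
  lra.
move=> e e0; have cw : 0 < cn (cexp w) by rewrite cn_gt0 cexp_neq0.
have [|d d0 dP] := H0 (e / cn (cexp w)); first by rewrite divr_gt0.
exists d => // z /dP zd.
rewrite -{1}(subrK w z) [z - w + w]addrC cexpD.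
rewrite (_ : _ - _ - _ = cexp w * (cexp (z - w) - 1 - (z - w))); last by ring.
by rewrite cnM mulrC -ler_pdivlMr // mulrAC.
Qed.

End complex_derivatives.

(** * Cauchy's theorem for rectangles *)

Section integrals.
Context {R : realType}.
Local Notation C := R[i].
Local Notation cn := (@ComplexField.Normc.normc R).
Implicit Types (f h : R -> R) (F K : R -> C) (a b m : R).

Definition rint f a b : R := \int[lebesgue_measure]_(x in `[a, b]) f x.

Lemma cont_integrable f a b : (forall x, a <= x <= b -> {for x, continuous f}) ->
  (@lebesgue_measure R).-integrable `[a, b] (EFin \o f).
Proof.
move=> cf; apply: continuous_compact_integrable; first exact: segment_compact.
apply: continuous_in_subspaceT => x; rewrite inE /= in_itv /= => xab; exact: cf.
Qed.

Lemma eq_rint f h a b : (forall x, a <= x <= b -> f x = h x) -> rint f a b = rint h a b.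
Proof. by move=> fh; apply: eq_Rintegral => x; rewrite inE /= in_itv /=; exact: fh. Qed.

Lemma rintB f h a b : (forall x, a <= x <= b -> {for x, continuous f}) ->
  (forall x, a <= x <= b -> {for x, continuous h}) ->
  rint (fun x => f x - h x) a b = rint f a b - rint h a b.
Proof. by move=> cf ch; apply: RintegralB => //; exact: cont_integrable. Qed.

Lemma rint_split f a m b : a <= m -> m <= b ->
  (forall x, a <= x <= b -> {for x, continuous f}) ->
  rint f a b = rint f a m + rint f m b.
Proof.
move=> am mb cf; have i1 := cont_integrable cf.
have i2 : lebesgue_measure.-integrable `[m, b] (EFin \o f).
  by apply: cont_integrable => x /andP[mx xb]; apply: cf; rewrite xb (le_trans am).
have := @Rintegral_itvB _ f (BLeft a) (BRight b) m i1; rewrite !bnd_simp => /(_ am mb).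
rewrite Rintegral_itv_obnd_cbnd; last first.
  apply: integrableS i2 => //; exact: subset_itv_oc_cc.
by rewrite /rint => <-; rewrite addrC subrK.
Qed.

Lemma rint_cst a b (c : R) : a <= b -> rint (fun=> c) a b = c * (b - a).
Proof.
move=> ab; rewrite /rint Rintegral_cst //.
have E : lebesgue_measure (`[a, b]%classic : set R) = (b - a)%:E.
  rewrite lebesgue_measure_itv /= lte_fin.
  by case: ltP => [//|ba]; rewrite (le_anti (introT andP (conj ab ba))) subrr.
by transitivity (c * fine (b - a)%:E) => //; congr (c * fine _); exact: E.
Qed.

Lemma rint_le f h a b : (forall x, a <= x <= b -> {for x, continuous f}) ->
  (forall x, a <= x <= b -> {for x, continuous h}) ->
  (forall x, a <= x <= b -> f x <= h x) -> rint f a b <= rint h a b.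
Proof.
move=> cf ch fh; apply: le_Rintegral => //; try exact: cont_integrable.
Qed.

Lemma rint_bound f a b (M : R) : a <= b -> (forall x, a <= x <= b -> {for x, continuous f}) ->
  (forall x, a <= x <= b -> `|f x| <= M) -> `|rint f a b| <= M * (b - a).
Proof.
move=> ab cf fM; rewrite ler_norml -mulNr -!rint_cst //.
have cc (c : R) x : a <= x <= b -> {for x, continuous (fun=> c : R)} by move=> _; exact: cfc.
apply/andP; split; apply: rint_le => //; try exact: cc; move=> x /fM; rewrite ler_norml => /andP[]//.
Qed.

Definition cint F a b : C :=
  Complex (rint (fun x => complex.Re (F x)) a b) (rint (fun x => complex.Im (F x)) a b).

Definition ccont F a b := forall x, a <= x <= b -> {for x, continuous F}.

Lemma ccont_Re F a b : ccont F a b ->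
  forall x, a <= x <= b -> {for x, continuous (fun x => complex.Re (F x))}.
Proof. by move=> cF x /cF cx; apply: (cf_comp cx); exact: continuous_Re. Qed.

Lemma ccont_Im F a b : ccont F a b ->
  forall x, a <= x <= b -> {for x, continuous (fun x => complex.Im (F x))}.
Proof. by move=> cF x /cF cx; apply: (cf_comp cx); exact: continuous_Im. Qed.

Lemma eq_cint F K a b : (forall x, a <= x <= b -> F x = K x) -> cint F a b = cint K a b.
Proof. by move=> FK; congr Complex; apply: eq_rint => x /FK ->. Qed.

Lemma cintB F K a b : ccont F a b -> ccont K a b ->
  cint (fun x => F x - K x) a b = cint F a b - cint K a b.
Proof.
move=> cF cK; have [rF iF] := (ccont_Re cF, ccont_Im cF).
have [rK iK] := (ccont_Re cK, ccont_Im cK).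
rewrite /cint (eq_rint (fun x _ => ReB _ _)) (eq_rint (fun x _ => ImB _ _)).
by rewrite !rintB.
Qed.

Lemma cint_split F a m b : a <= m -> m <= b -> ccont F a b ->
  cint F a b = cint F a m + cint F m b.
Proof.
move=> am mb cF; have [rF iF] := (ccont_Re cF, ccont_Im cF).
by rewrite /cint (rint_split am mb rF) (rint_split am mb iF).
Qed.

Lemma cint_cst a b (c : C) : a <= b -> cint (fun=> c) a b = c * (b - a)%:C%C.
Proof.
move=> ab; rewrite /cint !rint_cst //; case: c => x y /=; apply/eqP.
by rewrite eq_complex /= !mulr0 subr0 add0r !eqxx.
Qed.

Lemma cint_bound F a b (M : R) : a <= b -> ccont F a b ->
  (forall x, a <= x <= b -> cn (F x) <= M) -> cn (cint F a b) <= 2 * M * (b - a).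
Proof.
move=> ab cF FM; have [rF iF] := (ccont_Re cF, ccont_Im cF).
apply: le_trans (cn_le_ReIm _) _ => /=.
have := rint_bound ab rF (fun x xab => le_trans (Re_le_cn _) (FM x xab)).
have := rint_bound ab iF (fun x xab => le_trans (Im_le_cn _) (FM x xab)).
lra.
Qed.

End integrals.

Section goursat.
Context {R : realType}.
Local Notation C := R[i].
Local Notation cn := (@ComplexField.Normc.normc R).
Implicit Types (F K : C -> C) (x y w h s t : R).

(** The integral of [F dz] along the boundary of [[x, x + w] * [y, y + h]]. *)
Definition boundary F x y w h : C :=
  cint (fun t => F (Complex t y) - F (Complex t (y + h))) x (x + w) +
  Complex 0 1 * cint (fun t => F (Complex (x + w) t) - F (Complex x t)) y (y + h).

Definition cont_rect F x y w h := forall s t,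
  x <= s <= x + w -> y <= t <= y + h -> {for Complex s t, continuous F}.

Lemma cont_row F x y w h t : y <= t <= y + h -> cont_rect F x y w h ->
  ccont (fun s => F (Complex s t)) x (x + w).
Proof.
move=> tP cF s sP; apply: (@cf_comp R C C (fun s => Complex s t) F); last exact: cF.
by apply: cf_Complex; [exact: cf_id|exact: cfc].
Qed.

Lemma cont_col F x y w h s : x <= s <= x + w -> cont_rect F x y w h ->
  ccont (fun t => F (Complex s t)) y (y + h).
Proof.
move=> sP cF t tP; apply: (@cf_comp R C C (fun t => Complex s t) F); last exact: cF.
by apply: cf_Complex; [exact: cfc|exact: cf_id].
Qed.

Lemma boundaryE F x y w h : 0 <= w -> 0 <= h -> cont_rect F x y w h ->
  boundary F x y w h =
  cint (fun t => F (Complex t y)) x (x + w) - cint (fun t => F (Complex t (y + h))) x (x + w) +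
  Complex 0 1 * (cint (fun t => F (Complex (x + w) t)) y (y + h) -
                 cint (fun t => F (Complex x t)) y (y + h)).
Proof.
move=> w0 h0 cF; rewrite /boundary !cintB //.
- by apply: cont_col cF; rewrite lerDl w0 lexx.
- by apply: cont_col cF; rewrite lerDl w0 lexx.
- by apply: cont_row cF; rewrite lerDl h0 lexx.
- by apply: cont_row cF; rewrite lerDl h0 lexx.
Qed.

Lemma cont_rect_sub F x y w h x' y' w' h' : x <= x' -> x' + w' <= x + w ->
  y <= y' -> y' + h' <= y + h -> cont_rect F x y w h -> cont_rect F x' y' w' h'.
Proof.
move=> x1 x2 y1 y2 cF s t /andP[s1 s2] /andP[t1 t2]; apply: cF.
  by rewrite (le_trans x1) // (le_trans s2).
by rewrite (le_trans y1) // (le_trans t2).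
Qed.

Lemma boundary_quarters F x y w h : 0 <= w -> 0 <= h ->
  cont_rect F x y (w + w) (h + h) ->
  boundary F x y (w + w) (h + h) =
  boundary F x y w h + boundary F (x + w) y w h +
  (boundary F x (y + h) w h + boundary F (x + w) (y + h) w h).
Proof.
move=> w0 h0 cF.
rewrite !boundaryE ?addr_ge0 //; try (apply: cont_rect_sub cF; lra).
rewrite !addrA.
have sr t : y <= t <= y + (h + h) -> cint (fun s => F (Complex s t)) x (x + w + w) =
    cint (fun s => F (Complex s t)) x (x + w) + cint (fun s => F (Complex s t)) (x + w) (x + w + w).
  move=> tP; apply: cint_split; [lra|lra|].
  by have := cont_row tP cF; rewrite addrA.
have sc s : x <= s <= x + (w + w) -> cint (fun t => F (Complex s t)) y (y + h + h) =
    cint (fun t => F (Complex s t)) y (y + h) + cint (fun t => F (Complex s t)) (y + h) (y + h + h).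
  move=> sP; apply: cint_split; [lra|lra|].
  by have := cont_col sP cF; rewrite addrA.
have y1 : y <= y <= y + (h + h) by lra.
have y2 : y <= y + h <= y + (h + h) by lra.
have y3 : y <= y + h + h <= y + (h + h) by lra.
have x1 : x <= x <= x + (w + w) by lra.
have x2 : x <= x + w <= x + (w + w) by lra.
have x3 : x <= x + w + w <= x + (w + w) by lra.
by rewrite (sr _ y1) (sr _ y3) (sc _ x1) (sc _ x3); ring.
Qed.

Lemma boundaryB F K x y w h : 0 <= w -> 0 <= h ->
  cont_rect F x y w h -> cont_rect K x y w h ->
  boundary (fun z => F z - K z) x y w h = boundary F x y w h - boundary K x y w h.
Proof.
move=> w0 h0 cF cK; have cFK : cont_rect (fun z => F z - K z) x y w h.
  by move=> s t sP tP; apply: cfB; [exact: cF|exact: cK].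
rewrite (boundaryE w0 h0 cFK) (boundaryE w0 h0 cF) (boundaryE w0 h0 cK).
have xl : x <= x <= x + w by lra.
have xr : x <= x + w <= x + w by lra.
have yl : y <= y <= y + h by lra.
have yr : y <= y + h <= y + h by lra.
rewrite (cintB (cont_row yl cF) (cont_row yl cK)) (cintB (cont_row yr cF) (cont_row yr cK)).
rewrite (cintB (cont_col xl cF) (cont_col xl cK)) (cintB (cont_col xr cF) (cont_col xr cK)).
by ring.
Qed.

Lemma boundary_affine (b c : C) x y w h : 0 <= w -> 0 <= h ->
  boundary (fun z => b * z + c) x y w h = 0.
Proof.
move=> w0 h0; rewrite /boundary.
rewrite (@eq_cint _ (fun t => b * Complex t y + c - (b * Complex t (y + h) + c)) (fun=> b * Complex 0 (- h))); last first.
  move=> t _; rewrite (_ : b * Complex t y + c - _ = b * (Complex t y - Complex t (y + h))); last by ring.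
  by congr (_ * _); apply/eqP; rewrite eq_complex /= subrr opprD addNKr !eqxx.
rewrite (@eq_cint _ (fun t => b * Complex (x + w) t + c - (b * Complex x t + c)) (fun=> b * Complex w 0)); last first.
  move=> t _; rewrite (_ : b * Complex (x + w) t + c - _ = b * (Complex (x + w) t - Complex x t)); last by ring.
  by congr (_ * _); apply/eqP; rewrite eq_complex /= subrr addrC addKr !eqxx.
rewrite !cint_cst ?lerDl // ![_ + _ - _]addrC !addKr.
rewrite -!mulrA [Complex 0 1 * _]mulrCA -mulrDr (_ : _ + _ = 0) ?mulr0 //.
by apply/eqP; rewrite eq_complex /=; apply/andP; split; apply/eqP; ring.
Qed.

Lemma boundary_bound F x y w h (M : R) : 0 <= w -> 0 <= h -> 0 <= M ->
  cont_rect F x y w h ->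
  (forall s t : R, x <= s <= x + w -> y <= t <= y + h -> cn (F (Complex s t)) <= M) ->
  cn (boundary F x y w h) <= 4 * M * (w + h).
Proof.
move=> w0 h0 M0 cF FM.
have xl : x <= x <= x + w by lra.
have xr : x <= x + w <= x + w by lra.
have yl : y <= y <= y + h by lra.
have yr : y <= y + h <= y + h by lra.
have b1 : cn (cint (fun t => F (Complex t y) - F (Complex t (y + h))) x (x + w)) <= 2 * (2 * M) * (x + w - x).
  apply: cint_bound; first by lra.
    by move=> t tP; apply: cfB; [exact: (cont_row yl cF)|exact: (cont_row yr cF)].
  move=> t tP; have := cnD (F (Complex t y)) (- F (Complex t (y + h))); rewrite cnN.
  have := FM t y tP yl; have := FM t (y + h) tP yr; lra.
have b2 : cn (cint (fun t => F (Complex (x + w) t) - F (Complex x t)) y (y + h)) <= 2 * (2 * M) * (y + h - y).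
  apply: cint_bound; first by lra.
    by move=> t tP; apply: cfB; [exact: (cont_col xr cF)|exact: (cont_col xl cF)].
  move=> t tP; have := cnD (F (Complex (x + w) t)) (- F (Complex x t)); rewrite cnN.
  have := FM _ t xr tP; have := FM _ t xl tP; lra.
apply: le_trans (cnD _ _) _; rewrite cnM (_ : cn (Complex 0 1) = 1) ?mul1r; last first.
  by rewrite /ComplexField.Normc.normc expr0n expr1n add0r sqrtr1.
lra.
Qed.

Lemma halves (a u v L l : R) : a <= u -> u + L <= v -> 0 <= l -> L = l + l ->
  [/\ a <= u, u + l <= v, u <= u & u + l <= u + L] /\
  [/\ a <= u + l, u + l + l <= v, u <= u + l & u + l + l <= u + L].
Proof. by move=> au uv l0 Ll; rewrite Ll in uv *; split; split; lra. Qed.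

(** Cauchy's theorem for a rectangle: repeated quartering keeps a boundary integral
    at least proportional to the area, whereas differentiability at the limit point
    makes it negligible. *)
Lemma goursat F x y w h : 0 < w -> 0 < h ->
  (forall s t : R, x <= s <= x + w -> y <= t <= y + h -> exists a, cdiff F (Complex s t) a) ->
  boundary F x y w h = 0.
Proof.
move=> w0 h0 dF; apply/eqP; rewrite -cn_eq0 eq_le cn_ge0 andbT leNgt; apply/negP => I0.
have cF : cont_rect F x y w h.
  by move=> s t sP tP; have [a /cdiff_cont] := dF s t sP tP.
pose W n : R := w / 2 ^+ n; pose H n : R := h / 2 ^+ n.
have p2 n : 0 < 2 ^+ n :> R by rewrite exprn_gt0.
have W0 n : 0 < W n by rewrite divr_gt0.
have H0 n : 0 < H n by rewrite divr_gt0.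
have WS n : W n.+1 + W n.+1 = W n by rewrite /W exprS; field; rewrite lt0r_neq0.
have HS n : H n.+1 + H n.+1 = H n by rewrite /H exprS; field; rewrite lt0r_neq0.
set e := cn (boundary F x y w h) in I0.
pose good n (q : R * R) := [/\ x <= q.1, q.1 + W n <= x + w, y <= q.2, q.2 + H n <= y + h &
  e / 4 ^+ n <= cn (boundary F q.1 q.2 (W n) (H n))].
have step n q : exists q', good n q -> [/\ good n.+1 q',
    q.1 <= q'.1, q'.1 + W n.+1 <= q.1 + W n, q.2 <= q'.2 & q'.2 + H n.+1 <= q.2 + H n].
  have [[x1 x2 y1 y2 bq]|] := pselect (good n q); last by exists q.
  have [w1 h1] := (ltW (W0 n.+1), ltW (H0 n.+1)).
  have [ws hs] := (WS n, HS n).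
  pose B u v := cn (boundary F u v (W n.+1) (H n.+1)).
  have sum4 : e / 4 ^+ n <= B q.1 q.2 + B (q.1 + W n.+1) q.2 +
     (B q.1 (q.2 + H n.+1) + B (q.1 + W n.+1) (q.2 + H n.+1)).
    apply: le_trans bq _; rewrite -{1}WS -{1}HS boundary_quarters //.
      by apply: le_trans (cnD _ _) _; apply: lerD; exact: cnD.
    by apply: cont_rect_sub cF; rewrite ?WS ?HS.
  have e4 : e / 4 ^+ n = 4 * (e / 4 ^+ n.+1).
    by rewrite exprS; field; rewrite lt0r_neq0 // exprn_gt0.
  rewrite e4 in sum4; set eN := e / 4 ^+ n.+1 in sum4 *.
  have [[X1 X2 X3 X4] [X5 X6 X7 X8]] := halves x1 x2 w1 (esym ws).
  have [[Y1 Y2 Y3 Y4] [Y5 Y6 Y7 Y8]] := halves y1 y2 h1 (esym hs).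
  have [c1|c1] := lerP eN (B q.1 q.2); first by exists q => _; split=> //; split.
  have [c2|c2] := lerP eN (B (q.1 + W n.+1) q.2).
    by exists (q.1 + W n.+1, q.2) => _; split=> //; split.
  have [c3|c3] := lerP eN (B q.1 (q.2 + H n.+1)).
    by exists (q.1, q.2 + H n.+1) => _; split=> //; split.
  have [c4|c4] := lerP eN (B (q.1 + W n.+1) (q.2 + H n.+1)).
    by exists (q.1 + W n.+1, q.2 + H n.+1) => _; split=> //; split.
  by move: sum4 c1 c2 c3 c4; clear; lra.
have [nx nxP] : {nx : nat -> R * R -> R * R & forall n q, good n q ->
    [/\ good n.+1 (nx n q), q.1 <= (nx n q).1, (nx n q).1 + W n.+1 <= q.1 + W n,
      q.2 <= (nx n q).2 & (nx n q).2 + H n.+1 <= q.2 + H n]}.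
  exists (fun n q => xget (0, 0) [set q' | good n q -> [/\ good n.+1 q',
    q.1 <= q'.1, q'.1 + W n.+1 <= q.1 + W n, q.2 <= q'.2 & q'.2 + H n.+1 <= q.2 + H n]]) => n q.
  by case: xgetP => [q' _ //|none]; have [q' q'P] := step n q; have := none q' q'P.
pose Q := fix Q n := if n is m.+1 then nx m (Q m) else (x, y).
have Qgood n : good n (Q n).
  elim: n => [|n /(@nxP n) []//]; rewrite /good /W /H /= !expr0 !divr1 !lexx; split=> //.
have Qstep n m : (n <= m)%N -> [/\ (Q n).1 <= (Q m).1, (Q m).1 + W m <= (Q n).1 + W n,
    (Q n).2 <= (Q m).2 & (Q m).2 + H m <= (Q n).2 + H n].
  move/subnK <-; elim: (m - n)%N => [|k IH]; first by rewrite add0n !lexx.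
  rewrite addSn; have [_ a1 a2 a3 a4] := nxP _ _ (Qgood (k + n)%N); case: IH => b1 b2 b3 b4.
  by rewrite /= -/Q; split; [exact: le_trans a1|exact: le_trans b2|exact: le_trans a3|exact: le_trans b4].
have sup_in (u : nat -> R) (L : nat -> R) : (forall n, 0 < L n) ->
    (forall n m, (n <= m)%N -> u n <= u m /\ u m + L m <= u n + L n) ->
    exists s, forall n, u n <= s <= u n + L n.
  move=> L0 uL.
  have ub n : ubound (range u) (u n + L n).
    move=> _ [m _ <-]; have [nm|/ltnW mn] := leqP n m.
      by have [_] := uL _ _ nm; apply: le_trans; rewrite lerDl ltW.
    by have [h1 _] := uL _ _ mn; apply: le_trans h1 _; rewrite lerDl ltW.
  exists (sup (range u)) => n; apply/andP; split.
    by apply: ub_le_sup; [exists (u 0%N + L 0%N); exact: ub|exists n].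
  by apply: ge_sup; [exists (u 0%N); exists 0%N|exact: ub].
have [s0 s0P] := sup_in (fun n => (Q n).1) W W0 (fun n m nm => let: And4 a b _ _ := Qstep n m nm in conj a b).
have [t0 t0P] := sup_in (fun n => (Q n).2) H H0 (fun n m nm => let: And4 _ _ a b := Qstep n m nm in conj a b).
have [|| b db] := dF s0 t0.
- by have := s0P 0%N; rewrite /W expr0 divr1.
- by have := t0P 0%N; rewrite /H expr0 divr1.
pose k := e / (8 * (w + h) ^+ 2).
have k0 : 0 < k by rewrite divr_gt0 // mulr_gt0 // exprn_gt0 // addr_gt0.
have [d d0 dP] := db k k0.
have [n nd] : exists n, (w + h) / 2 ^+ n < d.
  pose n := (Num.trunc ((w + h) / d)).+1; exists n.
  rewrite ltr_pdivrMr // mulrC -ltr_pdivrMr //.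
  apply: (@lt_trans _ _ n%:R); first exact: truncnS_gt.
  by rewrite -natrX ltr_nat ltn_expl.
have [x1 x2 y1 y2 bq] := Qgood n.
set z0 := Complex s0 t0 in db dP.
pose A z := b * z + (F z0 - b * z0).
have cA : cont_rect A (Q n).1 (Q n).2 (W n) (H n).
  by move=> s t _ _; apply: (cdiff_cont (cdiff_affine b _ _)).
have cFn : cont_rect F (Q n).1 (Q n).2 (W n) (H n) by apply: cont_rect_sub cF.
have E : boundary F (Q n).1 (Q n).2 (W n) (H n) =
    boundary (fun z => F z - A z) (Q n).1 (Q n).2 (W n) (H n).
  by rewrite boundaryB ?ltW // boundary_affine ?subr0 ?ltW.
have bd : cn (boundary F (Q n).1 (Q n).2 (W n) (H n)) <=
    4 * (k * (W n + H n)) * (W n + H n).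
  rewrite E; apply: (boundary_bound (ltW (W0 n)) (ltW (H0 n))).
  - by apply: ltW; rewrite mulr_gt0 // addr_gt0.
  - by move=> s t sP tP; apply: cfB; [exact: cFn|exact: cA].
  move=> s t sP tP; have /andP[u1 u2] := s0P n; have /andP[v1 v2] := t0P n.
  have dz : cn (Complex s t - z0) <= W n + H n.
    apply: le_trans (cn_le_ReIm _) _; rewrite /z0 /= lerD // ler_norml; lra.
  have dd : cn (Complex s t - z0) < d.
    by apply: le_lt_trans dz _; rewrite /W /H -mulrDl.
  rewrite (_ : _ - A _ = F (Complex s t) - F z0 - b * (Complex s t - z0)); last by rewrite /A; ring.
  apply: le_trans (dP _ dd) _; by rewrite ler_pM2l.
have : e / 4 ^+ n <= e / 4 ^+ n / 2.
  apply: le_trans bq (le_trans bd _).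
  rewrite (_ : 4 * _ * _ = e / 4 ^+ n / 2) // /k /W /H -mulrDl.
  have -> : 4 ^+ n = 2 ^+ n * 2 ^+ n :> R by rewrite -exprMn; congr (_ ^+ _); ring.
  by field; rewrite !lt0r_neq0 ?addr_gt0.
have : 0 < e / 4 ^+ n by rewrite divr_gt0 // exprn_gt0.
lra.
Qed.

End goursat.

(** * The derivative of an injective holomorphic map *)

Lemma near_all (X : topologicalType) (x : X) (Q : X -> Prop) :
  (forall y, Q y) -> \forall y \near x, Q y.
Proof. exact: filterE. Qed.

Section injective_maps.
Context {R : realType}.
Local Notation C := R[i].
Local Notation cn := (@ComplexField.Normc.normc R).
Implicit Types (f : C -> C) (z w a : C).

(** Two arguments differ by an integer multiple of [2 pi], constant along the segment. *)
Lemma arg_unique (D : set C) (f : C -> C) (u v : C -> R) z :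
  (forall t : R, 0 <= t <= 1 -> D (t%:C%C * z)) -> (forall w, D w -> f w != 0) ->
  cont_on D u -> cont_on D v ->
  (forall w, D w -> f w = (cn (f w))%:C%C * cis (u w)) ->
  (forall w, D w -> f w = (cn (f w))%:C%C * cis (v w)) ->
  u 0 = v 0 -> u z = v z.
Proof.
move=> Dz f0 cu cv uP vP uv0.
pose p (t : R) : C := (sin t ^+ 2)%:C%C * z.
have s01 (t : R) : 0 <= sin t ^+ 2 <= 1.
  by rewrite sqr_ge0 /=; have := cos2Dsin2 t; have := sqr_ge0 (cos t); lra.
have Dp t : D (p t) by apply: Dz.
have cp : continuous p.
  move=> t; apply: (@cfM _ _ (fun t : R => (sin t ^+ 2)%:C%C) (fun=> z)); last exact: cfc.
  apply: cf_Complex; last exact: cfc.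
  by rewrite (_ : (fun t => _) = fun t => sin t * sin t) //; apply: cfM; exact: continuous_sin.
have p2 : pi *+ 2 != 0 :> R by rewrite gt_eqF // pmulrn_lgt0 ?pi_gt0.
have E : (u (p (pi / 2)) - v (p (pi / 2))) / (pi *+ 2) = (u (p 0) - v (p 0)) / (pi *+ 2).
  apply: (@int_valued_const R R `[(0 : R), (pi / 2)] (fun t => (u (p t) - v (p t)) / (pi *+ 2))).
  - exact: segment_connected.
  - apply: continuous_subspaceT => t.
    apply: (@cfM R R (fun t : R => u (p t) - v (p t)) (fun=> (pi *+ 2)^-1)); last exact: cfc.
    by apply: cfB; [exact: (cont_on_path cu cp Dp)|exact: (cont_on_path cv cp Dp)].
  - move=> t _; have [|n nE] := @cis_eq R (u (p t)) (v (p t)).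
      have ft : (cn (f (p t)))%:C%C != 0 :> C.
        by rewrite -cn_gt0 cn_real normr_gt0 cn_eq0 f0.
      by apply: (mulfI ft); rewrite -uP // -vP.
    by exists n; rewrite nE addrC addKr mulfK.
  - by rewrite /= in_itv /= lexx divr_ge0 // pi_ge0.
  - by rewrite /= in_itv /= lexx divr_ge0 // pi_ge0.
move/(mulIf (invr_neq0 p2)): E.
rewrite /p sin_pihalf sin0 expr1n expr0n /= mul1r mul0r uv0 subrr.
by move/eqP; rewrite subr_eq0 => /eqP.
Qed.

(** The arguments on the discs of integer radius, normalized at [0], extend each other. *)
Lemma has_arg_plane f : continuous f -> (forall z, f z != 0) ->
  exists2 u : C -> R, continuous u & forall z, f z = (cn (f z))%:C%C * cis (u z).
Proof.
move=> cf f0; have [t0 t0P] := polar (f 0).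
pose D (k : nat) := [set z | cn z <= k%:R].
have [U UP] : {U : nat -> C -> R & forall k, [/\ cont_on (D k) (U k),
    (forall w, D k w -> f w = (cn (f w))%:C%C * cis (U k w)) & U k 0 = t0]}.
  have ex k : exists u : C -> R, [/\ cont_on (D k) u,
      (forall w, D k w -> f w = (cn (f w))%:C%C * cis (u w)) & u 0 = t0].
    have [||u cu uP] := @has_arg_disc R k%:R f (ler0n _ _); [by move=> z _; exact: cf|by []|].
    have [|n nE] := @cis_eq R (u 0) t0.
      have ft : (cn (f 0))%:C%C != 0 :> C by rewrite -cn_gt0 cn_real normr_gt0 cn_eq0 f0.
      by apply: (mulfI ft); rewrite -uP ?[LHS]t0P //= cn0 ler0n.
    exists (fun z => u z + - (n%:~R * (pi *+ 2))); split.
    - apply: cont_onD => //; apply: cont_on_continuous => z _; exact: cfc.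
    - by move=> w Dw; rewrite cisB cis_pi2int divr1 -uP.
    - by rewrite nE addrK.
  exists (fun k => xget (fun=> 0) [set u | [/\ cont_on (D k) u,
      (forall w, D k w -> f w = (cn (f w))%:C%C * cis (u w)) & u 0 = t0]]) => k.
  by case: xgetP => [u _ //|none]; have [u uP] := ex k; have := none u uP.
have UU k m z : (k <= m)%N -> D k z -> U m z = U k z.
  move=> km Dkz; have [cm mP m0] := UP m; have [ck kP k0] := UP k.
  have sub : D k `<=` D m by move=> w /= /le_trans; apply; rewrite ler_nat.
  apply: (@arg_unique (D k) f) => //; last by rewrite m0 k0.
  - move=> t /andP[t0' t1]; rewrite /D /= cnM cn_real ger0_norm //.
    by apply: le_trans Dkz; rewrite ler_piMl ?cn_ge0.
  - exact: cont_on_sub cm.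
  - by move=> w /sub; exact: mP.
pose K z := (Num.trunc (cn z)).+1.
have DK z : D (K z) z by rewrite /D /= ltW // truncnS_gt.
exists (fun z => U (K z) z) => z; last by have [_ h _] := UP (K z); apply: h.
pose m := (K z).+1.
have nz : \forall w \near z, cn w < (K z)%:R.
  have := @continuous_cn R z [set x | x < (K z)%:R]; apply; apply: lt_nbhsl.
  exact: truncnS_gt.
have [cm _ _] := UP (K z).
apply: (@cf_near _ _ _ (U (K z))); last first.
  by apply: cont_on_nbhs cm _; apply: filterS nz => w /ltW.
apply: filterS nz => w wK.
have [kk|kk] := leqP (K w) (K z); first by rewrite (UU (K w) (K z)).
by rewrite (UU (K z) (K w)) ?(ltnW kk) // /D /= ltW.
Qed.

Definition twopii : C := Complex 0 (pi *+ 2).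

Lemma cexp_eq z w : cexp z = cexp w -> exists k : int, z = w + k%:~R * twopii.
Proof.
move=> zw; have re : complex.Re z = complex.Re w.
  by apply: expR_inj; rewrite -!cn_cexp zw.
have [|k kE] := @cis_eq R (complex.Im z) (complex.Im w).
  have e0 : (expR (complex.Re z))%:C%C != 0 :> C.
    by rewrite -cn_gt0 cn_real normr_gt0 gt_eqF // expR_gt0.
  by apply: (mulfI e0); move: zw; rewrite /cexp re.
exists k; case: z w re kE {zw} => [a b] [c d] /= -> ->.
rewrite /twopii -[k%:~R : C](@rmorph_int _ _ (real_complex R)) /=.
by apply/eqP; rewrite eq_complex /=; apply/andP; split; apply/eqP; ring.
Qed.

Lemma cexp_twopii w : cexp (w + twopii) = cexp w.
Proof. by rewrite cexpD /cexp /= expR0 cis2pi !mulr1. Qed.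

Lemma clog (r : R) z : 0 < r -> z != 0 -> exists w, z = r%:C%C * cexp w.
Proof.
move=> r0 z0; have [t zt] := polar z; exists (Complex (ln (cn z / r)) t).
have cz : 0 < cn z by rewrite cn_gt0.
rewrite /cexp /= lnK ?posrE ?divr_gt0 // mulrA -rmorphM.
by rewrite [r * _]mulrC divfK ?lt0r_neq0.
Qed.

Lemma int_valued_plane (p : C -> R) z w : continuous p ->
  (forall x, exists n : int, p x = n%:~R) -> p z = p w.
Proof.
move=> cp ip.
have := @int_valued_const R R `[(0 : R), 1] (fun t => p (w + t%:C%C * (z - w))).
move=> /(_ (@segment_connected _ _ _)) H.
have := H _ _ 1 0; rewrite mul1r mul0r addr0 [w + _]addrC subrK; apply.
- apply: continuous_subspaceT => t.
  apply: (@cf_comp R C R (fun t : R => w + t%:C%C * (z - w)) p); last exact: cp.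
  apply: cfD; first exact: cfc.
  apply: cfM; last exact: cfc.
  by apply: cf_Complex; [exact: cf_id|exact: cfc].
- by [].
- by rewrite /= in_itv /= lexx ler01.
- by rewrite /= in_itv /= lexx ler01.
Qed.

(** If [f] vanishes to higher order at [0], then, for the lift [L] of [f (r e^w)],
    of period [2 pi i n], the mean of [Re (L w - n w)] over a period is constant by
    Cauchy's theorem; this excludes [n <= 1]. If [n >= 2], then [e^(L / n)] is an
    injective continuous [n]-th root of [f], and by invariance of domain it takes
    two values that differ by a root of unity. *)
Lemma injective_derivative0 f (r : R) : 0 < r ->
  (forall z, cn z <= r -> exists a, cdiff f z a) ->
  (forall z w, cn z <= r -> cn w <= r -> f z = f w -> z = w) ->
  f 0 = 0 -> ~ cdiff f 0 0.
Proof.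
move=> r0 df fI f00 d0.
have cfr z : cn z <= r -> {for z, continuous f} by move=> /df [a /cdiff_cont].
have rC : r%:C%C != 0 :> C by rewrite -cn_gt0 cn_real normr_gt0 gt_eqF.
(* [rho] retracts the plane to the left half-plane, where [r * cexp] covers the
   punctured disc. *)
pose rho w : C := Complex (Num.min (complex.Re w) 0) (complex.Im w).
have rhoc : continuous rho.
  move=> w; apply: (@cf_Complex R C (fun w => Num.min (complex.Re w) 0) (@complex.Im R)); last exact: continuous_Im.
  by apply: cf_min; [exact: continuous_Re|exact: cfc].
have rhoE w : complex.Re w <= 0 -> rho w = w by move=> w0; rewrite /rho min_l //; case: w {w0}.
pose e w := r%:C%C * cexp (rho w).
have er w : cn (e w) <= r.
  rewrite cnM cn_real gtr0_norm // cn_cexp -[leRHS]mulr1 ler_pM2l //.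
  by rewrite -[X in _ <= X]expR0 ler_expR ge_min lexx orbT.
have ec : continuous e.
  move=> w; apply: (@cfM C C (fun=> r%:C%C) (fun w => cexp (rho w))); first exact: cfc.
  by apply: (@cf_comp C C C rho cexp); [exact: rhoc|exact: (cdiff_cont (cdiff_cexp _))].
pose G w := f (e w).
have Gc : continuous G.
  by move=> w; apply: (@cf_comp C C C e f); [exact: ec|apply: cfr; exact: er].
have G0 w : G w != 0.
  apply/eqP => Gw; have : e w = 0 by apply: fI; rewrite ?er ?cn0 ?ltW // f00.
  by apply/eqP; rewrite mulf_neq0 // cexp_neq0.
have [u uc uP] := has_arg_plane Gc G0.
pose L w : C := Complex (ln (cn (G w))) (u w).
have LG w : cexp (L w) = G w.
  by rewrite /cexp /= lnK ?posrE ?cn_gt0 // -uP.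
have cL : continuous L.
  move=> w; apply: (@cf_Complex R C (fun w => ln (cn (G w))) u); last exact: uc.
  apply: (@cf_comp C R R (fun w => cn (G w)) (@ln R)); last by apply: continuous_ln; rewrite cn_gt0.
  by apply: (@cf_comp C C R G cn); [exact: Gc|exact: continuous_cn].
have eper w : e (w + twopii) = e w.
  rewrite /e (_ : rho (w + twopii) = rho w + twopii) ?cexp_twopii //.
  by rewrite /rho ReD ImD /twopii /= addr0; apply/eqP; rewrite eq_complex /= addr0 !eqxx.
have Gper w : G (w + twopii) = G w by rewrite /G eper.
have p2 : pi *+ 2 != 0 :> R by rewrite gt_eqF // pmulrn_lgt0 ?pi_gt0.
have [n nP] : exists n : int, forall w, L (w + twopii) = L w + n%:~R * twopii.
  pose p w := (u (w + twopii) - u w) / (pi *+ 2).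
  have ip w : exists n : int, p w = n%:~R.
    have [|n nE] := @cis_eq R (u (w + twopii)) (u w).
      have ft : (cn (G w))%:C%C != 0 :> C.
        by rewrite -cn_gt0 cn_real normr_gt0 cn_eq0 G0.
      by apply: (mulfI ft); rewrite -uP -Gper -uP.
    by exists n; rewrite /p nE addrC addKr mulfK.
  have cp : continuous p.
    move=> w; apply: (@cfM C R (fun w => u (w + twopii) - u w) (fun=> (pi *+ 2)^-1)); last exact: cfc.
    apply: (@cfB C R (fun w => u (w + twopii)) u); last exact: uc.
    apply: (@cf_comp C C R (fun w => w + twopii) u); last exact: uc.
    by apply: cfD; [exact: cf_id|exact: cfc].
  have [n nE] := ip 0; exists n => w.
  have : p w = n%:~R by rewrite -nE; exact: int_valued_plane.
  move/eqP; rewrite /p -(inj_eq (mulIf p2)) divfK // subr_eq => /eqP uw.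
  rewrite /L Gper uw -[n%:~R : C](@rmorph_int _ _ (real_complex R)) /=.
  by apply/eqP; rewrite eq_complex /=; apply/andP; split; apply/eqP; ring.
have [n2|n2] := lerP 2 n; last first.
  (* If [n <= 1], the mean of [Re V] on vertical segments of length [2 pi] is independent
     of the abscissa by Cauchy's theorem and periodicity, but tends to [-oo]. *)
  have dL w : complex.Re w < 0 -> exists a, cdiff L w a.
    move=> w0.
    have near_neg : \forall v \near w, complex.Re v < 0.
      by have := @continuous_Re R w [set x | x < 0]; apply; exact: lt_nbhsl.
    have [b db] : exists b, cdiff G w b.
      have [b db] := df _ (er w).
      exists (b * (r%:C%C * cexp w)).
      apply: (@cdiff_near _ _ (fun v => f (r%:C%C * cexp v))).
        by apply: filterS near_neg => v v0; rewrite /G /e rhoE // ltW.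
      apply: (@cdiff_comp _ (fun v => r%:C%C * cexp v) f); last by move: db; rewrite /e rhoE // ltW.
      have := @cdiff_comp _ cexp (fun z => r%:C%C * z + 0) w _ _ (@cdiff_cexp R w) (cdiff_affine _ _ _).
      by apply: cdiff_near; apply: near_all => v; rewrite addr0.
    exists (b / cexp (L w)); apply: (@cdiff_solve _ G cexp L) => //.
    - exact: cexp_neq0.
    - exact: cL.
    - exact: cdiff_cexp.
    - exact: near_all.
  pose V w := L w + (- n%:~R * w + 0).
  have dV w : complex.Re w < 0 -> exists a, cdiff V w a.
    by move=> /dL [a da]; exists (a + - n%:~R); apply: cdiffD => //; exact: cdiff_affine.
  have Vper w : V (w + twopii) = V w by rewrite /V nP; ring.
  pose q (A : R) := rint (fun t => complex.Re (V (Complex A t))) 0 (pi *+ 2).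
  have p20 : 0 < pi *+ 2 :> R by rewrite pmulrn_lgt0 ?pi_gt0.
  have qc (A : R) : A < 0 -> forall t : R, 0 <= t <= pi *+ 2 ->
      {for t, continuous (fun t : R => complex.Re (V (Complex A t)))}.
    move=> A0 t _; apply: (@cf_comp R C R (fun t => V (Complex A t)) (@complex.Re R)); last exact: continuous_Re.
    apply: (@cf_comp R C C (fun t => Complex A t) V); first by apply: cf_Complex; [exact: cfc|exact: cf_id].
    by have [a /cdiff_cont] := dV (Complex A t) A0.
  have qE (A : R) : A < -1 -> q A = q (-1).
    move=> A1; have h0 : 0 < -1 - A by lra.
    have := @goursat R V A 0 (-1 - A) (pi *+ 2) h0 p20.
    have -> : A + (-1 - A) = -1 by ring.
    rewrite add0r => gou.
    have {gou} : boundary V A 0 (-1 - A) (pi *+ 2) = 0.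
      by apply: gou => s t /andP[_ s1] _; apply: dV => /=; lra.
    rewrite /boundary (_ : A + (-1 - A) = -1); last by ring.
    rewrite add0r (@eq_cint _ (fun t => V (Complex t 0) - V (Complex t (pi *+ 2))) (fun=> 0)); last first.
      move=> t _; rewrite (_ : Complex t (pi *+ 2) = Complex t 0 + twopii) ?Vper ?subrr //.
      by apply/eqP; rewrite eq_complex /= addr0 add0r !eqxx.
    rewrite cint_cst; last by lra.
    rewrite mul0r add0r => /eqP; rewrite mulf_eq0 => /orP[|].
      by rewrite eq_complex /= oner_eq0 andbF.
    rewrite /cint eq_complex /= => /andP[/eqP].
    rewrite (eq_rint (fun x _ => ReB _ _)) rintB; last 2 first.
    - by apply: qc; lra.
    - by apply: qc; lra.
    by move=> /eqP; rewrite subr_eq0 => /eqP h _; rewrite /q h.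
  (* With this [eps], the bound [cn (f z) <= eps * cn z] makes the mean of [Re V] at most
     its constant value minus [1]. *)
  pose eps := expR (q (-1) / (pi *+ 2) - ln r - 1).
  have eps0 : 0 < eps := expR_gt0 _.
  have [d dp dP] := d0 _ eps0.
  pose A := Num.min (-2) (ln (d / r) - 1).
  have A2 : A <= -2 by rewrite ge_min lexx.
  have Ad : A <= ln (d / r) - 1 by rewrite ge_min lexx orbT.
  have : q A <= (q (-1) / (pi *+ 2) - 1) * (pi *+ 2 - 0).
    rewrite -rint_cst; last by exact: ltW.
    apply: rint_le; first by apply: qc; lra.
      by move=> x _; exact: cfc.
    move=> t _; pose w := Complex A t; have w0 : complex.Re w <= 0 by rewrite /=; lra.
    have ew : cn (e w) = r * expR A by rewrite /e rhoE // cnM cn_real gtr0_norm // cn_cexp.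
    have ed : cn (e w - 0) < d.
      rewrite subr0 ew mulrC -ltr_pdivlMr // -[X in _ < X]lnK ?posrE ?divr_gt0 // ltr_expR; lra.
    have := dP _ ed; rewrite f00 mul0r !subr0 -/(G w) ew => Gle.
    have Gpos : 0 < cn (G w) by rewrite cn_gt0.
    have ReV : complex.Re (V w) = ln (cn (G w)) - n%:~R * A.
      rewrite /V !ReD /L /= addr0 -[n%:~R : C](@rmorph_int _ _ (real_complex R)) /=.
      by rewrite /w /=; ring.
    rewrite -/w ReV.
    have : ln (cn (G w)) <= ln (eps * (r * expR A)) by rewrite ler_ln ?posrE ?mulr_gt0 ?expR_gt0.
    rewrite lnM ?posrE ?mulr_gt0 ?expR_gt0 // lnM ?posrE ?expR_gt0 // !expRK => lle.
    have : (1 - n%:~R) * A <= 0.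
      apply: mulr_ge0_le0; last by apply: le_trans A2 _; rewrite oppr_le0 ler0n.
      rewrite subr_ge0 (_ : 1 = 1%:~R) // ler_int; move: n2; clear; lia.
    move: lle; rewrite mulrBl mul1r; lra.
  rewrite subr0 qE; last by lra.
  by rewrite mulrBl divfK ?gt_eqF // mul1r; lra.
(* If [n >= 2], then [e^(L / n)] descends to a continuous [n]-th root [phi] of [f]. *)
case: n n2 nP => // m; rewrite lez_nat => m2 nP.
have mC : m%:R != 0 :> C by rewrite pnatr_eq0 -lt0n (leq_trans _ m2).
have nPj j w : L (w + j%:R * twopii) = L w + j%:R * m%:R * twopii.
  elim: j => [|j IH]; first by rewrite !mul0r !addr0.
  by rewrite -natr1 mulrDl mul1r addrA nP IH; ring.
have root_ext w w' : cexp w = cexp w' -> cexp (L w / m%:R) = cexp (L w' / m%:R).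
  have H v (j : nat) : cexp (L (v + j%:R * twopii) / m%:R) = cexp (L v / m%:R).
    rewrite nPj mulrDl (_ : j%:R * m%:R * twopii / m%:R = j%:R * twopii); last by field.
    by elim: j => [|j IH]; [rewrite mul0r addr0|rewrite -natr1 mulrDl mul1r addrA cexp_twopii].
  move=> /cexp_eq [[j|j] ->]; first exact: H.
  by rewrite NegzE mulrNz mulNr -[LHS](H _ j.+1) subrK.
pose phi z := if z == 0 then 0 else cexp (L (xget 0 [set w | z = r%:C%C * cexp w]) / m%:R).
have phiE w : phi (r%:C%C * cexp w) = cexp (L w / m%:R).
  rewrite /phi mulf_eq0 (negbTE rC) (negbTE (cexp_neq0 _)) /=.
  apply: root_ext; case: xgetP => [v _ /= /(mulfI rC) //|/(_ w)/(_ erefl)//].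
have phiX z : cn z <= r -> phi z ^+ m = f z.
  move=> zr; have [->|z0] := eqVneq z 0.
    by rewrite /phi eqxx f00 expr0n gtn_eqF // (leq_trans _ m2).
  have [w wE] := clog r0 z0.
  have w0 : complex.Re w <= 0.
    move: zr; rewrite wE cnM cn_real gtr0_norm // cn_cexp.
    by rewrite -[X in _ <= X]mulr1 ler_pM2l // -[X in _ <= X]expR0 ler_expR.
  rewrite {1}wE phiE.
  have -> : cexp (L w / m%:R) ^+ m = cexp (L w).
    have X k v : cexp v ^+ k = cexp (k%:R * v).
      by elim: k => [|k IH]; [rewrite mul0r cexp0|rewrite exprS IH -cexpD -nat1r mulrDl mul1r].
    by rewrite X mulrC divfK.
  by rewrite LG /G /e rhoE // -wE.
have r2 : 0 < r / 2 by rewrite divr_gt0.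
have r2r z : cn z <= r / 2 -> cn z < r by move: r0; lra.
have phiC z : cn (z - 0) <= r / 2 -> {for z, continuous phi}.
  rewrite subr0 => /r2r zr; have FF : Filter (nbhs (z : C)) by exact: nbhs_filter.
  have [->|z0] := eqVneq z 0.
    have FF0 : Filter (nbhs (0 : C)) by exact: nbhs_filter.
    apply/cvg_cn => eps eps0; rewrite /phi eqxx -/phi.
    have em : 0 < eps ^+ m by rewrite exprn_gt0.
    have /cvg_cn /(_ _ em) /nbhs_cn [d dp dP] := cfr 0 (eq_ind_r (fun x => x <= r) (ltW r0) cn0).
    apply/nbhs_cn; exists (Num.min d r) => [|w]; first by rewrite lt_min dp.
    rewrite subr0 lt_min => /andP[wd wr].
    have := dP w; rewrite subr0 => /(_ wd); rewrite f00 subr0 -phiX ?ltW // cnX.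
    rewrite -/(phi w) subr0 ltr_pXn2r // ?nnegrE ?cn_ge0 ?ltW //.
    by rewrite (leq_trans _ m2).
  have [w0 w0E] := clog r0 z0.
  pose l v : C := w0 + Complex (ln (cn (v / z))) (argpos (v / z)).
  have near_pos : \forall v \near z, 0 < complex.Re (v / z).
    have : {for z, continuous (fun v : C => complex.Re (v / z))}.
      apply: (@cf_comp C C R (fun v => v / z) (@complex.Re R)); last exact: continuous_Re.
      by apply: cfM; [exact: cf_id|exact: cfc].
    by move/(_ [set x | 0 < x]); apply; rewrite divff //; exact: lt_nbhsr.
  apply: (@cf_near _ _ _ (fun v => cexp (L (l v) / m%:R))).
    apply: filterS near_pos => v v0; rewrite -phiE /l cexpD mulrA -w0E; congr phi.
    have vz : v / z != 0 by apply/eqP => vz; rewrite vz ltxx in v0.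
    by rewrite /cexp /= lnK ?posrE ?cn_gt0 // -argposP // mulrC divfK.
  apply: (@cf_comp C C C (fun v => L (l v) / m%:R) cexp); last exact: (cdiff_cont (cdiff_cexp _)).
  apply: (@cfM C C (fun v => L (l v)) (fun=> m%:R^-1)); last exact: cfc.
  apply: (@cf_comp C C C l L); last exact: cL.
  apply: (@cfD C C (fun=> w0) (fun v => Complex (ln (cn (v / z))) (argpos (v / z)))); first exact: cfc.
  have cq : {for z, continuous (fun v : C => v / z)} by apply: cfM; [exact: cf_id|exact: cfc].
  apply: (@cf_Complex R C (fun v => ln (cn (v / z))) (fun v => argpos (v / z))).
    apply: (@cf_comp C R R (fun v => cn (v / z)) (@ln R)); last by apply: continuous_ln; rewrite divff // cn1.
    by apply: (@cf_comp C C R (fun v => v / z) cn); [|exact: continuous_cn].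
  apply: (@cf_comp C C R (fun v => v / z) argpos) => //.
  by apply: continuous_argpos; rewrite divff.
have phiI z w : cn (z - 0) <= r / 2 -> cn (w - 0) <= r / 2 -> phi z = phi w -> z = w.
  rewrite !subr0 => /r2r/ltW zr /r2r/ltW wr zw; apply: fI => //.
  by rewrite -!phiX // zw.
have [eps eps0 epsP] := invariance_of_domain r2 phiC phiI.
have phi0 : phi 0 = 0 by rewrite /phi eqxx.
pose w0 : C := (eps / 2)%:C%C.
have cw0 : cn w0 = eps / 2 by rewrite cn_real gtr0_norm // divr_gt0.
pose zeta : C := cis (pi *+ 2 / m%:R).
(* [w0] and [w0 * zeta] have the same [m]-th power. *)
have [z0 z0r z0E] := epsP w0 (ltac:(rewrite phi0 subr0 cw0; lra)).
have [z1 z1r z1E] := epsP (w0 * zeta) (ltac:(rewrite phi0 subr0 cnM cn_cis mulr1 cw0; lra)).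
have zetaX : zeta ^+ m = 1.
  have X k (t : R) : cis t ^+ k = cis (k%:R * t).
    by elim: k => [|k IH]; [rewrite mul0r cis0|rewrite exprS IH -cisD -nat1r mulrDl mul1r].
  by rewrite X mulrC divfK ?cis2pi // pnatr_eq0 -lt0n (leq_trans _ m2).
rewrite subr0 in z0r; rewrite subr0 in z1r.
have z01 : z0 = z1.
  apply: fI; try (apply: ltW; exact: r2r).
  by rewrite -!phiX ?(ltW (r2r _ _)) // z0E z1E exprMn zetaX mulr1.
have w00 : w0 != 0 by rewrite -cn_gt0 cw0 divr_gt0.
have : zeta = 1 by apply: (mulfI w00); rewrite -z1E -z01 z0E mulr1.
move=> /cis_eq1 [k kE].
have mR : m%:R != 0 :> R by rewrite pnatr_eq0 -lt0n (leq_trans _ m2).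
have : (k * m%:Z)%:~R = 1%:~R :> R.
  apply: (mulIf p2); rewrite intrM mulrAC -kE divfK // mul1r //.
move/intr_inj/(congr1 (fun x => `|x|%N)); rewrite abszM /= => /eqP.
by rewrite muln_eq1 => /andP[_ /eqP m1]; rewrite m1 in m2.
Qed.

End injective_maps.

(** * Descent of equivariant Möbius transformations *)

Section projective_charts.
Context {R : realType}.
Local Notation C := R[i].
Local Notation cn := (@ComplexField.Normc.normc R).
Local Notation P := (P1 R).
Implicit Types (M N S : 'M[C]_2) (x : P).

Definition swap : 'M[C]_2 := \matrix_(i, j) (i != j)%:R.
Definition aff (x : P) : C := if x is Some z then z else 0.

(** The two charts of the projective line are the affine coordinate precomposed with
    an involution. *)
Definition chart_mx S := S = 1 \/ S = swap.
Definition P1_chart S : chart R P := ([set x : P | mobius S x <> None], fun x => aff (mobius S x)).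

Lemma mdet_swap : mdet swap = -1.
Proof. by rewrite /mdet !mxE /= mul0r mulr1 sub0r. Qed.

Lemma mobius_swap z : mobius swap (Some z) = if z == 0 then None else Some z^-1.
Proof. by rewrite /mobius !mxE /= mul1r addr0 mul0r add0r mul1r. Qed.

Lemma mobius_swap_None : mobius swap None = Some 0.
Proof. by rewrite /mobius !mxE /= oner_eq0 mul0r. Qed.

Lemma chart_mx_det S : chart_mx S -> mdet S != 0.
Proof. by move=> [->|->]; rewrite ?mdet1 ?mdet_swap ?oppr_eq0 oner_eq0. Qed.

Lemma chart_mxK S x : chart_mx S -> mobius S (mobius S x) = x.
Proof.
move=> [->|->]; first by rewrite !mobius1.
case: x => [z|]; last by rewrite mobius_swap_None mobius_swap eqxx.
rewrite mobius_swap; case: eqVneq => [->|z0]; first by rewrite mobius_swap_None.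
by rewrite mobius_swap invr_eq0 (negbTE z0) invrK.
Qed.

Lemma chart_mx_exists x : exists2 S, chart_mx S & mobius S x <> None.
Proof.
case: x => [z|]; first by exists 1; [left|rewrite mobius1].
by exists swap; [right|rewrite mobius_swap_None].
Qed.

Lemma P1_chart_atlas S : chart_mx S -> P1_atlas (P1_chart S).
Proof.
move=> [->|->]; rewrite /P1_chart; [left|right]; congr pair.
- by apply/seteqP; split=> x /=; rewrite mobius1.
- by apply/funext => x; rewrite mobius1.
- apply/seteqP; split=> -[z|] //=; last by rewrite mobius_swap_None.
    by rewrite mobius_swap; case: eqVneq => // z0 _ [] /eqP; rewrite (negbTE z0).
  by rewrite mobius_swap; case: eqVneq => // -> [].
- apply/funext => -[z|]; last by rewrite mobius_swap_None.
  by rewrite mobius_swap; case: eqVneq => // ->; rewrite invr0.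
Qed.

Lemma Some_aff x : x <> None -> Some (aff x) = x. Proof. by case: x. Qed.

Lemma cdiff_mobius N t : mdet N != 0 -> mobius N (Some t) <> None ->
  (\forall s \near t, mobius N (Some s) <> None) /\
  exists a, cdiff (fun s => aff (mobius N (Some s))) t a.
Proof.
move=> dN; have E s : N 1 0 * s + N 1 1 != 0 ->
    mobius N (Some s) = Some ((N 0 0 * s + N 0 1) / (N 1 0 * s + N 1 1)).
  by rewrite /mobius => /negbTE ->.
have [t0|t0 _] := eqVneq (N 1 0 * t + N 1 1) 0; first by rewrite /mobius t0 eqxx.
have near0 : \forall s \near t, N 1 0 * s + N 1 1 != 0.
  have c : {for t, continuous (fun s => N 1 0 * s + N 1 1)} := cdiff_cont (cdiff_affine _ _ _).
  have FF : Filter (nbhs (t : C)) by exact: nbhs_filter.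
  have e0 : 0 < cn (N 1 0 * t + N 1 1) by rewrite cn_gt0.
  move/cvg_cn : c => /(_ _ e0); apply: filterS => s; apply: contraTneq => ->.
  by rewrite sub0r cnN ltxx.
split; first by apply: filterS near0 => s /E ->.
have [c0|c0] := eqVneq (N 1 0) 0.
  exists (N 0 0 / N 1 1); apply: cdiff_near (cdiff_affine _ (N 0 1 / N 1 1) _).
  apply: filterS near0 => s /[dup] s0 /E -> /=; rewrite c0 mul0r add0r in s0 *.
  by rewrite mulrDl mulrAC.
pose b := - mdet N / N 1 0.
have := cdiff_comp (@cdiff_comp _ (fun s => N 1 0 * s + N 1 1) (fun z => z^-1) t _ _
  (cdiff_affine _ _ _) (cdiff_inv t0)) (cdiff_affine b (N 0 0 / N 1 0) _).
move=> H; eexists; apply: cdiff_near H; apply: filterS near0 => s /[dup] s0 /E -> /=.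
by rewrite /b /mdet; field; rewrite s0 c0.
Qed.

Lemma continuous_Some_mobius N : mdet N != 0 -> continuous (fun t : C => mobius N (Some t)).
Proof.
move=> dN t; apply: (@cf_comp C P P (fun t : C => Some t : P) (mobius N)).
  exact: one_point_compactification_some_continuous.
exact: mobius_continuous.
Qed.

Definition conjP x : P := if x is Some z then Some z^*%C else None.

Lemma conjPK x : conjP (conjP x) = x. Proof. by case: x => //= z; rewrite conjcK. Qed.

Lemma conjP_mobius S x : chart_mx S -> conjP (mobius S x) = mobius S (conjP x).
Proof.
move=> [->|->]; first by rewrite !mobius1.
case: x => [z|]; rewrite /conjP ?mobius_swap_None ?rmorph0 // !mobius_swap fmorph_eq0.
by case: eqP => //= _; rewrite fmorphV.
Qed.

Lemma conjP_mobius_conj (M : 'M[C]_2) x :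
  conjP (mobius M x) = mobius (map_mx (@conjc R) M) (conjP x).
Proof.
have ME i j : (map_mx (@conjc R) M) i j = (M i j)^*%C by rewrite mxE.
case: x => [z|]; rewrite /mobius {2}/conjP !ME -?rmorphM -?rmorphD fmorph_eq0.
  by case: ifP => // _; rewrite /conjP rmorphM fmorphV.
by case: ifP => // _; rewrite /conjP rmorphM fmorphV.
Qed.

Lemma aff_conj x : aff (conjP x) = (aff x)^*%C.
Proof. by case: x => //; rewrite /aff /conjP rmorph0. Qed.

Lemma conjP_None x : (conjP x = None) <-> (x = None). Proof. by case: x. Qed.

Lemma chordal_conjP x y : chordal (conjP x) (conjP y) = chordal x y.
Proof. by case: x y => [z|] [w|]; rewrite /chordal /conjP -?rmorphB ?cn_conj. Qed.

Lemma conjP_continuous : continuous conjP.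
Proof.
move=> x; have FF : Filter (nbhs x) by exact: nbhs_filter.
apply/cvg_chordal => e e0; apply/nbhs_P; exists e => // y.
by rewrite chordal_conjP.
Qed.

(** The inverse of an injective holomorphic map is continuous by invariance of domain,
    and differentiable because the derivative does not vanish. *)
Lemma inverse_cdiff (f : C -> C) (z : C) (r : R) : 0 < r ->
  (forall w, cn (w - z) <= r -> exists a, cdiff f w a) ->
  (forall w v, cn (w - z) <= r -> cn (v - z) <= r -> f w = f v -> w = v) ->
  exists j, [/\ j (f z) = z, \forall s \near f z, f (j s) = s &
    exists a, cdiff j (f z) a].
Proof.
move=> r0 df fI; have cf w : cn (w - z) <= r -> {for w, continuous f} by move=> /df [a /cdiff_cont].
have zr : cn (z - z) <= r by rewrite subrr cn0 ltW.
pose j s := xget z [set w | cn (w - z) <= r /\ f w = s].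
have jE w : cn (w - z) <= r -> j (f w) = w.
  by move=> wr; rewrite /j; case: xgetP => [v _ [vr /fI]|/(_ w)[]] //; apply.
have open e : 0 < e -> e <= r -> exists2 d : R, 0 < d & forall s, cn (s - f z) < d ->
    cn (j s - z) <= e /\ f (j s) = s.
  move=> e0 er; have le w : cn (w - z) <= e -> cn (w - z) <= r by move=> /le_trans; apply.
  have [||d d0 dP] := @invariance_of_domain _ f z e e0.
  - by move=> w /le; exact: cf.
  - by move=> w v /le wr /le; exact: fI.
  by exists d => // s /dP [w we <-]; rewrite jE //; exact: le.
have near_j : \forall s \near f z, f (j s) = s.
  have [d d0 dP] := open r r0 (lexx _); apply/nbhs_cn; exists d => // s /dP [] //.
exists j; split=> //; first exact: jE.
have cj : {for f z, continuous j}.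
  have FF : Filter (nbhs (f z : C)) by exact: nbhs_filter.
  apply/cvg_cn => e e0; rewrite jE //.
  have e1 : 0 < Num.min (e / 2) r by rewrite lt_min divr_gt0.
  have [|d d0 dP] := open _ e1; first by rewrite ge_min lexx orbT.
  apply/nbhs_cn; exists d => // s /dP [h _]; apply: le_lt_trans h _.
  by rewrite gt_min; apply/orP; left; lra.
have [b db] := df z zr.
exists (1 / b); apply: (@cdiff_solve _ (fun s => s) f j) near_j => //; last first.
- exact: cdiff_id.
- by rewrite jE.
apply/eqP => b0.
pose h w := f (w + z) - f z.
have dh w a : cdiff f (w + z) a -> cdiff h w a.
  move=> da e /da [d d0 dP]; exists d => // v vd.
  have E : v - w = v + z - (w + z) by ring.
  have := dP (v + z); rewrite -E => /(_ vd); rewrite /h.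
  by rewrite (_ : f (v + z) - f z - (f (w + z) - f z) = f (v + z) - f (w + z)); last by ring.
apply: (@injective_derivative0 R h r r0).
- move=> w wr; have [|a da] := df (w + z); first by rewrite addrK.
  by exists a; exact: dh.
- move=> w v wr vr /(addIr _) /fI wv; apply: (addIr z); apply: wv; by rewrite addrK.
- by rewrite /h add0r subrr.
- by apply: dh; rewrite add0r -b0.
Qed.

End projective_charts.

Section descent.
Context {R : realType}.
Local Notation C := R[i].
Local Notation cn := (@ComplexField.Normc.normc R).
Local Notation P := (P1 R).

Section one_surface.
Context {g : nat} {rho : schottky R g} {X : riemann_surface R} {p : P -> X}.
Hypothesis pU : uniformizes rho p.
Local Notation Om := (domain_of_discontinuity rho).

Lemma cdiff_uniformizing x S (d : chart R X) : Om x -> chart_mx S -> mobius S x <> None ->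
  rs_atlas d -> d.1 (p x) -> exists a, cdiff (fun t => d.2 (p (mobius S (Some t)))) (aff (mobius S x)) a.
Proof.
move=> Ox cS Sx Ad dx; have [hp _ _] := pU; have [_ hol] := hp x Ox.
have [f [/nbhs_singleton hf nf]] := hol _ d (P1_chart_atlas cS) Sx Ad dx.
have [a da] := (derivable_cdiff _ _).1 hf; exists a; apply: cdiff_near da.
have sx : mobius S (Some (aff (mobius S x))) = x by rewrite Some_aff // chart_mxK.
have := @continuous_Some_mobius R S (chart_mx_det cS) (aff (mobius S x)).
rewrite /continuous_at sx => /(_ _ nf) nf'.
have {nf'} : \forall t \near aff (mobius S x), d.2 (p (mobius S (Some t))) =
  f (aff (mobius S (mobius S (Some t)))) := nf'.
by apply: filterS => t ->; rewrite chart_mxK.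
Qed.

(** In the charts, [M] is a Möbius transformation of the plane, and the chain rule
    applies. *)
Lemma cdiff_uniformizing_mobius M x S (d : chart R X) : mdet M != 0 ->
  Om (mobius M x) -> chart_mx S -> mobius S x <> None -> rs_atlas d -> d.1 (p (mobius M x)) ->
  exists a, cdiff (fun t => d.2 (p (mobius M (mobius S (Some t))))) (aff (mobius S x)) a.
Proof.
move=> dM OM cS Sx Ad dx; have [S' cS' S'x] := chart_mx_exists (mobius M x).
have [b db] := cdiff_uniformizing OM cS' S'x Ad dx.
have [dS dS'] := (chart_mx_det cS, chart_mx_det cS').
pose N := S' * M * S.
have NE t : mobius N (Some t) = mobius S' (mobius M (mobius S (Some t))).
  by rewrite /N !mobius_comp.
have sx : mobius S (Some (aff (mobius S x))) = x by rewrite Some_aff // chart_mxK.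
have [||nN [a da]] := @cdiff_mobius R N (aff (mobius S x)).
- by rewrite /N !mdetM !mulf_neq0.
- by rewrite NE sx.
exists (b * a); apply: cdiff_near (@cdiff_comp R (fun s => aff (mobius N (Some s)))
  (fun t => d.2 (p (mobius S' (Some t)))) _ a b da _); last by rewrite NE sx.
by apply: filterS nN => t Nt; rewrite Some_aff // NE chart_mxK.
Qed.

(** In charts, [p] is holomorphic and, by proper discontinuity, injective near [x], so
    [inverse_cdiff] applies. *)
Lemma uniformizing_inverse x S (c : chart R X) : Om x -> chart_mx S -> mobius S x <> None ->
  rs_atlas c -> c.1 (p x) -> exists j : C -> C, [/\ j (c.2 (p x)) = aff (mobius S x),
    exists a, cdiff j (c.2 (p x)) a &
    \forall s \near c.2 (p x), [/\ Om (mobius S (Some (j s))), c.1 (p (mobius S (Some (j s)))) &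
       c.2 (p (mobius S (Some (j s)))) = s]].
Proof.
move=> Ox cS Sx Ac cx; set t0 := aff (mobius S x).
have sx : mobius S (Some t0) = x by rewrite Some_aff // chart_mxK.
pose f t := c.2 (p (mobius S (Some t))).
have [e e0 eP] := locally_injective Ox.
have [oc _ ic _] := rs_chart Ac.
have /nbhs_P [k k0 kP] := p_continuous pU Ox (open_near oc cx).
have cS0 := @continuous_Some_mobius R S (chart_mx_det cS) t0.
rewrite /continuous_at sx in cS0.
have m0 : 0 < Num.min e k by rewrite lt_min e0.
have /cvg_chordal /(_ _ m0) /nbhs_cn [r r0 rP] := cS0.
have ball t : cn (t - t0) <= r / 2 -> [/\ Om (mobius S (Some t)), c.1 (p (mobius S (Some t))) &
    chordal (mobius S (Some t)) x < e].
  move=> tr; have : cn (t - t0) < r by move: tr r0; lra.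
  by move=> /rP; rewrite lt_min => /andP[h1 h2]; split=> //; [exact: (eP _ h1).1|exact: kP].
have r2 : 0 < r / 2 by rewrite divr_gt0.
have [||j [j0 nj [a da]]] := @inverse_cdiff R f t0 (r / 2) r2.
- move=> t /ball [Ot ct _].
  have := cdiff_uniformizing Ot cS _ Ac ct; rewrite chart_mxK //=; exact.
- move=> t s /ball [Ot ct te] /ball [Os cs se].
  move=> /(ic _ _ (mem_set ct) (mem_set cs)) /(p_eq pU Ot Os) [w rw wE].
  have w0 : w = [::] by apply: ((eP _ te).2 w rw); rewrite -wE.
  move: wE; rewrite w0 act_nil => /(mobius_inj (chart_mx_det cS)) [] //.
have f0 : f t0 = c.2 (p x) by rewrite /f sx.
rewrite f0 in j0 nj da; exists j; split=> //; first by exists a.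
have cj : j @ nbhs (c.2 (p x)) --> t0.
  by rewrite -[X in _ --> X]j0; exact: cdiff_cont da.
have FF : Filter (nbhs (c.2 (p x) : C)) by exact: nbhs_filter.
have /cvg_cn /(_ _ r2) nb := cj.
apply: filterS2 nj nb => s fs /ltW /ball [h1 h2 _]; split=> //.
Qed.

End one_surface.

Context {g1 g2 : nat} {rho1 : schottky R g1} {rho2 : schottky R g2}.
Context {X1 X2 : riemann_surface R} {p1 : P -> X1} {p2 : P -> X2}.
Hypotheses (pU1 : uniformizes rho1 p1) (pU2 : uniformizes rho2 p2).
Local Notation Om1 := (domain_of_discontinuity rho1).
Local Notation Om2 := (domain_of_discontinuity rho2).

(** An equivariant map descends to the quotients. [kappa] is the identity or complex
    conjugation. *)
Lemma descend (F : P -> P) (kappa : C -> C) :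
  (forall x, Om1 x -> Om2 (F x)) -> (forall x, Om1 x -> {for x, continuous F}) ->
  (forall w x, reduced w -> Om1 x ->
     exists2 w', reduced w' & F (act rho1 w x) = act rho2 w' (F x)) ->
  (forall x S d, Om1 x -> chart_mx S -> mobius S x <> None -> rs_atlas d -> d.1 (p2 (F x)) ->
     exists a, cdiff (fun t => kappa (d.2 (p2 (F (mobius S (Some t)))))) (aff (mobius S x)) a) ->
  exists h : X1 -> X2, (forall x, Om1 x -> h (p1 x) = p2 (F x)) /\
    forall y, {for y, continuous h} /\ forall c d, rs_atlas c -> c.1 y -> rs_atlas d ->
      d.1 (h y) -> holomorphic_in c.2 (fun y => kappa (d.2 (h y))) y.
Proof.
move=> OF cF eF dF; have [_ surj1 _] := pU1.
pose lift (y : X1) : P := xget None [set x | Om1 x /\ p1 x = y].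
pose h y := p2 (F (lift y)).
have hE x : Om1 x -> h (p1 x) = p2 (F x).
  move=> Ox; rewrite /h /lift; case: xgetP => [x' _ [Ox' px']|/(_ x)[]] //.
  have [w rw xE] := (p_eq pU1 Ox' Ox).1 px'.
  have [w' rw' FE] := eF w x' rw Ox'.
  by apply/(p_eq pU2); [exact: OF|exact: OF|exists w' => //; rewrite xE FE].
have hC y : {for y, continuous h}.
  have [x Ox <-] : (p1 @` Om1) y by rewrite surj1.
  have cc : {for x, continuous (fun x => p2 (F x))}.
    by apply: (@cf_comp P P X2 F p2); [exact: cF|exact: (p_continuous pU2 (OF _ Ox))].
  move=> U; rewrite /= (hE x Ox) => /cc /nbhs_P [e e0 eP].
  have := p_open pU1 Ox e0; apply: filterS => _ [x' [Ox' xe] <-].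
  by rewrite /= hE //; exact: eP.
exists h; split=> // y; split=> // c d Ac cy Ad dy.
have [oc _ ic imc] := rs_chart Ac; have [od _ _ _] := rs_chart Ad.
pose q s : X1 := xget y [set y' | c.1 y' /\ c.2 y' = s].
have qE y' : c.1 y' -> q (c.2 y') = y'.
  move=> cy'; rewrite /q; case: xgetP => [z _ [cz /(ic _ _ (mem_set cz) (mem_set cy'))]|/(_ y')[]] //.
pose k s := kappa (d.2 (h (q s))).
have dk y' : c.1 y' -> d.1 (h y') -> derivable k (c.2 y') 1.
  move=> cy' dy'; apply/derivable_cdiff.
  have [x Ox xy'] : (p1 @` Om1) y' by rewrite surj1.
  rewrite -xy' in cy' dy' *.
  have [S cS Sx] := chart_mx_exists x.
  have [j [j0 [a da] nj]] := uniformizing_inverse pU1 Ox cS Sx Ac cy'.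
  rewrite (hE x Ox) in dy'.
  have [b db] := dF x S d Ox cS Sx Ad dy'.
  exists (b * a); rewrite -j0 in db.
  apply: cdiff_near (cdiff_comp da db).
  by apply: filterS nj => s [Os cs sE]; rewrite /k -{1}sE qE // hE.
exists k; split; last first.
  by have := open_near oc cy; apply: filterS => y' cy'; rewrite /k qE.
pose V := c.1 `&` h @^-1` d.1.
have oV : open V.
  by apply: openI => //; apply: open_comp => // y' _; exact: hC.
have /open_near : open (c.2 @` V) by apply: imc => // y' [].
move=> /(_ (c.2 y)) H; have : nbhs (c.2 y) (c.2 @` V) by apply: H; exists y.
by apply: filterS => _ [y' [cy' dy'] <-]; exact: dk.
Qed.

End descent.

Section equivalences.
Context {R : realType} {g : nat} {rho1 rho2 : schottky R g}.
Context {X1 X2 : riemann_surface R} {p1 : P1 R -> X1} {p2 : P1 R -> X2}.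
Hypotheses (pU1 : uniformizes rho1 p1) (pU2 : uniformizes rho2 p2).
Local Notation C := R[i].
Local Notation P := (P1 R).
Local Notation Om1 := (domain_of_discontinuity rho1).
Local Notation Om2 := (domain_of_discontinuity rho2).

Lemma conformal_of_mobius (M : 'M[C]_2) : mdet M != 0 ->
  (forall x, Om1 x <-> Om2 (mobius M x)) ->
  (forall w x, reduced w -> mobius M (act rho1 w x) = act rho2 w (mobius M x)) ->
  conformally_equivalent X1 X2.
Proof.
move=> dM OM eM; have dA : mdet (madj M) != 0 by rewrite mdet_adj.
have OA x : Om2 x <-> Om1 (mobius (madj M) x) by rewrite OM mobius_Kadj.
have eA w x : reduced w -> mobius (madj M) (act rho2 w x) = act rho1 w (mobius (madj M) x).
  by move=> rw; apply: (mobius_inj dM); rewrite eM // !mobius_Kadj.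
have [h [hE hP]] := descend pU1 pU2 (fun x => (OM x).1) (fun x _ => @mobius_continuous R M dM x)
  (fun w x rw _ => ex_intro2 _ _ w rw (eM w x rw))
  (fun x S d Ox cS Sx Ad dx => cdiff_uniformizing_mobius pU2 dM ((OM x).1 Ox) cS Sx Ad dx) (kappa := id).
have [k [kE kP]] := descend pU2 pU1 (fun x => (OA x).1) (fun x _ => @mobius_continuous R _ dA x)
  (fun w x rw _ => ex_intro2 _ _ w rw (eA w x rw))
  (fun x S d Ox cS Sx Ad dx => cdiff_uniformizing_mobius pU1 dA ((OA x).1 Ox) cS Sx Ad dx) (kappa := id).
have [_ s1 _] := pU1; have [_ s2 _] := pU2.
exists h, k; split.
- move=> y; have [x Ox <-] : (p1 @` Om1) y by rewrite s1.
  by rewrite hE // kE ?mobius_adjK //; apply/OM.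
- move=> y; have [x Ox <-] : (p2 @` Om2) y by rewrite s2.
  by rewrite kE // hE ?mobius_Kadj //; apply/OA.
- by move=> y _; have [] := hP y.
- by move=> y _; have [] := kP y.
Qed.

Lemma anticonformal_of_mobius (M : 'M[C]_2) : mdet M != 0 ->
  (forall x, Om1 x <-> Om2 (mobius M (conjP x))) ->
  (forall w x, reduced w -> mobius M (conjP (act rho1 w x)) = act rho2 w (mobius M (conjP x))) ->
  anticonformally_equivalent X1 X2.
Proof.
move=> dM OM eM; have dA : mdet (madj M) != 0 by rewrite mdet_adj.
pose F x := mobius M (conjP x); pose G x := conjP (mobius (madj M) x).
have FK x : G (F x) = x by rewrite /F /G mobius_adjK // conjPK.
have GK x : F (G x) = x by rewrite /F /G conjPK mobius_Kadj.
have OG x : Om2 x <-> Om1 (G x) by rewrite OM -/(F _) GK.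
have eG w x : reduced w -> G (act rho2 w x) = act rho1 w (G x).
  by move=> rw; rewrite -[RHS]FK; congr G; rewrite /F eM // -/(F _) GK.
have cF x : {for x, continuous F}.
  by apply: (@cf_comp P P P conjP (mobius M)); [exact: conjP_continuous|exact: mobius_continuous].
have cG x : {for x, continuous G}.
  by apply: (@cf_comp P P P (mobius (madj M)) conjP); [exact: mobius_continuous|exact: conjP_continuous].
(* [conjP] conjugates the Möbius transformation [N] to that of the conjugate matrix *)
pose N := map_mx (@conjc R) (madj M).
have dN : mdet N != 0.
  by rewrite /mdet !mxE -!rmorphM -rmorphB fmorph_eq0; have := dA; rewrite /mdet !mxE.
have GE x : G x = mobius N (conjP x) by rewrite /G conjP_mobius_conj.
have dconj (N' : 'M[C]_2) (rho : schottky R g) (X : riemann_surface R) (p : P -> X)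
    (pU : uniformizes rho p) x S (d : chart R X) : mdet N' != 0 ->
    domain_of_discontinuity rho (mobius N' (conjP x)) -> chart_mx S -> mobius S x <> None ->
    rs_atlas d -> d.1 (p (mobius N' (conjP x))) ->
    exists a, cdiff (fun t => (d.2 (p (mobius N' (conjP (mobius S (Some t))))))^*%C) (aff (mobius S x)) a.
  move=> dN' Ox cS Sx Ad dx.
  have Sx' : mobius S (conjP x) <> None by rewrite -conjP_mobius // conjP_None.
  have [a /cdiff_conj da] := cdiff_uniformizing_mobius pU dN' Ox cS Sx' Ad dx.
  exists a^*%C; move: da; rewrite -conjP_mobius // aff_conj conjcK.
  by apply: cdiff_near; apply: near_all => t; rewrite conjP_mobius.
have [h [hE hP]] := descend pU1 pU2 (fun x => (OM x).1) (fun x _ => cF x)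
  (fun w x rw _ => ex_intro2 _ _ w rw (eM w x rw))
  (fun x S d Ox cS Sx Ad dx => dconj M rho2 X2 p2 pU2 x S d dM ((OM x).1 Ox) cS Sx Ad dx) (kappa := @conjc R).
have GF : G = fun x => mobius N (conjP x) by apply/funext.
rewrite GF in OG eG cG FK GK.
have [k [kE kP]] := descend pU2 pU1 (fun x => (OG x).1) (fun x _ => cG x)
  (fun w x rw _ => ex_intro2 _ _ w rw (eG w x rw))
  (fun x S d Ox cS Sx Ad dx => dconj N rho1 X1 p1 pU1 x S d dN ((OG x).1 Ox) cS Sx Ad dx) (kappa := @conjc R).
have [_ s1 _] := pU1; have [_ s2 _] := pU2.
exists h, k; split.
- move=> y; have [x Ox <-] : (p1 @` Om1) y by rewrite s1.
  by rewrite hE // kE ?FK //; apply/OM.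
- move=> y; have [x Ox <-] : (p2 @` Om2) y by rewrite s2.
  by rewrite kE // hE; [congr p2; exact: GK|exact: (OG x).1].
- by move=> y _; have [] := hP y.
- by move=> y _; have [] := kP y.
Qed.

End equivalences.

(** * The action of the group on its ends *)

Section infinite_words.
Variable g : nat.
Hypothesis g2 : (1 < g)%N.
Local Notation letter := (letter g).
Implicit Types (a b c : letter) (w : seq letter) (v : nat -> letter).

Definition scons a v : nat -> letter := fun n => if n is m.+1 then v m else a.
Definition stail v : nat -> letter := fun n => v n.+1.

(** The left action of the free group on its ends. *)
Definition lmul a v : nat -> letter := if v 0%N == linv a then stail v else scons a v.

Lemma reduced_inf_tail v : reduced_inf v -> reduced_inf (stail v).
Proof. by move=> rv n; exact: rv. Qed.

Lemma reduced_inf_cons a v : reduced_inf v -> v 0%N != linv a -> reduced_inf (scons a v).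
Proof. by move=> rv av [|n]; [exact: av|exact: rv]. Qed.

Lemma reduced_inf_lmul a v : reduced_inf v -> reduced_inf (lmul a v).
Proof.
by move=> rv; rewrite /lmul; case: ifPn => h; [exact: reduced_inf_tail|exact: reduced_inf_cons].
Qed.

Lemma scons_tail v : scons (v 0%N) (stail v) = v.
Proof. by apply/funext => -[]. Qed.

Lemma lmulK a v : reduced_inf v -> lmul (linv a) (lmul a v) = v.
Proof.
move=> rv; rewrite {2}/lmul; case: ifPn => [/eqP va|va]; rewrite /lmul linvK.
  rewrite ifN; last by have := rv 0%N; rewrite va linvK.
  by rewrite -va scons_tail.
by rewrite eqxx; apply/funext.
Qed.

Lemma lmulKV a v : reduced_inf v -> lmul a (lmul (linv a) v) = v.
Proof. by move=> rv; rewrite -{1}[a]linvK lmulK. Qed.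

Lemma mkseq_scons a v n : mkseq (scons a v) n.+1 = a :: mkseq v n.
Proof. by rewrite mkseq_shift. Qed.

Lemma prefix_inf_cons a w v : prefix_inf (a :: w) v <-> v 0%N = a /\ prefix_inf w (stail v).
Proof.
rewrite /prefix_inf /= mkseq_shift.
by split=> [[<- e]|[<- e]]; [split=> //; exact: e|congr cons; exact: e].
Qed.

Lemma prefix_inf_scons a w v : prefix_inf (a :: w) (scons a v) <-> prefix_inf w v.
Proof. by rewrite prefix_inf_cons; split=> [[]|]. Qed.

Lemma avoid_letters a b : exists c, c != a /\ c != b.
Proof.
have : (#|[set a; b]%SET| < #|{: letter}|)%N.
  rewrite cards2 card_prod card_ord card_bool; move: g2; case: (a != b) => /=; lia.
move=> lt; have [c] : exists c, c \notin [set a; b]%SET.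
  apply/existsP; apply: contraLR lt; rewrite negb_exists -leqNgt => /forallP all_in.
  by apply: subset_leq_card; apply/fintype.subsetP => c _; have := all_in c; rewrite negbK.
by rewrite !inE negb_or => /andP[ca cb]; exists c.
Qed.

Lemma reduced_inf_const a : reduced_inf (fun=> a).
Proof. by move=> n; rewrite eq_sym linv_neq. Qed.

Lemma extend_word w : reduced w -> exists2 v, reduced_inf v & prefix_inf w v.
Proof.
elim: w => [_|a w IH].
  by exists (fun=> (Ordinal (ltnW g2), false)) => //; exact: reduced_inf_const.
rewrite reduced_cons; case: w IH => [_ _|b w IH /andP[ba rw]].
  by exists (fun=> a); [exact: reduced_inf_const|].
have [v rv pv] := IH rw; exists (scons a v); last exact/prefix_inf_scons.
by apply: reduced_inf_cons => //; have [-> _] := (prefix_inf_cons b w v).1 pv.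
Qed.

End infinite_words.

Section ends.
Context {R : realType} {g : nat} {rho : schottky R g}.
Hypotheses (cc : cocompact_group rho) (g2 : (1 < g)%N).
Variable x0 : P1 R.
Hypothesis Ox0 : domain_of_discontinuity rho x0.
Local Notation P := (P1 R).
Local Notation letter := (letter g).
Local Notation act := (act rho).
Local Notation Lam := (limit_set rho).
Local Notation io := (end_point rho x0).
Local Notation sh := (shadow rho x0).
Implicit Types (a b c : letter) (w : seq letter) (v : nat -> letter).

Lemma end_cvg v : reduced_inf v -> act (mkseq v n) x0 @[n --> \oo] --> io v.
Proof. by have [K [cK KO Kc]] := cc; exact: (end_point_cvg cK KO Kc Ox0). Qed.

Lemma end_limit v : reduced_inf v -> Lam (io v).
Proof. by have [K [cK KO Kc]] := cc; exact: (end_point_limit cK KO Kc Ox0). Qed.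

Lemma end_inj v v' : reduced_inf v -> reduced_inf v' -> io v = io v' -> v = v'.
Proof. by have [K [cK KO Kc]] := cc; exact: (end_point_inj cK KO Kc Ox0). Qed.

Lemma end_surj y : Lam y -> exists2 v, reduced_inf v & y = io v.
Proof. by have [K [cK KO Kc]] := cc; exact: (limit_end_point cK KO Kc Ox0). Qed.

Lemma closed_shadow w : reduced w -> closed (sh w).
Proof. by have [K [cK KO Kc]] := cc; exact: (shadow_closed cK KO Kc Ox0). Qed.

Lemma closed_shadowC w : reduced w -> closed (Lam `\` sh w).
Proof. by have [K [cK KO Kc]] := cc; exact: (shadow_compl_closed cK KO Kc Ox0). Qed.

Lemma small_shadow (e : R) : 0 < e -> exists N, forall w, reduced w -> (N <= size w)%N ->
  forall x y, sh w x -> sh w y -> chordal x y < e.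
Proof. by have [K [cK KO Kc]] := cc; exact: (shadow_small cK KO Kc Ox0). Qed.

Lemma shadow_prefix w v : reduced_inf v -> sh w (io v) <-> prefix_inf w v.
Proof.
move=> rv; split; last by move=> pv; exists v.
by move=> [v' [rv' pv'] e]; rewrite -(end_inj rv' rv e).
Qed.

Lemma shadow_end w y : sh w y -> exists v, [/\ reduced_inf v, prefix_inf w v & y = io v].
Proof. by move=> [v [rv pv] <-]; exists v. Qed.

Lemma shadow_limit w : sh w `<=` Lam.
Proof. by move=> _ [v [rv _] <-]; exact: end_limit. Qed.

Lemma shadow_nil : sh [::] = Lam.
Proof.
apply/seteqP; split; first exact: shadow_limit.
by move=> y /end_surj [v rv ->]; exists v.
Qed.

Lemma shadow_mkseq v n : reduced_inf v -> sh (mkseq v n) (io v).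
Proof. by move=> rv; apply/shadow_prefix => //; exact: prefix_inf_mkseq. Qed.

Lemma shadow_inj w w' y : size w = size w' -> sh w y -> sh w' y -> w = w'.
Proof.
move=> sw /shadow_end [v [rv pv ->]] /shadow_prefix -/(_ rv) pv'.
by rewrite pv pv' sw.
Qed.

Lemma shadow_nonempty w : reduced w -> exists y, sh w y.
Proof. by move=> /(extend_word g2) [v rv pv]; exists (io v), v. Qed.

(** Both sides are limits of the same orbit, up to a shift of the index. The identification
    of the ends with the limit set is thus equivariant. *)
Lemma act_end a v : reduced_inf v -> act [:: a] (io v) = io (lmul a v).
Proof.
move=> rv; have rl := reduced_inf_lmul a rv.
have c1 : (fun n => act [:: a] (act (mkseq v n.+1) x0)) @ \oo --> act [:: a] (io v).
  apply: (cvg_comp (fun n => act (mkseq v n.+1) x0) (act [:: a])); last exact: act_continuous.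
  by have := end_cvg rv; rewrite -(cvg_shiftS _).
have E n : act [:: a] (act (mkseq v n.+1) x0) =
    act (mkseq (lmul a v) (if v 0%N == linv a then n else n.+2)) x0.
  rewrite -act_cat /= /lmul; case: ifPn => va.
    rewrite mkseq_shift -act_red /= (eqP va).
    rewrite -/(stail v) red_id; last exact/reduced_mkseq/reduced_inf_tail.
    rewrite /cred; case E : (mkseq (stail v) n) => [|b s]; first by rewrite eqxx.
    rewrite ifN ?eqxx // linvK; have := reduced_mkseq n.+1 rv.
    by rewrite mkseq_shift -/(stail v) E reduced_cons (eqP va) linvK => /andP[].
  by rewrite mkseq_scons.
have c2 : (fun n => act [:: a] (act (mkseq v n.+1) x0)) @ \oo --> io (lmul a v).
  rewrite (_ : (fun n => _) = fun n => act (mkseq (lmul a v)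
     (if v 0%N == linv a then n else n.+2)) x0); last by apply/funext.
  have := end_cvg rl; case: (v 0%N == linv a) => //.
  rewrite -(cvg_shiftS _) -(cvg_shiftS _) //.
exact: (cvg_unique (@P1_hausdorff R) c1 c2).
Qed.

Lemma act_shadow_cons a w : (if w is b :: _ then b != linv a else false) ->
  act [:: a] @` sh w = sh (a :: w).
Proof.
case: w => // b w ba; apply/seteqP; split.
  move=> _ [_ [v [rv pv] <-] <-]; rewrite act_end // /lmul.
  have [v0 _] := (prefix_inf_cons b w v).1 pv.
  rewrite v0 (negbTE ba); exists (scons a v) => //.
  by split; [apply: reduced_inf_cons; rewrite ?v0|apply/prefix_inf_scons].
move=> _ [v [rv /prefix_inf_cons [va pv]] <-].
have rt := reduced_inf_tail rv; exists (io (stail v)); first by exists (stail v).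
have [v1 _] := (prefix_inf_cons _ _ _).1 pv.
by rewrite act_end // /lmul v1 (negbTE ba) -va scons_tail.
Qed.

Lemma act_letterK a x : act [:: linv a] (act [:: a] x) = x.
Proof. by rewrite -act_cat -act_red /= linvK eqxx act_nil. Qed.

Lemma act_shadow_tail a w : w <> [::] -> reduced (a :: w) ->
  act [:: linv a] @` sh (a :: w) = sh w.
Proof.
case: w => // b w _ raw; rewrite -act_shadow_cons; last by move: raw; rewrite reduced_cons => /andP[].
apply/seteqP; split=> [_ [_ [x xw <-] <-]|x xw]; first by rewrite act_letterK.
by exists (act [:: a] x); [exists x|rewrite act_letterK].
Qed.

(** An infinite word that starts with [a] becomes one that does not start with its
    inverse. *)
Lemma act_shadow_letter a : act [:: linv a] @` sh [:: a] = Lam `\` sh [:: linv a].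
Proof.
apply/seteqP; split.
  move=> _ [_ [v [rv /prefix_inf_cons [va _]] <-] <-].
  have rl := reduced_inf_lmul (linv a) rv.
  rewrite act_end //; split; first exact: end_limit.
  move=> /shadow_prefix -/(_ rl) /prefix_inf_cons [].
  rewrite /lmul linvK va eqxx /stail => v1 _.
  by have := rv 0%N; rewrite va v1 eqxx.
move=> _ [/end_surj [v rv ->] nv].
have va : v 0%N != linv a.
  by apply/eqP => va; apply: nv; apply/shadow_prefix => //; apply/prefix_inf_cons.
have rl := reduced_inf_cons rv va.
exists (io (scons a v)).
  by exists (scons a v) => //; split=> //; apply/prefix_inf_cons.
by rewrite act_end // /lmul /= linvK eqxx; congr io; apply/funext.
Qed.

Definition wmul w v := foldr (@lmul g) v w.

Lemma reduced_inf_wmul w v : reduced_inf v -> reduced_inf (wmul w v).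
Proof. by move=> rv; elim: w => //= a w IH; exact: reduced_inf_lmul. Qed.

Lemma act_word_end w v : reduced_inf v -> act w (io v) = io (wmul w v).
Proof.
move=> rv; elim: w => [|a w IH]; first by rewrite act_nil.
by rewrite -cat1s act_cat IH act_end //; exact: reduced_inf_wmul.
Qed.

End ends.

(** * The conformal measure of shadows *)

Section spherical_derivative.
Context {R : realType}.
Local Notation C := R[i].
Local Notation cn := (@ComplexField.Normc.normc R).
Local Notation P := (P1 R).
Implicit Types (M : 'M[C]_2) (x y : P).

Lemma continuous_sD M : mdet M != 0 -> continuous (sD M).
Proof.
move=> dM x; have [p px] := other_point x; have spos y := sD_gt0 y dM.
have cd : {for x, continuous (fun y => chordal y p)} := @continuous_chordal R p x.
have np : \forall y \near x, 0 < chordal y p.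
  by apply: (cd [set t | 0 < t]); apply: lt_nbhsr; rewrite chordal_sym.
apply: (@cf_near _ _ _ (fun y => chordal (mobius M y) (mobius M p) / (sD M p * chordal y p))).
  apply: filterS np => y yp; rewrite chordal_mobius //; field.
  by rewrite !lt0r_neq0.
apply: (@cfM P R (fun y => chordal (mobius M y) (mobius M p)) (fun y => (sD M p * chordal y p)^-1)).
  apply: (@cf_comp P P R (mobius M) (fun z => chordal z (mobius M p))); first exact: mobius_continuous.
  exact: continuous_chordal.
apply: (@cfV P R (fun y => sD M p * chordal y p)).
  by rewrite mulf_neq0 ?lt0r_neq0 // chordal_sym.
by apply: (@cfM P R (fun=> sD M p) (fun y => chordal y p)); first exact: cfc.
Qed.

(** The sphere has no isolated points, so the limit in the conformal derivative makes
    sense. *)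
Lemma P1_dnbhs_proper x : ProperFilter x^'.
Proof.
have FF : Filter (nbhs x) by exact: nbhs_filter.
have FD : Filter x^' by exact: dnbhs_filter.
apply: Build_ProperFilter => /nbhs_P [e e0 eP].
have := @coord_continuous R x 0; rewrite /continuous_at coord0 => /cvg_chordal /(_ e e0).
move=> /nbhs_cn [d d0 dP].
have dd : cn ((d / 2)%:C%C - 0) < d by rewrite subr0 cn_real gtr0_norm ?divr_gt0 //; lra.
apply: (eP _ (dP _ dd)); apply/eqP => E.
have : (d / 2)%:C%C = 0 :> C by apply: (@coord_inj R x); rewrite coord0.
by move/eqP; rewrite -cn_eq0 cn_real normr_eq0 gt_eqF // divr_gt0.
Qed.

(** The difference quotient of chordal distances is [sD M y * sD M x]. *)
Lemma conformal_derivativeE M x : mdet M != 0 ->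
  conformal_derivative (mobius M) x = sD M x ^+ 2.
Proof.
move=> dM; rewrite /conformal_derivative; apply: cvg_lim; first exact: Rhausdorff.
  exact: P1_dnbhs_proper.
have FF : Filter (nbhs x) by exact: nbhs_filter.
have c : sD M y * sD M x @[y --> x^'] --> sD M x ^+ 2.
  rewrite expr2; apply: cvg_within_filter.
  apply: (@cfM P R (sD M) (fun=> sD M x)); [exact: continuous_sD|exact: cfc].
apply: cvg_trans c; apply: near_eq_cvg.
near=> y; have yx : y != x by near: y; exact: nbhs_dnbhs_neq.
by rewrite chordal_mobius // mulfK // gt_eqF // chordal_gt0.
Unshelve. all: by end_near. Qed.

End spherical_derivative.

Section borel_sets.
Context {R : realType}.
Local Notation P := (P1 R).

Lemma measurable_open (E : set P) : open E -> measurable (E : set (borelP1 R)).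
Proof. by move=> oE; exact: sub_sigma_algebra. Qed.

Lemma measurable_closed (E : set P) : closed E -> measurable (E : set (borelP1 R)).
Proof.
move=> cE; rewrite -[E]setCK; apply: (@measurableC _ (borelP1 R)).
by apply: measurable_open; exact: closed_openC.
Qed.

Lemma measurable_continuous (f : P -> R) (D : set (borelP1 R)) : continuous f -> measurable D ->
  measurable_fun D (f : borelP1 R -> R).
Proof.
move=> cf mD; apply: (measurability _ (RGenOpens.measurableE R)).
move=> _ [_ [a [b ->] <-]]; apply: measurableI => //.
by apply: measurable_open; apply: open_comp => [x _|]; [exact: cf|exact: interval_open].
Qed.

End borel_sets.

Lemma cf_powR (R : realType) (X : topologicalType) (f : X -> R) (p : R) (x : X) : 0 < f x ->
  {for x, continuous f} -> {for x, continuous (fun y => f y `^ p)}.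
Proof.
move=> fx cf; apply: (@cf_comp X R R f (fun t => t `^ p) x cf).
have n0 : \forall t \near f x, 0 < t by exact: lt_nbhsr.
apply: (@cf_near _ _ _ (fun t => expR (p * ln t))).
  by apply: filterS n0 => t t0; rewrite /powR gt_eqF.
apply: (@cf_comp R R R (fun t => p * ln t) (@expR R)); last exact: continuous_expR.
by apply: (@cfM R R (fun=> p) (@ln R)); [exact: cfc|exact: continuous_ln].
Qed.

Section conformal_measure.
Context {R : realType} {g : nat} {rho : schottky R g}.
Hypotheses (cc : cocompact_group rho) (g2 : (1 < g)%N).
Variable x0 : P1 R.
Hypothesis Ox0 : domain_of_discontinuity rho x0.
Local Notation P := (P1 R).
Local Notation letter := (letter g).
Local Notation act := (act rho).
Local Notation Lam := (limit_set rho).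
Local Notation io := (end_point rho x0).
Local Notation sh := (shadow rho x0).
Variable mu : probability (borelP1 R) R.
Hypothesis muP : patterson_sullivan rho mu.
Implicit Types (a b c : letter) (w : seq letter) (v : nat -> letter).

Definition dens w (x : P) : R := (sD (wmx rho w) x ^+ 2) `^ hausdorff_dim Lam.

Lemma dens_gt0 w x : 0 < dens w x.
Proof. by rewrite powR_gt0 // exprn_gt0 // sD_gt0 // mdet_wmx. Qed.

Lemma continuous_dens w : continuous (dens w).
Proof.
move=> x; have sp := sD_gt0 x (mdet_wmx rho w).
apply: (@cf_powR R P (fun y => sD (wmx rho w) y ^+ 2)); first by rewrite exprn_gt0.
apply: (@cfM P R (sD (wmx rho w)) (sD (wmx rho w))); apply: continuous_sD; exact: mdet_wmx.
Qed.

Lemma mu_act w (E : set (borelP1 R)) : reduced w -> measurable E ->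
  mu (act w @` E) = (\int[mu]_(x in E) (dens w x)%:E)%E.
Proof.
move=> rw mE; have [_ /(_ w E rw mE) ->] := muP.
by apply: eq_integral => x _; rewrite /dens -conformal_derivativeE // mdet_wmx.
Qed.

Lemma measurable_dens w (D : set (borelP1 R)) : measurable D ->
  measurable_fun D (fun x : borelP1 R => (dens w x)%:E).
Proof.
by move=> mD; apply/measurable_EFinP; apply: measurable_continuous => //; exact: continuous_dens.
Qed.

Lemma mu_act0 w (E : set (borelP1 R)) : reduced w -> measurable E -> mu E = 0%E ->
  mu (act w @` E) = 0%E.
Proof.
by move=> rw mE E0; rewrite mu_act // null_set_integral //; exact: measurable_dens.
Qed.

Lemma measurable_shadow w : reduced w -> measurable (sh w : set (borelP1 R)).
Proof. by move=> rw; apply: measurable_closed; exact: (closed_shadow cc Ox0). Qed.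

Lemma measurable_limit : measurable (Lam : set (borelP1 R)).
Proof. by apply: measurable_closed; exact: limit_closed. Qed.

Definition mass w : R := fine (mu (sh w)).

Lemma massE w : reduced w -> mu (sh w) = (mass w)%:E.
Proof. by move=> rw; rewrite fineK // fin_num_measure //; exact: measurable_shadow. Qed.

Lemma mass_ge0 w : 0 <= mass w.
Proof. by rewrite fine_ge0 // measure_ge0. Qed.

Lemma mu_limitD w : reduced w -> mu (Lam `\` sh w) = (1 - mass w)%:E.
Proof.
move=> rw; have [mL _] := muP.
have E : mu (Lam `\` sh w) = (mu Lam - mu (sh w))%E.
  rewrite (measureD (measurable_limit) (measurable_shadow rw)); last first.
    by apply: le_lt_trans (ltry 1); rewrite -mL.
  congr (_ - _)%E; congr (mu _).
  by apply/seteqP; split=> [x []|x xw] //; split=> //; exact: (shadow_limit cc Ox0 xw).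
by rewrite E massE // mL.
Qed.

Lemma mass_disjoint a b : a != b -> mass [:: a] + mass [:: b] <= 1.
Proof.
move=> ab; rewrite -lee_fin EFinD -!massE // -measureU; [|exact: measurable_shadow|exact: measurable_shadow|].
  by apply: probability_le1; apply: measurableU; exact: measurable_shadow.
apply/seteqP; split=> // x [xa xb]; have [] := shadow_inj cc Ox0 (erefl : size [:: a] = size [:: b]) xa xb.
by move/eqP; rewrite (negbTE ab).
Qed.

(** If the shadow of [a] is null, then the shadow of [a^-1], being the image of its
    complement, has full measure; but its images under two further letters are null. *)
Lemma mass_gt0 w : reduced w -> 0 < mass w.
Proof.
have letter_pos a : mass [:: a] != 0.
  apply/eqP => a0; have ma0 : mu (sh [:: a]) = 0%E by rewrite massE // a0.
  have : mu (Lam `\` sh [:: linv a]) = 0%E.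
    by rewrite -(act_shadow_letter cc Ox0) mu_act0 //; exact: measurable_shadow.
  rewrite mu_limitD // => /(congr1 fine) /= /eqP; rewrite subr_eq0 => /eqP a1.
  have [b [ba bia]] := avoid_letters g2 a (linv a).
  have b0 : mu (sh [:: b]) = 0%E.
    have := mass_disjoint bia; rewrite -a1 massE //.
    by have := mass_ge0 [:: b] => h1 h2; congr EFin; lra.
  have rba : reduced [:: b; linv a]
    by rewrite reduced_cons /= andbT (inj_eq (can_inj (@linvK g))) eq_sym.
  have s0 : mu (sh [:: b; linv a]) = 0%E.
    apply: (subset_measure0 (measurable_shadow rba) (measurable_shadow _) _ b0) => //.
    by move=> _ [v [rv /prefix_inf_cons [vb _]] <-]; exists v => //; split=> //; apply/prefix_inf_cons.
  have : mu (sh [:: linv a]) = 0%E.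
    rewrite -(act_shadow_tail cc Ox0 _ rba) //; apply: mu_act0 => //; exact: measurable_shadow.
  by rewrite massE // -a1 => /eqP; rewrite eqe oner_eq0.
move=> rw; rewrite lt_neqAle mass_ge0 andbT eq_sym; elim: w rw => [|a w IH] rw.
  rewrite /mass (shadow_nil cc Ox0); have [-> _] := muP; exact: oner_neq0.
case: w IH rw => [_ _|b w IH rw]; first exact: letter_pos.
apply/eqP => a0; have : mass (b :: w) != 0 by apply: IH; exact: reduced_behead rw.
have rb := reduced_behead rw.
suff : mu (sh (b :: w)) = 0%E by rewrite massE // => /(congr1 fine) /= ->; rewrite eqxx.
rewrite -(act_shadow_tail cc Ox0 _ rw) //; apply: mu_act0 => //; first exact: measurable_shadow.
by rewrite massE // a0.
Qed.

(** The letter [a] lengthens the address of the shadow by one letter, or cancels its first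
    letter. *)
Lemma act_shadow_mkseq a v n : reduced_inf v -> (1 < n)%N ->
  act [:: a] @` sh (mkseq v n) = sh (mkseq (lmul a v) (if v 0%N == linv a then n.-1 else n.+1)).
Proof.
case: n => [|[|n]] // rv _; rewrite /lmul; case: ifPn => [/eqP va|va].
  rewrite mkseq_shift va -[a in act [:: a]]linvK (act_shadow_tail cc Ox0) //.
  by have := reduced_mkseq n.+2 rv; rewrite mkseq_shift va.
by rewrite mkseq_scons -(act_shadow_cons cc Ox0) // mkseq_shift.
Qed.

Lemma reduced_act_mkseq a v n : reduced_inf v ->
  reduced (mkseq (lmul a v) (if v 0%N == linv a then n.-1 else n.+1)).
Proof. by move=> rv; apply: reduced_mkseq; exact: reduced_inf_lmul. Qed.

(** Conformality gives the mass of the image of a small shadow as the integral of a density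
    that is almost constant on it. Hence the masses of shadows determine the density. *)
Lemma mass_ratio a v (e : R) : reduced_inf v -> 0 < e -> exists N, forall n, (N <= n)%N ->
  `|mass (mkseq (lmul a v) (if v 0%N == linv a then n.-1 else n.+1)) / mass (mkseq v n)
     - dens [:: a] (io v)| <= e.
Proof.
move=> rv e0; set c := dens _ _.
have c0 : 0 < c := dens_gt0 _ _.
have FF : Filter (nbhs (io v)) by exact: nbhs_filter.
have /cvgrPdist_lt /(_ e e0) /nbhs_P [d d0 dP] := @continuous_dens [:: a] (io v).
have [N NP] := small_shadow cc Ox0 d0.
exists (maxn N 2) => n; rewrite geq_max => /andP[Nn n2].
have rn := reduced_mkseq n rv.
have mn := measurable_shadow rn.
set w' := mkseq (lmul a v) _; have rw' : reduced w' := reduced_act_mkseq a n rv.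
have m0 := mass_gt0 rn.
have bnd x : sh (mkseq v n) x -> `|c - dens [:: a] x| < e.
  move=> xn; apply: dP; apply: (NP _ rn) => //; first by rewrite size_mkseq.
  exact: (shadow_mkseq cc Ox0).
have E : mu (sh w') = (\int[mu]_(x in sh (mkseq v n)) (dens [:: a] x)%:E)%E.
  by rewrite -mu_act // act_shadow_mkseq.
have up : mass w' <= (c + e) * mass (mkseq v n).
  rewrite -lee_fin EFinM -!massE // E -integral_cst //.
  apply: ge0_le_integral => //.
  - by move=> x _; rewrite lee_fin ltW // dens_gt0.
  - exact: measurable_dens.
  - by move=> x /bnd; rewrite lee_fin ltr_norml => /andP[h1 h2]; lra.
have low : Num.max 0 (c - e) * mass (mkseq v n) <= mass w'.
  rewrite -lee_fin EFinM -!massE // E -integral_cst //.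
  apply: ge0_le_integral => //.
  - by move=> x _; rewrite lee_fin le_max lexx.
  - exact: measurable_dens.
  - move=> x /bnd; rewrite lee_fin ltr_norml ge_max (ltW (dens_gt0 _ _)) /= => /andP[h1 h2]; lra.
have h1 : mass w' / mass (mkseq v n) <= c + e by rewrite ler_pdivrMr.
have h2 : c - e <= mass w' / mass (mkseq v n).
  by rewrite ler_pdivlMr //; apply: le_trans low; rewrite ler_pM2r // le_max lexx orbT.
rewrite ler_norml; apply/andP; split; lra.
Qed.

Lemma hausdorff_dim_ge0 (E : set P) : 0 <= hausdorff_dim E.
Proof.
rewrite /hausdorff_dim; set S := [set s | _].
have [[s Ss]|S0] := pselect (exists s, S s).
  by apply: lb_le_inf; [exists s|move=> t [/ltW]].
by rewrite (_ : S = set0) ?inf0 //; apply/seteqP; split=> // s Ss; apply: S0; exists s.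
Qed.

(** In dimension [0] the measure would be invariant, and the shadows of a generator and
    of its inverse would together have full measure. *)
Lemma hausdorff_dim_gt0 : 0 < hausdorff_dim Lam.
Proof.
rewrite lt_neqAle hausdorff_dim_ge0 andbT; apply/eqP => d0.
have full a : mass [:: a] + mass [:: linv a] = 1.
  have := mu_limitD (erefl : reduced [:: linv a]).
  rewrite -(act_shadow_letter cc Ox0) mu_act //; last exact: measurable_shadow.
  rewrite (eq_integral (cst 1%E)) => [|x _]; last by rewrite /dens -d0 powRr0.
  rewrite integral_cst ?mul1e ?massE //; last exact: measurable_shadow.
  by move/(congr1 fine) => /=; rewrite -/(mass _) => ->; rewrite subrK.
pose a : letter := (Ordinal (ltnW g2), false).
have [b [ba bia]] := avoid_letters g2 a (linv a).
have := full a; have := mass_gt0 (erefl : reduced [:: b]).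
suff : mass [:: b] + mass [:: linv a] <= 1 - mass [:: a] by lra.
have [mb mia] := (measurable_shadow (erefl : reduced [:: b]), measurable_shadow (erefl : reduced [:: linv a])).
rewrite -lee_fin -mu_limitD // EFinD -!massE // -measureU //; last first.
  apply/seteqP; split=> // x [xb xa].
  have [] := shadow_inj cc Ox0 (erefl : size [:: b] = size [:: linv a]) xb xa.
  by move/eqP; rewrite (negbTE bia).
apply: le_measure; rewrite ?inE; [exact: measurableU| |].
  by apply: measurableD; [exact: measurable_limit|exact: measurable_shadow].
move=> x [xb|xa]; split; try exact: (shadow_limit cc Ox0 xb); try exact: (shadow_limit cc Ox0 xa).
  move=> xa'; have [] := shadow_inj cc Ox0 (erefl : size [:: b] = size [:: a]) xb xa'.
  by move/eqP; rewrite (negbTE ba).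
move=> xa'; have [] := shadow_inj cc Ox0 (erefl : size [:: linv a] = size [:: a]) xa xa'.
by [].
Qed.

End conformal_measure.

(** * Two limit sets with the same measure of shadows *)

Section transport_of_ends.
Variable g : nat.
Local Notation letter := (letter g).
Implicit Types (a b c : letter) (w : seq letter) (u v z : nat -> letter).

Lemma wmul_cat w w' v : wmul (w ++ w') v = wmul w (wmul w' v).
Proof. by rewrite /wmul foldr_cat. Qed.

Lemma wmulKV w v : reduced_inf v -> wmul w (wmul (winv w) v) = v.
Proof.
elim: w v => [|a w IH] v rv //; rewrite winv_cons -cats1 wmul_cat /=.
by rewrite IH ?lmulKV //; exact: reduced_inf_lmul.
Qed.

Lemma wmul_prefix w z : reduced_inf z -> reduced (rcons w (z 0%N)) ->
  prefix_inf (rcons w (z 0%N)) (wmul w z).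
Proof.
move=> rz; elim: w => [//|a w IH] /=.
rewrite [rcons _ _]/= -/(reduced (a :: rcons w (z 0%N))) reduced_cons => /andP[h rw].
have := IH rw; set t := wmul w z; case E : (rcons w (z 0%N)) h => [|b w'].
  by case: (w) E.
move=> ba pt; have tb : t 0%N = b by have /prefix_inf_cons [] := pt.
by rewrite /lmul tb (negbTE ba) prefix_inf_scons.
Qed.

Lemma wmul_prefixl w z : reduced_inf z -> reduced (rcons w (z 0%N)) -> prefix_inf w (wmul w z).
Proof.
move=> rz rw; have := wmul_prefix rz rw; rewrite /prefix_inf size_rcons mkseqS.
by move=> /eqP; rewrite eqseq_rcons => /andP[/eqP].
Qed.

Lemma winv_mkseqS u n : winv (mkseq u n.+1) = linv (u n) :: winv (mkseq u n).
Proof. by rewrite mkseqS /winv map_rcons rev_rcons. Qed.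

(** Removing from [v] the initial word of another infinite word [u] leaves, past the
    common part, a word that starts with the inverse of the last removed letter. *)
Lemma quotient_head u v : reduced_inf u -> u <> v ->
  exists N, forall n, (N <= n)%N -> wmul (winv (mkseq u n.+1)) v 0%N = linv (u n).
Proof.
move=> ru uv; have [m [um mP]] : exists m, u m != v m /\ forall k, (k < m)%N -> u k = v k.
  have ex : exists k, u k != v k.
    apply: contrapT => nk; apply: uv; apply/funext => k; apply/eqP/negPn/negP => h.
    by apply: nk; exists k.
  exists (ex_minn ex); case: ex_minnP => m um mm; split=> // k km.
  by apply/eqP/negPn/negP => /mm; rewrite leqNgt km.
have H n : (n <= m)%N -> wmul (winv (mkseq u n)) v = fun k => v (n + k)%N.
  elim: n => [//|n IH] nm; rewrite winv_mkseqS [LHS]/= -/(wmul _ v) IH ?(ltnW nm) //.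
  rewrite /lmul linvK addn0 -(mP n nm) eqxx; apply/funext => k.
  by rewrite /stail addnS addSn.
have step n : wmul (winv (mkseq u n)) v 0%N != u n -> wmul (winv (mkseq u n.+1)) v 0%N = linv (u n).
  move=> h; rewrite winv_mkseqS [in LHS]/= -/(wmul _ v) /lmul linvK.
  by rewrite (negbTE h).
exists m; elim=> [|n IH].
  by rewrite leqn0 => /eqP m0; apply: step; subst m; rewrite H //= eq_sym.
rewrite leq_eqVlt => /orP[/eqP m0|mn]; apply: step.
  by rewrite -m0 H // addn0 eq_sym.
by rewrite (IH mn) eq_sym ru.
Qed.

End transport_of_ends.

Section rigidity.
Context {R : realType} {g : nat} {rho1 rho2 : schottky R g}.
Hypotheses (cc1 : cocompact_group rho1) (cc2 : cocompact_group rho2) (g2 : (1 < g)%N).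
Variables (x1 x2 : P1 R).
Hypotheses (Ox1 : domain_of_discontinuity rho1 x1) (Ox2 : domain_of_discontinuity rho2 x2).
Variables (mu1 mu2 : probability (borelP1 R) R).
Hypotheses (muP1 : patterson_sullivan rho1 mu1) (muP2 : patterson_sullivan rho2 mu2).
Local Notation letter := (letter g).
Local Notation io1 := (end_point rho1 x1).
Local Notation io2 := (end_point rho2 x2).
Local Notation d1 := (hausdorff_dim (limit_set rho1)).
Local Notation d2 := (hausdorff_dim (limit_set rho2)).
Implicit Types (a b c : letter) (w : seq letter) (u v z : nat -> letter).

Hypothesis same_mass : forall w, reduced w -> mass (rho := rho1) x1 mu1 w = mass (rho := rho2) x2 mu2 w.

(** The two densities are limits of the same quotients of masses. *)
Lemma same_density a v : reduced_inf v -> dens (rho := rho1) [:: a] (io1 v) = dens (rho := rho2) [:: a] (io2 v).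
Proof.
move=> rv; apply/eqP; rewrite -subr_eq0 -normr_eq0; apply/negPn/negP => ne.
set d := `|_| in ne; have d0 : 0 < d by rewrite lt_neqAle eq_sym ne normr_ge0.
have e0 : 0 < d / 3 by rewrite divr_gt0.
have [N1 H1] := mass_ratio cc1 g2 Ox1 muP1 a rv e0.
have [N2 H2] := mass_ratio cc2 g2 Ox2 muP2 a rv e0.
have := H1 _ (leq_maxl N1 N2); have := H2 _ (leq_maxr N1 N2).
rewrite !same_mass; [|exact: reduced_mkseq|exact: reduced_act_mkseq].
set q := _ / _ => h2 h1; have : d <= d / 3 + d / 3.
  apply: le_trans (lerD h1 h2); rewrite -[X in _ <= X + _]normrN opprB.
  by apply: le_trans (ler_normD _ _); rewrite addrA subrK.
by have := d0; lra.
Qed.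

Lemma densE (rho : schottky R g) w x :
  dens (rho := rho) w x = (sD (wmx rho w) x `^ hausdorff_dim (limit_set rho)) ^+ 2.
Proof.
have s0 : 0 <= sD (wmx rho w) x by rewrite ltW // sD_gt0 // mdet_wmx.
by rewrite /dens expr2 (powRM _ s0 s0) expr2.
Qed.

Lemma same_sD a v : reduced_inf v ->
  sD (wmx rho1 [:: a]) (io1 v) `^ d1 = sD (wmx rho2 [:: a]) (io2 v) `^ d2.
Proof.
move=> rv; have sq (x y : R) : 0 <= x -> 0 <= y -> x ^+ 2 = y ^+ 2 -> x = y.
  by move=> x0 y0 /eqP; rewrite eqrXn2 // => /eqP.
apply: (sq _ _ (powR_ge0 _ _) (powR_ge0 _ _)).
exact: etrans (esym (densE rho1 [:: a] (io1 v))) (etrans (same_density a rv) (densE rho2 [:: a] (io2 v))).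
Qed.

Definition distortion v u : R := chordal (io1 v) (io1 u) `^ d1 / chordal (io2 v) (io2 u) `^ d2.

(** By [chordal_mobius], the letter multiplies both distances, raised to the dimensions, by
    the same factors, which are square roots of the densities. *)
Lemma distortion_letter a v u : reduced_inf v -> reduced_inf u ->
  distortion (lmul a v) (lmul a u) = distortion v u.
Proof.
move=> rv ru; rewrite /distortion.
rewrite -(act_end cc1 Ox1 a rv) -(act_end cc1 Ox1 a ru) -(act_end cc2 Ox2 a rv) -(act_end cc2 Ox2 a ru).
have M1 := mdet_wmx rho1 [:: a]; have M2 := mdet_wmx rho2 [:: a].
rewrite /act /sch_act -!/(wmx _ _) (chordal_mobius _ _ M1) (chordal_mobius _ _ M2).
have p1 (z : P1 R) : 0 <= sD (wmx rho1 [:: a]) z by rewrite ltW // sD_gt0.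
have p2 (z : P1 R) : 0 < sD (wmx rho2 [:: a]) z by rewrite sD_gt0.
rewrite (powRM _ (mulr_ge0 (p1 _) (p1 _)) (chordal_ge0 _ _)) (powRM _ (p1 _) (p1 _)).
rewrite (powRM _ (mulr_ge0 (ltW (p2 _)) (ltW (p2 _))) (chordal_ge0 _ _)) (powRM _ (ltW (p2 _)) (ltW (p2 _))).
rewrite (same_sD a rv) (same_sD a ru); set p := sD _ _ `^ _; set q := sD _ _ `^ _.
have pq : p * q != 0 by rewrite mulf_neq0 // gt_eqF // powR_gt0 // p2.
by rewrite invfM mulrACA divff // mul1r.
Qed.

Lemma distortion_word w v u : reduced_inf v -> reduced_inf u ->
  distortion (wmul w v) (wmul w u) = distortion v u.
Proof.
move=> rv ru; elim: w => [|a w IH]; first by [].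
by rewrite -IH; apply: distortion_letter; exact: reduced_inf_wmul.
Qed.

Lemma chordal_lip (x y y' : P1 R) : `|chordal x y - chordal x y'| <= chordal y y'.
Proof.
have h1 := chordal_tri x y y'; have h2 := chordal_tri x y' y.
by rewrite ler_norml; rewrite (chordal_sym y' y) in h2; apply/andP; split; lra.
Qed.

Lemma distortion_cvg (vs : nat -> nat -> letter) v u : reduced_inf u -> reduced_inf v -> v <> u ->
  (forall n, reduced_inf (vs n)) -> (\forall n \near \oo, prefix_inf (mkseq v n.+1) (vs n)) ->
  (fun n => distortion (vs n) u) @ \oo --> distortion v u.
Proof.
move=> ru rv vu rs ps.
have key (rho : schottky R g) x (cc : cocompact_group rho) (Ox : domain_of_discontinuity rho x) :
    (fun n => chordal (end_point rho x (vs n)) (end_point rho x u)) @ \oo -->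
      chordal (end_point rho x v) (end_point rho x u).
  apply/cvgrPdist_lt => e e0; have [N HN] := small_shadow cc Ox e0.
  have [M _ HM] := ps; near=> n.
  have nN : (N <= n)%N by near: n; exists N.
  have nM : (M <= n)%N by near: n; exists M.
  rewrite !(chordal_sym _ (end_point rho x u)); apply: le_lt_trans (chordal_lip _ _ _) _.
  apply: (HN (mkseq v n.+1)); [exact: reduced_mkseq|by rewrite size_mkseq leqW|exact: shadow_mkseq|].
  by apply/(shadow_prefix cc Ox) => //; exact: HM.
have pos (rho : schottky R g) x (cc : cocompact_group rho) (Ox : domain_of_discontinuity rho x) :
    0 < chordal (end_point rho x v) (end_point rho x u).
  by rewrite chordal_gt0; apply/eqP => /(end_inj cc Ox rv ru).
have kp (rho : schottky R g) x (cc : cocompact_group rho) (Ox : domain_of_discontinuity rho x) d :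
    (fun n => chordal (end_point rho x (vs n)) (end_point rho x u) `^ d) @ \oo -->
      chordal (end_point rho x v) (end_point rho x u) `^ d.
  have h := @cf_powR R R id d _ (pos rho x cc Ox) (fun _ => id).
  exact: (cvg_comp _ _ (key rho x cc Ox) h).
apply: cvgM; first exact: kp.
apply: cvgV; last exact: kp.
by rewrite gt_eqF // powR_gt0 // pos.
Unshelve. all: by end_near. Qed.

Lemma distortion_sym v u : distortion v u = distortion u v.
Proof. by rewrite /distortion !(chordal_sym (end_point _ _ v)). Qed.

(** Two pairs of distinct ends are both limits of pairs in a single orbit, and the
    distortion is continuous and invariant. *)
Lemma distortion_const v u v' u' : reduced_inf v -> reduced_inf u -> reduced_inf v' -> reduced_inf u' ->
  v <> u -> v' <> u' -> distortion v u = distortion v' u'.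
Proof.
move=> rv ru rv' ru' vu vu'.
have uv : u <> v by move=> E; apply: vu.
have [N HN] := quotient_head ru uv; have [N' HN'] := quotient_head rv' vu'.
have /choice [c Hc] n : exists c, c != linv (u n) /\ c != v' n by exact: avoid_letters.
pose p n := mkseq u n.+1; pose p' n := mkseq v' n.+1.
pose z n := wmul (winv (p n)) v; pose t n := wmul (winv (p' n)) u'.
have rz n : reduced_inf (z n) by exact: reduced_inf_wmul.
have rt n : reduced_inf (t n) by exact: reduced_inf_wmul.
(* The pair [(y n, v)] tends to [(u, v)], and its translate [(x n, u')] to [(v', u')]; the
   letter [c n] separates the two long words so that nothing cancels. *)
pose y n := wmul (p n) (lmul (c n) (t n)); pose x n := wmul (p' n) (lmul (linv (c n)) (z n)).
have E n : distortion (y n) v = distortion (x n) u'.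
  have ry := reduced_inf_lmul (c n) (rt n); have rx := reduced_inf_lmul (linv (c n)) (rz n).
  rewrite -{1}(wmulKV (p n) rv) -{1}(wmulKV (p' n) ru').
  rewrite (distortion_word (p n) ry (rz n)) (distortion_word (p' n) rx (rt n)).
  by rewrite -(distortion_letter (linv (c n)) ry (rz n)) (lmulK (c n) (rt n)); exact: distortion_sym.
have red_ext (w : nat -> letter) n b : reduced_inf w -> b != linv (w n) -> reduced (rcons (mkseq w n.+1) b).
  move=> rw bw; have := reduced_mkseq n.+1 rw.
  rewrite mkseqS -!cats1 -catA !reduced_cat => /and3P[-> _ h].
  by apply/andP; split=> //; apply/andP; split=> //; rewrite /= bw.
have ys : \forall n \near \oo, prefix_inf (mkseq u n.+1) (y n).
  exists N' => // n /= nN; have tn : t n 0%N = linv (v' n) by exact: HN'.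
  have [cu cv] := Hc n; have l0 : lmul (c n) (t n) 0%N = c n.
    by rewrite /lmul tn (inj_eq (can_inj (@linvK g))) eq_sym (negbTE cv).
  by apply: wmul_prefixl; [exact: reduced_inf_lmul|rewrite l0; exact: red_ext].
have xs : \forall n \near \oo, prefix_inf (mkseq v' n.+1) (x n).
  exists N => // n /= nN; have zn : z n 0%N = linv (u n) by exact: HN.
  have [cu cv] := Hc n; have l0 : lmul (linv (c n)) (z n) 0%N = linv (c n).
    by rewrite /lmul zn linvK eq_sym (negbTE cu).
  apply: wmul_prefixl; [exact: reduced_inf_lmul|rewrite l0; apply: red_ext => //].
  by rewrite (inj_eq (can_inj (@linvK g))).
have ry n : reduced_inf (y n) by apply: reduced_inf_wmul; exact: reduced_inf_lmul.
have rx n : reduced_inf (x n) by apply: reduced_inf_wmul; exact: reduced_inf_lmul.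
have hy := distortion_cvg rv ru uv ry ys; have hx := distortion_cvg ru' rv' vu' rx xs.
rewrite distortion_sym; apply: (cvg_unique _ hy); first exact: norm_hausdorff.
by apply: cvg_trans hx; apply: near_eq_cvg; apply: nearW => n; rewrite E.
Qed.

End rigidity.

(** * Three points of the projective line *)

Section three_points.
Context {R : realType}.
Local Notation C := R[i].
Local Notation P := (P1 R).
Local Notation cn := (@ComplexField.Normc.normc R).
Implicit Types (M N : 'M[C]_2) (x y p q r : P) (z w : C).

(** The Möbius transformation that maps [p], [q], [r] to [oo], [0], [1]. *)
Definition normalize p q r : 'M[C]_2 :=
  \matrix_(i, j) (if i == 0 then hdet r p * (if j == 0 then h1 q else - h0 q)
                  else hdet r q * (if j == 0 then h1 p else - h0 p)).

Lemma normalize_ma p q r x : ma (normalize p q r) x = hdet r p * hdet x q.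
Proof. by rewrite /ma !mxE /= /hdet; ring. Qed.

Lemma normalize_mb p q r x : mb (normalize p q r) x = hdet r q * hdet x p.
Proof. by rewrite /mb !mxE /= /hdet; ring. Qed.

Lemma normalize_det p q r : p != q -> r != p -> r != q -> mdet (normalize p q r) != 0.
Proof.
move=> pq rp rq; have -> : mdet (normalize p q r) = hdet r p * hdet r q * hdet q p.
  by rewrite /mdet !mxE /= /hdet; ring.
by rewrite !mulf_neq0 // eq_hdet0 // eq_sym.
Qed.

Lemma normalizeP p q r : p != q -> r != p -> r != q ->
  [/\ mobius (normalize p q r) p = None, mobius (normalize p q r) q = Some 0 &
      mobius (normalize p q r) r = Some 1].
Proof.
move=> pq rp rq; have hxx x : hdet x x = 0 by apply/eqP; rewrite eq_hdet0.
have n0 x y : x != y -> hdet x y == 0 = false by rewrite -eq_hdet0 => /negbTE.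
have qp : q != p by rewrite eq_sym.
rewrite !mobiusE !normalize_ma !normalize_mb !hxx !mulr0 /pt eqxx !mulf_eq0 !n0 //=.
by split=> //; rewrite ?mul0r // (mulrC (hdet r q)) divff // mulf_neq0 // eq_hdet0.
Qed.

Lemma mobius_fix_0oo M : mdet M != 0 -> mobius M None = None -> mobius M (Some 0) = Some 0 ->
  [/\ M 0 0 != 0, M 1 1 != 0 & forall z, mobius M (Some z) = Some (M 0 0 / M 1 1 * z)].
Proof.
move=> dM; rewrite /mobius; case: eqP => // c0 _.
rewrite !mulr0 !add0r; case: eqP => // d0 [] /eqP; rewrite mulf_eq0 invr_eq0 => /orP[/eqP b0|/eqP //].
have : M 0 0 * M 1 1 != 0 by move: dM; rewrite /mdet b0 mul0r subr0.
rewrite mulf_eq0 negb_or => /andP[a0 _]; split=> [//|//|z].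
by rewrite c0 b0 mul0r add0r addr0; case: eqP => // _; rewrite mulrAC.
Qed.

(** In the coordinate in which the fixed points are [oo], [0], [1], the transformation is
    affine, then linear, then the identity. *)
Lemma mobius_fix3 M p q r : mdet M != 0 -> p != q -> r != p -> r != q ->
  mobius M p = p -> mobius M q = q -> mobius M r = r -> forall x, mobius M x = x.
Proof.
move=> dM pq rp rq Mp Mq Mr x; set N := normalize p q r.
have dN : mdet N != 0 by exact: normalize_det.
have [Np Nq Nr] := normalizeP pq rp rq; rewrite -/N in Np Nq Nr.
have dA : mdet (madj N) != 0 by rewrite mdet_adj.
pose Q := N * M * madj N.
have dQ : mdet Q != 0 by rewrite !mdetM !mulf_neq0.
have QE y : mobius Q (mobius N y) = mobius N (mobius M y).
  by rewrite /Q !mobius_comp // mobius_adjK.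
have [a0 d0 Qz] : [/\ Q 0 0 != 0, Q 1 1 != 0 & forall z, mobius Q (Some z) = Some (Q 0 0 / Q 1 1 * z)].
  by apply: mobius_fix_0oo => //; rewrite -?Np -?Nq QE ?Mp ?Mq.
have l1 : Q 0 0 / Q 1 1 = 1.
  by have := QE r; rewrite Mr Nr Qz mulr1 => -[].
apply: (mobius_inj dN); rewrite -QE; case E : (mobius N x) => [z|].
  by rewrite Qz l1 mul1r.
by rewrite -Np QE Mp.
Qed.

Lemma mobius_eq3 M N p q r : mdet M != 0 -> mdet N != 0 -> p != q -> r != p -> r != q ->
  mobius M p = mobius N p -> mobius M q = mobius N q -> mobius M r = mobius N r ->
  forall x, mobius M x = mobius N x.
Proof.
move=> dM dN pq rp rq Mp Mq Mr x; have dA : mdet (madj N) != 0 by rewrite mdet_adj.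
have E y : mobius (madj N * M) y = mobius (madj N) (mobius M y) by rewrite mobius_comp.
rewrite -(mobius_Kadj (mobius M x) dN) -E; congr (mobius N _).
apply: (mobius_fix3 (p := p) (q := q) (r := r)) => //.
- by rewrite mdetM mulf_neq0.
- by rewrite E Mp mobius_adjK.
- by rewrite E Mq mobius_adjK.
- by rewrite E Mr mobius_adjK.
Qed.

(** Under [M], the chordal distances are multiplied by factors that cancel in the quotient,
    except those at the pole [p]. *)
Lemma affine_distance M p x y z w : mdet M != 0 -> mobius M p = None ->
  mobius M x = Some z -> mobius M y = Some w ->
  cn (z - w) = 2 / sD M p ^+ 2 * (chordal x y / (chordal x p * chordal y p)).
Proof.
move=> dM Mp Mx My.
have xp : x != p by apply/eqP => E; rewrite E Mp in Mx.
have yp : y != p by apply/eqP => E; rewrite E Mp in My.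
have cxp : 0 < chordal x p by rewrite chordal_gt0.
have cyp : 0 < chordal y p by rewrite chordal_gt0.
have sx := sD_gt0 x dM; have sy := sD_gt0 y dM; have sp := sD_gt0 p dM.
have h1 := chordal_mobius x y dM; have h2 := chordal_mobius x p dM; have h3 := chordal_mobius y p dM.
rewrite Mx My Mp in h1 h2 h3.
have sq u : 0 < Num.sqrt (1 + cn u ^+ 2) :> R by rewrite sqrtr_gt0 ltr_pwDl // exprn_ge0 // cn_ge0.
have key : cn (z - w) = 2 * (chordal (Some z : P) (Some w : P) /
    (chordal (Some z : P) (None : P) * chordal (Some w : P) (None : P))).
  rewrite /chordal; field; by rewrite !gt_eqF.
rewrite key h1 h2 h3; field; by rewrite !gt_eqF.
Qed.

Lemma powR_eq_inj (u v d : R) : 0 <= u -> 0 <= v -> 0 < d -> u `^ d = v `^ d -> u = v.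
Proof.
move=> u0 v0 d0 /(congr1 (fun t : R => t `^ d^-1)).
by rewrite -!powRrM mulfV ?gt_eqF // !powRr1.
Qed.

Lemma powR_zero (d d' : R) : 0 < d -> 0 < d' -> 0 `^ d = 0 `^ d' :> R.
Proof. by move=> h h'; rewrite !powR0 ?gt_eqF. Qed.

Lemma powR_factor (u v u' v' d d' : R) : 0 <= u -> 0 <= v -> 0 < u' -> 0 <= v' ->
  (u * v) `^ d = (u' * v') `^ d' -> u `^ d = u' `^ d' -> v `^ d = v' `^ d'.
Proof.
move=> u0 v0 u0' v0'; rewrite (powRM _ u0 v0) (powRM _ (ltW u0') v0') => e E; rewrite E in e.
by apply: (mulfI _ e); rewrite gt_eqF // powR_gt0.
Qed.

Lemma powR_superadditive (r t : R) : 0 < r -> 1 < t -> 1 + r `^ t < (1 + r) `^ t.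
Proof.
move=> r0 t1; have E (x : R) : 0 < x -> x `^ t = x * x `^ (t - 1).
  move=> x0; rewrite -{2}(powRr1 (ltW x0)) -powRD; last by rewrite (gt_eqF x0) implybT.
  by rewrite addrC subrK.
have r1 : 0 < 1 + r by rewrite addr_gt0.
have t0 : 0 < t - 1 by rewrite subr_gt0.
rewrite (E _ r0) (E _ r1) mulrDl mul1r; apply: ltr_leD.
  have := gt0_ltr_powR t0 (_ : 1 \in Num.nneg) (_ : 1 + r \in Num.nneg) (_ : 1 < 1 + r).
  by rewrite powR1; apply; rewrite ?nnegrE ?(ltW r1) // ltrDl.
rewrite ler_wpM2l ?(ltW r0) //; apply: ge0_ler_powR; rewrite ?nnegrE ?(ltW t0) ?(ltW r0) ?(ltW r1) //.
by rewrite lerDr.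
Qed.

(** Convexity of the power. *)
Lemma powR_mean (a b t : R) : 0 <= a -> 0 <= b -> 1 <= t ->
  2 * ((a + b) / 2) `^ t <= a `^ t + b `^ t.
Proof.
move=> a0 b0 t1.
have h0 : 0 <= (2^-1 : R) by rewrite invr_ge0.
have h1 : (2^-1 : R) <= 1 by rewrite invf_le1 ?ler1n.
have : (2^-1 * a + (1 - 2^-1) * b) `^ t <= 2^-1 * a `^ t + (1 - 2^-1) * b `^ t.
  by apply: (convex_powR t1 (Itv01 h0 h1)); rewrite inE /= in_itv /= ?a0 ?b0.
rewrite (_ : 1 - 2^-1 = 2^-1 :> R); last by field.
rewrite -!mulrDr (mulrC 2^-1) => h; have := ler_wpM2l (ler0n R 2) h.
by rewrite mulrA mulfV // mul1r.
Qed.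

Lemma parallelogram z w : cn (z + w) ^+ 2 + cn (z - w) ^+ 2 = 2 * (cn z ^+ 2 + cn w ^+ 2).
Proof. by rewrite !cn_sqr ReB ImB ReD ImD; ring. Qed.

(** A dilation by [l1] that is a [t]-snowflake of a dilation by [l2] on the points [0],
    [1], [-1], [l] is impossible for [1 < t], by the parallelogram law. *)
Lemma no_snowflake (l1 l2 : C) (d1 d2 : R) : 0 < d1 -> l2 != 0 ->
  cn l1 `^ d1 = cn l2 `^ d2 -> cn (1 + l1) `^ d1 = cn (1 + l2) `^ d2 ->
  cn (1 - l1) `^ d1 = cn (1 - l2) `^ d2 -> d2 <= d1.
Proof.
move=> d10 l0 e e1 e2; rewrite leNgt; apply/negP => dd.
pose t := d2 / d1; have t1 : 1 < t by rewrite ltr_pdivlMr // mul1r.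
have T (a b : R) : 0 <= a -> 0 <= b -> a `^ d1 = b `^ d2 -> a ^+ 2 = (b ^+ 2) `^ t.
  move=> a0 b0 E; have -> : a = b `^ t.
    have := congr1 (fun x : R => x `^ d1^-1) E; rewrite -!powRrM mulfV ?gt_eqF // powRr1 //.
  by rewrite !expr2 powRM.
have h := T _ _ (cn_ge0 _) (cn_ge0 _) e.
have h1 := T _ _ (cn_ge0 _) (cn_ge0 _) e1; have h2 := T _ _ (cn_ge0 _) (cn_ge0 _) e2.
have p1 := parallelogram 1 l1; have p2 := parallelogram 1 l2.
rewrite cn1 expr1n h h1 h2 in p1; rewrite cn1 expr1n in p2.
have m := powR_mean (exprn_ge0 2 (cn_ge0 (1 + l2))) (exprn_ge0 2 (cn_ge0 (1 - l2))) (ltW t1).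
rewrite p1 p2 mulrAC mulfV ?mul1r // in m.
have r0 : 0 < cn l2 ^+ 2 by rewrite exprn_gt0 // cn_gt0.
have s := powR_superadditive r0 t1.
by move: m; rewrite ler_pM2l // leNgt s.
Qed.

(** The distances to [0] and [1] determine a complex number up to conjugation, and its distance
    to a nonreal number that is fixed, or that is conjugated, decides between the two. *)
Lemma isometry_id_or_conj (T : Type) (E : set T) (h f : T -> C) (s0 s1 : T) :
  E s0 -> E s1 -> h s0 = 0 -> f s0 = 0 -> h s1 = 1 -> f s1 = 1 ->
  (forall s t, E s -> E t -> cn (h s - h t) = cn (f s - f t)) ->
  (forall s, E s -> f s = h s) \/ (forall s, E s -> f s = (h s)^*%C).
Proof.
move=> E0 E1 h0 f0 h1 f1 fd.
have base s : E s -> complex.Re (f s) = complex.Re (h s) /\ complex.Im (f s) ^+ 2 = complex.Im (h s) ^+ 2.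
  move=> Es; have := fd s s0 Es E0; have := fd s s1 Es E1; rewrite f0 f1 h0 h1 !subr0.
  move=> /(congr1 (fun r : R => r ^+ 2)); rewrite !cn_sqr !ReB !ImB /= !subr0 => e1.
  move=> /(congr1 (fun r : R => r ^+ 2)); rewrite !cn_sqr => e2.
  have e : complex.Re (f s) = complex.Re (h s) by move: e1 e2; rewrite !sqrrB1 => ? ?; lra.
  by split=> //; move: e2; rewrite e => /addrI.
have alt s : E s -> f s = h s \/ f s = (h s)^*%C.
  move=> /base [hr /eqP]; rewrite eqf_sqr => /orP[] /eqP hi; [left|right].
    by move: hr hi; case: (f s) => u v /= -> ->; case: (h s).
  by move: hr hi; case: (f s) => u v /= -> ->; case: (h s).
have [all|/existsNP [t /not_implyP [Et n0]]] := pselect (forall s, E s -> f s = h s); first by left.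
right=> s Es; have [fs|//] := alt s Es; have [//|ft] := alt t Et.
have := fd s t Es Et; rewrite fs ft => /(congr1 (fun r : R => r ^+ 2)).
rewrite ft in n0; move: n0; rewrite !cn_sqr; case: (h s) (h t) => u v [u' v']; rewrite /= => n0.
rewrite !opprK => /eqP; rewrite (inj_eq (addrI _)) eqf_sqr => /orP[/eqP e|/eqP e].
  by exfalso; apply: n0; congr Complex; lra.
by congr Complex; lra.
Qed.

End three_points.

(** * Rigidity of the boundary map *)

Section fixed_ends.
Variable g : nat.
Local Notation letter := (letter g).

Lemma lmul_const (a : letter) : lmul a (fun=> a) = fun=> a.
Proof.
rewrite /lmul eq_sym (negbTE (linv_neq a)); apply/funext => -[|n] //.
Qed.

Lemma lmul_const_linv (a : letter) : lmul a (fun=> linv a) = fun=> linv a.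
Proof. by rewrite /lmul eqxx. Qed.

End fixed_ends.

Section coordinates.
Context {R : realType} {g : nat} {rho : schottky R g}.
Hypotheses (cc : cocompact_group rho).
Variable x0 : P1 R.
Hypothesis Ox0 : domain_of_discontinuity rho x0.
Variables a b : letter g.
Hypotheses (ba : b != a) (bA : b != linv a).
Local Notation C := R[i].
Local Notation letter := (letter g).
Local Notation cn := (@ComplexField.Normc.normc R).
Local Notation io := (end_point rho x0).
Local Notation p := (fun _ : nat => a).
Local Notation q := (fun _ : nat => linv a).
Local Notation r := (fun _ : nat => b).
Implicit Types (v u : nat -> letter).

Let rp : reduced_inf p. Proof. exact: reduced_inf_const. Qed.
Let rq : reduced_inf q. Proof. exact: reduced_inf_const. Qed.
Let rr : reduced_inf r. Proof. exact: reduced_inf_const. Qed.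

Lemma end_neq v u : reduced_inf v -> reduced_inf u -> v <> u -> io v != io u.
Proof. by move=> rv ru vu; apply/eqP => /(end_inj cc Ox0 rv ru). Qed.

Lemma const_neq (c d : letter) : c != d -> (fun _ : nat => c) <> (fun _ : nat => d).
Proof. by move=> cd /(congr1 (fun f => f 0%N)) E; rewrite E eqxx in cd. Qed.

Lemma end_pq : io p != io q.
Proof. by apply: end_neq => //; apply: const_neq; rewrite eq_sym linv_neq. Qed.

Lemma end_rp : io r != io p.
Proof. by apply: end_neq => //; exact: const_neq. Qed.

Lemma end_rq : io r != io q.
Proof. by apply: end_neq => //; exact: const_neq. Qed.

Definition frame : 'M[C]_2 := normalize (io p) (io q) (io r).

Lemma frame_det : mdet frame != 0.
Proof. exact: normalize_det end_pq end_rp end_rq. Qed.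

Lemma frameP : [/\ mobius frame (io p) = None, mobius frame (io q) = Some 0 &
  mobius frame (io r) = Some 1].
Proof. exact: normalizeP end_pq end_rp end_rq. Qed.

(** An affine coordinate on the ends in which the letter [a], which fixes the ends
    [p] at [oo] and [q] at [0], acts as a dilation. *)
Definition end_coord v : C := aff (mobius frame (io v)).

Lemma coordE v : reduced_inf v -> v <> p -> mobius frame (io v) = Some (end_coord v).
Proof.
move=> rv vp; rewrite /end_coord; case E : (mobius frame (io v)) => [z|] //.
exfalso; apply: vp; apply: (end_inj cc Ox0 rv rp); apply: (mobius_inj frame_det).
by rewrite E; have [-> _ _] := frameP.
Qed.

Lemma coord_q : end_coord q = 0. Proof. by rewrite /end_coord; have [_ -> _] := frameP. Qed.
Lemma coord_r : end_coord r = 1. Proof. by rewrite /end_coord; have [_ _ ->] := frameP. Qed.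

Lemma end_coord_inj v u : reduced_inf v -> reduced_inf u -> v <> p -> u <> p -> end_coord v = end_coord u -> v = u.
Proof.
move=> rv ru vp up E; apply: (end_inj cc Ox0 rv ru); apply: (mobius_inj frame_det).
by rewrite !coordE // E.
Qed.

Lemma lmul_neq_p v : reduced_inf v -> v <> p -> lmul a v <> p.
Proof.
move=> rv vp E; apply: vp; rewrite -(lmulK a rv) E -{1}(lmul_const a) lmulK //.
Qed.

Lemma dilation : exists l : C, l != 0 /\ forall v, reduced_inf v -> v <> p -> end_coord (lmul a v) = l * end_coord v.
Proof.
have dN := frame_det; have dA : mdet (madj frame) != 0 by rewrite mdet_adj.
pose M := frame * wmx rho [:: a] * madj frame.
have dM : mdet M != 0 by rewrite !mdetM !mulf_neq0 ?mdet_wmx.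
have ME v : reduced_inf v -> mobius M (mobius frame (io v)) = mobius frame (io (lmul a v)).
  move=> rv; rewrite /M mobius_comp // mobius_adjK // mobius_comp ?mdet_wmx //.
  by rewrite -(act_end cc Ox0 a rv).
have [Fp Fq _] := frameP.
have M0 : mobius M None = None by rewrite -{1}Fp ME // lmul_const.
have M1 : mobius M (Some 0) = Some 0 by rewrite -{1}Fq ME // lmul_const_linv.
have [a0 d0 Mz] := mobius_fix_0oo dM M0 M1.
exists (M 0 0 / M 1 1); split=> [|v rv vp]; first by rewrite mulf_neq0 ?invr_eq0.
have := ME v rv; rewrite (coordE rv vp) Mz coordE; last 2 first.
- exact: reduced_inf_lmul.
- exact: lmul_neq_p.
by case.
Qed.

Lemma coord_distance v u : reduced_inf v -> reduced_inf u -> v <> p -> u <> p ->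
  cn (end_coord v - end_coord u) = 2 / sD frame (io p) ^+ 2 *
    (chordal (io v) (io u) / (chordal (io v) (io p) * chordal (io u) (io p))).
Proof.
move=> rv ru vp up; apply: affine_distance; [exact: frame_det| |exact: coordE|exact: coordE].
by have [] := frameP.
Qed.

End coordinates.

Lemma scaled_ratio (F : fieldType) (k k' D s t t' : F) : (k' == 0) = false -> (D == 0) = false ->
  (t == 0) = false -> (t' == 0) = false ->
  k * (D * s / (D * t * (D * t'))) = k / (D * k') * (k' * (s / (t * t'))).
Proof. by move=> h1 h2 h3 h4; field; rewrite h1 h2 h3 h4. Qed.

Lemma mdet_conj (R : realType) (M : 'M[R[i]]_2) : mdet (map_mx (@conjc R) M) = (mdet M)^*%C.
Proof. by rewrite /mdet !mxE rmorphB !rmorphM. Qed.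

Section boundary_rigidity.
Context {R : realType} {g : nat} {rho1 rho2 : schottky R g}.
Hypotheses (cc1 : cocompact_group rho1) (cc2 : cocompact_group rho2) (g2 : (1 < g)%N).
Variables (x1 x2 : P1 R).
Hypotheses (Ox1 : domain_of_discontinuity rho1 x1) (Ox2 : domain_of_discontinuity rho2 x2).
Variables (mu1 mu2 : probability (borelP1 R) R).
Hypotheses (muP1 : patterson_sullivan rho1 mu1) (muP2 : patterson_sullivan rho2 mu2).
Hypothesis same_mass : forall w, reduced w -> mass (rho := rho1) x1 mu1 w = mass (rho := rho2) x2 mu2 w.
Variables a b : letter g.
Hypotheses (ba : b != a) (bA : b != linv a).
Local Notation C := R[i].
Local Notation letter := (letter g).
Local Notation cn := (@ComplexField.Normc.normc R).
Local Notation io1 := (end_point rho1 x1).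
Local Notation io2 := (end_point rho2 x2).
Local Notation d1 := (hausdorff_dim (limit_set rho1)).
Local Notation d2 := (hausdorff_dim (limit_set rho2)).
Local Notation p := (fun _ : nat => a).
Local Notation q := (fun _ : nat => linv a).
Local Notation r := (fun _ : nat => b).
Local Notation h1 := (end_coord (rho := rho1) x1 a b).
Local Notation h2 := (end_coord (rho := rho2) x2 a b).
Implicit Types (v u : nat -> letter).

Let rp : reduced_inf p. Proof. exact: reduced_inf_const. Qed.
Let rq : reduced_inf q. Proof. exact: reduced_inf_const. Qed.
Let rr : reduced_inf r. Proof. exact: reduced_inf_const. Qed.
Let qp : q <> p. Proof. by apply: const_neq; exact: linv_neq. Qed.
Let rp' : r <> p. Proof. exact: const_neq. Qed.
Let rq' : r <> q. Proof. exact: const_neq. Qed.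

Lemma d1_gt0 : 0 < d1. Proof. exact: (hausdorff_dim_gt0 cc1 g2 Ox1 muP1). Qed.
Lemma d2_gt0 : 0 < d2. Proof. exact: (hausdorff_dim_gt0 cc2 g2 Ox2 muP2). Qed.

Lemma chordal_power : exists2 D : R, 0 < D & forall v u, reduced_inf v -> reduced_inf u -> v <> u ->
  chordal (io1 v) (io1 u) `^ d1 = D * chordal (io2 v) (io2 u) `^ d2.
Proof.
have pos1 v u : reduced_inf v -> reduced_inf u -> v <> u -> 0 < chordal (io1 v) (io1 u) `^ d1.
  by move=> rv ru vu; rewrite powR_gt0 // chordal_gt0; exact: (end_neq cc1 Ox1).
have pos2 v u : reduced_inf v -> reduced_inf u -> v <> u -> 0 < chordal (io2 v) (io2 u) `^ d2.
  by move=> rv ru vu; rewrite powR_gt0 // chordal_gt0; exact: (end_neq cc2 Ox2).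
exists (distortion (rho1 := rho1) (rho2 := rho2) x1 x2 r q); first by rewrite divr_gt0 ?pos1 ?pos2.
move=> v u rv ru vu.
rewrite -(distortion_const cc1 cc2 g2 Ox1 Ox2 muP1 muP2 same_mass rv ru rr rq vu rq').
by rewrite /distortion divfK // gt_eqF // pos2.
Qed.

(** Normalising three ends to [oo], [0], [1] makes the constant distortion disappear. *)
Lemma coord_power v u : reduced_inf v -> reduced_inf u -> v <> p -> u <> p ->
  cn (h1 v - h1 u) `^ d1 = cn (h2 v - h2 u) `^ d2.
Proof.
have [D D0 HD] := chordal_power.
have [K HK] : exists K : R, forall v u, reduced_inf v -> reduced_inf u -> v <> p -> u <> p -> v <> u ->
    cn (h1 v - h1 u) `^ d1 = K * cn (h2 v - h2 u) `^ d2.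
  set k1 := 2 / sD (frame (rho := rho1) x1 a b) (io1 p) ^+ 2.
  set k2 := 2 / sD (frame (rho := rho2) x2 a b) (io2 p) ^+ 2.
  have k10 : 0 < k1 by rewrite divr_gt0 // exprn_gt0 // sD_gt0 // (frame_det cc1 Ox1 ba bA).
  have k20 : 0 < k2 by rewrite divr_gt0 // exprn_gt0 // sD_gt0 // (frame_det cc2 Ox2 ba bA).
  exists (k1 `^ d1 / (D * k2 `^ d2)) => {}v {}u rv ru vp up vu.
  rewrite (coord_distance cc1 Ox1 ba bA rv ru vp up) (coord_distance cc2 Ox2 ba bA rv ru vp up) -/k1 -/k2.
  have ex (k s t t' : R) d : 0 <= k -> 0 <= s -> 0 <= t -> 0 <= t' ->
      (k * (s / (t * t'))) `^ d = k `^ d * (s `^ d / (t `^ d * t' `^ d)).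
    move=> k0 s0 t0 t0'; have i0 (z : R) : 0 <= z -> z^-1 `^ d = (z `^ d)^-1.
      by move=> z0; rewrite -(powR_inv1 z0) -powRrM mulN1r powRN.
    by rewrite (powRM _ k0) ?divr_ge0 ?mulr_ge0 // (powRM _ s0) ?invr_ge0 ?mulr_ge0 // i0 ?mulr_ge0 // powRM.
  rewrite !ex ?chordal_ge0 ?(ltW k10) ?(ltW k20) // !HD //.
  set s := chordal (io2 v) (io2 u) `^ _; set t := chordal (io2 v) (io2 p) `^ _.
  set t' := chordal (io2 u) (io2 p) `^ _.
  have t0 : 0 < t by rewrite powR_gt0 // chordal_gt0; exact: (end_neq cc2 Ox2).
  have t0' : 0 < t' by rewrite powR_gt0 // chordal_gt0; exact: (end_neq cc2 Ox2).
  have k0 : 0 < k2 `^ d2 by rewrite powR_gt0.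
  exact: scaled_ratio (gt_eqF k0) (gt_eqF D0) (gt_eqF t0) (gt_eqF t0').
have K1 : K = 1.
  have := HK r q rr rq rp' qp rq'.
  rewrite (coord_q cc1 Ox1 ba bA) (coord_q cc2 Ox2 ba bA) (coord_r cc1 Ox1 ba bA) (coord_r cc2 Ox2 ba bA).
  by rewrite !subr0 !cn1 !powR1 mulr1 => <-.
move=> rv ru vp up; have [->|vu] := pselect (v = u); last by rewrite HK // K1 mul1r.
rewrite (subrr (h1 u)) (subrr (h2 u)) cn0; exact: powR_zero d1_gt0 d2_gt0.
Qed.

(** The letter [a] is a dilation in both coordinates, and the two coordinates are related by
    [coord_power] on the ends [0], [1], [l], [l ^+ 2], which also gives the distance from
    [-1] to [l]. Then [no_snowflake] applies in both directions. *)
Lemma dimension_eq : d1 = d2.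
Proof.
have [l1 [l10 L1]] := dilation cc1 Ox1 ba bA; have [l2 [l20 L2]] := dilation cc2 Ox2 ba bA.
(* In the coordinate, the five ends [q], [r], [u], [v] and [p] are [0], [1], [l], [l ^+ 2]
   and [oo]. *)
pose u := lmul a r; pose v := lmul a u.
have ru : reduced_inf u by exact: reduced_inf_lmul.
have rv : reduced_inf v by exact: reduced_inf_lmul.
have up : u <> p by exact: lmul_neq_p.
have vp : v <> p by exact: lmul_neq_p.
have ur : r <> u.
  move=> /(congr1 (fun f => f 0%N)); rewrite /u /lmul (negbTE bA) /= => E.
  by move: ba; rewrite E eqxx.
have c1 := coord_r cc1 Ox1 ba bA; have c2 := coord_r cc2 Ox2 ba bA.
have u1 : h1 u = l1 by rewrite L1 // c1 mulr1.
have u2 : h2 u = l2 by rewrite L2 // c2 mulr1.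
have v1 : h1 v = l1 ^+ 2 by rewrite L1 // u1 expr2.
have v2 : h2 v = l2 ^+ 2 by rewrite L2 // u2 expr2.
have e : cn l1 `^ d1 = cn l2 `^ d2.
  have := coord_power ru rq up qp.
  by rewrite u1 u2 (coord_q cc1 Ox1 ba bA) (coord_q cc2 Ox2 ba bA) !subr0.
have e1 : cn (1 - l1) `^ d1 = cn (1 - l2) `^ d2.
  by have := coord_power rr ru rp' up; rewrite u1 u2 c1 c2.
have e2 : cn (1 + l1) `^ d1 = cn (1 + l2) `^ d2.
  have := coord_power rr rv rp' vp; have sq (l : C) : 1 - l ^+ 2 = (1 - l) * (1 + l) by ring.
  rewrite v1 v2 c1 c2 !sq !cnM => e3; apply: (powR_factor _ _ _ _ e3 e1); rewrite ?cn_ge0 //.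
  rewrite cn_gt0 subr_eq0.
  by apply/eqP => E; apply: ur; apply: (end_coord_inj cc2 Ox2 ba bA rr ru rp' up); rewrite c2 u2.
apply/eqP; rewrite eq_le; apply/andP; split.
  exact: (no_snowflake d2_gt0 l10 (esym e) (esym e2) (esym e1)).
exact: (no_snowflake d1_gt0 l20 e e2 e1).
Qed.

Lemma coord_isometry v u : reduced_inf v -> reduced_inf u -> v <> p -> u <> p ->
  cn (h1 v - h1 u) = cn (h2 v - h2 u).
Proof.
move=> rv ru vp up; have := coord_power rv ru vp up; rewrite dimension_eq.
exact: (powR_eq_inj (cn_ge0 _) (cn_ge0 _) d2_gt0).
Qed.

(** In normalized coordinates, the boundary map preserves distances and fixes [0] and [1]. *)
Lemma boundary_rigidity :
  (exists2 M : 'M[C]_2, mdet M != 0 & forall v, reduced_inf v -> io2 v = mobius M (io1 v)) \/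
  (exists2 M : 'M[C]_2, mdet M != 0 & forall v, reduced_inf v -> io2 v = mobius M (conjP (io1 v))).
Proof.
pose N1 := frame (rho := rho1) x1 a b; pose N2 := frame (rho := rho2) x2 a b.
have dN1 : mdet N1 != 0 by exact: frame_det.
have dN2 : mdet N2 != 0 by exact: frame_det.
have dA : mdet (madj N2) != 0 by rewrite mdet_adj.
have [F1 _ _] := frameP cc1 Ox1 ba bA; have [F2 _ _] := frameP cc2 Ox2 ba bA.
have P v : reduced_inf v -> v <> p -> [/\ mobius N1 (io1 v) = Some (h1 v) & mobius N2 (io2 v) = Some (h2 v)].
  by move=> rv vp; split; apply: coordE.
have [same|conj] := isometry_id_or_conj (E := [set v | reduced_inf v /\ v <> p]) (s0 := q) (s1 := r)
  (conj rq qp) (conj rr rp') (coord_q cc1 Ox1 ba bA) (coord_q cc2 Ox2 ba bA)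
  (coord_r cc1 Ox1 ba bA) (coord_r cc2 Ox2 ba bA)
  (fun v u rv ru => coord_isometry rv.1 ru.1 rv.2 ru.2).
  left; exists (madj N2 * N1); first by rewrite mdetM mulf_neq0.
  move=> v rv; rewrite mobius_comp // -[LHS](mobius_adjK _ dN2); congr (mobius _ _).
  have [->|vp] := pselect (v = p); first by rewrite F1 F2.
  by have [-> ->] := P v rv vp; rewrite same.
have dc : mdet (map_mx (@conjc R) N1) != 0.
  by rewrite mdet_conj fmorph_eq0.
right; exists (madj N2 * map_mx (@conjc R) N1); first by rewrite mdetM mulf_neq0.
move=> v rv; rewrite mobius_comp // -conjP_mobius_conj -[LHS](mobius_adjK _ dN2); congr (mobius _ _).
have [->|vp] := pselect (v = p); first by rewrite F1 F2.
by have [-> ->] := P v rv vp; rewrite conj.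
Qed.

End boundary_rigidity.

Section equivariance.
Context {R : realType} {g : nat} {rho1 rho2 : schottky R g}.
Hypotheses (cc1 : cocompact_group rho1) (cc2 : cocompact_group rho2) (g2 : (1 < g)%N).
Variables (x1 x2 : P1 R).
Hypotheses (Ox1 : domain_of_discontinuity rho1 x1) (Ox2 : domain_of_discontinuity rho2 x2).
Local Notation io1 := (end_point rho1 x1).
Local Notation io2 := (end_point rho2 x2).
Variable T : P1 R -> P1 R.
Hypotheses (Tinj : injective T) (TE : forall v, reduced_inf v -> io2 v = T (io1 v)).

Lemma extension_domain x : domain_of_discontinuity rho1 x <-> domain_of_discontinuity rho2 (T x).
Proof.
split=> Ox; rewrite /domain_of_discontinuity => L; apply: Ox.
  have [v rv E] := end_surj cc2 Ox2 L; have := end_limit cc1 Ox1 rv.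
  by move: E; rewrite TE // => /Tinj ->.
have [v rv ->] := end_surj cc1 Ox1 L; rewrite -TE //; exact: (end_limit cc2 Ox2).
Qed.

(** Both sides are Möbius transformations evaluated at [f x], and they agree at three ends. *)
Lemma extension_equivariant (M N : 'M[R[i]]_2) (f : P1 R -> P1 R) w : mdet M != 0 -> mdet N != 0 ->
  injective f -> (forall x, mobius M (f x) = T (act rho1 w x)) ->
  (forall x, mobius N (f x) = act rho2 w (T x)) ->
  forall x, T (act rho1 w x) = act rho2 w (T x).
Proof.
move=> dM dN fi fM fN x; rewrite -fM -fN.
pose a : letter g := (Ordinal (ltnW g2), false).
have [b [ba bA]] := avoid_letters g2 a (linv a).
have rc c : reduced_inf (fun _ : nat => c : letter g) by exact: reduced_inf_const.
have E v : reduced_inf v -> mobius M (f (io1 v)) = mobius N (f (io1 v)).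
  move=> rv; rewrite fM fN (act_word_end cc1 Ox1 w rv) -!TE //; last exact: reduced_inf_wmul.
  by rewrite (act_word_end cc2 Ox2 w rv).
have ne y z : y != z -> f y != f z by move=> yz; rewrite (inj_eq fi).
apply: (mobius_eq3 dM dN (ne _ _ (end_pq cc1 Ox1 a)) (ne _ _ (end_rp cc1 Ox1 ba)) (ne _ _ (end_rq cc1 Ox1 bA))); exact: E.
Qed.

End equivariance.

(** * Dimension and orthonormal families *)

Section dimension.
Context {K : fieldType} {V : lmodType K}.
Implicit Types (E : set V).

Lemma lin_span_range d (b : 'I_d -> V) v :
  lin_span (range b) v <-> exists c : 'I_d -> K, v = \sum_i c i *: b i.
Proof.
split; last by move=> [c ->]; exists d, c, b; split=> // i; exists i.
move=> [n [c [b' [bb ->]]]].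
have [s sP] : {s : 'I_n -> 'I_d & forall i, b' i = b (s i)}.
  have ex i : exists j, b j = b' i by have [j _ <-] := bb i; exists j.
  by exists (fun i => sval (cid (ex i))) => i; case: (cid (ex i)).
exists (fun j => \sum_(i | s i == j) c i).
rewrite [RHS](eq_bigr (fun j => \sum_(i | s i == j) c i *: b j)); last by move=> j _; rewrite scaler_suml.
rewrite (exchange_big_dep predT) //=; apply: eq_bigr => i _.
by rewrite (big_pred1 (s i)) ?sP // => j; rewrite eq_sym.
Qed.

(** The coordinates of a basis of [E] in a basis of [E'] form a matrix with free rows. *)
Lemma has_dim_le E E' d d' : has_dim E d -> has_dim E' d' -> E `<=` E' -> (d <= d')%N.
Proof.
move=> [b [bfree bE]] [b' [_ bE']] EE'; rewrite leqNgt; apply/negP => dd.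
have bspan i : exists c : 'I_d' -> K, b i = \sum_j c j *: b' j.
  apply/lin_span_range; rewrite bE'; apply: EE'; rewrite -bE; apply/lin_span_range.
  exists (fun j => (i == j)%:R); rewrite (bigD1 i) //= eqxx scale1r big1 ?addr0 // => j ji.
  by rewrite eq_sym (negbTE ji) scale0r.
pose A : 'M[K]_(d, d') := \matrix_(i, j) (sval (cid (bspan i))) j.
have AE i : b i = \sum_j A i j *: b' j.
  rewrite {1}(svalP (cid (bspan i))); apply: eq_bigr => j _; by rewrite mxE.
have : kermx A != 0.
  by rewrite kermx_eq0 /row_free neq_ltn (leq_ltn_trans (rank_leq_col A) dd).
case/rowV0Pn => u /sub_kermxP uA; apply/negP; rewrite negbK; apply/eqP/rowP => i.
rewrite mxE; apply: (bfree (fun i => u 0 i)).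
under eq_bigr => j _ do rewrite AE scaler_sumr.
rewrite exchange_big big1 //= => j _.
under eq_bigr => k _ do rewrite scalerA.
rewrite -scaler_suml (_ : \sum_k _ = (u *m A) 0 j); last by rewrite mxE.
by rewrite uA mxE scale0r.
Qed.

Lemma lin_dimE E d : has_dim E d -> lin_dim E = d.
Proof.
move=> dE; rewrite /lin_dim; case: xgetP => [n _ nE|/(_ d)//].
by apply/eqP; rewrite eqn_leq (has_dim_le nE dE) // (has_dim_le dE nE).
Qed.

End dimension.

Section hilbert_geometry.
Context {R : realType} {H : completeNormedModType R[i]}.
Variable ip : H -> H -> R[i].
Hypothesis ipP : hilbert_product ip.
Local Notation C := R[i].
Implicit Types (x y z : H) (l s : seq H) (c : C).

Lemma ip_linear c x y z : ip (c *: x + y) z = c * ip x z + ip y z.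
Proof. by have [h _ _] := ipP; exact: h. Qed.
Lemma ip_conj x y : ip y x = (ip x y)^*%C.
Proof. by have [_ h _] := ipP; exact: h. Qed.
Lemma ip_norm x : `|x| ^+ 2 = ip x x.
Proof. by have [_ _ h] := ipP; exact: h. Qed.

Lemma ipDl x y z : ip (x + y) z = ip x z + ip y z.
Proof. by rewrite -[x in ip (x + y)]scale1r ip_linear mul1r. Qed.
Lemma ip0l z : ip 0 z = 0.
Proof. by apply: (addIr (ip 0 z)); rewrite -ipDl addr0 add0r. Qed.
Lemma ipZl c x z : ip (c *: x) z = c * ip x z.
Proof. by rewrite -[c *: x]addr0 ip_linear ip0l addr0. Qed.
Lemma ipNl x z : ip (- x) z = - ip x z.
Proof. by rewrite -scaleN1r ipZl mulN1r. Qed.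
Lemma ipBl x y z : ip (x - y) z = ip x z - ip y z.
Proof. by rewrite ipDl ipNl. Qed.
Lemma ipDr x y z : ip z (x + y) = ip z x + ip z y.
Proof. by rewrite !(ip_conj _ z) ipDl rmorphD. Qed.
Lemma ip0r z : ip z 0 = 0.
Proof. by rewrite ip_conj ip0l rmorph0. Qed.
Lemma ipZr c x z : ip z (c *: x) = c^*%C * ip z x.
Proof. by rewrite !(ip_conj _ z) ipZl rmorphM. Qed.
Lemma ipBr x y z : ip z (x - y) = ip z x - ip z y.
Proof. by rewrite ipDr -scaleN1r ipZr rmorphN rmorph1 mulN1r. Qed.

Lemma ip_suml I (r : seq I) (F : I -> H) z : ip (\sum_(i <- r) F i) z = \sum_(i <- r) ip (F i) z.
Proof. by elim/big_rec2: _ => [|i c x _ <-]; [exact: ip0l|exact: ipDl]. Qed.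
Lemma ip_sumr I (r : seq I) (F : I -> H) z : ip z (\sum_(i <- r) F i) = \sum_(i <- r) ip z (F i).
Proof. by elim/big_rec2: _ => [|i c x _ <-]; [exact: ip0r|exact: ipDr]. Qed.

Lemma ip_eq0 x : ip x x = 0 -> x = 0.
Proof. by rewrite -ip_norm => /eqP; rewrite sqrf_eq0 normr_eq0 => /eqP. Qed.

(** Orthogonal vectors satisfy the Pythagorean theorem, so a vector orthogonal to a
    dense set is [0]. *)
Lemma orthogonal_dense (D : set H) x : closure D = setT -> (forall d, D d -> ip x d = 0) -> x = 0.
Proof.
move=> cD xD; apply/eqP; rewrite -normr_eq0; apply/negPn/negP => x0.
have x1 : 0 < `|x| by rewrite lt_neqAle eq_sym x0 normr_ge0.
have : closure D x by rewrite cD.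
move=> /(_ (ball x `|x|) (nbhsx_ballx _ _ x1)) [d [Dd]].
rewrite -ball_normE /ball_ /= => lt.
have : `|x - d| ^+ 2 = `|x| ^+ 2 + `|d| ^+ 2.
  have xd := xD d Dd; have dx : ip d x = 0 by rewrite ip_conj xd conjc0.
  by rewrite !ip_norm ipBl !ipBr xd dx subr0 sub0r opprK.
move=> E; have : `|x| ^+ 2 <= `|x - d| ^+ 2 by rewrite E lerDl exprn_ge0.
rewrite ler_pXn2r ?nnegrE // => le; have := le_lt_trans le lt; by rewrite ltxx.
Qed.

Definition orthonormal l := forall i j, (i < size l)%N -> (j < size l)%N ->
  ip l`_i l`_j = (i == j)%:R.

Definition pr l x : H := \sum_(e <- l) ip x e *: e.

Definition in_span l x := pr l x = x.

Lemma prD l x y : pr l (x + y) = pr l x + pr l y.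
Proof. by rewrite /pr -big_split; apply: eq_bigr => e _; rewrite ipDl scalerDl. Qed.
Lemma prZ l c x : pr l (c *: x) = c *: pr l x.
Proof. by rewrite /pr scaler_sumr; apply: eq_bigr => e _; rewrite ipZl scalerA. Qed.
Lemma pr0 l : pr l 0 = 0.
Proof. by rewrite /pr big1 // => e _; rewrite ip0l scale0r. Qed.

Lemma in_spanD l x y : in_span l x -> in_span l y -> in_span l (x + y).
Proof. by rewrite /in_span prD => -> ->. Qed.
Lemma in_spanZ l c x : in_span l x -> in_span l (c *: x).
Proof. by rewrite /in_span prZ => ->. Qed.
Lemma in_span_sum I (r : seq I) (F : I -> H) l : (forall i, in_span l (F i)) ->
  in_span l (\sum_(i <- r) F i).
Proof. by move=> lF; elim/big_rec: _ => [|i x _]; [exact: pr0|exact: in_spanD]. Qed.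

Lemma pr_nth l x : pr l x = \sum_(i < size l) ip x l`_i *: l`_i.
Proof. by rewrite /pr (big_nth 0) big_mkord. Qed.

Lemma ip_pr_nth l x j : orthonormal l -> (j < size l)%N -> ip (pr l x) l`_j = ip x l`_j.
Proof.
move=> ol jl; rewrite pr_nth ip_suml (bigD1 (Ordinal jl)) //= big1 ?addr0.
  by rewrite ipZl ol // eqxx mulr1.
by move=> i ij; rewrite ipZl ol // -val_eqE in ij *; rewrite (negbTE ij) mulr0.
Qed.

Lemma in_span_nth l j : orthonormal l -> (j < size l)%N -> in_span l l`_j.
Proof.
move=> ol jl; rewrite /in_span pr_nth (bigD1 (Ordinal jl)) //= big1 ?addr0.
  by rewrite ol // eqxx scale1r.
by move=> i ij; rewrite ol // eq_sym; rewrite -val_eqE in ij; rewrite (negbTE ij) scale0r.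
Qed.

Lemma in_span_pr l x : orthonormal l -> in_span l (pr l x).
Proof.
move=> ol; rewrite pr_nth; apply: in_span_sum => i; apply: in_spanZ.
exact: in_span_nth.
Qed.

Lemma pr_orthogonal l x y : orthonormal l -> in_span l y -> ip (x - pr l x) y = 0.
Proof.
move=> ol yl; rewrite -yl (pr_nth l y) ip_sumr big1 // => i _.
by rewrite ipZr ipBl ip_pr_nth // subrr mulr0.
Qed.

Lemma orthonormal_rcons l x : orthonormal l -> (forall i, (i < size l)%N -> ip x l`_i = 0) ->
  ip x x = 1 -> orthonormal (rcons l x).
Proof.
move=> ol xl x1 i j; rewrite size_rcons !ltnS !nth_rcons => il jl.
have [il'|il'] := ltnP i (size l); have [jl'|jl'] := ltnP j (size l).
- exact: ol.
- have -> : j = size l by apply/eqP; rewrite eqn_leq jl jl'.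
  by rewrite eqxx ip_conj xl // conjc0 ltn_eqF.
- have -> : i = size l by apply/eqP; rewrite eqn_leq il il'.
  by rewrite eqxx xl // gtn_eqF.
- have -> : i = size l by apply/eqP; rewrite eqn_leq il il'.
  have -> : j = size l by apply/eqP; rewrite eqn_leq jl jl'.
  by rewrite !eqxx.
Qed.

Lemma in_span_cat l l' x : orthonormal (l ++ l') -> in_span l x -> in_span (l ++ l') x.
Proof.
move=> ol <-; rewrite pr_nth; apply: in_span_sum => i; apply: in_spanZ.
have il : (i < size (l ++ l'))%N by rewrite size_cat ltn_addr.
by have := in_span_nth ol il; rewrite nth_cat ltn_ord.
Qed.

(** The Gram-Schmidt process, which skips dependent vectors so that the characteristic
    functions of all shadows can be fed to it. *)
Definition gs_step l x := let y := x - pr l x in if y == 0 then l else rcons l (`|y|^-1 *: y).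
Definition gs l s := foldl gs_step l s.

Lemma conjc_ge0 (z : C) : 0 <= z -> z^*%C = z.
Proof. by rewrite lecE /= => /andP[/eqP z0 _]; case: z z0 => a b /= ->; rewrite oppr0. Qed.

Lemma gs_stepP l x : orthonormal l -> [/\ orthonormal (gs_step l x), in_span (gs_step l x) x &
  exists l', gs_step l x = l ++ l'].
Proof.
move=> ol; rewrite /gs_step; set y := x - pr l x.
case: eqVneq => [y0|y0].
  split=> //; last by exists [::]; rewrite cats0.
  by apply/esym/eqP; rewrite -subr_eq0 -/y y0.
have n0 : `|y| != 0 by rewrite normr_eq0.
have oy : orthonormal (rcons l (`|y|^-1 *: y)).
  apply: orthonormal_rcons => // [i il|].
    by rewrite ipZl pr_orthogonal ?mulr0 //; exact: in_span_nth.
  rewrite ipZl ipZr conjc_ge0 ?invr_ge0 // -ip_norm; field; exact: n0.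
split=> //; last by exists [:: `|y|^-1 *: y]; rewrite cats1.
have -> : x = pr l x + `|y| *: (`|y|^-1 *: y) by rewrite scalerA divff // scale1r addrC subrK.
apply: in_spanD.
  by rewrite -cats1; apply: in_span_cat; [rewrite cats1|exact: in_span_pr].
apply: in_spanZ; have sl : (size l < size (rcons l (`|y|^-1 *: y)))%N by rewrite size_rcons.
by have := in_span_nth oy sl; rewrite nth_rcons ltnn eqxx.
Qed.

Lemma gsP l s : orthonormal l -> [/\ orthonormal (gs l s), forall x, x \in s -> in_span (gs l s) x &
  exists l', gs l s = l ++ l'].
Proof.
elim: s l => [|x s IH] l ol; first by split=> //; exists [::]; rewrite cats0.
have [ wl1 sx [l1 E1]] := gs_stepP x ol; have [ wl2 s2 [l2 E2]] := IH _ wl1.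
split=> //=; last by exists (l1 ++ l2); rewrite E2 E1 catA.
move=> y; rewrite inE => /predU1P[->|/s2 //]; rewrite E2; apply: in_span_cat sx.
by rewrite -E2.
Qed.

Lemma gs_sub (E : set H) l s : (forall c x y, E x -> E y -> E (c *: x + y)) -> E 0 ->
  (forall x, x \in l -> E x) -> (forall x, x \in s -> E x) -> forall x, x \in gs l s -> E x.
Proof.
move=> Elin E0; elim: s l => [|x s IH] l lE sE //=.
have xE : E x by apply: sE; rewrite mem_head.
apply: IH => [y|y ys]; last by apply: sE; rewrite inE ys orbT.
rewrite /gs_step; case: eqP => [_ /lE //|_]; rewrite mem_rcons inE => /predU1P[->|/lE //].
have Epr : E (pr l x).
  rewrite /pr; elim: (l) lE => [|e l' IHl] lE; first by rewrite big_nil.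
  rewrite big_cons; apply: Elin; first by apply: lE; rewrite mem_head.
  by apply: IHl => z zl; apply: lE; rewrite inE zl orbT.
rewrite -[_ *: _]addr0; apply: (Elin) => //.
by rewrite addrC -scaleN1r; apply: Elin.
Qed.

Lemma orthogonal_projectionE (E : set H) l x : orthonormal l -> (forall y, E y <-> in_span l y) ->
  orthogonal_projection ip E x = pr l x.
Proof.
move=> ol El; rewrite /orthogonal_projection.
have prE : E (pr l x) /\ forall h, E h -> ip (x - pr l x) h = 0.
  by split; [apply/El; exact: in_span_pr|move=> h /El; exact: pr_orthogonal].
case: xgetP => [p _ [/El Ep px]|/(_ (pr l x))//].
apply/eqP; rewrite -subr_eq0; apply/eqP/ip_eq0.
have Eh : E (p - pr l x).
  apply/El; rewrite -[- _]scaleN1r; apply: in_spanD => //; apply: in_spanZ; exact: in_span_pr.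
rewrite {1}(_ : p - pr l x = (x - pr l x) - (x - p)); last by rewrite opprB [RHS]addrC addrA subrK.
by rewrite ipBl px // prE.2 // subrr.
Qed.

End hilbert_geometry.

(** * Functions of finite level on the limit set *)

Section words_of_length.
Variable g : nat.
Local Notation letter := (letter g).

Definition words n : seq (seq letter) :=
  [seq tval t | t <- enum [pred t : n.-tuple letter | reduced t]].

Lemma mem_words n (w : seq letter) : (w \in words n) = (size w == n) && reduced w.
Proof.
apply/mapP/andP => [[t]|[/eqP sw rw]].
  by rewrite mem_enum inE => rt ->; rewrite size_tuple eqxx.
have st : size w == n by rewrite sw.
by exists (Tuple st) => //; rewrite mem_enum inE.
Qed.

Lemma words_uniq n : uniq (words n).
Proof. by rewrite map_inj_uniq ?enum_uniq //; exact: val_inj. Qed.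

Lemma size_words0 : size (words 0) = 1%N.
Proof.
rewrite (@perm_size _ _ [:: [::]]) //; apply: uniq_perm; rewrite ?words_uniq // => w.
by rewrite mem_words inE size_eq0; case: w.
Qed.

Lemma size_words1 : size (words 1) = (2 * g)%N.
Proof.
rewrite size_map -cardE (eq_card (_ : _ =i predT)).
  by rewrite card_tuple expn1 card_prod card_ord card_bool mulnC.
by move=> t; rewrite !inE; case: t => -[|a [|]].
Qed.

Lemma prefix_take n (v : nat -> letter) (w : seq letter) : (size w <= n)%N ->
  prefix_inf w v <-> w = take (size w) (mkseq v n).
Proof.
move=> wn; rewrite /prefix_inf (_ : take _ _ = mkseq v (size w)) //.
by rewrite -(subnKC wn) mkseqD take_size_cat ?size_mkseq.
Qed.

End words_of_length.

Section finite_level_functions.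
Context {R : realType} {g : nat} {rho : schottky R g}.
Hypotheses (cc : cocompact_group rho) (g2 : (1 < g)%N).
Variable x0 : P1 R.
Hypothesis Ox0 : domain_of_discontinuity rho x0.
Local Notation C := R[i].
Local Notation P := (P1 R).
Local Notation Lam := (limit_set rho).
Local Notation io := (end_point rho x0).
Local Notation sh := (shadow rho x0).
Local Notation filt := (filtration rho x0).
Local Notation cn := (@ComplexField.Normc.normc R).
Implicit Types (w : seq (letter g)) (a b f : P -> C).

Definition chi w : P -> C := \1_(sh w).

Lemma chi1 w x : sh w x -> chi w x = 1.
Proof. by move=> xw; rewrite /chi /indic mem_set. Qed.

Lemma chi0 w x : ~ sh w x -> chi w x = 0.
Proof. by move=> xw; rewrite /chi /indic memNset. Qed.

(** A description of the [n]-th step of the filtration without spans. The values off the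
    limit set matter, since the step is a set of functions on the sphere. *)
Definition level n f := (forall x, ~ Lam x -> f x = 0) /\
  (forall w x y, size w = n -> sh w x -> sh w y -> f x = f y).

Definition sample w : P := xget point (sh w).

Lemma sampleP w : reduced w -> sh w (sample w).
Proof.
move=> /(@shadow_nonempty _ _ rho g2 x0 _) [y yw]; rewrite /sample.
by case: xgetP => [x _ //|/(_ y)].
Qed.

Lemma sum_chi n (c : seq (letter g) -> C) w x : size w = n -> reduced w -> sh w x ->
  (\sum_(u <- words g n) c u *: chi u) x = c w.
Proof.
move=> sw rw xw; rewrite fct_sumE (bigD1_seq w) ?words_uniq ?mem_words ?sw ?eqxx //=.
rewrite big_seq_cond big1 ?addr0; first by rewrite [LHS](_ : _ = c w * chi w x) // chi1 ?mulr1.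
move=> u /andP[]; rewrite mem_words => /andP[/eqP su _] uw.
rewrite [LHS](_ : _ = c u * chi u x) // chi0 ?mulr0 // => xu.
by move/eqP: uw; apply; apply: (shadow_inj cc Ox0 _ xu xw); rewrite su sw.
Qed.

Lemma sum_chi0 n (c : seq (letter g) -> C) x : ~ Lam x ->
  (\sum_(u <- words g n) c u *: chi u) x = 0.
Proof.
move=> xL; rewrite fct_sumE big1 // => u _.
rewrite [LHS](_ : _ = c u * chi u x) // chi0 ?mulr0 // => xu; apply: xL.
exact: (shadow_limit cc Ox0 xu).
Qed.

(** The shadows of the words of length [n] partition the limit set. *)
Lemma level_sum n f : level n f -> f = \sum_(u <- words g n) f (sample u) *: chi u.
Proof.
move=> [f0 fc]; apply/funext => x; have [xL|xL] := pselect (Lam x); last first.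
  by rewrite f0 // sum_chi0.
have [v rv xv] := end_surj cc Ox0 xL; have rm := reduced_mkseq n rv.
have sm : sh (mkseq v n) x by rewrite xv; exact: (shadow_mkseq cc Ox0).
have s : size (mkseq v n) = n by rewrite size_mkseq.
rewrite (@sum_chi n (fun u => f (sample u)) _ x s rm sm).
by apply: fc sm _ => //; exact: sampleP.
Qed.

Lemma level_lin n (c : C) a b : level n a -> level n b -> level n (c *: a + b).
Proof.
move=> [a0 ac] [b0 bc]; have E x : (c *: a + b) x = c * a x + b x by [].
split=> [x xL|w x y sw xw yw]; rewrite !E; first by rewrite a0 // b0 // mulr0 addr0.
by rewrite (ac w x y) // (bc w x y).
Qed.

Lemma level0 n : level n (0 : P -> C). Proof. by []. Qed.

Lemma level_chi n w : (size w <= n)%N -> level n (chi w).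
Proof.
move=> wn; split=> [x xL|u x y su xu yu].
  by rewrite chi0 // => /(shadow_limit cc Ox0).
have H z : sh u z -> sh w z <-> w = take (size w) u.
  move=> /shadow_end [v [rv pv ->]]; rewrite (shadow_prefix cc Ox0) // (prefix_take _ wn).
  by rewrite pv su.
have [xw|xw] := pselect (sh w x).
  by rewrite !chi1 //; apply/(H y yu)/(H x xu).
by rewrite !chi0 // => /(H y yu)/(H x xu).
Qed.

Lemma filtrationP n a : filt n a <-> level n a.
Proof.
split.
  move=> [m [c [b [bP ->]]]]; elim/big_rec: _ => [|i f _ lf]; first exact: level0.
  apply: level_lin => //; have [w [rw wn ->]] := bP i; exact: level_chi.
move=> /level_sum ->; exists (size (words g n)).
exists (fun i => a (sample (nth [::] (words g n) i))), (fun i => chi (nth [::] (words g n) i)).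
split; last by rewrite (big_nth [::]) big_mkord.
move=> i; exists (nth [::] (words g n) i).
have := mem_nth [::] (ltn_ord i); rewrite mem_words => /andP[/eqP s r].
by rewrite s r.
Qed.

Lemma has_dim_filtration n : has_dim (filt n) (size (words g n)).
Proof.
exists (fun i => chi (nth [::] (words g n) i)).
have W (i : 'I_(size (words g n))) : size (nth [::] (words g n) i) = n /\ reduced (nth [::] (words g n) i).
  by have := mem_nth [::] (ltn_ord i); rewrite mem_words => /andP[/eqP].
have S (c : 'I_(size (words g n)) -> C) (i : 'I_(size (words g n))) x : sh (nth [::] (words g n) i) x ->
    (\sum_j c j *: chi (nth [::] (words g n) j)) x = c i.
  move=> xi; rewrite fct_sumE (bigD1 i) //= big1 ?addr0.
    by rewrite [LHS](_ : _ = c i * chi (nth [::] (words g n) i) x) // chi1 ?mulr1.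
  move=> j ji; rewrite [LHS](_ : _ = c j * chi (nth [::] (words g n) j) x) // chi0 ?mulr0 // => xj.
  have := shadow_inj cc Ox0 _ xj xi; rewrite (W i).1 (W j).1 => /(_ erefl) /eqP.
  by rewrite nth_uniq ?words_uniq // => /eqP/val_inj/eqP; rewrite (negbTE ji).
split.
  move=> c c0 i; have [x xi] := @shadow_nonempty _ _ rho g2 x0 _ (W i).2.
  by rewrite -(S c i x xi) c0.
apply/seteqP; split=> a.
  move=> /lin_span_range [c ->]; apply/filtrationP.
  elim/big_rec: _ => [|i f _ lf]; first exact: level0.
  by apply: level_lin => //; apply: level_chi; rewrite (W i).1.
move=> /filtrationP /level_sum ->; apply/lin_span_range.
exists (fun i => a (sample (nth [::] (words g n) i))).
by rewrite (big_nth [::]) big_mkord.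
Qed.

Lemma filtration_mono m n : (m <= n)%N -> filt m `<=` filt n.
Proof.
move=> mn a [k [c [b [bP ->]]]]; exists k, c, b; split=> // i.
by have [w [rw wm ->]] := bP i; exists w; split=> //; exact: leq_trans mn.
Qed.

Lemma dim_filtration0 : lin_dim (filt 0) = 1%N.
Proof. by rewrite -(size_words0 g); apply: lin_dimE; exact: has_dim_filtration. Qed.

Lemma dim_filtration1 : lin_dim (filt 1) = (2 * g)%N.
Proof. by rewrite -size_words1; apply: lin_dimE; exact: has_dim_filtration. Qed.

Lemma dim_filtration_ge n : (0 < n)%N -> (2 * g <= lin_dim (filt n))%N.
Proof.
move=> n0; rewrite -size_words1 (lin_dimE (has_dim_filtration n)).
by apply: has_dim_le (has_dim_filtration 1) (has_dim_filtration n) _; exact: filtration_mono.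
Qed.

Lemma cfun_cvg a : continuous_functions rho a <->
  forall x, Lam x -> a y @[y --> within Lam (nbhs x)] --> a x.
Proof. exact: (subspace_continuousP Lam a). Qed.

Lemma cfunP a : continuous_functions rho a <->
  forall x, Lam x -> forall e : R, 0 < e -> exists2 d : R, 0 < d &
    forall y, Lam y -> chordal y x < d -> cn (a y - a x) < e.
Proof.
rewrite cfun_cvg; split=> H x Lx.
  move=> e e0; have /cvg_cn /(_ e e0) /nbhs_P [d d0 dP] := H x Lx.
  by exists d => // y Ly yd; exact: dP.
apply/cvg_cn => e e0; have [d d0 dP] := H x Lx e e0.
by apply/nbhs_P; exists d => // y yd Ly; exact: dP.
Qed.

Lemma locally_constant_continuous a : locally_constant_functions rho a -> continuous_functions rho a.
Proof.
move=> la; apply/cfunP => x Lx e e0; have /nbhs_P [d d0 dP] := la x Lx.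
by exists d => // y Ly yd; rewrite (dP y yd Ly) subrr cn0.
Qed.

Lemma level_locally_constant n a : level n a -> locally_constant_functions rho a.
Proof.
move=> [_ ac] x Lx; have [v rv xv] := end_surj cc Ox0 Lx.
have rm := reduced_mkseq n rv.
have sx : sh (mkseq v n) x by rewrite xv; exact: (shadow_mkseq cc Ox0).
have oU : open (~` (Lam `\` sh (mkseq v n))) by apply: closed_openC; exact: (closed_shadowC cc Ox0).
have : nbhs x (~` (Lam `\` sh (mkseq v n))) by apply: open_near => // -[].
apply: filterS => y ny Ly; apply: (ac (mkseq v n)) => //; first by rewrite size_mkseq.
by apply: contrapT => nyw; apply: ny.
Qed.

Lemma cfun_lin (c : C) a b : continuous_functions rho a -> continuous_functions rho b ->
  continuous_functions rho (c *: a + b).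
Proof.
move=> /cfun_cvg ca /cfun_cvg cb; apply/cfun_cvg => x Lx.
have FF : Filter (within Lam (nbhs x)) by exact: within_filter.
apply: (@cvgD C C _ _ FF (fun y => c * a y) b); last exact: cb.
by apply: (@cvgM C _ _ FF (fun=> c) a); [exact: cvg_cst|exact: ca].
Qed.

Lemma cfunM a b : continuous_functions rho a -> continuous_functions rho b ->
  continuous_functions rho (fun x => a x * b x).
Proof.
move=> /cfun_cvg ca /cfun_cvg cb; apply/cfun_cvg => x Lx.
have FF : Filter (within Lam (nbhs x)) by exact: within_filter.
by apply: (@cvgM C _ _ FF a b); [exact: ca|exact: cb].
Qed.

Lemma cfun_cst (c : C) : continuous_functions rho (fun=> c).
Proof. by apply/cfun_cvg => x Lx; exact: cvg_cst. Qed.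

Lemma cfun_ext a b : (forall x, Lam x -> a x = b x) -> continuous_functions rho a ->
  continuous_functions rho b.
Proof.
move=> ab /cfunP ca; apply/cfunP => x Lx e e0; have [d d0 dP] := ca x Lx e e0.
by exists d => // y Ly yd; rewrite -!ab //; exact: dP.
Qed.

Lemma cfun_level n a : level n a -> continuous_functions rho a.
Proof. by move=> /level_locally_constant; exact: locally_constant_continuous. Qed.

(** Continuous functions are uniformly approximated by functions of finite level, as
    they vary little on small shadows. *)
Lemma level_dense a (e : R) : continuous_functions rho a -> 0 < e ->
  exists n b, level n b /\ forall x, Lam x -> cn (a x - b x) <= e.
Proof.
move=> /cfunP ca e0.
have cL : compact Lam by apply: (subclosed_compact _ (@P1_compact R)) => //; exact: limit_closed.
have : \forall d \near (0 : R)^'+, forall x, Lam x -> Lam x -> forall y, Lam y -> chordal y x < d -> cn (a x - a y) <= e.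
  move/compact_near_coveringP: cL; apply => x Lx.
  have e2 : 0 < e / 2 by rewrite divr_gt0.
  have [k k0 kP] := ca x Lx _ e2.
  have k2 : 0 < k / 2 by rewrite divr_gt0.
  have nx : nbhs x [set y | chordal y x < k / 2] by apply/nbhs_P; exists (k / 2).
  near=> x' d => /= Lx' y Ly yd.
  have x'k : chordal x' x < k / 2 by near: x'.
  have dk : d <= k / 2 by near: d; exact: nbhs_right_le.
  have h1 := kP x' Lx'; have h2 := kP y Ly.
  have tri := chordal_tri y x' x.
  have := cnD (a x' - a x) (a x - a y); rewrite addrA subrK (cnB (a x) (a y)).
  have {}h1 : cn (a x' - a x) < e / 2 by apply: h1; move: x'k k0; lra.
  have {}h2 : cn (a y - a x) < e / 2 by apply: h2; move: x'k k0 tri dk yd; lra.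
  by lra.
move=> H; have /filter_ex [d [d0 dP]] : \forall d \near (0 : R)^'+, 0 < d /\
    forall x, Lam x -> Lam x -> forall y, Lam y -> chordal y x < d -> cn (a x - a y) <= e.
  by near=> d; split; near: d => //; exact: nbhs_right_gt.
have [N NP] := small_shadow cc Ox0 d0.
pose b := \sum_(u <- words g N) a (sample u) *: chi u.
exists N, b; split.
  rewrite /b big_seq; elim/big_rec: _ => [|u f]; first by [].
  by rewrite mem_words => /andP[/eqP su _] lf; apply: level_lin => //; apply: level_chi; rewrite su.
move=> x Lx; have [v rv xv] := end_surj cc Ox0 Lx; have rm := reduced_mkseq N rv.
have sm : sh (mkseq v N) x by rewrite xv; exact: (shadow_mkseq cc Ox0).
have s : size (mkseq v N) = N by rewrite size_mkseq.
have pm := sampleP rm.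
rewrite /b (@sum_chi N (fun u => a (sample u)) _ x s rm sm); apply: dP => //.
  exact: (shadow_limit cc Ox0 pm).
by apply: (NP _ rm) => //; rewrite s.
Unshelve. all: by end_near. Qed.

Lemma measurable_cfun (f : P -> R) : {within Lam, continuous f} ->
  measurable_fun (Lam : set (borelP1 R)) (f : borelP1 R -> R).
Proof.
move=> /continuousP cf mD; apply: (measurability _ (RGenOpens.measurableE R)) => //.
move=> _ [_ [a [b ->] <-]].
have oab : open (`]a, b[%classic : set R) by exact: interval_open.
have /open_subspaceP [V oV VE] := cf _ oab.
rewrite setIC -VE; apply: measurableI => //; exact: measurable_open.
Qed.

End finite_level_functions.

(** * The spectral decomposition of the Dirac operator *)

Section spectral_triple_of_group.
Context {R : realType} {g : nat} {rho : schottky R g}.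
Hypotheses (cc : cocompact_group rho) (g2 : (1 < g)%N).
Variable S : spectral_triple rho.
Local Notation C := R[i].
Local Notation P := (P1 R).
Local Notation Lam := (limit_set rho).
Local Notation x0 := (st_base S).
Local Notation Ox0 := (@st_baseP R g rho S).
Local Notation mu := (st_mu S).
Local Notation muP := (@st_muP R g rho S).
Local Notation ip := (@st_ip R g rho S).
Local Notation ipP := (@st_ipP R g rho S).
Local Notation vec := (st_vec S).
Local Notation rep := (@st_rep R g rho S).
Local Notation cfun := (continuous_functions rho).
Local Notation lev := (@level R g rho x0).
Local Notation chi := (@chi R g rho x0).
Local Notation filt := (filtration rho x0).
Local Notation cn := (@ComplexField.Normc.normc R).
Local Notation mass := (@mass R g rho x0 mu).
Implicit Types (a b : P -> C) (w : seq (letter g)).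

Lemma cfun_lev n a : lev n a -> cfun a.
Proof. exact: (cfun_level cc Ox0). Qed.

Lemma cfun_chi w : cfun (chi w).
Proof. by apply: cfun_lev; exact: (level_chi cc Ox0 (leqnn (size w))). Qed.

Lemma vec0 : vec 0 = 0.
Proof.
have c0 : cfun 0 by exact: cfun_cst.
have := @st_vec_linear R g rho S 1 _ _ c0 c0; rewrite !scale1r addr0 => E.
by apply: (addIr (vec 0)); rewrite add0r -E.
Qed.

Lemma vecZ (c : C) a : cfun a -> vec (c *: a) = c *: vec a.
Proof.
move=> ca; have c0 : cfun 0 by exact: cfun_cst.
by have := @st_vec_linear R g rho S c _ _ ca c0; rewrite vec0 !addr0.
Qed.

Lemma state_ext a b : (forall x, Lam x -> a x = b x) -> state rho mu a = state rho mu b.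
Proof.
by move=> ab; rewrite /state; congr Complex; apply: eq_Rintegral => x; rewrite inE => /ab ->.
Qed.

(** The difference of the two vectors is orthogonal to both of them. *)
Lemma vec_ext a b : cfun a -> (forall x, Lam x -> a x = b x) -> vec a = vec b.
Proof.
move=> ca ab; have cb := cfun_ext ab ca.
have E c : cfun c -> ip (vec a - vec b) (vec c) = 0.
  move=> cc'; rewrite (ipBl ipP) !st_vec_isometry //.
  by rewrite (state_ext (b := fun x => (c x)^*%C * b x)) ?subrr // => x /ab ->.
apply/eqP; rewrite -subr_eq0; apply/eqP; apply: (ip_eq0 ipP).
by rewrite (ipBr ipP) !E // subrr.
Qed.

Lemma state_chi w : reduced w -> state rho mu (chi w) = (mass w)%:C%C.
Proof.
move=> rw; have mw := measurable_shadow cc Ox0 rw; have mL := @measurable_limit R g rho.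
rewrite /state /Rintegral.
have -> : (\int[mu]_(x in Lam) (complex.Re (chi w x))%:E = mu (shadow rho x0 w))%E.
  rewrite (eq_integral (fun x : borelP1 R => ((\1_(shadow rho x0 w : set (borelP1 R)) x : R)%:E))).
    rewrite integral_indic //; congr (mu _).
    by apply/seteqP; split=> [x []|x xw] //; split=> //; exact: (shadow_limit cc Ox0 xw).
  by move=> x _; rewrite /chi /indic; case: (x \in _).
rewrite (eq_integral (fun=> 0%E)) ?integral0 //.
by move=> x _; rewrite /chi /indic; case: (x \in _).
Qed.

Lemma chi_sqr w x : (chi w x)^*%C * chi w x = chi w x.
Proof. by rewrite /chi /indic; case: (x \in _); rewrite ?mulr0 // mulr1 rmorph1. Qed.

Lemma ip_chi w : reduced w -> ip (vec (chi w)) (vec (chi w)) = (mass w)%:C%C.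
Proof.
move=> rw; rewrite st_vec_isometry; [|exact: cfun_chi|exact: cfun_chi].
by rewrite -state_chi //; apply: state_ext => x _; exact: chi_sqr.
Qed.

Lemma vec_chi_neq0 w : reduced w -> vec (chi w) != 0.
Proof.
move=> rw; apply/eqP => v0; have := ip_chi rw; rewrite v0 (ip0l ipP) => /esym/eqP.
by rewrite -cn_eq0 cn_real normr_eq0 gt_eqF //; exact: (mass_gt0 cc g2 Ox0 muP).
Qed.

(** The measure has mass one, so the uniform norm dominates the Hilbert norm. *)
Lemma vec_close a b (e : R) : cfun a -> cfun b -> 0 <= e ->
  (forall x, Lam x -> cn (a x - b x) <= e) -> `|vec a - vec b| <= e%:C%C.
Proof.
move=> ca cb e0 ab.
have cd : cfun ((-1 : C) *: b + a) by exact: cfun_lin.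
have -> : vec a - vec b = vec ((-1 : C) *: b + a).
  by rewrite (@st_vec_linear R g rho S (-1) _ _ cb ca) scaleN1r addrC.
have e0C : 0 <= e%:C%C :> C by rewrite lecR.
rewrite -(ler_pXn2r (n := 2)) ?nnegrE // (ip_norm ipP) st_vec_isometry //.
set d := (-1) *: b + a in cd *.
have dE x : d x = a x - b x by rewrite /d [LHS](_ : _ = -1 * b x + a x) // mulN1r addrC.
have sq z : (z^*%C * z : C) = (cn z ^+ 2)%:C%C by rewrite mulrC mulc_conj.
have -> : state rho mu (fun x => (d x)^*%C * d x) =
    (\int[mu]_(x in Lam) (cn (d x) ^+ 2))%:C%C.
  rewrite (state_ext (b := fun x => (cn (d x) ^+ 2)%:C%C)) => [|x _]; last exact: sq.
  rewrite /state /=; congr Complex.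
  by rewrite /Rintegral (eq_integral (fun=> 0%E)) ?integral0.
rewrite -rmorphXn lecR.
have mL := @measurable_limit R g rho.
have [mL1 _] := muP.
have cs : {within Lam, continuous (fun x => cn (d x) ^+ 2)}.
  apply/subspace_continuousP => x Lx; have /cfun_cvg /(_ x Lx) dx := cd.
  have FF : Filter (within Lam (nbhs x)) by exact: within_filter.
  by apply: (@cvgM R _ _ FF (fun y => cn (d y)) (fun y => cn (d y))); exact: cvg_cnorm.
rewrite -[leRHS](mulr1) -[X in _ * X](_ : fine (mu Lam) = 1); last by rewrite mL1.
rewrite -Rintegral_cst // /Rintegral.
have md : measurable_fun (Lam : set (borelP1 R)) (fun x : borelP1 R => (cn (d x) ^+ 2)%:E).
  by apply/measurable_EFinP; exact: measurable_cfun.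
have le : (\int[mu]_(x in Lam) (cn (d x) ^+ 2)%:E <= \int[mu]_(x in Lam) (e ^+ 2)%:E)%E.
  apply: ge0_le_integral => //.
  - by move=> x _; rewrite lee_fin sqr_ge0.
  - by move=> x Lx; rewrite lee_fin dE ler_pXn2r ?nnegrE ?cn_ge0 // ab.
have fin : (\int[mu]_(x in Lam) (e ^+ 2)%:E)%E = (e ^+ 2)%:E.
  rewrite (_ : (fun x : borelP1 R => (e ^+ 2)%:E) = cst (e ^+ 2)%:E) // integral_cst //.
  by rewrite [X in (_ * X)%E]mL1 mule1.
rewrite fin in le *; rewrite -lee_fin fineK //.
rewrite ge0_fin_numE; first by apply: le_lt_trans le (ltry _).
by apply: integral_ge0 => x _; rewrite lee_fin sqr_ge0.
Qed.

Definition Hn n : set S := vec @` filt n.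

Lemma Hn_vec n a : lev n a -> Hn n (vec a).
Proof. by move=> la; exists a => //; apply/(filtrationP cc g2 Ox0). Qed.

Lemma HnP n x : Hn n x <-> exists2 a, lev n a & x = vec a.
Proof.
split; last by move=> [a la ->]; exact: Hn_vec.
by move=> [a /(filtrationP cc g2 Ox0) la <-]; exists a.
Qed.

Lemma Hn_lin n (c : C) x y : Hn n x -> Hn n y -> Hn n (c *: x + y).
Proof.
move=> /HnP [a la ->] /HnP [b lb ->]; rewrite -st_vec_linear; last 2 first.
- exact: cfun_lev la.
- exact: cfun_lev lb.
by apply: Hn_vec; exact: level_lin.
Qed.

Lemma Hn0 n : Hn n 0.
Proof. by rewrite -vec0; apply: Hn_vec; exact: level0. Qed.

Lemma Hn_mono m n : (m <= n)%N -> Hn m `<=` Hn n.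
Proof. by move=> mn x [a fa <-]; exists a => //; exact: filtration_mono fa. Qed.

Lemma Hn_dense : closure (\bigcup_n Hn n) = setT.
Proof.
apply/seteqP; split=> // y _ U /nbhs_ballP [e /= e0 eU].
have e'0 : 0 < complex.Re e by move: e0; rewrite ltcE => /andP[].
have eE : e = (complex.Re e)%:C%C.
  by move: e0; rewrite ltcE => /andP[/eqP]; case: (e) => r i /= ->.
pose r := complex.Re e / 2; have r0 : 0 < r by rewrite divr_gt0.
have r0C : 0 < r%:C%C :> C by rewrite ltcR.
have : closure (vec @` cfun) y by rewrite st_vec_dense.
move=> /(_ _ (nbhsx_ballx y r%:C%C r0C)) [_ [[a ca <-]]].
rewrite -ball_normE /ball_ /= => ya.
have [n [b [lb ab]]] := level_dense cc g2 Ox0 ca r0.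
exists (vec b); split; first by exists n => //; exact: Hn_vec.
apply: eU; rewrite -ball_normE /ball_ /= -(subrK (vec a) y) -addrA.
apply: le_lt_trans (ler_normD _ _) _.
have := vec_close ca (cfun_lev lb) (ltW r0) ab => h.
have -> : e = r%:C%C + r%:C%C by rewrite eE -rmorphD /= /r -splitr.
exact: ltr_leD ya h.
Qed.

Lemma vec_sum_chi n (c : seq (letter g) -> C) :
  vec (\sum_(u <- words g n) c u *: chi u) = \sum_(u <- words g n) c u *: vec (chi u).
Proof.
suff H (s : seq (seq (letter g))) :
    vec (\sum_(u <- s) c u *: chi u) = \sum_(u <- s) c u *: vec (chi u) /\
    cfun (\sum_(u <- s) c u *: chi u) by case: (H (words g n)).
elim: s => [|u s [IH cs]]; first by rewrite !big_nil vec0; split=> //; exact: cfun_cst.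
have cu := @cfun_chi u.
have E : \sum_(v <- u :: s) c v *: chi v = c u *: chi u + \sum_(v <- s) c v *: chi v.
  by rewrite big_cons.
rewrite E; split; last by apply: cfun_lin; [exact: cu|exact: cs].
by rewrite big_cons -IH; exact: (@st_vec_linear R g rho S (c u) _ _ cu cs).
Qed.

(** An orthonormal basis of [Hn n] that extends the one of [Hn n.-1]. *)
Definition Ln : nat -> seq S := fix Ln n :=
  let W := [seq vec (chi w) | w <- words g n] in
  if n is m.+1 then gs ip (Ln m) W else gs ip [::] W.

Lemma LnP n : [/\ orthonormal ip (Ln n), (forall u, u \in words g n -> in_span ip (Ln n) (vec (chi u))) &
  forall y, y \in Ln n -> Hn n y].
Proof.
have mW m y : y \in [seq vec (chi w) | w <- words g m] -> Hn m y.
  move=> /mapP [u]; rewrite mem_words => /andP[/eqP su _] ->; apply: Hn_vec.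
  by apply: (level_chi cc Ox0); rewrite su.
elim: n => [|n [on _ In]].
  have o0 : orthonormal ip [::] by [].
  have [wl ws _] := gsP ipP [seq vec (chi w) | w <- words g 0] o0.
  split=> [//|u uw|]; first by apply: ws; exact: map_f.
  apply: (gs_sub (E := Hn 0)) => //; [exact: Hn_lin|exact: Hn0|exact: mW].
have [wl ws _] := gsP ipP [seq vec (chi w) | w <- words g n.+1] on.
split=> [//|u uw|]; first by apply: ws; exact: map_f.
apply: (gs_sub (E := Hn n.+1)); [exact: Hn_lin|exact: Hn0| |exact: mW].
by move=> y /In; apply: Hn_mono.
Qed.

Lemma Ln_prefix m n : (m <= n)%N -> exists l, Ln n = Ln m ++ l.
Proof.
move=> /subnK <-; elim: (n - m)%N => [|k [l E]]; first by exists [::]; rewrite cats0.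
have [on _ _] := LnP (k + m).
have [_ _ [l' E']] := gsP ipP [seq vec (chi w) | w <- words g (k + m).+1] on.
by exists (l ++ l'); rewrite addSn /= E' E catA.
Qed.

Lemma Hn_span n y : Hn n y <-> in_span ip (Ln n) y.
Proof.
have [on Wn In] := LnP n; split.
  move=> /HnP [a la ->]; rewrite (level_sum cc g2 Ox0 la) vec_sum_chi.
  rewrite big_seq_cond; elim/big_rec: _ => [|u z /andP[uw _] sz]; first exact: (pr0 ipP).
  by apply: (in_spanD ipP) => //; apply: (in_spanZ ipP); exact: Wn.
move=> <-; rewrite /pr big_seq; elim/big_rec: _ => [|e z eL zH]; first exact: Hn0.
by apply: Hn_lin => //; exact: In.
Qed.

Lemma projE n (y : S) : Defs.proj n y = pr ip (Ln n) y.
Proof. by have [on _ _] := LnP n; apply: (@orthogonal_projectionE _ _ ip ipP (vec @` filt n) (Ln n) y on) => z; exact: Hn_span. Qed.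

Lemma rep_mul a b : cfun a -> cfun b -> rep a (vec b) = vec (fun x => a x * b x).
Proof. exact: st_rep_mul. Qed.

(** A shadow splits into two shadows of positive mass, so the filtration is strict. *)
Lemma Hn_strict n : exists2 y, Hn n.+1 y & ~ Hn n y.
Proof.
have [w0 rw0 sw0] : exists2 w : seq (letter g), reduced w & size w = n.
  pose a : letter g := (Ordinal (ltnW g2), false).
  by exists (mkseq (fun=> a) n); [exact: reduced_mkseq (reduced_inf_const a)|rewrite size_mkseq].
pose bad := if w0 is a :: w then linv (last a w) else (Ordinal (ltnW g2), false) : letter g.
have [a [ab _]] := avoid_letters g2 bad bad.
have [a' [a'b a'a]] := avoid_letters g2 bad a.
have ext c : c != bad -> reduced (w0 ++ [:: c]).
  by move=> cb; rewrite reduced_cat rw0 /= /bad in cb *; case: (w0) cb.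
have [ra ra'] := (ext a ab, ext a' a'b).
have sz c : size (w0 ++ [:: c]) = n.+1 by rewrite size_cat sw0 addn1.
exists (vec (chi (w0 ++ [:: a]))).
  by apply: Hn_vec; apply: (level_chi cc Ox0); rewrite sz.
move=> /HnP [b lb E]; have [b0 bc] := lb.
have sub c y : shadow rho x0 (w0 ++ [:: c]) y -> shadow rho x0 w0 y.
  move=> [v [rv pv] <-]; exists v => //; split=> //.
  have := (prefix_take v (w := w0) (n := n.+1)); rewrite sw0 => /(_ (leqnSn n)) ->.
  by rewrite /prefix_inf sz in pv; rewrite -pv take_size_cat.
have [z zw] := @shadow_nonempty _ _ rho g2 x0 _ rw0.
have cb := cfun_lev lb.
have bE c y : shadow rho x0 (w0 ++ [:: c]) y -> b y = b z by move=> /sub yw; exact: (bc w0).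
have ca := @cfun_chi (w0 ++ [:: a]).
have key c : reduced (w0 ++ [:: c]) -> (c == a)%:R = b z.
  move=> rc; have cchi := @cfun_chi (w0 ++ [:: c]).
  have : rep (chi (w0 ++ [:: c])) (vec (chi (w0 ++ [:: a]))) = rep (chi (w0 ++ [:: c])) (vec b) by rewrite E.
  rewrite !rep_mul // => EE.
  have v1 : vec (fun x => chi (w0 ++ [:: c]) x * chi (w0 ++ [:: a]) x) = (c == a)%:R *: vec (chi (w0 ++ [:: c])).
    rewrite -vecZ //; apply: vec_ext; first exact: cfunM.
    move=> x _; rewrite [RHS](_ : _ = (c == a)%:R * chi (w0 ++ [:: c]) x) //.
    have [xc|xc] := pselect (shadow rho x0 (w0 ++ [:: c]) x); last by rewrite chi0 // mul0r mulr0.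
    rewrite (chi1 xc) mul1r mulr1; case: eqP => [<-|ca']; first by rewrite chi1.
    rewrite chi0 // => xa; apply: ca'.
    have := shadow_inj cc Ox0 _ xc xa; rewrite !sz => /(_ erefl) /eqP.
    by rewrite eqseq_cat // eqxx /= => /eqP [].
  have v2 : vec (fun x => chi (w0 ++ [:: c]) x * b x) = b z *: vec (chi (w0 ++ [:: c])).
    rewrite -vecZ //; apply: vec_ext; first exact: cfunM.
    move=> x _; rewrite [RHS](_ : _ = b z * chi (w0 ++ [:: c]) x) //.
    have [xc|xc] := pselect (shadow rho x0 (w0 ++ [:: c]) x); last by rewrite chi0 // mul0r mulr0.
    by rewrite (chi1 xc) mul1r mulr1 (bE c).
  move: EE; rewrite v1 v2 => /eqP; rewrite -subr_eq0 -scalerBl scaler_eq0.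
  by rewrite (negbTE (vec_chi_neq0 rc)) orbF subr_eq0 => /eqP.
have := key a ra; rewrite -(key a' ra') eqxx (negbTE a'a) => /eqP.
by rewrite oner_eq0.
Qed.

Lemma size_Ln n : (n < size (Ln n))%N.
Proof.
elim: n => [|n IH].
  rewrite lt0n size_eq0; apply/eqP => L0; have := vec_chi_neq0 (erefl : reduced ([::] : seq (letter g))).
  have [_ W _] := LnP 0; have := W [::]; rewrite mem_words L0 => /(_ isT) <-.
  by rewrite /pr big_nil eqxx.
have [l E] := Ln_prefix (leqnSn n).
case: l E => [|z l] E; last by rewrite E size_cat /=; apply: leq_trans (_ : (n.+2 <= n.+1 + (size l).+1)%N) _; lia.
have [y /Hn_span y1 y0] := Hn_strict n; exfalso; apply: y0; apply/Hn_span.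
by move: y1; rewrite E cats0.
Qed.

(** The bases [Ln n] extend each other, and [Ln k] has more than [k] vectors; so the [k]-th
    vector of their union can be read in [Ln k]. *)
Definition en k : S := (Ln k)`_k.

Lemma en_nth n k : (k < size (Ln n))%N -> en k = (Ln n)`_k.
Proof.
move=> kn; have [l1 E1] := Ln_prefix (leq_maxl k n); have [l2 E2] := Ln_prefix (leq_maxr k n).
rewrite /en; transitivity ((Ln (maxn k n))`_k); first by rewrite E1 nth_cat size_Ln.
by rewrite E2 nth_cat kn.
Qed.

Lemma en_basis : orthonormal_basis ip en.
Proof.
split=> [i j|x xe].
  have [on _ _] := LnP (maxn i j).
  have ii : (i < size (Ln (maxn i j)))%N by apply: leq_ltn_trans (size_Ln _); exact: leq_maxl.
  have jj : (j < size (Ln (maxn i j)))%N by apply: leq_ltn_trans (size_Ln _); exact: leq_maxr.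
  by rewrite (en_nth ii) (en_nth jj) on.
apply: (orthogonal_dense ipP Hn_dense) => y [n _ /Hn_span <-].
rewrite pr_nth (ip_sumr ipP) big1 // => i _.
by rewrite (ipZr ipP) -(en_nth (ltn_ord i)) xe mulr0.
Qed.

Lemma en_level_ex k : exists n, (k < size (Ln n))%N.
Proof. by exists k; exact: size_Ln. Qed.

Definition en_level k := ex_minn (en_level_ex k).

Lemma en_levelP k n : (en_level k <= n)%N = (k < size (Ln n))%N.
Proof.
rewrite /en_level; case: ex_minnP => m km min; apply/idP/idP; last exact: min.
move=> mn; have [l ->] := Ln_prefix mn; by rewrite size_cat ltn_addr.
Qed.

Lemma en_level0 : en_level 0 = 0%N.
Proof. by apply/eqP; rewrite -leqn0 en_levelP size_Ln. Qed.

Lemma size_Ln0 : size (Ln 0) = 1%N.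
Proof.
apply/eqP; rewrite eqn_leq size_Ln andbT /=.
have : size (words g 0) = 1%N by exact: size_words0.
case: (words g 0) => [|w [|w' s]] //= _; rewrite /gs /= /gs_step.
by case: ifP; rewrite ?size_rcons.
Qed.

Lemma en_level_gt0 k : (0 < k)%N -> (0 < en_level k)%N.
Proof. by move=> k0; rewrite ltnNge en_levelP size_Ln0 -ltnNge ltnS. Qed.

Lemma en_level1 : en_level 1 = 1%N.
Proof. by apply/eqP; rewrite eqn_leq en_level_gt0 // en_levelP size_Ln. Qed.

Lemma ip_projr n (y : S) k : ip (Defs.proj n y) (en k) = if (en_level k <= n)%N then ip y (en k) else 0.
Proof.
have [on _ _] := LnP n; rewrite projE en_levelP; case: ifPn => kn.
  by rewrite (en_nth kn) (ip_pr_nth ipP).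
rewrite pr_nth (ip_suml ipP) big1 // => i _.
rewrite (ipZl ipP) -(en_nth (ltn_ord i)); have [oe _] := en_basis.
by rewrite oe; case: eqP => [E|_]; [rewrite -E ltn_ord in kn|rewrite mulr0].
Qed.

Lemma proj_en n k : Defs.proj n (en k) = if (en_level k <= n)%N then en k else 0.
Proof.
have [on _ _] := LnP n; rewrite projE en_levelP; case: ifPn => kn.
  by rewrite (en_nth kn); exact: in_span_nth.
rewrite pr_nth big1 // => i _; rewrite -(en_nth (ltn_ord i)); have [oe _] := en_basis.
by rewrite oe; case: eqP => [E|_]; [rewrite E ltn_ord in kn|rewrite scale0r].
Qed.

Lemma spectral_proj_en n k : dirac_spectral_proj n (en k) = if n == en_level k then en k else 0.
Proof.
case: n => [|n]; rewrite /dirac_spectral_proj !proj_en.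
  by rewrite leqn0 eq_sym.
case: (ltngtP n.+1 (en_level k)) => h; rewrite ?subrr ?subr0 //.
- by rewrite leqNgt (ltnW h) subrr.
- by rewrite -ltnS h subrr.
- by rewrite -h leqNgt ltnSn subr0.
Qed.

Lemma ip_spectral_projr n y k : ip (dirac_spectral_proj n y) (en k) =
  if n == en_level k then ip y (en k) else 0.
Proof.
case: n => [|n]; rewrite /dirac_spectral_proj ?(ipBl ipP) !ip_projr.
  by rewrite leqn0 eq_sym.
case: (ltngtP n.+1 (en_level k)) => h; rewrite ?subrr ?subr0 //.
- by rewrite leqNgt (ltnW h) subrr.
- by rewrite -ltnS h subrr.
- by rewrite -h leqNgt ltnSn subr0.
Qed.

Definition lambda k : R := dirac_eigenvalue S (en_level k).

Lemma lambda0 : lambda 0 = 1.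
Proof. by rewrite /lambda en_level0 /dirac_eigenvalue (dim_filtration0 cc g2 Ox0). Qed.

Lemma lambda1 : lambda 1 = ((2 * g) ^ 3)%:R.
Proof. by rewrite /lambda en_level1 /dirac_eigenvalue (dim_filtration1 cc g2 Ox0). Qed.

Lemma lambda_ge k : (0 < k)%N -> ((2 * g) ^ 3)%:R <= lambda k.
Proof.
move=> k0; rewrite /lambda /dirac_eigenvalue ler_nat leq_exp2r //.
by apply: (dim_filtration_ge cc g2 Ox0); exact: en_level_gt0.
Qed.

Lemma calculus_en (f : R -> C) k N : (en_level k < N)%N -> dirac_calculus f (en k) N = f (lambda k) *: en k.
Proof.
move=> kN; rewrite /dirac_calculus (bigD1 (Ordinal kN)) //= big1 ?addr0.
  by rewrite spectral_proj_en eqxx.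
by move=> i; rewrite -val_eqE spectral_proj_en => /negbTE -> ; rewrite scaler0.
Qed.

Lemma calculus_cvg (f : R -> C) k : dirac_calculus f (en k) @ \oo --> f (lambda k) *: en k.
Proof.
apply: cvg_near_cst; exists (en_level k).+1 => // N /= kN; exact: calculus_en.
Qed.

Lemma abs_dirac_pow_en s k : abs_dirac_pow s (en k) = cpow `|lambda k| s *: en k.
Proof.
apply: cvg_lim; first exact: norm_hausdorff.
exact: (@calculus_cvg (fun l => cpow `|l| s) k).
Qed.

Lemma ip_calculusr (f : R -> C) y k N : (en_level k < N)%N ->
  ip (dirac_calculus f y N) (en k) = f (lambda k) * ip y (en k).
Proof.
move=> kN; rewrite /dirac_calculus (ip_suml ipP) (bigD1 (Ordinal kN)) //= big1 ?addr0.
  by rewrite (ipZl ipP) ip_spectral_projr eqxx.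
by move=> i; rewrite -val_eqE (ipZl ipP) ip_spectral_projr => /negbTE -> ; rewrite mulr0.
Qed.

End spectral_triple_of_group.

(** * Zeta functions near minus infinity *)

Section power_sums.
Context {R : realType}.
Implicit Types (M B c d x : R) (l t : nat -> R).

Lemma powR_large (q d B c : R) : 1 < q -> 0 < d -> exists2 s, s < c & B < d * q `^ (- s).
Proof.
move=> q1 d0; have lq : 0 < ln q by rewrite ln_gt0.
pose x := `|B| / (d * ln q) + `|c| + 1; exists (- x).
  rewrite ltrNl /x; apply: (@le_lt_trans _ _ (`|c|)); first by rewrite -normrN ler_norm.
  by rewrite -addrA addrCA ltrDl ltr_pwDr // divr_ge0 // mulr_ge0 ?ltW.
rewrite opprK /powR ifF; last by apply/negbTE; rewrite gt_eqF // (lt_trans _ q1).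
apply: (@lt_le_trans _ _ (d * (1 + x * ln q))); last first.
  by rewrite ler_pM2l // expR_ge1Dx.
have -> : d * (1 + x * ln q) = `|B| + (d + d * ln q * (`|c| + 1)).
  rewrite /x; field; by rewrite !gt_eqF.
apply: (@le_lt_trans _ _ `|B|); first exact: ler_norm.
by rewrite ltrDl addr_gt0 // mulr_gt0 ?mulr_gt0 // ltr_pwDr.
Qed.

Variables (l : nat -> R) (M : R).
Hypotheses (M1 : 1 < M) (l0 : l 0 = 1) (l1 : l 1 = M) (lM : forall k, (0 < k)%N -> M <= l k).

Lemma l_gt0 k : 0 < l k.
Proof.
by case: k => [|k]; [rewrite l0|apply: lt_le_trans (lM _) => //; exact: lt_trans M1].
Qed.

(** The terms of index [0] and [1] are [1] and [M ^ s]. *)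
Lemma power_sum_ge (s z : R) : (fun N => \sum_(k < N) l k `^ s) @ \oo --> z -> M `^ s <= z - 1.
Proof.
move=> H; have le : (fun N => \sum_(k < N) l k `^ s) 2%N <= limn (fun N => \sum_(k < N) l k `^ s).
  apply: nondecreasing_cvgn_le; last by apply/cvg_ex; exists z.
  apply/nondecreasing_seqP => n; rewrite big_ord_recr /= lerDl powR_ge0 //.
move: le; rewrite (cvg_lim _ H) // !big_ord_recr big_ord0 /= add0r l0 l1 powR1 => le.
by rewrite lerBrDl.
Qed.

(** For [s <= s0], each term after the first one satisfies
    [l k ^ s <= l k ^ s0 * M ^ (s - s0)]. *)
Lemma power_sum_le (s s0 z z0 : R) : s <= s0 ->
  (fun N => \sum_(k < N) l k `^ s) @ \oo --> z ->
  (fun N => \sum_(k < N) l k `^ s0) @ \oo --> z0 ->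
  z - 1 <= (z0 - 1) * M `^ (- s0) * M `^ s.
Proof.
move=> ss H H0.
rewrite -mulrA -powRD; last by rewrite (gt_eqF (lt_trans ltr01 M1)) implybT.
have M0 : 0 < M by exact: lt_trans M1.
have le n : \sum_(k < n.+1) l k `^ s - 1 <= (z0 - 1) * M `^ (- s0 + s).
  rewrite big_ord_recl /= l0 powR1 addrC addKr.
  have le0 : \sum_(k < n) l k.+1 `^ s0 <= z0 - 1.
    have le : (fun N => \sum_(k < N) l k `^ s0) n.+1 <= limn (fun N => \sum_(k < N) l k `^ s0).
      apply: nondecreasing_cvgn_le; last by apply/cvg_ex; exists z0.
      apply/nondecreasing_seqP => m; rewrite big_ord_recr /= lerDl powR_ge0 //.
    by move: le; rewrite (cvg_lim _ H0) // big_ord_recl /= l0 powR1 lerBrDl.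
  apply: le_trans (_ : (\sum_(k < n) l k.+1 `^ s0) * M `^ (- s0 + s) <= _); last first.
    by rewrite ler_wpM2r ?powR_ge0.
  rewrite mulr_suml; apply: ler_sum => i _; have li := l_gt0 i.+1.
  have -> : l i.+1 `^ s = l i.+1 `^ s0 * l i.+1 `^ (- s0 + s).
    by rewrite -powRD ?(gt_eqF li) ?implybT // addrA subrr add0r.
  rewrite ler_wpM2l ?powR_ge0 //.
  have -> : - s0 + s = - (s0 - s) by rewrite opprB addrC.
  rewrite !powRN lef_pV2 ?posrE ?powR_gt0 //.
  by apply: ge0_ler_powR; rewrite ?nnegrE ?subr_ge0 // ?(ltW M0) ?(ltW li) // lM.
have H1 : (fun N => \sum_(k < N.+1) l k `^ s - 1) @ \oo --> z - 1.
  by apply: cvgB; [rewrite (cvg_shiftS (fun N => \sum_(k < N) l k `^ s))|exact: cvg_cst].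
rewrite -(cvg_lim _ H1) //; apply: limr_le; first by apply/cvg_ex; exists (z - 1).
by apply: nearW.
Qed.

(** The term of index [0] is the leading one. *)
Lemma weighted_power_sum (t : nat -> R) (s z za : R) : (forall k, 0 <= t k <= 1) ->
  (fun N => \sum_(k < N) l k `^ s) @ \oo --> z ->
  (fun N => \sum_(k < N) l k `^ s * t k) @ \oo --> za ->
  t 0%N <= za <= t 0%N + (z - 1).
Proof.
move=> t01 H Ha.
have E n : \sum_(k < n.+1) l k `^ s * t k = t 0%N + \sum_(k < n) l k.+1 `^ s * t k.+1.
  by rewrite big_ord_recl /= l0 powR1 mul1r.
have Ha1 : (fun N => \sum_(k < N.+1) l k `^ s * t k) @ \oo --> za.
  by rewrite (cvg_shiftS (fun N => \sum_(k < N) l k `^ s * t k)).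
have H1 : (fun N => t 0%N + (\sum_(k < N.+1) l k `^ s - 1)) @ \oo --> t 0%N + (z - 1).
  apply: cvgD; first exact: cvg_cst.
  by apply: cvgB; [rewrite (cvg_shiftS (fun N => \sum_(k < N) l k `^ s))|exact: cvg_cst].
apply/andP; split.
  rewrite -(cvg_lim _ Ha1) //; apply: limr_ge; first by apply/cvg_ex; exists za.
  apply: nearW => n; rewrite E lerDl sumr_ge0 // => i _.
  by rewrite mulr_ge0 ?powR_ge0 //; case/andP: (t01 i.+1).
apply: (ler_cvg_to Ha1 H1); apply: nearW => n; rewrite E lerD2l.
rewrite big_ord_recl /= l0 powR1 addrC addKr; apply: ler_sum => i _.
by rewrite ler_piMr ?powR_ge0 //; case/andP: (t01 i.+1).
Qed.

End power_sums.

Section zeta_of_triple.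
Context {R : realType} {g : nat} {rho : schottky R g}.
Hypotheses (cc : cocompact_group rho) (g2 : (1 < g)%N).
Variable S : spectral_triple rho.
Local Notation C := R[i].
Local Notation P := (P1 R).
Local Notation Lam := (limit_set rho).
Local Notation x0 := (st_base S).
Local Notation Ox0 := (@st_baseP R g rho S).
Local Notation mu := (st_mu S).
Local Notation muP := (@st_muP R g rho S).
Local Notation ip := (@st_ip R g rho S).
Local Notation ipP := (@st_ipP R g rho S).
Local Notation vec := (st_vec S).
Local Notation rep := (@st_rep R g rho S).
Local Notation cfun := (continuous_functions rho).
Local Notation chi := (@chi R g rho x0).
Local Notation cn := (@ComplexField.Normc.normc R).
Local Notation mass := (@mass R g rho x0 mu).
Local Notation en := (en S).
Local Notation lambda := (lambda cc g2 S).
Implicit Types (a b : P -> C) (w : seq (letter g)).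

Definition rank_pow (g : nat) : R := ((2 * g) ^ 3)%:R.

Lemma rank_pow_gt1 : 1 < rank_pow g.
Proof. by rewrite /rank_pow (ltr_nat _ 1) -(exp1n 3) ltn_exp2r //; lia. Qed.

Lemma en_vec k : exists2 b, cfun b & en k = vec b.
Proof.
have [_ _ In] := LnP cc g2 S k.
have /In /(HnP cc g2) [b lb ->] : en k \in Ln S k by rewrite mem_nth // size_Ln.
by exists b => //; exact: (cfun_lev cc lb).
Qed.

Lemma mass_nil : mass [::] = 1.
Proof. by rewrite /mass (shadow_nil cc Ox0); have [-> _] := muP. Qed.

Lemma vec_one : vec (chi [::]) = vec (fun=> 1).
Proof.
apply: vec_ext => [|x Lx]; first exact: cfun_chi.
by rewrite chi1 // (shadow_nil cc Ox0).
Qed.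

Lemma en0 : en 0 = vec (fun=> 1).
Proof.
rewrite /en /=; have := size_words0 g; have := mem_words 0 ([::] : seq (letter g)).
case: (words g 0) => [|w [|]] //; rewrite inE eqxx /= => /eqP <- _.
rewrite /gs /= /gs_step /pr big_nil subr0.
have v0 := vec_chi_neq0 cc g2 S (erefl : reduced ([::] : seq (letter g))).
rewrite (negbTE v0) /= -vec_one.
have nv : `|vec (chi [::])| ^+ 2 = 1 by rewrite (ip_norm ipP) ip_chi // mass_nil.
have -> : `|vec (chi [::])| = 1.
  by apply/eqP; rewrite -(eqrXn2 (n := 2)) // nv expr1n.
by rewrite invr1 scale1r.
Qed.

Lemma rep_en a (c : C) k : cfun a -> rep a (c *: en k) = c *: rep a (en k).
Proof.
move=> ca; have [b cb ->] := en_vec k.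
have cab : cfun (fun x => a x * b x) by exact: cfunM.
have ccb : cfun (c *: b).
  have c0 : cfun 0 by exact: cfun_cst.
  by rewrite -[_ *: _]addr0; exact: cfun_lin.
rewrite -vecZ // !rep_mul // -vecZ //; apply: vec_ext; first exact: cfunM.
by move=> x _; rewrite [LHS](_ : _ = a x * (c * b x)) // mulrCA.
Qed.

(** The function [a] acts as an orthogonal projection, since it is real and idempotent. *)
Lemma chi_coef a w k : cfun a -> (forall x, Lam x -> a x = chi w x) ->
  0 <= ip (rep a (en k)) (en k) <= 1.
Proof.
move=> ca aw; have [b cb E] := en_vec k.
have cab : cfun (fun x => a x * b x) by exact: cfunM.
have [on _] := en_basis cc g2 S; have e1 := on k k; rewrite eqxx in e1.
set y := rep a (en k); have yE : y = vec (fun x => a x * b x) by rewrite /y E rep_mul.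
have yy : ip y y = ip y (en k).
  rewrite yE E !st_vec_isometry //; apply: state_ext => x /aw ->.
  by rewrite /chi /indic; case: (x \in _); rewrite ?mul0r ?mulr0 // !mul1r.
have y0 : 0 <= ip y y by rewrite -(ip_norm ipP) exprn_ge0.
rewrite -yy y0 /=.
have : 0 <= ip (en k - y) (en k - y) by rewrite -(ip_norm ipP) exprn_ge0.
rewrite (ipBl ipP) !(ipBr ipP) e1 -yy (ip_conj ipP y (en k)) -yy (conjc_ge0 y0) subrr subr0.
by rewrite subr_ge0.
Qed.

(** The first basis vector is the constant function [1]. *)
Lemma chi_coef0 a w : reduced w -> cfun a -> (forall x, Lam x -> a x = chi w x) ->
  ip (rep a (en 0)) (en 0) = (mass w)%:C%C.
Proof.
move=> rw ca aw; rewrite en0; have c1 : cfun (fun=> 1) by exact: cfun_cst.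
rewrite (rep_mul S ca c1) (@st_vec_isometry R g rho S _ _ (cfunM ca c1) c1).
rewrite -(state_chi cc S rw); apply: state_ext => x /aw ->.
by rewrite rmorph1 mul1r mulr1.
Qed.

Lemma cpow_real (x s : R) : cpow x s%:C%C = (x `^ s)%:C%C.
Proof. by rewrite /cpow /= mul0r cos0 sin0 mulr1. Qed.

Lemma zeta_sum a w (Z : C -> C) : cfun a -> (forall x, Lam x -> a x = chi w x) ->
  is_zeta S a Z -> exists c : R, forall s, s < c ->
    (fun N => \sum_(k < N) lambda k `^ s * complex.Re (ip (rep a (en k)) (en k))) @ \oo -->
      complex.Re (Z s%:C%C).
Proof.
move=> ca aw [_ [c H]]; exists c => s sc.
have /(_ en (en_basis cc g2 S)) T := H s%:C%C sc.
have := cvg_comp _ _ T (@continuous_Re R (Z s%:C%C)); apply: cvg_trans.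
apply: near_eq_cvg; apply: nearW => N /=.
rewrite (big_morph _ (@ReD R) (erefl : complex.Re 0 = 0)); apply: eq_bigr => k _.
have lk : 0 <= lambda k.
  case: (nat_of_ord k) => [|j]; first by rewrite (lambda0 cc g2).
  by apply: le_trans (lambda_ge cc g2 S _).
rewrite (abs_dirac_pow_en cc g2) rep_en // (ipZl ipP) cpow_real ger0_norm //.
by case: (ip _ _) => u v /=; rewrite mul0r subr0.
Qed.

Lemma zeta_one_sum (Z : C -> C) : is_zeta S (fun=> 1) Z -> exists c : R, forall s, s < c ->
    (fun N => \sum_(k < N) lambda k `^ s) @ \oo --> complex.Re (Z s%:C%C).
Proof.
move=> /(@zeta_sum _ [::]) [|x Lx|c H]; first exact: cfun_cst.
  by rewrite chi1 // (shadow_nil cc Ox0).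
exists c => s /H; rewrite (_ : (fun N => _) = fun N => \sum_(k < N) lambda k `^ s) //.
apply/funext => N; apply: eq_bigr => k _; have [b cb E] := en_vec k.
have [on _] := en_basis cc g2 S; have := on k k; rewrite eqxx => e1.
have -> : rep (fun=> 1) (en k) = en k.
  have c1 : cfun (fun=> 1) by exact: cfun_cst.
  rewrite E (rep_mul S c1 cb).
  by congr vec; apply/funext => x; rewrite mul1r.
by rewrite e1 mulr1.
Qed.

Lemma zeta_one_ge (Z : C -> C) : is_zeta S (fun=> 1) Z -> exists c : R, forall s, s < c ->
  rank_pow g `^ s <= complex.Re (Z s%:C%C) - 1.
Proof.
move=> /zeta_one_sum [c H]; exists c => s sc.
exact: (power_sum_ge (lambda0 cc g2 S) (lambda1 cc g2 S) (H s sc)).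
Qed.

Lemma zeta_one_le (Z : C -> C) : is_zeta S (fun=> 1) Z -> exists c B : R, forall s, s < c ->
  complex.Re (Z s%:C%C) - 1 <= B * rank_pow g `^ s.
Proof.
move=> /zeta_one_sum [c H]; pose s0 := c - 1; have s0c : s0 < c by rewrite /s0 ltrBlDr ltrDl.
exists s0, ((complex.Re (Z s0%:C%C) - 1) * rank_pow g `^ (- s0)) => s ss.
exact: (power_sum_le rank_pow_gt1 (lambda0 cc g2 S) (lambda_ge cc g2 S) (ltW ss) (H s (lt_trans ss s0c)) (H s0 s0c)).
Qed.

(** The trace in the basis [en] is the mass of the shadow, from the eigenvalue [1], plus terms
    dominated by those of the zeta function of [1]. *)
Lemma zeta_chi_le a w (Z1 Z : C -> C) : reduced w -> cfun a -> (forall x, Lam x -> a x = chi w x) ->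
  is_zeta S (fun=> 1) Z1 -> is_zeta S a Z -> exists c B : R, forall s, s < c ->
  `|complex.Re (Z s%:C%C) - mass w| <= B * rank_pow g `^ s.
Proof.
move=> rw ca aw z1 z; have [c2 [B HB]] := zeta_one_le z1.
have [c1 H1] := zeta_one_sum z1; have [c H] := zeta_sum ca aw z.
exists (Num.min c (Num.min c1 c2)), B => s; rewrite !lt_min => /and3P[sc sc1 sc2].
apply: le_trans (HB s sc2).
have tt k : 0 <= complex.Re (ip (rep a (en k)) (en k)) <= 1.
  by have /andP[] := chi_coef k ca aw; rewrite !lecE => /andP[_ ->] /andP[_ ->].
have := weighted_power_sum (lambda0 cc g2 S) tt (H1 s sc1) (H s sc).
rewrite (chi_coef0 rw ca aw) /= => /andP[h1 h2].
by rewrite ger0_norm ?subr_ge0 // lerBlDl.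
Qed.

End zeta_of_triple.

(** * Comparison of two spectral triples *)

Section eigenvectors.
Context {R : realType} {g : nat} {rho : schottky R g}.
Hypotheses (cc : cocompact_group rho) (g2 : (1 < g)%N).
Variable S : spectral_triple rho.
Local Notation C := R[i].
Local Notation ip := (@st_ip R g rho S).
Local Notation ipP := (@st_ipP R g rho S).
Local Notation en := (en S).
Local Notation lambda := (lambda cc g2 S).
Local Notation cn := (@ComplexField.Normc.normc R).
Implicit Types (x y e : S).

Lemma ip_le_norm (x e : S) : ip e e = 1 -> `|ip x e| <= `|x|.
Proof.
move=> e1; rewrite -(ler_pXn2r (n := 2)) ?nnegrE // (ip_norm ipP).
have : 0 <= `|x - ip x e *: e| ^+ 2 by rewrite exprn_ge0.
rewrite (ip_norm ipP) !(ipBl ipP) !(ipBr ipP) !(ipZl ipP) !(ipZr ipP) e1 mulr1 (ip_conj ipP x e).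
set z := ip x e; rewrite (mulrC z^*%C) subrr subr0 subr_ge0.
by rewrite normE mulc_conj -rmorphXn.
Qed.

(** The operator [D] is diagonal in the basis [en], and taking a coefficient is continuous. *)
Lemma dirac_coef x y k : Defs.dirac x y -> ip y (en k) = (lambda k)%:C%C * ip x (en k).
Proof.
move=> xy; have [on _] := en_basis cc g2 S; have ek := on k k; rewrite eqxx in ek.
apply/eqP; rewrite -subr_eq0 -normr_eq0 eq_le normr_ge0 andbT.
have real (z : C) : (forall e : C, 0 < e -> `|z| <= e) -> `|z| <= 0.
  move=> H; rewrite normE; case: (eqVneq (cn z) 0) => [->//|z0].
  have zp : 0 < cn z by rewrite lt_neqAle eq_sym z0 cn_ge0.
  have := H (cn z / 2)%:C%C; rewrite ltcR divr_gt0 // normE lecR => /(_ isT).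
  by rewrite ler_pdivlMr // mulr2n mulrDr mulr1 gerDl leNgt zp.
apply: real => e e0.
have /cvgrPdist_le /(_ e e0) [N _ HN] := xy.
have := HN (maxn N (en_level cc g2 S k).+1); rewrite /= leq_maxl => /(_ isT) le.
apply: le_trans le; rewrite -(@ip_calculusr R g rho cc g2 S (fun l => l%:C%C) x k _ (leq_maxr N _)).
by rewrite -(ipBl ipP); exact: ip_le_norm.
Qed.

Lemma dirac_en k : Defs.dirac (en k) ((lambda k)%:C%C *: en k).
Proof. exact: (@calculus_cvg R g rho cc g2 S (fun l => l%:C%C) k). Qed.

Lemma dirac_eigenvalue_ex x (c : C) : x != 0 -> Defs.dirac x (c *: x) -> exists k, c = (lambda k)%:C%C.
Proof.
move=> x0 xc; apply: contrapT => nk; move/eqP: x0; apply.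
have [_ tot] := en_basis cc g2 S; apply: tot => k.
have := dirac_coef k xc; rewrite (ipZl ipP) => /eqP.
rewrite -subr_eq0 -mulrBl mulf_eq0 subr_eq0 => /orP[/eqP E|/eqP //].
by exfalso; apply: nk; exists k.
Qed.

(** The eigenvalue [1] is simple, so [D] determines the line of constant functions. *)
Lemma dirac_fixed x : Defs.dirac x x -> x = ip x (en 0) *: en 0.
Proof.
move=> xx; have [on tot] := en_basis cc g2 S.
apply/eqP; rewrite -subr_eq0; apply/eqP; apply: tot => k.
rewrite (ipBl ipP) (ipZl ipP) on; case: k => [|k]; first by rewrite mulr1 subrr.
rewrite mulr0 subr0; have /eqP := dirac_coef k.+1 xx.
rewrite -subr_eq0 -{1}(mul1r (ip x _)) -mulrBl mulf_eq0 subr_eq0 => /orP[/eqP E|/eqP //].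
have := lambda_ge cc g2 S (ltn0Sn k); have := @rank_pow_gt1 R g g2.
rewrite /rank_pow => h1 h2; have := lt_le_trans h1 h2.
have -> : lambda k.+1 = 1 by case: E.
by rewrite ltxx.
Qed.

End eigenvectors.

Section comparison.
Context {R : realType}.
Local Notation C := R[i].

Lemma rank_pow_le g1 g2 : @rank_pow R g1 <= rank_pow g2 -> (g1 <= g2)%N.
Proof. by rewrite /rank_pow ler_nat leq_exp2r // leq_pmul2l. Qed.

(** Up to constants, the zeta function of [1] minus [1] decays like [rank_pow g ^ s]. *)
Lemma zeta_rank_le g1 g2 (rho1 : schottky R g1) (rho2 : schottky R g2)
  (S1 : spectral_triple rho1) (S2 : spectral_triple rho2) (Z : C -> C) :
  cocompact_group rho1 -> cocompact_group rho2 -> (1 < g1)%N -> (1 < g2)%N ->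
  is_zeta S1 (fun=> 1) Z -> is_zeta S2 (fun=> 1) Z -> (g2 <= g1)%N.
Proof.
move=> cc1 cc2 g1' g2' z1 z2.
have [c1 H1] := zeta_one_ge cc1 g1' z1; have [c2 [B H2]] := zeta_one_le cc2 g2' z2.
apply: rank_pow_le; rewrite leNgt; apply/negP => lt.
have p1 : 0 < @rank_pow R g1 by apply: lt_trans (@rank_pow_gt1 R g1 g1').
have p2 : 0 < @rank_pow R g2 by apply: lt_trans (@rank_pow_gt1 R g2 g2').
have q1 : 1 < rank_pow g2 / rank_pow g1 :> R by rewrite ltr_pdivlMr // mul1r.
(* For [s] near [-oo], the larger rank has a much smaller leading term. *)
have [s sc BB] := powR_large B (Num.min c1 c2) q1 (@ltr01 R).
move: sc; rewrite lt_min => /andP[sc1 sc2].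
have := le_trans (H1 s sc1) (H2 s sc2).
rewrite -ler_pdivrMr ?powR_gt0 // leNgt; apply/negP; rewrite negbK.
apply: lt_le_trans BB _; rewrite mul1r powRM ?invr_ge0 ?(ltW p1) ?(ltW p2) //.
by rewrite -(powR_inv1 (ltW p1)) -powRrM mulN1r opprK powRN mulrC.
Qed.

End comparison.

Section same_rank.
Context {R : realType} {g : nat} {rho1 rho2 : schottky R g}.
Hypotheses (cc1 : cocompact_group rho1) (cc2 : cocompact_group rho2) (g2 : (1 < g)%N).
Variables (S1 : spectral_triple rho1) (S2 : spectral_triple rho2).
Local Notation C := R[i].
Local Notation io1 := (end_point rho1 (st_base S1)).
Local Notation io2 := (end_point rho2 (st_base S2)).
Local Notation Ox1 := (@st_baseP R g rho1 S1).
Local Notation Ox2 := (@st_baseP R g rho2 S2).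
Local Notation chA := (@chi R g rho1 (st_base S1)).
Local Notation chB := (@chi R g rho2 (st_base S2)).
Local Notation mass1 := (@mass R g rho1 (st_base S1) (st_mu S1)).
Local Notation mass2 := (@mass R g rho2 (st_base S2) (st_mu S2)).

Lemma cast_letter_id (e : g = g) : cast_letter e = id.
Proof.
by rewrite (eq_axiomK e); apply/funext => -[i b]; rewrite /cast_letter cast_ord_id.
Qed.

Lemma boundary_map_end (e : g = g) v : reduced_inf v -> boundary_map S1 S2 e (io1 v) = io2 v.
Proof.
move=> rv; rewrite /boundary_map; set E := [set _ | _].
have Ev : E (io2 v) by exists v; split=> //; rewrite cast_letter_id.
have : E (xget point E) by exact: (xgetI point Ev).
move=> [v' [rv' /(end_inj cc1 Ox1 rv rv') <- ->]].
by rewrite cast_letter_id.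
Qed.

Lemma boundary_map_inj (e : g = g) : {in limit_set rho1 &, injective (boundary_map S1 S2 e)}.
Proof.
move=> x y; rewrite !inE => /(end_surj cc1 Ox1) [v rv ->] /(end_surj cc1 Ox1) [v' rv' ->].
by rewrite !boundary_map_end // => /(end_inj cc2 Ox2 rv rv') ->.
Qed.

Lemma push_end (e : g = g) (a : P1 R -> C) v : reduced_inf v -> push S1 S2 e a (io2 v) = a (io1 v).
Proof.
move=> rv; rewrite /push /= -(boundary_map_end e rv) pinvKV //; first exact: boundary_map_inj.
by rewrite inE; exact: (end_limit cc1 Ox1).
Qed.

Lemma push_chi (e : g = g) w x : limit_set rho2 x -> push S1 S2 e (chA w) x = chB w x.
Proof.
move=> /(end_surj cc2 Ox2) [v rv ->]; rewrite push_end //.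
have s1 := shadow_prefix cc1 Ox1 w rv; have s2 := shadow_prefix cc2 Ox2 w rv.
have [pv|pv] := pselect (prefix_inf w v); first by rewrite !chi1 //; [apply/s2|apply/s1].
by rewrite !chi0 //; [move/s2|move/s1].
Qed.

Lemma push_cfun (e : g = g) w : continuous_functions rho2 (push S1 S2 e (chA w)).
Proof.
apply: (cfun_ext (a := chB w)); last exact: (@cfun_chi R g rho2 cc2 S2 w).
by move=> x /push_chi ->.
Qed.

(** The zeta function of the characteristic function of a shadow tends to the mass
    of the shadow at [-oo], because the eigenvalue of [1] is [1] and the other
    eigenvalues are at least [(2 * g) ^ 3]. *)
Lemma same_zetas_mass w : same_zetas S1 S2 -> reduced w -> mass1 w = mass2 w.
Proof.
move=> [[Z1 [z11 z12]] /(_ erefl (chA w))] H rw.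
have lc : locally_constant_functions rho1 (chA w).
  by apply: (level_locally_constant cc1 Ox1); exact: (level_chi cc1 Ox1 (leqnn (size w))).
have [Z [z1 z2]] := H lc.
have [c1 [B1 H1]] := zeta_chi_le cc1 g2 rw (@cfun_chi R g rho1 cc1 S1 w) (fun x _ => erefl) z11 z1.
have [c2 [B2 H2]] := zeta_chi_le cc2 g2 rw (@push_cfun erefl w) (@push_chi erefl w) z12 z2.
apply/eqP; rewrite -subr_eq0 -normr_eq0; apply/negPn/negP => ne.
have d0 : 0 < `|mass1 w - mass2 w| by rewrite lt_neqAle eq_sym ne normr_ge0.
have [s sc BB] := powR_large (B1 + B2) (Num.min c1 c2) (@rank_pow_gt1 R g g2) d0.
move: sc; rewrite lt_min => /andP[sc1 sc2].
have p : 0 < @rank_pow R g by apply: lt_trans (@rank_pow_gt1 R g g2).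
move: BB; rewrite powRN ltr_pdivlMr ?powR_gt0 // ltNge => /negP; apply.
rewrite mulrDl; apply: le_trans (lerD (H1 s sc1) (H2 s sc2)).
rewrite -[X in _ <= X + _]normrN opprB; apply: le_trans (ler_normD _ _).
by rewrite addrA subrK.
Qed.

(** The unitary map preserves the eigenspace of [1], hence sends the constant function [1] to
    a multiple of itself of modulus one, and it intertwines the multiplications by
    characteristic functions of shadows; so it preserves their integrals. *)
Lemma same_triples_mass w : same_spectral_triples S1 S2 -> reduced w -> mass1 w = mass2 w.
Proof.
move=> [U [Ulin [Uip Usurj] UD Urep]] rw; have /(_ (chA w)) U0 := Urep erefl.
have [on1 _] := en_basis cc1 g2 S1; have [on2 _] := en_basis cc2 g2 S2.
have d1 : Defs.dirac (en S1 0) (en S1 0).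
  by have := @dirac_en R g rho1 cc1 g2 S1 0; rewrite (lambda0 cc1 g2 S1) scale1r.
have /dirac_fixed -/(_ cc2 g2) E := (UD _ _).1 d1.
set c := st_ip _ _ in E.
have c1 : c * c^*%C = 1.
  have := Uip (en S1 0) (en S1 0); rewrite (on1 0%N 0%N) E (ipZl (@st_ipP _ _ _ S2)).
  by rewrite (ipZr (@st_ipP _ _ _ S2)) (on2 0%N 0%N) mulr1.
have h1 := chi_coef0 cc1 g2 rw (@cfun_chi R g rho1 cc1 S1 w) (fun x _ => erefl).
have h2 := chi_coef0 cc2 g2 rw (@push_cfun erefl w) (@push_chi erefl w).
suff : (mass1 w)%:C%C = (mass2 w)%:C%C :> C by case.
rewrite -h1 -h2 -Uip U0; last exact: (@cfun_chi R g rho1 cc1 S1 w).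
rewrite E (rep_en cc2 g2) ; last exact: push_cfun.
by rewrite (ipZl (@st_ipP _ _ _ S2)) (ipZr (@st_ipP _ _ _ S2)) mulrA c1 mul1r.
Qed.

End same_rank.

Section rank.
Context {R : realType} {g1 g2 : nat} {rho1 : schottky R g1} {rho2 : schottky R g2}.
Hypotheses (cc1 : cocompact_group rho1) (cc2 : cocompact_group rho2).
Hypotheses (h1 : (1 < g1)%N) (h2 : (1 < g2)%N).
Variables (S1 : spectral_triple rho1) (S2 : spectral_triple rho2).

Lemma same_zetas_rank : same_zetas S1 S2 -> g1 = g2.
Proof.
move=> [[Z [z1 z2]] _]; apply/eqP; rewrite eqn_leq.
by rewrite (zeta_rank_le cc1 cc2 h1 h2 z1 z2) (zeta_rank_le cc2 cc1 h2 h1 z2 z1).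
Qed.

Lemma eigenvalue_ge g (rho : schottky R g) (cc : cocompact_group rho) (gg : (1 < g)%N)
    (S : spectral_triple rho) k : lambda cc gg S k != 1 -> rank_pow g <= lambda cc gg S k.
Proof. by case: k => [|k] ne; [rewrite lambda0 eqxx in ne|exact: lambda_ge]. Qed.

(** The rank can be read from the spectrum: the least eigenvalue of [D] different from [1]
    is [(2 * g) ^ 3]. *)
Lemma same_triples_rank : same_spectral_triples S1 S2 -> g1 = g2.
Proof.
move=> [U [Ulin [Uip Usurj] UD _]].
have ipP1 := @st_ipP _ _ _ S1; have ipP2 := @st_ipP _ _ _ S2.
have U0 : U 0 = 0.
  by have := Ulin 1 0 0; rewrite !scale1r addr0 => E; apply: (addIr (U 0)); rewrite add0r -E.
have UZ c x : U (c *: x) = c *: U x by rewrite -[c *: x]addr0 Ulin U0 addr0.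
have [on1 _] := en_basis cc1 h1 S1; have [on2 _] := en_basis cc2 h2 S2.
have l1 : lambda cc1 h1 S1 1 = rank_pow g1 by exact: lambda1.
have l2 : lambda cc2 h2 S2 1 = rank_pow g2 by exact: lambda1.
apply/eqP; rewrite eqn_leq; apply/andP; split; apply: (@rank_pow_le R).
  have [x Ux] := Usurj (en S2 1).
  have := @dirac_en R g2 rho2 cc2 h2 S2 1; rewrite -Ux -UZ => /(UD _ _).2.
  move=> /(dirac_eigenvalue_ex cc1 h1) [|k [E]].
    apply/eqP => x0; have := on2 1%N 1%N; rewrite -Ux x0 U0 (ip0l ipP2) => /esym/eqP.
    by rewrite oner_eq0.
  rewrite -l2 E; apply: eigenvalue_ge.
  by rewrite -E [X in X != _](l2) gt_eqF // rank_pow_gt1.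
have := @dirac_en R g1 rho1 cc1 h1 S1 1 => /(UD _ _).1; rewrite UZ.
move=> /(dirac_eigenvalue_ex cc2 h2) [|k [E]].
  apply/eqP => x0; have := Uip (en S1 1) (en S1 1); rewrite on1 x0 (ip0l ipP2) => /esym/eqP.
  by rewrite oner_eq0.
rewrite -l1 E; apply: eigenvalue_ge.
by rewrite -E [X in X != _](l1) gt_eqF // rank_pow_gt1.
Qed.

End rank.

(** * From equal measures to equivalent surfaces *)

Section same_masses.
Context {R : realType} {g : nat} {rho1 rho2 : schottky R g}.
Context {X1 X2 : riemann_surface R} {p1 : P1 R -> X1} {p2 : P1 R -> X2}.
Hypotheses (pU1 : uniformizes rho1 p1) (pU2 : uniformizes rho2 p2).
Hypotheses (cc1 : cocompact_group rho1) (cc2 : cocompact_group rho2) (g2 : (1 < g)%N).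
Variables (S1 : spectral_triple rho1) (S2 : spectral_triple rho2).
Local Notation Ox1 := (@st_baseP R g rho1 S1).
Local Notation Ox2 := (@st_baseP R g rho2 S2).

(** The Möbius or anti-Möbius map that extends the boundary map is equivariant and maps one
    domain of discontinuity onto the other, so it descends to the quotient surfaces. *)
Lemma same_mass_equivalent :
  (forall w, reduced w ->
     mass (rho := rho1) (st_base S1) (st_mu S1) w = mass (rho := rho2) (st_base S2) (st_mu S2) w) ->
  conformally_equivalent X1 X2 \/ anticonformally_equivalent X1 X2.
Proof.
move=> sm; pose a : letter g := (Ordinal (ltnW g2), false).
have [b [ba bA]] := avoid_letters g2 a (linv a).
have [[M dM ME]|[M dM ME]] := boundary_rigidity cc1 cc2 g2 Ox1 Ox2
  (@st_muP R g rho1 S1) (@st_muP R g rho2 S2) sm ba bA.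
  have Ti := mobius_inj dM.
  left; apply: (conformal_of_mobius pU1 pU2 dM); first exact: (extension_domain cc1 cc2 Ox1 Ox2 Ti ME).
  move=> w x _; apply: (extension_equivariant cc1 cc2 g2 Ox1 Ox2 ME (M := M * wmx rho1 w)
    (N := wmx rho2 w * M) (f := id)) => //.
  - by rewrite mdetM mulf_neq0 // mdet_wmx.
  - by rewrite mdetM mulf_neq0 // mdet_wmx.
  - by move=> y; rewrite mobius_comp ?mdet_wmx.
  - by move=> y; rewrite mobius_comp.
have ci : injective (@conjP R) by exact: can_inj (@conjPK R).
have Ti : injective (fun x => mobius M (conjP x)) by move=> x y /(mobius_inj dM) /ci.
right; apply: (anticonformal_of_mobius pU1 pU2 dM); first exact: (extension_domain cc1 cc2 Ox1 Ox2 Ti ME).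
have dc w : mdet (map_mx (@conjc R) (wmx rho1 w)) != 0 by rewrite mdet_conj fmorph_eq0 mdet_wmx.
move=> w x _; apply: (extension_equivariant cc1 cc2 g2 Ox1 Ox2 (T := fun x => mobius M (conjP x)) ME
  (M := M * map_mx (@conjc R) (wmx rho1 w)) (N := wmx rho2 w * M) (f := @conjP R)) => //.
- by rewrite mdetM mulf_neq0 // dc.
- by rewrite mdetM mulf_neq0 // mdet_wmx.
- by move=> y; rewrite mobius_comp // -conjP_mobius_conj.
- by move=> y; rewrite mobius_comp.
Qed.

End same_masses.

Theorem theorem2 (R : realType) (g1 g2 : nat) (X1 X2 : riemann_surface R)
    (rho1 : schottky R g1) (rho2 : schottky R g2)
    (p1 : P1 R -> X1) (p2 : P1 R -> X2)
    (S1 : spectral_triple rho1) (S2 : spectral_triple rho2) :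
  (2 <= g1)%N -> (2 <= g2)%N ->
  compact [set: X1] -> compact [set: X2] ->
  has_genus X1 g1 -> has_genus X2 g2 ->
  uniformizes rho1 p1 -> uniformizes rho2 p2 ->
  (same_zetas S1 S2 ->
     conformally_equivalent X1 X2 \/ anticonformally_equivalent X1 X2) /\
  (same_spectral_triples S1 S2 ->
     conformally_equivalent X1 X2 \/ anticonformally_equivalent X1 X2).
Proof.
move=> h1 h2 k1 k2 _ _ u1 u2.
have cc1 : cocompact_group rho1 by exact: cocompact u1 k1.
have cc2 : cocompact_group rho2 by exact: cocompact u2 k2.
split=> H.
  have e := same_zetas_rank cc1 cc2 h1 h2 H; subst g2.
  by apply: (same_mass_equivalent u1 u2 cc1 cc2 h1) => w rw; exact: (same_zetas_mass cc1 cc2 h1 H rw).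
have e := same_triples_rank cc1 cc2 h1 h2 H; subst g2.
by apply: (same_mass_equivalent u1 u2 cc1 cc2 h1) => w rw; exact: (same_triples_mass cc1 cc2 h1 H rw).
Qed.
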